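(* Let $C \subseteq \mathbb{R}^n$ be a $(0,r,R)$-centered, $\gamma$-symmetric convex body (given by an oracle) and $L \subseteq \mathbb{R}^n$ an $n$-dimensional lattice given by a basis. Let $x \in \mathbb{R}^n$. For any $\varepsilon \in (0,\frac{1}{3})$, a lattice vector $y \in L$ with $\|y-x\|_C \leq (1+\varepsilon)\, d_C(L,x)$ can be computed by a randomized algorithm in time $O\big(\frac{1}{\gamma^4\varepsilon^2}\big)^n$ with probability at least $1-2^{-n}$. Furthermore, if $d_C(L,x) \leq t\,\lambda_1(C,L)$ for some $t \geq 2$, then a vector $y \in L$ with $\|y - x\|_C = d_C(L,x)$ can be computed in time $O\big(\frac{t^2}{\gamma^4}\big)^n$ with probability at least $1-2^{-n}$.
   Context: A convex body is a full-dimensional compact convex set; $C$ is $(0,r,R)$-centered if $rB_2^n \subseteq C \subseteq RB_2^n$ ($B_2^n$ the Euclidean unit ball). The gauge (semi-norm) of $C$ is $\|x\|_C = \inf\{s \geq 0 : x \in sC\}$; it satisfies all norm axioms except possibly symmetry. $C$ is $\gamma$-symmetric ($0<\gamma\le 1$) if $\mathrm{vol}(C \cap -C) \geq \gamma^n \mathrm{vol}(C)$. For an $n$-dimensional lattice $L$, $\lambda_1(C,L) = \inf_{z\in L\setminus\{0\}}\|z\|_C$ and $d_C(L,x) = \inf_{z \in L}\|z - x\|_C$. Complexity is measured in oracle calls and arithmetic operations, with polynomial factors in the input size omitted. *)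

(* Defs.v *)
From HB Require Import structures.
From mathcomp Require Import all_boot all_order all_algebra.
From mathcomp Require Import all_classical all_reals all_analysis.
Set Implicit Arguments.
Unset Strict Implicit.
Unset Printing Implicit Defensive.
Import Order.TTheory GRing.Theory Num.Theory.
Import numFieldNormedType.Exports.
Local Open Scope classical_set_scope.
Local Open Scope ring_scope.

Section geometry.
Context {R : realType} {n : nat}.
Implicit Types (C L : set 'rV[R]_n) (B : 'M[R]_n) (x y : 'rV[R]_n).

Definition eucl_ball (s : R) : set 'rV[R]_n :=
  [set x | \sum_i x 0 i ^+ 2 <= s ^+ 2].

Definition convex_body C : Prop :=
  [/\ compact C, convex_set C & C° !=set0].

Definition centered (r Rad : R) C : Prop :=
  [/\ 0 < r, eucl_ball r `<=` C & C `<=` eucl_ball Rad].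

Definition gauge C x : R :=
  inf [set s : R | 0 <= s /\ [set s *: c | c in C] x].

(* Lebesgue outer measure, by countable covers with closed boxes
   [a k, b k]; it is the n-dimensional volume on measurable sets. *)
Definition vol (A : set 'rV[R]_n) : \bar R :=
  ereal_inf [set v | exists a b : nat -> 'rV[R]_n,
    [/\ forall k i, a k 0 i <= b k 0 i,
        A `<=` \bigcup_k [set x | forall i, a k 0 i <= x 0 i <= b k 0 i] &
        v = (\sum_(0 <= k <oo) (\prod_i (b k 0 i - a k 0 i))%:E)%E]].

Definition symmetric_upto (gamma : R) C : Prop :=
  ((gamma ^+ n)%:E * vol C <= vol (C `&` [set (- c)%R | c in C]))%E.

(* The lattice spanned by the rows of B. *)
Definition lattice B : set 'rV[R]_n :=
  [set z | exists c : 'rV[int]_n, z = map_mx intr c *m B].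

Definition lambda1 C L : R := inf [set gauge C z | z in L `\ 0].

Definition lattice_dist C L x : R := inf [set gauge C (z - x) | z in L].

(* Finitely many membership answers cannot in general decide which of two
   vectors has the smaller gauge, so computing an exact closest vector needs
   the gauge oracle; membership suffices for approximation. *)
Definition membership_oracle C : 'rV[R]_n -> R := \1_C.

Definition gauge_oracle C : 'rV[R]_n -> R := gauge C.

End geometry.

(* Real random access machine. There is an unbounded memory of index (nat)
   cells and an unbounded memory of real cells. Operands of index instructions
   are addresses of index cells; a real operand a designates the real cell
   whose address is stored in index cell a. There is no rounding of reals to
   indices and no real constant other than integers, so that neither a
   unit-cost floor nor non-computable advice is available. *)
Inductive instr :=
  | Iconst (d k : nat)
  | Iadd (d a b : nat)
  | Isub (d a b : nat)        (* truncated *)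
  | Iload (d a : nat)         (* indirect read *)
  | Istore (d a : nat)        (* indirect write *)
  | Iflip (d : nat)           (* fair coin *)
  | Rconst (d : nat) (z : int)
  | Rcopy (d a : nat)
  | Radd (d a b : nat)
  | Rsub (d a b : nat)
  | Rmul (d a b : nat)
  | Rdiv (d a b : nat)
  | Rquery (d a : nat)        (* oracle call on n consecutive real cells *)
  | Jump (l : nat)
  | Jlt_idx (a b l : nat)
  | Jlt_real (a b l : nat).

Definition program := seq instr.

Section machine.
Context {R : realType} {n : nat}.

Record config := Config {
  pc : nat;
  idx : nat -> nat;
  mem : nat -> R;
  coins : seq bool }.

Definition read_vec (m : nat -> R) (a : nat) : 'rV[R]_n :=
  \row_(j < n) m (a + j)%N.

Variables (P : program) (oracle : 'rV[R]_n -> R).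

Definition exec (i : instr) (s : config) : config :=
  let: Config p f m w := s in
  let seti d k := Config p.+1 [eta f with d |-> k] m w in
  let setr d v := Config p.+1 f [eta m with f d |-> v] w in
  let jump (b : bool) l := Config (if b then l else p.+1) f m w in
  match i with
  | Iconst d k => seti d k
  | Iadd d a b => seti d (f a + f b)%N
  | Isub d a b => seti d (f a - f b)%N
  | Iload d a => seti d (f (f a))
  | Istore d a => seti (f d) (f a)
  | Iflip d =>
      Config p.+1 [eta f with d |-> nat_of_bool (head false w)] m (behead w)
  | Rconst d z => setr d z%:~R
  | Rcopy d a => setr d (m (f a))
  | Radd d a b => setr d (m (f a) + m (f b))
  | Rsub d a b => setr d (m (f a) - m (f b))
  | Rmul d a b => setr d (m (f a) * m (f b))
  | Rdiv d a b => setr d (m (f a) / m (f b))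
  | Rquery d a => setr d (oracle (read_vec m (f a)))
  | Jump l => jump true l
  | Jlt_idx a b l => jump (f a < f b)%N l
  | Jlt_real a b l => jump (m (f a) < m (f b)) l
  end.

Definition halted (s : config) : bool := (size P <= pc s)%N.

Definition step (s : config) : config :=
  if onth P (pc s) is Some i then exec i s else s.

(* The dimension is in index cell 0 and the input numbers are in the first
   real cells; all other cells are 0. *)
Definition init (input : seq R) (w : seq bool) : config :=
  Config 0 [eta (fun=> 0%N) with 0%N |-> n] (nth 0 input) w.

Definition run (input : seq R) (w : seq bool) (T : nat) : config :=
  iter T step (init input w).

Definition output (s : config) : 'rV[R]_n := read_vec (mem s) 0.

(* Every run halts within T <= tau steps, each instruction and each oracle
   call counting for one step, and the output is good with probability at
   least p over T fair coins (a run of T steps flips at most T coins). *)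
Definition computes_within (input : seq R) (tau p : R)
    (good : set 'rV[R]_n) : Prop :=
  exists T : nat,
  [/\ T%:R <= tau,
      forall w : T.-tuple bool, halted (run input w T) &
      p <= #|[set w : T.-tuple bool | `[< good (output (run input w T)) >]]|%:R
           / 2 ^+ T].

End machine.

Section encoding.
Context {R : realType} {n : nat}.

(* par is the accuracy eps or the distance ratio t; B is stored by rows. *)
Definition cvp_input (r Rad gamma par : R) (B : 'M[R]_n) (x : 'rV[R]_n) :
    seq R :=
  [:: r; Rad; gamma; par]
    ++ [seq B i j | i <- enum 'I_n, j <- enum 'I_n]
    ++ [seq x 0 j | j <- enum 'I_n].

(* ln 0 = 0; for a fraction a = p / q in lowest terms this is at most the
   larger of ln |p| and ln q, hence at most the bit length of a. *)
Definition logmag (a : R) : R := `|ln `|a| |.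

(* Size of real input data. The last term bounds how degenerate the basis is;
   on rational data, where det B has a bit length polynomial in the one of B,
   this size is bounded by a polynomial in the binary encoding length of the
   input. *)
Definition input_size (r Rad gamma par : R) (B : 'M[R]_n) (x : 'rV[R]_n) : R :=
  n%:R + logmag r + logmag Rad + logmag gamma + logmag par
  + \sum_i \sum_j logmag (B i j) + \sum_j logmag (x 0 j) + logmag (\det B).

End encoding.

(* Main.v *)
(* The algorithm is deterministic. In coefficient space let
   A_h = {v : |v|_oo <= h, vB and -vB in C}, so that A_h is contained in A_2h,
   which is contained in 2 A_h. For a power g of 2 that is large enough for the
   input, A_(1/g) is a cube, all v with vB in K = C /\ -C lie in A_g, and the
   scales 1/g, 2/g, ..., g connect the two. At each scale h and each radius rho
   in a geometric range, one keeps a list of integer vectors such that every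
   integer vector in 4 rho A_h lies in z + rho A_h for some z in the list. Sums
   of elements of two lists at scale h and radii 2 rho, rho / 2, pruned
   greedily to a set separated by (rho / 2) A_2h, form such a list at scale 2h
   and radius rho; by a packing bound it has at most 512^n elements. At scale g
   the lists cover multiples of K, and refining {0} with them, while only
   keeping vectors z with zB - x in (d + rho)C, gives for every guess d of the
   distance a list of lattice vectors that approximates, up to (e d)K, every
   lattice vector y with y - x in dC. Here the packing bound is (192/(e gamma))^n,
   by symmetry up to gamma. With e = eps / 8 the best element is a (1 + eps)-closest
   vector; with e = 1 / (16 t) the resolution is finer than the distances
   between lattice vectors, so that a closest vector itself is in the list.

   The packing bound is obtained without Lebesgue measure theory, by counting
   points of fine grids: on compact sets these counts are bounded by the volume
   because finitely many slightly enlarged boxes of a cover suffice. *)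
Require Import Defs.
From mathcomp Require Import all_boot all_order all_algebra.
From mathcomp Require Import all_classical all_reals all_analysis.
From mathcomp Require Import zify ring lra.
Set Implicit Arguments.
Unset Strict Implicit.
Unset Printing Implicit Defensive.
Import Order.TTheory GRing.Theory Num.Theory.
Import numFieldNormedType.Exports.
Local Open Scope classical_set_scope.
Local Open Scope ring_scope.

(** * A structured language for the machine *)

(** The machine has no rounding and no roots, and this shapes the algorithm. Rounding steps as in
    basis reduction are avoided: integer vectors enter only through the grids in the initial cubes,
    whose width is 1 or a larger power of two, and afterwards only as sums of listed vectors. The
    scale g is found by doubling until it exceeds a bound computed by field operations alone; that
    bound involves det B and x only through det B squared and the square of the norm of x.

    The radii 2 rho and rho / 2 are forced by the covering property. Since A_2h lies in 2 A_h, a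
    vector of 4 rho A_2h lies in 4 (2 rho) A_h, so the list of radius 2 rho leaves an error in 2 rho
    A_h = 4 (rho / 2) A_h; the list of radius rho / 2 reduces it to (rho / 2) A_h, and pruning at
    rho / 2 adds up to rho. This costs one radius step up and one down for each doubling of h, so a
    whole range of radii is kept.

    The number 512 is 2 * 16 * 8 * 2: a packing constant 16, filter radius 8 rho, pruning radius rho
    / 2, and a factor 2 of the packing bound moved into the base. *)

(* Names: I for index and R for real operations; C constant, A add, S subtract,
   X multiply, D divide, M move, L indirect read, W indirect write, Q query.
   Index variable k < 64 is index cell 32 + k. Real variable k < 32 is a real
   cell beyond the input, whose address is in index cell k; pointers (the p
   of RL, RW and RQ) are index variables holding addresses of real cells. *)
Inductive op :=
  | IC (d k : nat) | IA (d a b : nat) | IS (d a b : nat)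
  | IL (d a : nat) | IW (d a : nat)
  | RC (d : nat) (z : int) | RM (d a : nat)
  | RA (d a b : nat) | RS (d a b : nat) | RX (d a b : nat) | RD (d a b : nat)
  | RL (d p : nat) | RW (p a : nat) | RQ (d p : nat).

Inductive cond := CI (a b : nat) | CR (a b : nat).

Inductive cmd :=
  | Blk (l : seq op)
  | Seq (c1 c2 : cmd)
  | IfC (b : cond) (c1 c2 : cmd)
  | Wh (b : cond) (c : cmd).

Notation "c1 ;; c2" := (Seq c1 c2) (at level 60, right associativity).

Definition trans (o : op) : instr :=
  match o with
  | IC d k => Iconst (32 + d) k
  | IA d a b => Iadd (32 + d) (32 + a) (32 + b)
  | IS d a b => Isub (32 + d) (32 + a) (32 + b)
  | IL d a => Iload (32 + d) (32 + a)
  | IW d a => Istore (32 + d) (32 + a)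
  | RC d z => Rconst d z
  | RM d a => Rcopy d a
  | RA d a b => Radd d a b
  | RS d a b => Rsub d a b
  | RX d a b => Rmul d a b
  | RD d a b => Rdiv d a b
  | RL d p => Rcopy d (32 + p)
  | RW p a => Rcopy (32 + p) a
  | RQ d p => Rquery d (32 + p)
  end.

Definition wf_op (o : op) : bool :=
  match o with
  | IC d _ => (d < 64)%N
  | IA d a b | IS d a b => [&& (d < 64)%N, (a < 64)%N & (b < 64)%N]
  | IL d a | IW d a => (d < 64)%N && (a < 64)%N
  | RC d _ => (d < 32)%N
  | RM d a => (d < 32)%N && (a < 32)%N
  | RA d a b | RS d a b | RX d a b | RD d a b =>
      [&& (d < 32)%N, (a < 32)%N & (b < 32)%N]
  | RL d p | RQ d p => (d < 32)%N && (p < 64)%N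
  | RW p a => (p < 64)%N && (a < 32)%N
  end.

Definition wf_cond (b : cond) : bool :=
  match b with
  | CI a b => (a < 64)%N && (b < 64)%N
  | CR a b => (a < 32)%N && (b < 32)%N
  end.

Fixpoint wf (c : cmd) : bool :=
  match c with
  | Blk l => all wf_op l
  | Seq c1 c2 => wf c1 && wf c2
  | IfC b c1 c2 => [&& wf_cond b, wf c1 & wf c2]
  | Wh b c1 => wf_cond b && wf c1
  end.

Definition jmp (b : cond) (l : nat) : instr :=
  match b with
  | CI a b => Jlt_idx (32 + a) (32 + b) l
  | CR a b => Jlt_real a b l
  end.

Fixpoint csize (c : cmd) : nat :=
  match c with
  | Blk l => size l
  | Seq c1 c2 => csize c1 + csize c2
  | IfC _ c1 c2 => (csize c2 + csize c1).+2
  | Wh _ c1 => (csize c1).+3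
  end.

(** Jump targets are absolute, so the address [b] of the first instruction is a parameter.
    Conditional jumps fire when the comparison holds; hence the else branch comes first, and a loop
    begins by hopping over its exit jump. *)
Fixpoint comp (c : cmd) (b : nat) : program :=
  match c with
  | Blk l => map trans l
  | Seq c1 c2 => comp c1 b ++ comp c2 (b + csize c1)
  | IfC cd c1 c2 =>
      jmp cd (b + csize c2).+2 :: comp c2 b.+1
        ++ Jump (b + csize c2 + csize c1).+2 :: comp c1 (b + csize c2).+2
  | Wh cd c1 =>
      jmp cd b.+2 :: Jump (b + csize c1).+3 :: comp c1 b.+2 ++ [:: Jump b]
  end.

Lemma size_comp c b : size (comp c b) = csize c.
Proof.
elim: c b => [l|c1 IH1 c2 IH2|cd c1 IH1 c2 IH2|cd c1 IH1] b /=.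
- by rewrite size_map.
- by rewrite size_cat IH1 IH2.
- by rewrite size_cat /= IH1 IH2 addnS.
- by rewrite size_cat /= IH1 addn1.
Qed.

Definition modI_op (o : op) : seq nat :=
  match o with IC d _ | IA d _ _ | IS d _ _ | IL d _ => [:: d] | _ => [::] end.

Definition modR_op (o : op) : seq nat :=
  match o with
  | RC d _ | RM d _ | RA d _ _ | RS d _ _ | RX d _ _ | RD d _ _
  | RL d _ | RQ d _ => [:: d]
  | _ => [::]
  end.

Fixpoint modI (c : cmd) : seq nat :=
  match c with
  | Blk l => flatten (map modI_op l)
  | Seq c1 c2 | IfC _ c1 c2 => modI c1 ++ modI c2
  | Wh _ c1 => modI c1
  end.

Fixpoint modR (c : cmd) : seq nat :=
  match c with
  | Blk l => flatten (map modR_op l)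
  | Seq c1 c2 | IfC _ c1 c2 => modR c1 ++ modR c2
  | Wh _ c1 => modR c1
  end.

Definition is_IW (o : op) := if o is IW _ _ then true else false.

Fixpoint noIW (c : cmd) : bool :=
  match c with
  | Blk l => all (predC is_IW) l
  | Seq c1 c2 | IfC _ c1 c2 => noIW c1 && noIW c2
  | Wh _ c1 => noIW c1
  end.

Definition is_RW (o : op) := if o is RW _ _ then true else false.

Fixpoint noRW (c : cmd) : bool :=
  match c with
  | Blk l => all (predC is_RW) l
  | Seq c1 c2 | IfC _ c1 c2 => noRW c1 && noRW c2
  | Wh _ c1 => noRW c1
  end.

Definition upd T (f : nat -> T) (d : nat) (v : T) : nat -> T :=
  fun k => if k == d then v else f k.

(* First cell after the input; the real variables live in the 32 cells from
   there on. *)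
Definition inlen (n : nat) : nat := (4 + n * n + n)%N.

(** * Evaluation of structured programs and correctness of compilation *)

Section semantics.
Context {R : realType} {n : nat}.
Variable oracle : 'rV[R]_n -> R.

(** The memory in four parts: index variables, index cells from 96 on, real variables, and the real
    cells outside the window of the real variables. Index cells below 32 are left out because they
    hold only the fixed addresses of the real variables. *)
Record st := St {
  iv : nat -> nat;
  it : nat -> nat;
  rv : nat -> R;
  hp : nat -> R }.

Definition heap_addr (p : nat) : bool :=
  (p < inlen n)%N || (inlen n + 32 <= p)%N.

(** Indirect accesses must stay away from the cells of named variables. A query has to start above
    the window of real variables, since a block starting in the input could run into that window. *)
Definition ok_op (o : op) (s : st) : bool :=
  match o with
  | IL _ a => (96 <= iv s a)%N
  | IW d _ => (96 <= iv s d)%N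
  | RL _ p | RW p _ => heap_addr (iv s p)
  | RQ _ p => (inlen n + 32 <= iv s p)%N
  | _ => true
  end.

Definition den_op (o : op) (s : st) : st :=
  let: St i t r h := s in
  match o with
  | IC d k => St (upd i d k) t r h
  | IA d a b => St (upd i d (i a + i b)%N) t r h
  | IS d a b => St (upd i d (i a - i b)%N) t r h
  | IL d a => St (upd i d (t (i a))) t r h
  | IW d a => St i (upd t (i d) (i a)) r h
  | RC d z => St i t (upd r d z%:~R) h
  | RM d a => St i t (upd r d (r a)) h
  | RA d a b => St i t (upd r d (r a + r b)) h
  | RS d a b => St i t (upd r d (r a - r b)) h
  | RX d a b => St i t (upd r d (r a * r b)) h
  | RD d a b => St i t (upd r d (r a / r b)) h
  | RL d p => St i t (upd r d (h (i p))) h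
  | RW p a => St i t r (upd h (i p) (r a))
  | RQ d p => St i t (upd r d (oracle (read_vec h (i p)))) h
  end.

Fixpoint ok_ops (l : seq op) (s : st) : Prop :=
  if l is o :: l' then ok_op o s /\ ok_ops l' (den_op o s) else True.

Definition den_ops (l : seq op) (s : st) : st := foldl (fun s o => den_op o s) s l.

Definition holds (b : cond) (s : st) : bool :=
  match b with
  | CI a b => (iv s a < iv s b)%N
  | CR a b => rv s a < rv s b
  end.

(** The counter is the exact number of machine steps of the compiled code. The jumps cost one step
    in a then branch, two in an else branch, two per round of a loop and two at its exit. *)
Inductive ev : cmd -> st -> st -> nat -> Prop :=
  | ev_blk l s : ok_ops l s -> ev (Blk l) s (den_ops l s) (size l)
  | ev_seq c1 c2 s s1 s2 t1 t2 :
      ev c1 s s1 t1 -> ev c2 s1 s2 t2 -> ev (Seq c1 c2) s s2 (t1 + t2)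
  | ev_ifT b c1 c2 s s1 t :
      holds b s -> ev c1 s s1 t -> ev (IfC b c1 c2) s s1 t.+1
  | ev_ifF b c1 c2 s s1 t :
      ~~ holds b s -> ev c2 s s1 t -> ev (IfC b c1 c2) s s1 t.+2
  | ev_whT b c s s1 s2 t1 t2 :
      holds b s -> ev c s s1 t1 -> ev (Wh b c) s1 s2 t2 ->
      ev (Wh b c) s s2 (t1 + t2).+2
  | ev_whF b c s : ~~ holds b s -> ev (Wh b c) s s 2.

Record sim (s : st) (f : nat -> nat) (m : nat -> R) : Prop := Sim {
  sim_id : forall k, (k < 32)%N -> f k = (inlen n + k)%N;
  sim_iv : forall k, (k < 64)%N -> f (32 + k)%N = iv s k;
  sim_it : forall a, (96 <= a)%N -> f a = it s a;
  sim_rv : forall k, (k < 32)%N -> m (inlen n + k)%N = rv s k;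
  sim_hp : forall a, heap_addr a -> m a = hp s a }.

Variable P : program.

Definition code_at (b : nat) (l : program) : Prop :=
  exists p q, P = p ++ l ++ q /\ size p = b.

Lemma code_at_cat b l1 l2 : code_at b (l1 ++ l2) ->
  code_at b l1 /\ code_at (b + size l1) l2.
Proof.
move=> [p [q [E <-]]]; split.
  by exists p, (l2 ++ q); rewrite E !catA.
by exists (p ++ l1), q; rewrite E !catA size_cat.
Qed.

Lemma code_at_cons b i l : code_at b (i :: l) ->
  onth P b = Some i /\ code_at b.+1 l.
Proof.
rewrite -cat1s => /code_at_cat[[p [q [-> <-]]]]; rewrite addn1; split => //.
by rewrite onthE (nth_map i) ?size_cat /= ?addnS ?ltnS ?leq_addr // nth_cat
  ltnn subnn.
Qed.

Lemma den_op_sim o s f m b w : wf_op o -> ok_op o s -> sim s f m ->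
  exists f' m', exec oracle (trans o) (Config b f m w) = Config b.+1 f' m' w
    /\ sim (den_op o s) f' m'.
Proof.
case: s => i t r h wfo oko [Sid Siv Sit Srv Shp] /=.
have hv k : (k < 32)%N -> heap_addr (inlen n + k)%N = false.
  by rewrite /heap_addr; lia.
have setI d v : (d < 64)%N -> sim (St (upd i d v) t r h)
    (fun x => if x == (32 + d)%N then v else f x) m.
  move=> d64; split => //= k kb; rewrite ?eqn_add2l /upd.
  - by rewrite ifF ?Sid //; lia.
  - by case: eqP => // _; exact: Siv.
  - by rewrite ifF ?Sit //; lia.
have setR d v : (d < 32)%N -> sim (St i t (upd r d v) h)
    f (fun x => if x == (inlen n + d)%N then v else m x).
  move=> d64; split => //= k kb; rewrite ?eqn_add2l /upd.
  - by case: eqP => // _; exact: Srv.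
  - case: eqP => [e|_]; last exact: Shp.
    by move: kb; rewrite e hv.
case: o wfo oko => /=.
- by move=> d k wfd _; eexists; eexists; split; [reflexivity|exact: setI].
- move=> d a b0 /and3P[d1 a1 b1] _; rewrite !Siv //.
  by eexists; eexists; split; [reflexivity|exact: setI].
- move=> d a b0 /and3P[d1 a1 b1] _; rewrite !Siv //.
  by eexists; eexists; split; [reflexivity|exact: setI].
- move=> d a /andP[d1 a1] ha; rewrite !Siv // Sit //.
  by eexists; eexists; split; [reflexivity|exact: setI].
- move=> d a /andP[d1 a1] ha; rewrite !Siv //.
  eexists; eexists; split; [reflexivity|split => //= k kb].
  + by rewrite ifF ?Sid //; lia.
  + by rewrite ifF ?Siv //; lia.
  + by rewrite /upd Sit.
- move=> d z d1 _; rewrite Sid //.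
  by eexists; eexists; split; [reflexivity|exact: setR].
- move=> d a /andP[d1 a1] _; rewrite !Sid // Srv //.
  by eexists; eexists; split; [reflexivity|exact: setR].
- move=> d a b0 /and3P[d1 a1 b1] _; rewrite !Sid // !Srv //.
  by eexists; eexists; split; [reflexivity|exact: setR].
- move=> d a b0 /and3P[d1 a1 b1] _; rewrite !Sid // !Srv //.
  by eexists; eexists; split; [reflexivity|exact: setR].
- move=> d a b0 /and3P[d1 a1 b1] _; rewrite !Sid // !Srv //.
  by eexists; eexists; split; [reflexivity|exact: setR].
- move=> d a b0 /and3P[d1 a1 b1] _; rewrite !Sid // !Srv //.
  by eexists; eexists; split; [reflexivity|exact: setR].
- move=> d a /andP[d1 a1] ha; rewrite Siv // !Sid // Shp //.
  by eexists; eexists; split; [reflexivity|exact: setR].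
- move=> d a /andP[d1 a1] ha; rewrite Siv // Sid // Srv //.
  eexists; eexists; split; [reflexivity|split => //= k kb].
  + rewrite ifF ?Srv //; apply/negP => /eqP e.
    by move: ha; rewrite -e hv.
  + by rewrite /upd Shp.
- move=> d a /andP[d1 a1] ha; rewrite Siv // !Sid //.
  have -> : read_vec m (i a) = read_vec h (i a) :> 'rV_n.
    by apply/rowP => j; rewrite !mxE Shp // /heap_addr; lia.
  by eexists; eexists; split; [reflexivity|exact: setR].
Qed.

Lemma step_at b i f m w : onth P b = Some i ->
  step P oracle (Config b f m w) = exec oracle i (Config b f m w).
Proof. by rewrite /step /= => ->. Qed.

Definition steps t c c' := iter t (step P oracle) c = c'.

Lemma steps_trans t1 t2 c1 c2 c3 :
  steps t1 c1 c2 -> steps t2 c2 c3 -> steps (t1 + t2) c1 c3.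
Proof. by rewrite /steps => <- <-; rewrite addnC iterD. Qed.

Lemma steps1 b i f m w c : onth P b = Some i ->
  exec oracle i (Config b f m w) = c -> steps 1 (Config b f m w) c.
Proof. by move=> /step_at h <-; rewrite /steps /= h. Qed.

Lemma steps_ops l s b f m w : all wf_op l -> ok_ops l s -> sim s f m ->
  code_at b (map trans l) ->
  exists f' m', steps (size l) (Config b f m w) (Config (b + size l) f' m' w)
    /\ sim (den_ops l s) f' m'.
Proof.
elim: l s b f m => [|o l IH] s b f m /=.
  by move=> _ _ S _; exists f, m; rewrite addn0.
move=> /andP[wo wl] [oo ol] S /code_at_cons[ho hl].
have [f1 [m1 [e1 S1]]] := den_op_sim b w wo oo S.
have [f2 [m2 [e2 S2]]] := IH _ _ _ _ wl ol S1 hl.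
exists f2, m2; split => //; rewrite -addn1 addnC addnA addn1.
by apply: steps_trans e2; exact: steps1 ho e1.
Qed.

Lemma steps_jmp cd l s b f m w : wf_cond cd -> sim s f m ->
  onth P b = Some (jmp cd l) ->
  steps 1 (Config b f m w) (Config (if holds cd s then l else b.+1) f m w).
Proof.
move=> wc S h; apply: (steps1 h).
case: cd wc h => a c /= /andP[ha hc] _.
  by rewrite !(sim_iv S).
by rewrite !(sim_id S) // !(sim_rv S).
Qed.

Lemma steps_Jump l b f m w : onth P b = Some (Jump l) ->
  steps 1 (Config b f m w) (Config l f m w).
Proof. by move=> h; exact: (steps1 h). Qed.

Lemma comp_correct c s s' t : ev c s s' t -> wf c ->
  forall b f m w, code_at b (comp c b) -> sim s f m ->
  exists f' m', steps t (Config b f m w) (Config (b + csize c) f' m' w)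
    /\ sim s' f' m'.
Proof.
elim=> {c s s' t}.
- by move=> l s okl wl b f m w ca S; exact: steps_ops.
- move=> c1 c2 s s1 s2 t1 t2 _ IH1 _ IH2 /= /andP[w1 w2] b f m w.
  move=> /code_at_cat[]; rewrite size_comp => ca1 ca2 S.
  have [f1 [m1 [e1 S1]]] := IH1 w1 _ _ _ w ca1 S.
  have [f2 [m2 [e2 S2]]] := IH2 w2 _ _ _ w ca2 S1.
  by exists f2, m2; rewrite addnA; split => //; exact: steps_trans e1 e2.
- move=> cd c1 c2 s s1 t hc _ IH /= /and3P[wc w1 w2] b f m w.
  move=> /code_at_cons[hj /code_at_cat[_ /code_at_cons[_]]].
  rewrite size_comp addSn => ca S.
  have [f1 [m1 [e1 S1]]] := IH w1 _ _ _ w ca S.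
  exists f1, m1; split => //.
  have := steps_jmp w wc S hj; rewrite hc => ej.
  by rewrite 2!addnS addnA -2!addSn -(add1n t); exact: steps_trans ej e1.
- move=> cd c1 c2 s s1 t hc _ IH /= /and3P[wc w1 w2] b f m w.
  move=> /code_at_cons[hj /code_at_cat[ca /code_at_cons[hJ _]]].
  move: hJ; rewrite size_comp => hJ S.
  have [f1 [m1 [e1 S1]]] := IH w2 _ _ _ w ca S.
  exists f1, m1; split => //.
  have := steps_jmp w wc S hj; rewrite (negPf hc) => ej.
  rewrite 2!addnS addnA -(addn1 t.+1) -(add1n t).
  by apply: steps_trans (steps_Jump _ _ _ hJ); exact: steps_trans ej e1.
- move=> cd c s s1 s2 t1 t2 hc _ IH1 _ IH2 /= wb b f m w.
  have /andP[wc w1] := wb.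
  move=> /[dup] caw /code_at_cons[hj /code_at_cons[_ /code_at_cat[ca]]].
  move=> /code_at_cons[hJ _] S; move: hJ; rewrite size_comp => hJ.
  have [f1 [m1 [e1 S1]]] := IH1 w1 _ _ _ w ca S.
  have [f2 [m2 [e2 S2]]] := IH2 wb _ _ _ w caw S1.
  exists f2, m2; split => //.
  have := steps_jmp w wc S hj; rewrite hc => ej.
  have -> : (t1 + t2).+2 = (1 + t1 + 1 + t2)%N by lia.
  apply: steps_trans e2; apply: steps_trans (steps_Jump _ _ _ hJ).
  exact: steps_trans ej e1.
- move=> cd c s hc /= /andP[wc _] b f m w.
  move=> /code_at_cons[hj /code_at_cons[hJ _]] S; exists f, m; split => //.
  have := steps_jmp w wc S hj; rewrite (negPf hc) => ej.
  rewrite !addnS; have := steps_trans ej (steps_Jump _ _ _ hJ).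
  by rewrite addn1.
Qed.

End semantics.

(** * Start-up code and transfer to the machine model *)

Local Open Scope nat_scope.

(** There is no index multiplication, so n * n comes from n additions of n. The dimension is first
    copied to index variable 0, because cell 0 is about to receive the address of real variable 0.
    Index variables 0, 1 and 3 are left with n, 1 and the length of the input. *)
Definition prologue : program :=
  [:: Iconst 33 1; Iadd 32 0 34; Iconst 35 4; Iadd 35 35 32;
      Jlt_idx 34 32 6; Jump 9;
      Iadd 35 35 32; Iadd 34 34 33; Jump 4]
  ++ flatten [seq [:: Iconst 36 k; Iadd k 36 35] | k <- iota 0 32].

Definition assemble (c : cmd) : program :=
  prologue ++ comp c (size prologue).

Section run.
Context {R : realType} {n : nat}.
Variable oracle : 'rV[R]_n -> R.

Lemma prologue_ev rest (input : seq R) : exists t f,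
  [/\ forall w, steps oracle (prologue ++ rest) t (@init R n input w)
        (Config (size prologue) f (nth 0%R input) w),
      (t <= 4 * n + 70)%N, (forall k, (k < 32)%N -> f k = (inlen n + k)%N) &
      [/\ f 32 = n, f 33 = 1%N & f 35 = inlen n]].
Proof.
set P := prologue ++ rest.
have [f1 [e1 [a1 a2 a3 a4]]] : exists f,
    (forall w, steps oracle P 4 (@init R n input w) (Config 4 f (nth 0%R input) w)) /\
    [/\ f 32 = n, f 33 = 1, f 34 = 0 & f 35 = 4 + n]%N.
  eexists; split; first by move=> w; rewrite /steps /=; reflexivity.
  by split => /=; lia.
have [t2 [f2 [e2 lt2 [b1 b2 b3]]]] : exists t f,
    [/\ forall w, steps oracle P t (Config 4 f1 (nth 0%R input) w)
         (Config 9 f (nth 0%R input) w), (t = 4 * n + 2)%N &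
       [/\ f 32 = n, f 33 = 1%N & f 35 = inlen n]].
  have : exists k, (k + f1 34 = n)%N by exists n; lia.
  move=> [k ek].
  have : f1 35 = (4 + n + f1 34 * n)%N by rewrite a3 a4; lia.
  have : exists t f, [/\ forall w, steps oracle P t (Config 4 f1 (nth 0%R input) w)
      (Config 9 f (nth 0%R input) w), (t = 4 * k + 2)%N &
     [/\ f 32 = n, f 33 = 1%N & f 35 = (f1 35 + k * n)%N]].
    move: (f1) a1 a2 ek; elim: (k) => [|k' IH] f c1 c2 ek.
      exists 2, f; split => //; last by split => //; rewrite mul0n addn0.
      by move=> w; rewrite /steps /step /P /= c1 (_ : (f 34 < n)%N = false) //; lia.
    set f' : nat -> nat := fun x => if x == 34 then (f 34 + f 33)%N else
      if x == 35 then (f 35 + f 32)%N else f x.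
    have [|||t [g [d1 d2 [d3 d4 d5]]]] := IH f' => //.
      by rewrite /f' /=; lia.
    exists (4 + t)%N, g; split; last 1 first.
    - by split => //; rewrite d5 /f' /=; lia.
    - move=> w; apply: steps_trans (d1 w); rewrite /steps /step /P /= c1.
      by rewrite (_ : (f 34 < n)%N = true) //; lia.
    - lia.
  move=> [t [f [c1 c2 [c3 c4 c5]]]] e; exists t, f; split => //; first lia.
  by split => //; rewrite c5 e /inlen; lia.
have hP k : (k < 32)%N -> onth P (9 + 2 * k)%N = Some (Iconst 36 k) /\
    onth P (9 + 2 * k).+1 = Some (Iadd k 36 35).
  by do 32! [case: k => [//|k]].
have : forall k, (k <= 32)%N -> exists f,
    [/\ forall w, steps oracle P (2 * k) (Config 9 f2 (nth 0%R input) w)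
      (Config (9 + 2 * k) f (nth 0%R input) w),
      forall j, (j < k)%N -> f j = (inlen n + j)%N &
      [/\ f 32 = n, f 33 = 1%N & f 35 = inlen n]].
  elim => [_|k IH lk]; first by exists f2.
  have [f [c1 c2 [c3 c4 c5]]] := IH (ltnW lk).
  have [h1 h2] := hP _ lk.
  exists (fun x => if x == k then (k + f 35)%N else if x == 36 then k else f x).
  have -> : (2 * k.+1 = 2 * k + 2)%N by lia.
  split.
  - move=> w; apply: steps_trans (c1 w) _; rewrite addnA.
    rewrite -(addn1 1); apply: steps_trans; first exact: steps1 h1 erefl.
    by rewrite addn2; apply: steps1 h2 _.
  - move=> j; rewrite ltnS leq_eqVlt => /orP[/eqP ->|jk].
      by rewrite eqxx c5; lia.
    by rewrite !ifF ?c2 //; lia.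
  - by split; rewrite !ifF //; lia.
move=> /(_ 32 (leqnn _))[f3 [c1 c2 c3]].
exists (4 + t2 + 64)%N, f3; split => //; last by rewrite lt2; lia.
by move=> w; apply: (steps_trans (steps_trans (e1 w) (e2 w))); exact: c1.
Qed.

(** Compiled programs flip no coin, so the run and its length are the same for every coin sequence:
    all sequences are good and the success probability is 1. *)
Lemma computes_of_ev (c : cmd) (input : seq R) (tau p : R)
    (good : set 'rV[R]_n) (tm : nat) : (0 < n)%N -> wf c ->
  (forall s0 : @st R, iv s0 0 = n -> iv s0 1 = 1%N -> iv s0 3 = inlen n ->
    (forall a, @heap_addr n a -> hp s0 a = nth 0%R input a) ->
    exists s' t, [/\ ev oracle c s0 s' t, (t <= tm)%N &
                     good (read_vec (hp s') 0)]) ->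
  ((tm + 4 * n + 70)%:R <= tau)%R -> (p <= 1)%R ->
  computes_within (assemble c) oracle input tau p good.
Proof.
move=> n0 wfc H ltau p1.
have [t [lt key]] : exists t, (t <= tm + 4 * n + 70)%N /\ forall w, exists f m,
    steps oracle (assemble c) t (@init R n input w)
         (Config (size (assemble c)) f m w) /\ good (read_vec m 0).
  have [t0 [f0 [e0 lt0 idf [f1 f2 f3]]]] :=
    prologue_ev (comp c (size prologue)) input.
  pose s0 := St (fun k => f0 (32 + k)%N) f0
    (fun k => nth 0%R input (inlen n + k)) (nth 0%R input).
  have [s' [t [ec lt hg]]] := H s0 f1 f2 f3 (fun _ _ => erefl).
  exists (t0 + t)%N; split; first by lia.
  move=> w; have S0 : @sim R n s0 f0 (nth 0%R input) by split.
  have ca : code_at (assemble c) (size prologue) (comp c (size prologue)).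
    by exists prologue, [::]; rewrite cats0.
  have [f [m [e1 S1]]] := comp_correct ec wfc w ca S0.
  exists f, m; split.
  - apply: steps_trans (e0 w) _.
    by rewrite (_ : size (assemble c) = size prologue + csize c) //
      /assemble size_cat size_comp.
  - have -> // : read_vec m 0 = read_vec (hp s') 0 :> 'rV_n.
    apply/rowP => j; rewrite !mxE (sim_hp S1) // /heap_addr /inlen.
    by apply/orP; left; rewrite add0n; have := ltn_ord j; nia.
exists t; split.
- by apply: le_trans ltau; rewrite ler_nat.
- by move=> w; have [f [m [e _]]] := key w; rewrite /run e /halted /=.
- rewrite (@eq_card _ _ predT); last first.
    move=> w; rewrite [RHS]inE; apply/mem_set; apply/asboolP.
    by have [f [m [e hg]]] := key w; rewrite /run e.
  by rewrite card_tuple card_bool natrX divff // expf_neq0 // pnatr_eq0.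
Qed.

End run.

Local Open Scope ring_scope.

(** * Total-correctness rules with time bounds *)

Section reach.
Context {R : realType} {n : nat}.
Variable oracle : 'rV[R]_n -> R.
Implicit Types (s : @st R) (c : cmd) (Q : @st R -> Prop).

Inductive reach c s (tm : nat) Q : Prop :=
  Reach s' t of ev oracle c s s' t & (t <= tm)%N & Q s'.

Record frame c s s' : Prop := Frame {
  frI : forall k, k \notin modI c -> iv s' k = iv s k;
  frR : forall k, k \notin modR c -> rv s' k = rv s k;
  frT : noIW c -> it s' = it s;
  frH : noRW c -> hp s' = hp s }.

Lemma frame_trans c s1 s2 s3 : frame c s1 s2 -> frame c s2 s3 -> frame c s1 s3.
Proof.
move=> [a1 a2 a3 a4] [b1 b2 b3 b4]; split => [k h|k h|h|h].
- by rewrite b1 ?a1.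
- by rewrite b2 ?a2.
- by rewrite b3 ?a3.
- by rewrite b4 ?a4.
Qed.

Lemma frame_sub c c' s s' : {subset modI c' <= modI c} ->
  {subset modR c' <= modR c} -> (noIW c -> noIW c') -> (noRW c -> noRW c') ->
  frame c' s s' -> frame c s s'.
Proof.
move=> sI sR sT sH [a1 a2 a3 a4]; split => [k h|k h|h|h].
- by apply: a1; apply: contra h; exact: sI.
- by apply: a2; apply: contra h; exact: sR.
- by apply: a3; exact: sT.
- by apply: a4; exact: sH.
Qed.

(** Since the frame is read off the syntax, each specification below has to mention only what its
    program changes. *)
Lemma ev_frame c s s' t : ev oracle c s s' t -> frame c s s'.
Proof.
elim=> {c s s' t} //.
- elim=> [|o l IH] s //= [_ /IH{IH}[h1 h2 h3 h4]].
  have [g1 g2 g3 g4] : frame (Blk [:: o]) s (den_op oracle o s).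
    case: s {h1 h2 h3 h4} => i t r h.
    by case: o => * /=; split => //= k; rewrite ?inE /upd => /negPf ->.
  rewrite /= !cats0 in g1 g2 g3 g4; split => [k|k|/andP[oi li]|/andP[oi li]] /=.
  + by rewrite mem_cat negb_or => /andP[ko kl]; rewrite h1 // g1.
  + by rewrite mem_cat negb_or => /andP[ko kl]; rewrite h2 // g2.
  + by rewrite h3 // g3 //= andbT.
  + by rewrite h4 // g4 //= andbT.
- move=> c1 c2 s s1 s2 t1 t2 _ IH1 _ IH2; apply: (@frame_trans _ _ s1).
    by apply: frame_sub IH1 => //= [k|k|/andP[]|/andP[]] //; rewrite mem_cat => ->.
  by apply: frame_sub IH2 => //= [k|k|/andP[]|/andP[]] //; rewrite mem_cat orbC => ->.
- move=> b c1 c2 s s1 t _ _ IH1.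
  by apply: frame_sub IH1 => //= [k|k|/andP[]|/andP[]] //; rewrite mem_cat => ->.
- move=> b c1 c2 s s1 t _ _ IH2.
  by apply: frame_sub IH2 => //= [k|k|/andP[]|/andP[]] //; rewrite mem_cat orbC => ->.
- by move=> b c s s1 s2 t1 t2 _ _ IH1 _ IH2; apply: frame_trans IH2;
  apply: frame_sub IH1.
Qed.

Lemma reach_le c s tm tm' Q : reach c s tm' Q -> (tm' <= tm)%N -> reach c s tm Q.
Proof. by move=> [s' t e lt h] l; apply: (Reach (s' := s') (t := t)) => //; lia. Qed.

Lemma reach_post c s tm Q Q' : reach c s tm Q' ->
  (forall s', frame c s s' -> Q' s' -> Q s') -> reach c s tm Q.
Proof.
move=> [s' t e lt h] l; apply: (Reach (s' := s') (t := t)) => //.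
by apply: l => //; exact: ev_frame e.
Qed.

Lemma reach_blk l s Q : ok_ops (n := n) oracle l s -> Q (den_ops oracle l s) ->
  reach (Blk l) s (size l) Q.
Proof. by move=> ok q; apply: (Reach (s' := (den_ops oracle l s)) (t := (size l))) => //; exact: ev_blk. Qed.

Lemma reach_seq c1 c2 s t1 t2 Q1 Q : reach c1 s t1 Q1 ->
  (forall s1, frame c1 s s1 -> Q1 s1 -> reach c2 s1 t2 Q) ->
  reach (Seq c1 c2) s (t1 + t2) Q.
Proof.
move=> [s1 u1 e1 l1 q1] /(_ s1 (ev_frame e1) q1)[s2 u2 e2 l2 q2].
by apply: (Reach (s' := s2) (t := (u1 + u2)%N)) => //; [exact: ev_seq e1 e2|lia].
Qed.

Lemma reach_ops l c s tm Q : ok_ops (n := n) oracle l s ->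
  reach c (den_ops oracle l s) tm Q -> reach (Seq (Blk l) c) s (size l + tm) Q.
Proof.
move=> ok [s' t e lt q]; 
by apply: (Reach (s' := s') (t := (size l + t)%N)) => //; [exact: ev_seq (ev_blk ok) e|rewrite leq_add2l].
Qed.

Lemma reach_if b c1 c2 s tm Q :
  (holds b s -> reach c1 s tm Q) -> (~~ holds b s -> reach c2 s tm Q) ->
  reach (IfC b c1 c2) s (tm + 2) Q.
Proof.
have [hb /(_ isT) h _|hb _ /(_ isT) h] := boolP (holds b s);
  have [s1 t e l q] := h.
  by apply: (Reach (s' := s1) (t := t.+1)) => //; [exact: ev_ifT|lia].
by apply: (Reach (s' := s1) (t := t.+2)) => //; [exact: ev_ifF|lia].
Qed.

(* The bound N on the number of iterations is only needed as long as the
   loop condition holds, so the loop may stop earlier. *)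
Lemma reach_while b c s0 (I : nat -> @st R -> Prop) N tm :
  I 0%N s0 ->
  (forall k s, frame (Wh b c) s0 s -> I k s -> holds b s -> (k < N)%N) ->
  (forall k s, frame (Wh b c) s0 s -> I k s -> holds b s -> reach c s tm (I k.+1)) ->
  reach (Wh b c) s0 (N * (tm + 2) + 2) (fun s => exists2 k, I k s & ~~ holds b s).
Proof.
move=> I0 lN step.
have gen d k s : (N - k = d)%N -> frame (Wh b c) s0 s -> I k s -> reach (Wh b c) s (d * (tm + 2) + 2)
    (fun s => exists2 k, I k s & ~~ holds b s).
  elim: d k s => [|d IH] k s ed fr Ik; have [hb|hb] := boolP (holds b s).
  - by have := lN _ _ fr Ik hb; lia.
  - by apply: (Reach (s' := s) (t := 2%N)) => //; [exact: ev_whF|exists k].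
  - have [s1 t1 e1 l1 I1] := step _ _ fr Ik hb.
    have [||s2 t2 e2 l2 q2] := IH k.+1 s1 _ _ I1; first by lia.
      by apply: (frame_trans fr); apply: frame_sub (ev_frame e1).
    by apply: (Reach (s' := s2) (t := (t1 + t2).+2)) => //; [exact: ev_whT e1 e2|nia].
  - by apply: (Reach (s' := s) (t := 2%N)) => //; [exact: ev_whF|lia|exists k].
by have := gen N 0%N s0; rewrite subn0; apply.
Qed.

Lemma reach_for i m c s0 (I : nat -> @st R -> Prop) N tm :
  I 0%N s0 -> iv s0 i = 0%N -> iv s0 m = N -> m \notin modI c -> 
  (forall k s, frame (Wh (CI i m) c) s0 s -> I k s -> iv s i = k -> (k < N)%N ->
     reach c s tm (fun s' => I k.+1 s' /\ iv s' i = k.+1)) ->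
  reach (Wh (CI i m) c) s0 (N * (tm + 2) + 2) (I N).
Proof.
move=> I0 i0 mN mc step.
have H := @reach_while (CI i m) c s0
  (fun k s => [/\ I k s, iv s i = k & (k <= N)%N]) N tm.
apply: reach_post (H _ _ _) _ => //.
- by move=> k s fr [Ik ik kN] /=; rewrite (frI fr mc) ik mN.
- move=> k s fr [Ik ik kN] /=; rewrite (frI fr mc) ik mN => lk.
  by apply: reach_post (step _ _ fr Ik ik lk) _ => s' _ [].
- move=> s' fr [k [Ik ik kN]] /=; rewrite (frI fr mc) ik mN -leqNgt => Nk.
  by have -> : N = k by apply/eqP; rewrite eqn_leq Nk.
Qed.

Lemma reach_forP (I : nat -> @st R -> Prop) (N tm : nat) i m c s0 tt Q :
  (N * (tm + 2) + 2 <= tt)%N ->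
  I 0%N s0 -> iv s0 i = 0%N -> iv s0 m = N -> m \notin modI c ->
  (forall k s, frame (Wh (CI i m) c) s0 s -> I k s -> iv s i = k -> (k < N)%N ->
     reach c s tm (fun s' => I k.+1 s' /\ iv s' i = k.+1)) ->
  (forall s', frame (Wh (CI i m) c) s0 s' -> I N s' -> Q s') ->
  reach (Wh (CI i m) c) s0 tt Q.
Proof.
move=> lt I0 i0 mN mc step post.
exact: (reach_le (reach_post (reach_for I0 i0 mN mc step) post) lt).
Qed.

End reach.

(** * Programs *)

(** [d := a p + b q] on blocks of n cells. Index variables from 60 on and real variables 30 and 31
    are scratch space of the vector macros, which is why callers use smaller ones. *)
Definition LIN (d a p b q : nat) : cmd :=
  Blk [:: IC 60 0; IA 61 p 60; IA 62 q 60; IA 63 d 60] ;;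
  Wh (CI 60 0) (Blk
    [:: RL 30 61; RL 31 62; RX 30 30 a; RX 31 31 b; RA 30 30 31; RW 63 30;
        IA 61 61 1; IA 62 62 1; IA 63 63 1; IA 60 60 1]).

Definition DOT (r p q : nat) : cmd :=
  Blk [:: IC 60 0; IA 61 p 60; IA 62 q 60; RC r 0] ;;
  Wh (CI 60 0) (Blk
    [:: RL 30 61; RL 31 62; RX 30 30 31; RA r r 30;
        IA 61 61 1; IA 62 62 1; IA 60 60 1]).

Definition SUP (f p a : nat) : cmd :=
  Blk [:: IC 60 0; IA 61 p 60] ;;
  Wh (CI 60 0) (
    Blk [:: RL 30 61; RS 31 0 30] ;;
    IfC (CR a 30) (Blk [:: IC f 0]) (Blk [::]) ;;
    IfC (CR a 31) (Blk [:: IC f 0]) (Blk [::]) ;;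
    Blk [:: IA 61 61 1; IA 60 60 1]).

Section macros.
Context {R : realType} {n : nat}.
Variable oracle : 'rV[R]_n -> R.
Implicit Types (s : @st R).

Definition vreg (p : nat) : bool :=
  (p + n <= inlen n)%N || (inlen n + 32 <= p)%N.

Lemma vreg_heap p k : vreg p -> (k < n)%N -> @heap_addr n (p + k).
Proof. by rewrite /vreg /heap_addr; lia. Qed.

(* Heap blocks may overlap only when the destination does not lie after the
   source. *)
Definition alias_ok (d p : nat) : bool := (d <= p)%N || (p + n <= d)%N.

Definition same_out (lo hi : nat) (h h' : nat -> R) : Prop :=
  forall k, (k < lo)%N || (hi <= k)%N -> h' k = h k.

Lemma read_vecE (h : nat -> R) p (j : 'I_n) :
  (read_vec h p : 'rV_n) 0 j = h (p + j)%N.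
Proof. by rewrite mxE. Qed.

Lemma same_out_read lo hi h h' p : same_out lo hi h h' ->
  (p + n <= lo)%N || (hi <= p)%N -> read_vec h' p = read_vec h p :> 'rV_n.
Proof.
move=> so hp; apply/rowP => j; rewrite !read_vecE so //.
by have := ltn_ord j; lia.
Qed.

Lemma LIN_spec s d a p b q : (d < 60)%N -> (p < 60)%N -> (q < 60)%N ->
  (a < 30)%N -> (b < 30)%N -> iv s 0 = n -> iv s 1 = 1%N ->
  vreg (iv s d) -> vreg (iv s p) -> vreg (iv s q) ->
  alias_ok (iv s d) (iv s p) -> alias_ok (iv s d) (iv s q) ->
  reach oracle (LIN d a p b q) s (12 * n + 6) (fun s' =>
    read_vec (hp s') (iv s d) =
      rv s a *: (read_vec (hp s) (iv s p) : 'rV_n)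
      + rv s b *: read_vec (hp s) (iv s q)
    /\ same_out (iv s d) (iv s d + n) (hp s) (hp s')).
Proof.
move=> d60 p60 q60 a30 b30 n0 n1 vd vp vq ap aq.
case: s n0 n1 vd vp vq ap aq => i t r h /= n0 n1 vd vp vq ap aq.
have [d' [p' q']] : ((d == 60)%N = false) /\ ((p == 60)%N = false) /\ ((q == 60)%N = false)
  by lia.
have [d1 [p1 q1]] : ((d == 61)%N = false) /\ ((p == 61)%N = false) /\ ((q == 61)%N = false)
  by lia.
have d2 : (d == 62)%N = false by lia.
have q2 : (q == 62)%N = false by lia.
have -> : (12 * n + 6 = 4 + (n * (10 + 2) + 2))%N by lia.
apply: reach_ops => //.
pose val (j : nat) := r a * h (i p + j)%N + r b * h (i q + j)%N.
pose I k s' := [/\ iv s' 61 = (i p + k)%N, iv s' 62 = (i q + k)%N,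
  iv s' 63 = (i d + k)%N &
  forall x, hp s' x = if (i d <= x < i d + k)%N then val (x - i d)%N
                      else h x].
apply: (reach_forP (I := I) (N := n) (tm := 10)) => //=.
- split => /=; rewrite /upd /= ?d' ?p' ?q' ?addn0 ?d1 ?p1 ?q1 ?d2 ?q2 //.
  by move=> x; rewrite ltnNge andbN.
- move=> k [i1 t1 r1 h1] fr [/= e1 e2 e3 eh] ek kn.
  have e0 : i1 0 = n by apply: etrans n0; apply: (frI fr).
  have eo : i1 1 = 1%N by apply: etrans n1; apply: (frI fr).
  have ea : r1 a = r a by apply: (frR fr); rewrite /= !inE; lia.
  have eb : r1 b = r b by apply: (frR fr); rewrite /= !inE; lia.
  have [a0 [b0 [b1 a1]]] : (a == 30)%N = false /\ (b == 30)%N = false /\ (b == 31)%N = false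
    /\ (a == 31)%N = false by lia.
  apply: reach_blk; rewrite /= /upd /=.
    by rewrite e1 e2 e3 !vreg_heap.
  rewrite e1 e2 e3 eo ek; split; last by rewrite addn1.
  rewrite a0 b0 b1 a1; split => /=; rewrite ?addn1 ?addnS //.
  move=> x; rewrite ea eb ltnS; case: eqP => [->|nx].
    rewrite leq_addr leqnn /= addKn /val !eh.
    (* The source cell that is read now is not among the first k cells of the destination, so it
       still has its original content. *)
    have -> : (i d <= i p + k < i d + k)%N = false by move: ap; rewrite /alias_ok; lia.
    have -> : (i d <= i q + k < i d + k)%N = false by move: aq; rewrite /alias_ok; lia.
    by rewrite mulrC [X in _ + X]mulrC.
  rewrite eh; have -> // : (i d <= x <= i d + k)%N = (i d <= x < i d + k)%N.
  by rewrite [(x <= _)%N]leq_eqVlt (introF eqP nx).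
- move=> s' fr [e1 e2 e3 eh]; split; last by move=> k hk; rewrite eh ifF //; lia.
  apply/rowP => j; rewrite !(read_vecE, mxE) eh.
  by have := ltn_ord j; rewrite leq_addr ltn_add2l => -> /=; rewrite addKn.
Qed.

Lemma DOT_spec s r p q : (p < 60)%N -> (q < 60)%N -> (r < 30)%N ->
  iv s 0 = n -> iv s 1 = 1%N -> vreg (iv s p) -> vreg (iv s q) ->
  reach oracle (DOT r p q) s (9 * n + 6) (fun s' =>
    rv s' r = \sum_(j < n) (read_vec (hp s) (iv s p) : 'rV_n) 0 j
                           * (read_vec (hp s) (iv s q) : 'rV_n) 0 j).
Proof.
move=> p60 q60 r30 n0 n1 vp vq.
case: s n0 n1 vp vq => i t rr h /= n0 n1 vp vq.
have [p' q'] : ((p == 60)%N = false) /\ ((q == 60)%N = false) by lia.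
have q1 : (q == 61)%N = false by lia.
have -> : (9 * n + 6 = 4 + (n * (7 + 2) + 2))%N by lia.
apply: reach_ops => //.
pose I k s' := [/\ iv s' 61 = (i p + k)%N, iv s' 62 = (i q + k)%N &
  rv s' r = \sum_(0 <= j < k) h (i p + j)%N * h (i q + j)%N].
apply: (reach_forP (I := I) (N := n) (tm := 7)) => //=.
- by split => /=; rewrite /upd /= ?p' ?q' ?addn0 ?q1 ?eqxx // big_geq.
- move=> k [i1 t1 r1 h1] fr [/= e1 e2 er] ek kn.
  have eo : i1 1 = 1%N by apply: etrans n1; apply: (frI fr).
  have eh : h1 = h by apply: (frH fr).
  have [r0 r3] : (r == 30)%N = false /\ (r == 31)%N = false by lia.
  apply: reach_blk; rewrite /= /upd /=.
    by rewrite e1 e2 !vreg_heap.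
  rewrite e1 e2 eo ek; split; last by rewrite addn1.
  split => /=; rewrite ?addn1 ?addnS // ?eqxx r0 r3 er eh.
  by rewrite big_nat_recr.
- move=> s' fr [e1 e2 ->]; rewrite big_mkord.
  by apply: eq_bigr => j _; rewrite !read_vecE.
Qed.

Lemma SUP_spec s f p a : (f < 60)%N -> (1 < f)%N -> (p < 60)%N -> (a < 30)%N ->
  iv s 0 = n -> iv s 1 = 1%N -> rv s 0 = 0 -> vreg (iv s p) -> iv s f = 1%N ->
  reach oracle (SUP f p a) s (13 * n + 4) (fun s' =>
    iv s' f = [forall j : 'I_n,
      `|(read_vec (hp s) (iv s p) : 'rV_n) 0 j| <= rv s a] :> nat).
Proof.
move=> f60 f1 p60 a30 n0 n1 z0 vp ef.
case: s n0 n1 z0 vp ef => i t rr h /= n0 n1 z0 vp ef.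
have p' : (p == 60)%N = false by lia.
have -> : (13 * n + 4 = 2 + (13 * n + 2))%N by lia.
apply: reach_ops => //.
pose I k s' := iv s' 61 = (i p + k)%N /\ 
  iv s' f = [forall j : 'I_n, (j < k)%N ==> (`|h (i p + j)%N| <= rr a)] :> nat.
have [F0 [F1 [F3 [F4 F5]]]] : (f == 0)%N = false /\ (f == 1)%N = false /\ (f == 60)%N = false
  /\ (f == 61)%N = false /\ (61 == f)%N = false by lia.
apply: (reach_forP (I := I) (N := n) (tm := 11)) => //=; first lia.
- split => /=; rewrite /upd /= ?p' ?addn0 ?F3 ?F4 //.
  by rewrite ef (_ : [forall _, _] = true) //; apply/forallP => j.
- by rewrite !inE; lia.
- move=> k [i1 t1 r1 h1] fr [/= e1 er] ek kn.
  have eo : i1 1 = 1%N by apply: etrans n1; apply: (frI fr); rewrite /= !inE; lia.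
  have eh : h1 = h by apply: (frH fr).
  have ea : r1 a = rr a by apply: (frR fr); rewrite /= !inE; lia.
  have ez : r1 0 = 0 by apply: etrans z0; apply: (frR fr).
  have [a0 a3] : (a == 30)%N = false /\ (a == 31)%N = false by lia.
  subst h1; apply: (reach_le (tm' := 2 + ((1 + 2) + ((1 + 2) + 2)))) => //.
  apply: reach_ops; first by rewrite /= e1 !vreg_heap.
  apply: reach_seq.
    apply: (reach_if (Q := fun s' => s' = St
      (if rr a < h (i p + k)%N then upd i1 f 0%N else i1) t1
      (upd (upd r1 30 (h (i p + k)%N)) 31 (- h (i p + k)%N)) h)) => /=.
      rewrite /upd /= a0 a3 ea e1 => ->.
      apply: (reach_le (tm' := 1)) => //; apply: reach_blk => //=.
      by rewrite ez sub0r.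
    rewrite /upd /= a0 a3 ea e1 => /negPf ->.
    apply: (reach_le (tm' := 0)) => //; apply: reach_blk => //=.
    by rewrite ez sub0r.
  move=> s3 _ ->; apply: reach_seq.
    apply: (reach_if (Q := fun s' => s' = St
      (if (rr a < h (i p + k)%N) || (rr a < - h (i p + k)%N) then upd i1 f 0%N
       else i1) t1
      (upd (upd r1 30 (h (i p + k)%N)) 31 (- h (i p + k)%N)) h)) => /=.
      rewrite /upd /= a0 a3 ea => ->.
      apply: (reach_le (tm' := 1)) => //; apply: reach_blk => //=.
      rewrite orbT; congr St; apply/funext => x; rewrite /upd.
      by case xf: (x == f) => //; case: ifP => // _; rewrite xf.
    rewrite /upd /= a0 a3 ea => /negPf ->.
    apply: (reach_le (tm' := 0)) => //; apply: reach_blk => //=.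
    by rewrite orbF.
  move=> s4 _ ->; apply: (reach_le (tm' := 2)) => //; apply: reach_blk => //=.
  set b := _ || _; set i2 := if b then _ else _.
  have i2E x : (x == f)%N = false -> i2 x = i1 x.
    by move=> xf; rewrite /i2; case: (b) => //; rewrite /upd xf.
  have i2f : i2 f = if b then 0%N else i1 f.
    by rewrite /i2; case: (b) => //; rewrite /upd eqxx.
  have g61 : i2 61%N = (i p + k)%N by rewrite i2E // eq_sym.
  have g60 : i2 60%N = k by rewrite i2E // eq_sym.
  have g1 : i2 1%N = 1%N by rewrite i2E // eq_sym.
  rewrite {}/I /upd /= F4 F3 g61 g60 g1 !addn1 addnS.
  split => //; split => //; rewrite i2f.
  rewrite er.
  have bE : ~~ b = (`|h (i p + k)%N| <= rr a).
    by rewrite /b negb_or -!leNgt ler_norml lerNl andbC.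
  have -> : [forall j : 'I_n, (j < k.+1)%N ==> (`|h (i p + j)%N| <= rr a)] =
    [forall j : 'I_n, (j < k)%N ==> (`|h (i p + j)%N| <= rr a)] && ~~ b.
    rewrite bE; apply/forallP/andP => [H|[/forallP H Hk] j].
      split; last by have := H (Ordinal kn); rewrite /= ltnS leqnn.
      by apply/forallP => j; apply/implyP => jk; have := H j;
        rewrite ltnS (ltnW jk).
    rewrite ltnS leq_eqVlt; case: eqP => [->//|_] /=; exact: H.
  by case: (b); rewrite ?andbF ?andbT.
- move=> s' fr [_ ->]; congr nat_of_bool; apply: eq_forallb => j.
  by rewrite ltn_ord /= read_vecE.
Qed.

End macros.

(** * Membership tests by oracle queries *)

Local Open Scope nat_scope.

(** Leaves (z - q) B - x in block T. The difference z - q remains in block D, where [NEAR] also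
    bounds its coordinates. *)
Definition AMB (z q x : nat) : cmd :=
  LIN 7 1 z 2 q ;; LIN 8 2 x 0 x ;;
  Blk [:: IC 50 0; IA 51 4 50; IA 52 7 50] ;;
  Wh (CI 50 0) (Blk [:: RL 20 52] ;; LIN 8 1 8 20 51 ;;
    Blk [:: IA 51 51 0; IA 52 52 1; IA 50 50 1]).

(* With a membership oracle a query v fails when 1_C(v) < 1, with a gauge
   oracle when 1 < ||v||_C. *)
Definition fails (mo : bool) : cond := if mo then CR 12 1 else CR 1 12.

(** A failed test clears index variable 2 and a successful one leaves it alone, so consecutive tests
    form a conjunction. *)
Definition TST (mo : bool) (a : nat) : cmd :=
  Blk [:: RD 21 1 a] ;; LIN 9 21 8 0 8 ;; Blk [:: RQ 12 9] ;;
  IfC (fails mo) (Blk [:: IC 2 0]) (Blk [::]).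

(** The second test divides by -r: it checks the opposite point, which gives membership in the
    symmetric set K. *)
Definition NEAR (mo : bool) (z q r : nat) : cmd :=
  Blk [:: IC 2 1] ;; AMB z q 6 ;; Blk [:: RX 11 r 5] ;; SUP 2 7 11 ;;
  TST mo r ;; Blk [:: RS 10 0 r] ;; TST mo 10.

Definition FILC (mo : bool) : cmd :=
  Blk [:: IC 2 1] ;; AMB 13 6 5 ;; TST mo 4.

Section layout.
Variable n : nat.
Definition pZ := inlen n + 32.
Definition pD := pZ + n.
Definition pT := pZ + 2 * n.
Definition pU := pZ + 3 * n.
Definition pO := pZ + 4 * n.
Definition pY := pZ + 5 * n.
Definition pM := pZ + 14 * n.
Definition free0 := pZ + 14 * n + n * n.

(** Each address is given relative to its predecessor. The addresses are then made opaque, so that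
    [lia] works with these relations instead of unfolded products. *)
Lemma layoutE : [/\ pZ = 4 + n * n + n + 32, pD = pZ + n, pT = pD + n,
  pU = pT + n & [/\ pO = pU + n, pY = pO + n, pM = pY + 9 * n &
  free0 = pM + n * n]].
Proof. by rewrite /free0 /pM /pY /pO /pU /pT /pD /pZ /inlen; split; last split; lia. Qed.
End layout.

Lemma row_end i n : i < n -> i * n + n <= n * n.
Proof. by move=> h; rewrite addnC -mulSn leq_mul2r h orbT. Qed.

Opaque pZ pD pT pU pO pY pM free0.

(* Fixed contents of the index variables: 0 is the dimension, 1 is one, 3 is
   zero, 4 to 12 are addresses (B, x, the zero vector, the scratch vectors D,
   T, U, the output vector, a buffer Y for nine vectors, a matrix M), 13 is the
   first free real cell, 14 the start of the table of lists, and 15 the exponent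
   of g. Variable 2 is the result of a test. *)
Definition ctx_regs : seq nat := [:: 0; 1; 3; 4; 5; 6; 7; 8; 9; 10; 11; 12; 14].

Section tests.
Context {R : realType} {n : nat}.
Variables (oracle : 'rV[R]_n -> R) (mo : bool).
Variables (B : 'M[R]_n) (x : 'rV[R]_n).
Implicit Types (s : @st R).

Record ctx s : Prop := Ctx {
  ctx_n : iv s 0 = n;
  ctx_1 : iv s 1 = 1;
  ctx_0 : iv s 3 = 0;
  ctx_B : iv s 4 = 4;
  ctx_X : iv s 5 = 4 + n * n;
  ctx_Z : iv s 6 = pZ n;
  ctx_D : iv s 7 = pD n;
  ctx_T : iv s 8 = pT n;
  ctx_U : iv s 9 = pU n;
  ctx_O : iv s 10 = pO n;
  ctx_Y : iv s 11 = pY n;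
  ctx_M : iv s 12 = pM n;
  ctx_tb : iv s 14 = 96;
  ctx_r0 : rv s 0 = 0%R;
  ctx_r1 : rv s 1 = 1%R;
  ctx_r2 : rv s 2 = (-1)%R;
  ctx_hB : forall i : 'I_n, read_vec (hp s) (4 + i * n) = row i B;
  ctx_hX : read_vec (hp s) (4 + n * n) = x;
  ctx_hZ : read_vec (hp s) (pZ n) = 0%R :> 'rV_n }.

Lemma ctx_frame c s s' : ctx s -> frame c s s' ->
  all (fun k => k \notin modI c) ctx_regs ->
  all (fun k => k \notin modR c) [:: 0; 1; 2] ->
  (forall k, k < pD n -> hp s' k = hp s k) -> ctx s'.
Proof.
move=> C fr; rewrite /= !andbT.
move=> /and4P[h0 h1 h3 /and5P[h4 h5 h6 h7 /and5P[h8 h9 h10 h11 /andP[h12 h14]]]].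
move=> /and3P[r0 r1 r2] hh.
have [PZ PD _ _ _] := layoutE n.
have hr p : p + n <= pD n -> read_vec (hp s') p = read_vec (hp s) p :> 'rV_n.
  move=> lp; apply/rowP => j; rewrite !read_vecE; apply: hh.
  by apply: leq_trans lp; rewrite ltn_add2l.
split; try by (rewrite (frI fr); [apply C|assumption]).
- by rewrite (frR fr); [apply C|assumption].
- by rewrite (frR fr); [apply C|assumption].
- by rewrite (frR fr); [apply C|assumption].
- move=> i; rewrite hr; first exact: (ctx_hB C).
  by have := row_end (ltn_ord i); clear -PD PZ; lia.
- by rewrite hr; [exact: (ctx_hX C)|clear -PD PZ; lia].
- by rewrite hr; [exact: (ctx_hZ C)|clear -PD PZ; lia].
Qed.

Definition tst (v : 'rV[R]_n) : bool :=
  if mo then ~~ (oracle v < 1)%R else ~~ (1 < oracle v)%R.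

Definition amb (z q u : 'rV[R]_n) : 'rV[R]_n := ((z - q) *m B - u)%R.

(** The test for z - q in t A_h, as [nearbP] confirms. *)
Definition nearb (h t : R) (z q : 'rV[R]_n) : bool :=
  [&& [forall j, `|(z - q) 0 j| <= t * h]%R,
      tst (t^-1 *: amb z q 0)%R & tst ((- t)^-1 *: amb z q 0)%R].

Definition filcb (a : R) (z : 'rV[R]_n) : bool := tst (a^-1 *: amb z 0 x)%R.

(* Everything below the scratch vectors, and everything from the output vector
   to the free pointer, is kept. *)
Definition keeps lo (h h' : nat -> R) :=
  forall k, (k < pD n) || ((pO n <= k) && (k < lo)) -> h' k = h k.

Lemma keeps_trans lo h1 h2 h3 : keeps lo h1 h2 -> keeps lo h2 h3 -> keeps lo h1 h3.
Proof. by move=> k1 k2 k hk; rewrite k2 ?k1. Qed.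

Lemma keeps_read lo h h' p : keeps lo h h' ->
  (p + n <= pD n) || ((pO n <= p) && (p + n <= lo)) ->
  read_vec h' p = read_vec h p :> 'rV_n.
Proof.
move=> kk hp; apply/rowP => j; rewrite !read_vecE kk //.
by have := ltn_ord j; lia.
Qed.

Lemma vreg_B (i : 'I_n) : @vreg n (4 + i * n).
Proof. by rewrite /vreg /inlen; have := row_end (ltn_ord i); lia. Qed.

Lemma vreg_ge p : pZ n <= p -> @vreg n p.
Proof. by have [PZ _ _ _ _] := layoutE n; rewrite /vreg /inlen; lia. Qed.

Definition tAMB := n * (12 * n + 12) + 24 * n + 17.

Lemma AMB_spec s z q w : ctx s ->
  z < 50 -> q < 50 -> w < 50 ->
  [/\ iv s z = pZ n \/ pO n <= iv s z, iv s q = pZ n \/ pO n <= iv s q &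
      iv s w = pZ n \/ iv s w = 4 + n * n] ->
  reach oracle (AMB z q w) s tAMB (fun s' =>
    [/\ read_vec (hp s') (pT n) = amb (read_vec (hp s) (iv s z))
          (read_vec (hp s) (iv s q)) (read_vec (hp s) (iv s w)),
        read_vec (hp s') (pD n) = (read_vec (hp s) (iv s z)
          - read_vec (hp s) (iv s q) : 'rV_n)%R &
        same_out (pD n) (pU n) (hp s) (hp s')]).
Proof.
move=> C z50 q50 w50 [vz vq vw].
have [PZ PD PT PU [PO _ _ _]] := layoutE n.
have -> : tAMB = (12 * n + 6) + ((12 * n + 6) + (3 + (n * (12 * n + 10 + 2) + 2))).
  by rewrite /tAMB; lia.
apply: reach_seq.
  apply: (LIN_spec oracle (d := 7) (a := 1) (p := z) (b := 2) (q := q)) => //;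
   rewrite ?(ctx_n C) ?(ctx_1 C) ?(ctx_D C) //; try lia;
   try (apply: vreg_ge; lia); rewrite /alias_ok; lia.
move=> s1 fr1 [hD so1].
have C1 : ctx s1 by apply: (ctx_frame C fr1) => //; move=> k hk; apply: so1;
  rewrite (ctx_D C) hk.
have wE : iv s1 w = iv s w by rewrite (frI fr1) //= !inE; lia.
apply: reach_seq.
  apply: (LIN_spec oracle (d := 8) (a := 2) (p := w) (b := 0) (q := w)) => //;
   rewrite ?(ctx_n C1) ?(ctx_1 C1) ?(ctx_T C1) ?wE //; try lia;
   try (rewrite /vreg /inlen; lia); rewrite /alias_ok; lia.
move=> s2 fr2 [hT so2].
have C2 : ctx s2 by apply: (ctx_frame C1 fr2) => //; move=> k hk; apply: so2;
  rewrite (ctx_T C1); lia.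
apply: reach_ops => //.
pose dl := (read_vec (hp s) (iv s z) - read_vec (hp s) (iv s q) : 'rV_n)%R.
have hD2 : read_vec (hp s2) (pD n) = dl.
  rewrite (same_out_read so2) ?(ctx_T C1); last by lia.
  move: hD; rewrite (ctx_D C) (ctx_r1 C) (ctx_r2 C) => ->.
  by rewrite scale1r scaleN1r.
have hT2 : read_vec (hp s2) (pT n) = (- read_vec (hp s) (iv s w) : 'rV_n)%R.
  move: hT; rewrite (ctx_T C1) (ctx_r2 C1) (ctx_r0 C1) wE => ->.
  rewrite scale0r addr0 scaleN1r (same_out_read so1) // (ctx_D C); lia.
set s3 := den_ops _ _ _.
have C3 : ctx s3.
  have fr3 : frame (Blk [:: IC 50 0; IA 51 4 50; IA 52 7 50]) s2 s3.
    exact: (ev_frame (ev_blk (n := n) (oracle := oracle) _)).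
  by apply: (ctx_frame C2 fr3) => // k hk; rewrite (frH fr3).
pose I k s' := [/\ iv s' 51 = 4 + k * n, iv s' 52 = pD n + k,
  read_vec (hp s') (pT n) = (\sum_(i < n | (i < k)%N) dl 0 i *: row i B
                             - read_vec (hp s) (iv s w))%R :> 'rV_n &
  same_out (pD n) (pU n) (hp s2) (hp s') /\
  read_vec (hp s') (pD n) = dl].
apply: (reach_forP (I := I) (N := n) (tm := 12 * n + 10)) => //.
- rewrite /I /s3; case: (s2) C2 hD2 hT2 => i2 t2 r2 h2 /= C2 hD2 hT2.
  rewrite /upd /=.
  split => //; rewrite ?addn0.
  + by have /= -> := ctx_B C2.
  + by have /= -> := ctx_D C2.
  + by rewrite hT2 big1 ?sub0r.
- by rewrite /s3; case: (s2).
- exact: (ctx_n C3).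
- move=> k s4 fr4 [e1 e2 hT4 [so4 hD4]] ek kn.
  have hk : hp s4 (pD n + k) = dl 0%R (Ordinal kn) by rewrite -hD4 read_vecE.
  have C4 : ctx s4.
    apply: (ctx_frame C3 fr4) => //= k' hk'.
    by rewrite so4 ?hk' // /s3; case: (s2).
  apply: (reach_le (tm' := 1 + ((12 * n + 6) + 3))); last by lia.
  apply: reach_ops.
    by split => //; rewrite /= e2 /heap_addr /inlen; lia.
  have C5 : ctx (den_ops oracle [:: RL 20 52] s4).
    have fr5 : frame (Blk [:: RL 20 52]) s4 (den_ops oracle [:: RL 20 52] s4).
      apply: (ev_frame (ev_blk (n := n) (oracle := oracle) _)).
      by split => //; rewrite /= e2 /heap_addr /inlen; lia.
    apply: (ctx_frame C4 fr5) => // k' hk'.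
    by case: (s4).
  set s5 := den_ops _ _ _ in C5 *.
  have [e51 e52 e50] : [/\ iv s5 51 = 4 + k * n, iv s5 52 = pD n + k & iv s5 50 = k].
    by rewrite -e1 -e2 -ek /s5; case: (s4).
  have h5 : hp s5 = hp s4 by rewrite /s5; case: (s4).
  have r5 : rv s5 20 = hp s4 (pD n + k).
    by rewrite /s5 -e2; case: (s4) => * /=.
  apply: reach_seq.
    apply: (LIN_spec oracle (d := 8) (a := 1) (p := 8) (b := 20) (q := 51)) => //;
     rewrite ?(ctx_n C5) ?(ctx_1 C5) ?(ctx_T C5) ?e51 //.
    * by apply: vreg_ge; lia.
    * by apply: vreg_ge; lia.
    * exact: (vreg_B (Ordinal kn)).
    * by rewrite /alias_ok leqnn.
    * by rewrite /alias_ok; have := row_end kn; clear -PZ PD PT; lia.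
  move=> s6 fr6 []; rewrite (ctx_T C5) h5 => hT6 so6.
  have C6 : ctx s6.
    by apply: (ctx_frame C5 fr6) => // k' hk'; rewrite h5 so6 //; lia.
  have hB : read_vec (hp s4) (4 + k * n) = row (Ordinal kn) B.
    exact: (ctx_hB C4 (Ordinal kn)).
  apply: reach_blk => //.
  have [d0 d1 d50] : [/\ iv s6 51 = 4 + k * n, iv s6 52 = pD n + k & iv s6 50 = k].
    by rewrite !(frI fr6).
  split; last first.
    have -> : iv (den_ops oracle [:: IA 51 51 0; IA 52 52 1; IA 50 50 1] s6) 50
      = iv s6 50 + iv s6 1 by case: (s6).
    by rewrite d50 (ctx_1 C6) addn1.
  have -> : I k.+1 (den_ops oracle [:: IA 51 51 0; IA 52 52 1; IA 50 50 1] s6) =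
    I k.+1 (St (upd (upd (iv s6) 51 (iv s6 51 + iv s6 0)) 52 (iv s6 52 + iv s6 1))
       (it s6) (rv s6) (hp s6)) by rewrite /I; case: (s6).
  rewrite /I /upd /= d0 d1 (ctx_n C6) (ctx_1 C6) addn1 addnS; split => //.
  + by rewrite mulSn; lia.
  + rewrite hT6 (ctx_r1 C5) r5 hk e51 hB scale1r hT4.
    rewrite addrAC; congr (_ - _)%R.
    rewrite [in RHS](bigD1 (Ordinal kn)) //= addrC; congr (_ + _)%R.
    by apply: eq_bigl => i; rewrite -val_eqE /= ltnS ltn_neqAle andbC.
  + split; last by rewrite (same_out_read so6) //; lia.
    by move=> k' hk'; rewrite so6 ?so4 //; lia.
- move=> s' fr [_ _ hT' [so' hD']]; split => //.
  + rewrite hT' /amb mulmx_sum_row; congr (_ - _)%R.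
    by apply: eq_bigl => i; rewrite ltn_ord.
  + move=> k hk; rewrite so' // so2 ?so1 ?(ctx_D C) ?(ctx_T C1) //; lia.
Qed.

Definition tTST := 12 * n + 11.

Lemma TST_spec s a : ctx s -> a < 30 ->
  reach oracle (TST mo a) s tTST (fun s' =>
    iv s' 2 = (if tst ((rv s a)^-1 *: read_vec (hp s) (pT n))%R then iv s 2 else 0) /\
    same_out (pU n) (pO n) (hp s) (hp s')).
Proof.
move=> C a30.
have [PZ PD PT PU [PO _ _ _]] := layoutE n.
have -> : tTST = 1 + ((12 * n + 6) + (1 + (1 + 2))) by rewrite /tTST; lia.
apply: reach_ops => //.
set s1 := den_ops _ _ _.
have C1 : ctx s1.
  have fr1 : frame (Blk [:: RD 21 1 a]) s s1.
    exact: (ev_frame (ev_blk (n := n) (oracle := oracle) _)).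
  by apply: (ctx_frame C fr1) => // k hk; rewrite /s1; case: (s).
have [h1 i1 r1] : [/\ hp s1 = hp s, iv s1 = iv s & rv s1 21 = (rv s a)^-1%R].
  rewrite /s1; move: (ctx_r1 C); case: (s) => i t r h /= e.
  by split => //; rewrite /upd /= e div1r.
apply: reach_seq.
  apply: (LIN_spec oracle (d := 9) (a := 21) (p := 8) (b := 0) (q := 8)) => //;
   rewrite ?(ctx_n C1) ?(ctx_1 C1) ?(ctx_T C1) ?(ctx_U C1) //;
   try (apply: vreg_ge; lia); rewrite /alias_ok; lia.
move=> s2 fr2 []; rewrite (ctx_U C1) (ctx_T C1) r1 (ctx_r0 C1) scale0r addr0 h1.
move=> hU so2; have i2 : iv s2 9 = pU n by rewrite (frI fr2) // (ctx_U C1).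
apply: reach_ops; first by split => //=; rewrite i2 /inlen; lia.
set s3 := den_ops _ _ _.
have [h3 i3 r3 r31] : [/\ hp s3 = hp s2, iv s3 2 = iv s 2,
   rv s3 12 = oracle ((rv s a)^-1 *: read_vec (hp s) (pT n))%R & rv s3 1 = 1%R].
  have e2 : iv s2 2 = iv s 2 by rewrite (frI fr2) // i1.
  have e3 : rv s2 1 = 1%R by rewrite (frR fr2) // (ctx_r1 C1).
  by rewrite /s3; move: i2 hU e2 e3; case: (s2) => i t r h /= -> -> -> e3.
have hold : holds (fails mo) s3 = ~~ tst ((rv s a)^-1 *: read_vec (hp s) (pT n))%R.
  by rewrite /tst /fails; case: (mo) => /=; rewrite r3 r31 negbK.
apply: reach_if.
  rewrite hold => /negPf ->; apply: reach_blk => //; rewrite /=.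
  split; first by case: (s3).
  have -> : hp (den_ops oracle [:: IC 2 0] s3) = hp s3 by case: (s3).
  by rewrite h3; move: so2; rewrite PO.
rewrite hold negbK => ->; apply: (reach_le (tm' := 0)) => //; apply: reach_blk => //=.
by rewrite h3 i3; split => //; move: so2; rewrite PO.
Qed.

Lemma same_out_sub lo hi lo' hi' (h h' : nat -> R) : same_out lo hi h h' ->
  lo' <= lo -> hi <= hi' -> same_out lo' hi' h h'.
Proof. by move=> so l1 l2 k hk; apply: so; lia. Qed.

Lemma same_out_trans lo hi (h1 h2 h3 : nat -> R) : same_out lo hi h1 h2 ->
  same_out lo hi h2 h3 -> same_out lo hi h1 h3.
Proof. by move=> s1 s2 k hk; rewrite s2 ?s1. Qed.

Definition tNEAR := tAMB + 2 * tTST + 13 * n + 7.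

Lemma NEAR_spec s z q r : ctx s -> z < 50 -> q < 50 -> r < 10 ->
  1 < z -> 2 < q -> (z == 2) = false ->
  iv s z = pZ n \/ pO n <= iv s z -> iv s q = pZ n \/ pO n <= iv s q ->
  reach oracle (NEAR mo z q r) s tNEAR (fun s' =>
    iv s' 2 = nearb (rv s 5) (rv s r) (read_vec (hp s) (iv s z))
                (read_vec (hp s) (iv s q)) :> nat /\
    same_out (pD n) (pO n) (hp s) (hp s')).
Proof.
move=> C z50 q50 r10 z1 q2 z2 vz vq.
have [PZ PD PT PU [PO _ _ _]] := layoutE n.
have -> : tNEAR = 1 + (tAMB + (1 + ((13 * n + 4) + (tTST + (1 + tTST))))).
  by rewrite /tNEAR; lia.
have q2f : (q == 2) = false by lia.
apply: reach_ops => //.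
set s1 := den_ops _ _ _.
have fr1 : frame (Blk [:: IC 2 1]) s s1.
  exact: (ev_frame (ev_blk (n := n) (oracle := oracle) _)).
have C1 : ctx s1.
  by apply: (ctx_frame C fr1) => // k hk; rewrite (frH fr1).
have e1 : iv s1 2 = 1 by rewrite /s1; case: (s).
have ez : iv s1 z = iv s z by rewrite (frI fr1) //= inE z2.
have eq' : iv s1 q = iv s q by rewrite (frI fr1) //= inE q2f.
have h1 : hp s1 = hp s by rewrite (frH fr1).
apply: reach_seq.
  apply: (AMB_spec (z := z) (q := q) (w := 6)) => //; rewrite ez eq' (ctx_Z C1).
  by split => //; left.
move=> s2 fr2; rewrite ez eq' (ctx_Z C1) (ctx_hZ C1) h1 => -[hT hD so2].
have C2 : ctx s2 by apply: (ctx_frame C1 fr2) => // k hk; rewrite h1 so2 ?hk.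
apply: reach_ops => //.
set s3 := den_ops _ _ _.
have fr3 : frame (Blk [:: RX 11 r 5]) s2 s3.
  exact: (ev_frame (ev_blk (n := n) (oracle := oracle) _)).
have C3 : ctx s3.
  by apply: (ctx_frame C2 fr3) => // k hk; rewrite (frH fr3).
have rr k : k < 10 -> rv s2 k = rv s k.
  by move=> hk; rewrite (frR fr2) ?(frR fr1) //= !inE; lia.
have r11 : rv s3 11 = (rv s r * rv s 5)%R.
  by rewrite -!rr // /s3; case: (s2).
have h3 : hp s3 = hp s2 by rewrite (frH fr3).
apply: reach_seq.
  apply: (SUP_spec oracle (f := 2) (p := 7) (a := 11)) => //;
    rewrite ?(ctx_n C3) ?(ctx_1 C3) ?(ctx_r0 C3) ?(ctx_D C3) //.
    by apply: vreg_ge; lia.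
  by rewrite (frI fr3) // (frI fr2) // e1.
move=> s4 fr4; rewrite (ctx_D C3) h3 hD r11 => e4.
have h4 : hp s4 = hp s2 by rewrite (frH fr4).
have C4 : ctx s4 by apply: (ctx_frame C3 fr4) => // k hk; rewrite h4 h3.
have rr4 k : k < 10 -> rv s4 k = rv s k.
  by move=> hk; rewrite (frR fr4) ?(frR fr3) ?rr //= !inE; lia.
apply: reach_seq.
  by apply: (TST_spec (a := r)) => //; lia.
move=> s5 fr5; rewrite rr4 // h4 hT e4 => -[e5 so5].
have C5 : ctx s5.
  by apply: (ctx_frame C4 fr5) => // k hk; rewrite so5 ?h4 //; lia.
apply: reach_ops => //.
set s6 := den_ops _ _ _.
have fr6 : frame (Blk [:: RS 10 0 r]) s5 s6.
  exact: (ev_frame (ev_blk (n := n) (oracle := oracle) _)).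
have h6 : hp s6 = hp s5 by rewrite (frH fr6).
have C6 : ctx s6.
  by apply: (ctx_frame C5 fr6) => // k hk; rewrite h6.
have r6 : rv s6 10 = (- rv s r)%R.
  have <- : rv s5 r = rv s r by rewrite (frR fr5) ?rr4 //= !inE; lia.
  rewrite /s6; move: (ctx_r0 C5); case: (s5) => i t rr' h /= e.
  by rewrite /upd /= e sub0r.
apply: reach_post; first by apply: (TST_spec (a := 10)).
move=> s7 fr7 [e7 so7]; split.
  rewrite e7 r6 h6 (same_out_read so5); last by lia.
  rewrite hT (frI fr6) // e5 /nearb.
  by case: tst; case: tst; case: [forall _, _].
rewrite h6 in so7.
have so7' := same_out_sub so7 (lo' := pD n) (hi' := pO n).
have so5' := same_out_sub so5 (lo' := pD n) (hi' := pO n).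
have so2' := same_out_sub so2 (lo' := pD n) (hi' := pO n).
apply: (same_out_trans (same_out_trans (so2' _ _) (so5' _ _)) (so7' _ _)); lia.
Qed.

Definition tFILC := tAMB + tTST + 1.

Lemma FILC_spec s : ctx s -> pO n <= iv s 13 ->
  reach oracle (FILC mo) s tFILC (fun s' =>
    iv s' 2 = filcb (rv s 4) (read_vec (hp s) (iv s 13)) :> nat /\
    same_out (pD n) (pO n) (hp s) (hp s')).
Proof.
move=> C v13.
have [PZ PD PT PU [PO _ _ _]] := layoutE n.
have -> : tFILC = 1 + (tAMB + tTST) by rewrite /tFILC; lia.
apply: reach_ops => //.
set s1 := den_ops _ _ _.
have fr1 : frame (Blk [:: IC 2 1]) s s1.
  exact: (ev_frame (ev_blk (n := n) (oracle := oracle) _)).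
have C1 : ctx s1.
  by apply: (ctx_frame C fr1) => // k hk; rewrite (frH fr1).
have e1 : iv s1 2 = 1 by rewrite /s1; case: (s).
have h1 : hp s1 = hp s by rewrite (frH fr1).
have e13 : iv s1 13 = iv s 13 by rewrite (frI fr1).
apply: reach_seq.
  apply: (AMB_spec (z := 13) (q := 6) (w := 5)) => //.
  by rewrite e13 (ctx_Z C1) (ctx_X C1); split; [right|left|right].
move=> s2 fr2; rewrite e13 (ctx_Z C1) (ctx_hZ C1) (ctx_X C1) (ctx_hX C1) h1.
move=> -[hT _ so2].
have C2 : ctx s2 by apply: (ctx_frame C1 fr2) => // k hk; rewrite h1 so2 ?hk.
apply: reach_post; first by apply: (TST_spec (a := 4)).
move=> s3 fr3 [e3 so3]; split.
  rewrite e3 hT (frR fr2) // (frR fr1) // (frI fr2) // e1 /filcb.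
  by case: tst.
have so3' := same_out_sub so3 (lo' := pD n) (hi' := pO n).
have so2' := same_out_sub so2 (lo' := pD n) (hi' := pO n).
apply: (same_out_trans (so2' _ _) (so3' _ _)); lia.
Qed.

End tests.

(** * Greedy pruning of sums of two lists *)

Local Open Scope ring_scope.

Section greedy.
Context {V : zmodType}.
Variables (f : pred V) (nr : V -> V -> bool).

Definition ins (D : seq V) (z : V) : seq V :=
  if f z && ~~ has (nr z) D then rcons D z else D.

Definition comb1 (Y : seq V) (D : seq V) (u : V) : seq V :=
  foldl (fun D v => ins D (u + v)) D Y.

(* Greedy choice among the sums u + v of those that satisfy f and are not
   close to an element chosen before. *)
Definition comb (X Y : seq V) : seq V := foldl (comb1 Y) [::] X.

Lemma size_ins D z : (size D <= size (ins D z))%N.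
Proof. by rewrite /ins; case: ifP; rewrite ?size_rcons. Qed.

Lemma size_comb1 Y D u : (size D <= size (comb1 Y D u))%N.
Proof.
rewrite /comb1; elim: Y D => //= v Y IH D.
exact: leq_trans (size_ins _ _) (IH _).
Qed.

Lemma size_foldl_comb1 Y X D : (size D <= size (foldl (comb1 Y) D X))%N.
Proof.
elim: X D => //= u X IH D; exact: leq_trans (size_comb1 _ _ _) (IH _).
Qed.

(** Insertions never shrink a list, so the list at any moment of the double loop is no longer than
    the final one. A bound on the final list, which is what packing provides, therefore bounds every
    scan. *)
Lemma size_comb_take Y X k j :
  (size (comb1 (take j Y) (foldl (comb1 Y) [::] (take k X)) (nth 0%R X k))
   <= size (comb X Y))%N \/ (size X <= k)%N.
Proof.
have [|kX] := leqP (size X) k; [by right|left].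
rewrite /comb -[in leqRHS](cat_take_drop k.+1 X) foldl_cat.
apply: leq_trans (size_foldl_comb1 _ _ _).
rewrite (take_nth 0) // foldl_rcons; set D0 := foldl _ _ _.
rewrite /comb1 -[in leqRHS](cat_take_drop j Y) foldl_cat.
exact: (size_comb1 (drop j Y)).
Qed.

End greedy.

Local Open Scope nat_scope.

Definition FIL (mo fl : bool) : cmd := if fl then FILC mo else NEAR mo 13 6 4.

Definition SCAN (mo : bool) : cmd :=
  Blk [:: IC 23 1; IA 17 22 3] ;;
  Wh (CI 17 13) (NEAR mo 13 17 3 ;;
    IfC (CI 3 2) (Blk [:: IC 23 0]) (Blk [::]) ;; Blk [:: IA 17 17 0]) ;;
  IfC (CI 3 23) (Blk [:: IA 13 13 0]) (Blk [::]).

(** The candidate is built at the free pointer, just behind the list. It is accepted by moving the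
    pointer past it; otherwise the next candidate overwrites it. *)
Definition INS (mo fl : bool) : cmd :=
  LIN 13 1 18 1 19 ;; FIL mo fl ;; IfC (CI 3 2) (SCAN mo) (Blk [::]).

(** The operands lie between the pointers 18 and 20 and between 24 and 21. The result starts at the
    old free pointer, remembered in variable 22; memory is never reclaimed. *)
Definition COMB (mo fl : bool) : cmd :=
  Blk [:: IA 22 13 3] ;;
  Wh (CI 18 20) (Blk [:: IA 19 24 3] ;;
    Wh (CI 19 21) (INS mo fl ;; Blk [:: IA 19 19 0]) ;;
    Blk [:: IA 18 18 0]).

Lemma notin_all (T : eqType) (r L : seq T) :
  all (fun k => k \notin r) L -> forall l, l \in L -> l \notin r.
Proof. by move/allP. Qed.

Section combine.
Context {R : realType} {n : nat}.
Hypothesis n_gt0 : 0 < n.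
Variables (oracle : 'rV[R]_n -> R) (mo : bool).
Variables (B : 'M[R]_n) (x : 'rV[R]_n).
Implicit Types (s : @st R).

Let ctx := @ctx R n B x.

(** These loops have no counter: a pointer advances by [e] cells per round up to an end pointer, and
    the number of rounds is read off its position. *)
Lemma reach_iter (I : nat -> @st R -> Prop) (N tm : nat) (p0 e : nat)
    i m c s0 tt (Q : @st R -> Prop) :
  (N * (tm + 2) + 2 <= tt)%N -> (0 < e)%N ->
  I 0%N s0 -> iv s0 i = p0 -> iv s0 m = (p0 + N * e)%N -> m \notin modI c ->
  (forall k s, frame (Wh (CI i m) c) s0 s -> I k s -> iv s i = (p0 + k * e)%N ->
     (k < N)%N ->
     reach oracle c s tm (fun s' => I k.+1 s' /\ iv s' i = (p0 + k.+1 * e)%N)) ->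
  (forall s', frame (Wh (CI i m) c) s0 s' -> I N s' -> Q s') ->
  reach oracle (Wh (CI i m) c) s0 tt Q.
Proof.
move=> lt e0 I0 i0 mN mc step post.
have hk (k : nat) : (p0 + k * e < p0 + N * e) = (k < N).
  by rewrite ltn_add2l ltn_mul2r e0.
have H := @reach_while R n oracle (CI i m) c s0
  (fun k s => [/\ I k s, iv s i = p0 + k * e & k <= N]) N tm.
apply: reach_le lt; apply: reach_post (H _ _ _) _.
- by rewrite i0 mul0n addn0.
- by move=> k s fr [Ik ik kN] /=; rewrite (frI fr mc) ik mN hk.
- move=> k s fr [Ik ik kN] /=; rewrite (frI fr mc) ik mN hk => lk.
  by apply: reach_post (step _ _ fr Ik ik lk) _ => s' _ [].
- move=> s' fr [k [Ik ik kN]] /=; rewrite (frI fr mc) ik mN hk -leqNgt => Nk.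
  by apply: post => //; have -> : N = k by apply/eqP; rewrite eqn_leq Nk.
Qed.

Definition filb (fl : bool) (a h : R) (z : 'rV[R]_n) : bool :=
  if fl then filcb oracle mo B x a z else nearb oracle mo B h a z 0%R.

Definition lst (h : nat -> R) (p : nat) (D : seq 'rV[R]_n) : Prop :=
  forall k, k < size D -> read_vec h (p + k * n) = nth 0%R D k.

Lemma lst_keeps lo h h' p D : lst h p D -> @keeps R n lo h h' ->
  pO n <= p -> p + size D * n <= lo -> lst h' p D.
Proof.
move=> lD kh hp hlo k kD; rewrite (keeps_read kh) ?lD //.
have : k * n + n <= size D * n by rewrite addnC -mulSn leq_mul2r kD orbT.
by move=> ?; apply/orP; right; lia.
Qed.

Lemma lst_rcons h p D z : lst h p D -> read_vec h (p + size D * n) = z ->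
  lst h p (rcons D z).
Proof.
move=> lD hz k; rewrite size_rcons ltnS leq_eqVlt nth_rcons => /orP[/eqP ->|kD].
  by rewrite ltnn eqxx.
by rewrite kD lD.
Qed.

Lemma same_out_keeps lo (h h' : nat -> R) : same_out (pD n) (pO n) h h' ->
  @keeps R n lo h h'.
Proof. by move=> so k /orP[hk|/andP[hk _]]; apply: so; rewrite hk ?orbT. Qed.

Definition tFIL := @tNEAR n + @tFILC n.

Lemma FIL_spec fl s : ctx s -> pO n <= iv s 13 ->
  reach oracle (FIL mo fl) s tFIL (fun s' =>
    iv s' 2 = filb fl (rv s 4) (rv s 5) (read_vec (hp s) (iv s 13)) :> nat /\
    same_out (pD n) (pO n) (hp s) (hp s')).
Proof.
move=> C h13; rewrite /FIL /filb; case: fl.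
  apply: (reach_le (tm' := @tFILC n)); last by rewrite /tFIL leq_addl.
  exact: (FILC_spec oracle mo C).
apply: (reach_le (tm' := @tNEAR n)); last by rewrite /tFIL leq_addr.
apply: reach_post.
  apply: (NEAR_spec oracle mo C (z := 13) (q := 6) (r := 4)) => //; first by right.
  by left; rewrite (ctx_Z C).
by move=> s' fr; rewrite (ctx_Z C) (ctx_hZ C).
Qed.

Definition tSCAN (M : nat) := M * (@tNEAR n + 6) + 7.

Lemma SCAN_spec s D z : ctx s -> pO n <= iv s 22 ->
  lst (hp s) (iv s 22) D -> iv s 13 = iv s 22 + size D * n ->
  read_vec (hp s) (iv s 13) = z ->
  reach oracle (SCAN mo) s (tSCAN (size D)) (fun s' =>
    iv s' 13 = iv s 13 + (~~ has (nearb oracle mo B (rv s 5) (rv s 3) z) D) * n /\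
    same_out (pD n) (pO n) (hp s) (hp s')).
Proof.
move=> C h22 lD e13 hz; pose nr := nearb oracle mo B (rv s 5) (rv s 3) z.
have -> : tSCAN (size D) = 2 + ((size D * (@tNEAR n + 4 + 2) + 2) + (1 + 2)).
  by rewrite /tSCAN; lia.
apply: reach_ops => //; set s1 := den_ops _ _ _.
have fr1 : frame (Blk [:: IC 23 1; IA 17 22 3]) s s1.
  exact: (ev_frame (ev_blk (n := n) (oracle := oracle) _)).
have C1 : ctx s1 by apply: (ctx_frame C fr1) => // k hk; rewrite (frH fr1).
have [e23 e17] : iv s1 23 = 1 /\ iv s1 17 = iv s 22.
  rewrite /s1; move: (ctx_0 C); case: (s) => i t r h /= e.
  by rewrite /upd /= e addn0.
have e1 k : k < 23 -> k != 17 -> iv s1 k = iv s k.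
  by move=> k1 k2; rewrite (frI fr1) //= !inE; lia.
have h1 : hp s1 = hp s by rewrite (frH fr1).
have r1 : rv s1 = rv s by rewrite /s1; case: (s).
apply: reach_seq.
  pose I k s' := iv s' 23 = ~~ has nr (take k D) :> nat /\
    same_out (pD n) (pO n) (hp s) (hp s').
  apply: (reach_iter (I := I) (N := size D) (tm := @tNEAR n + 4) (p0 := iv s 22)
    (e := n) (Q := fun s' => iv s' 23 = ~~ has nr D :> nat /\
    same_out (pD n) (pO n) (hp s) (hp s'))) => //.
  - by rewrite /I e23 take0 h1.
  - by rewrite e1.
  - move=> k s2 fr2 [f23 so2] f17 kD.
    have C2 : ctx s2.
      by apply: (ctx_frame C1 fr2) => // k' hk'; rewrite so2 ?h1 ?hk'.
    have g13 : iv s2 13 = iv s 13 by rewrite (frI fr2) // e1.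
    have g5 : rv s2 5 = rv s 5 by rewrite (frR fr2) // r1.
    have g3 : rv s2 3 = rv s 3 by rewrite (frR fr2) // r1.
    have rd p : pO n <= p -> read_vec (hp s2) p = read_vec (hp s) p :> 'rV_n.
      by move=> hp; rewrite (same_out_read so2) // hp orbT.
    apply: (reach_le (tm' := @tNEAR n + ((1 + 2) + 1))); last by clear; lia.
    apply: reach_seq.
      apply: (NEAR_spec oracle mo C2 (z := 13) (q := 17) (r := 3)) => //.
        by right; rewrite g13 e13; clear -h22; lia.
      by right; rewrite f17; clear -h22; lia.
    move=> s3 fr3; rewrite g13 g5 g3 !rd; last 2 first.
    - by rewrite f17; clear -h22; lia.
    - by rewrite e13; clear -h22; lia.
    rewrite hz f17 lD // -/(nr _) => -[f2 so3].
    have f23' : iv s3 23 = iv s2 23 by rewrite (frI fr3).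
    have f17' : iv s3 17 = iv s 22 + k * n by rewrite (frI fr3).
    have C3 : ctx s3.
      apply: (ctx_frame C2 fr3) => // k' hk'.
      by rewrite so3 ?hk'.
    have step : ~~ has nr (take k.+1 D) = ~~ has nr (take k D) && ~~ nr (nth 0%R D k).
      by rewrite (take_nth 0%R) // has_rcons negb_or andbC.
    apply: reach_seq.
      apply: (reach_if (Q := fun s' => [/\ iv s' 23 = ~~ has nr (take k.+1 D) :> nat,
        hp s' = hp s3, iv s' 17 = iv s3 17 & iv s' 0 = n])) => /=; rewrite f2 (ctx_0 C3).
        case: (nr _) step => // step _; apply: reach_blk => //=.
        rewrite step andbF; move: (ctx_n C3); case: (s3) => //.
      case: (nr _) step => // step _.
      apply: (reach_le (tm' := 0)) => //; apply: reach_blk => //=.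
      by rewrite step andbT f23' f23 (ctx_n C3).
    move=> s4 fr4 [g23 gh g17 g0]; apply: reach_blk => //.
    move: g23 gh g17 g0; case: (s4) => i4 t4 r4 h4 /= g23 -> g17 g0.
    rewrite /upd /= g17 f17' g0; split; last by rewrite mulSn; clear; lia.
    split; first by rewrite /= g23.
    exact: same_out_trans so2 so3.
  - by move=> s2 fr2 []; rewrite take_size.
move=> s2 fr2 [e2 so2].
have C2 : ctx s2.
  by apply: (ctx_frame C1 fr2) => // k' hk'; rewrite so2 ?h1 ?hk'.
have g13 : iv s2 13 = iv s 13 by rewrite (frI fr2) // e1.
apply: reach_if => /=; rewrite e2 (ctx_0 C2).
  rewrite -/nr; case: has => // _; apply: reach_blk => //=.
  by move: so2 g13 (ctx_n C2); case: (s2) => i t r h /= so -> ->; rewrite /upd /= mul1n.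
rewrite -/nr; case: has => // _; apply: (reach_le (tm' := 0)) => //.
by apply: reach_blk => //=; rewrite g13 mul0n addn0.
Qed.

Definition tINS (M : nat) := 12 * n + 8 + tFIL + tSCAN M.

Lemma INS_spec fl s D : ctx s -> pO n <= iv s 22 ->
  lst (hp s) (iv s 22) D -> iv s 13 = iv s 22 + size D * n ->
  pO n <= iv s 18 -> iv s 18 + n <= iv s 13 ->
  pO n <= iv s 19 -> iv s 19 + n <= iv s 13 ->
  reach oracle (INS mo fl) s (tINS (size D)) (fun s' =>
    let D' := ins (filb fl (rv s 4) (rv s 5)) (nearb oracle mo B (rv s 5) (rv s 3))
      D (read_vec (hp s) (iv s 18) + read_vec (hp s) (iv s 19))%R in
    [/\ lst (hp s') (iv s 22) D', iv s' 13 = iv s 22 + size D' * n &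
        @keeps R n (iv s 13) (hp s) (hp s')]).
Proof.
move=> C h22 lD e13 h18 k18 h19 k19.
set z := (read_vec (hp s) (iv s 18) + read_vec (hp s) (iv s 19))%R.
have [PZ PD PT PU [PO _ _ _]] := layoutE n.
have p13 : pO n <= iv s 13 by rewrite e13; clear -h22; lia.
have -> : tINS (size D) = (12 * n + 6) + (tFIL + (tSCAN (size D) + 2)).
  by rewrite /tINS; clear; lia.
apply: reach_seq.
  apply: (LIN_spec oracle (d := 13) (a := 1) (p := 18) (b := 1) (q := 19)) => //;
   rewrite ?(ctx_n C) ?(ctx_1 C) //; try (apply: vreg_ge; lia);
   rewrite /alias_ok ?k18 ?k19 orbT //.
move=> s1 fr1; rewrite (ctx_r1 C) !scale1r -/z => -[hz so1].
have C1 : ctx s1.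
  by apply: (ctx_frame C fr1) => // k hk; rewrite so1 //; lia.
have r1 k : k < 30 -> rv s1 k = rv s k by move=> kk; rewrite (frR fr1) //= !inE; lia.
have i1 k : k < 60 -> iv s1 k = iv s k by move=> kk; rewrite (frI fr1) //= !inE; lia.
apply: reach_seq.
  by apply: (FIL_spec fl C1); rewrite i1.
move=> s2 fr2; rewrite i1 // hz !r1 // => -[f2 so2].
have fI k : k \in [:: 13; 22] -> iv s2 k = iv s k.
  by move=> kk; rewrite -(i1 k); last (by move: kk; rewrite !inE; lia); apply: (frI fr2);
     move: kk; rewrite /FIL; case: (fl); rewrite !inE => /orP[] /eqP ->.
have fR k : k \in [:: 3; 5] -> rv s2 k = rv s k.
  by move=> kk; rewrite -(r1 k); last (by move: kk; rewrite !inE; lia); apply: (frR fr2);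
     move: kk; rewrite /FIL; case: (fl); rewrite !inE => /orP[] /eqP ->.
have C2 : ctx s2.
  apply: (ctx_frame C1 fr2); try by rewrite /FIL; case: (fl).
  by move=> k hk; rewrite so2 ?hk.
have kp : @keeps R n (iv s 13) (hp s) (hp s2).
  apply: (keeps_trans (h2 := hp s1)); last exact: same_out_keeps so2.
  by move=> k hk; apply: so1; move: hk p13; clear -PO PU PT PD; lia.
have lD2 : lst (hp s2) (iv s 22) D.
  by apply: lst_keeps lD kp _ _ => //; rewrite e13.
have hz2 : read_vec (hp s2) (iv s 13) = z.
  by rewrite (same_out_read so2) ?p13 ?orbT.
apply: reach_if => /=; rewrite f2 (ctx_0 C2) /ins /=.
  case: filb => // _ /=.
  apply: reach_post.
    by apply: (SCAN_spec (D := D) (z := z) C2); rewrite !fI.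
  move=> s3 fr3; rewrite !fI // !fR // => -[g13 so3].
  have kp3 : @keeps R n (iv s 13) (hp s) (hp s3).
    by apply: (keeps_trans kp); exact: same_out_keeps so3.
  have lD3 : lst (hp s3) (iv s 22) D.
    by apply: lst_keeps lD kp3 _ _ => //; rewrite e13.
  have hz3 : read_vec (hp s3) (iv s 13) = z.
    by rewrite (same_out_read so3) ?p13 ?orbT.
  move: g13; case: has => /= g13; split => //.
  - by rewrite g13 mul0n addn0 e13.
  - by apply: lst_rcons => //; rewrite -e13.
  - by rewrite g13 size_rcons e13 mulSn; clear; lia.
case: filb => // _; apply: (reach_le (tm' := 0)) => //; apply: reach_blk => //=.
by rewrite fI // e13.
Qed.

Definition tCOMB (nX nY M : nat) := nX * (nY * (tINS M + 3) + 6) + 3.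

Lemma COMB_spec fl s X Y M :
  ctx s -> pO n <= iv s 13 ->
  lst (hp s) (iv s 18) X -> iv s 20 = iv s 18 + size X * n ->
  pO n <= iv s 18 -> iv s 20 <= iv s 13 ->
  lst (hp s) (iv s 24) Y -> iv s 21 = iv s 24 + size Y * n ->
  pO n <= iv s 24 -> iv s 21 <= iv s 13 ->
  let D := comb (filb fl (rv s 4) (rv s 5)) (nearb oracle mo B (rv s 5) (rv s 3)) X Y in
  size D <= M ->
  reach oracle (COMB mo fl) s (tCOMB (size X) (size Y) M) (fun s' =>
    [/\ lst (hp s') (iv s 13) D, iv s' 22 = iv s 13,
        iv s' 13 = iv s 13 + size D * n &
        @keeps R n (iv s 13) (hp s) (hp s')]).
Proof.
move=> C p13 lX eX pX qX lY eY pY qY.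
set f := filb _ _ _; set nr := nearb _ _ _ _ _; move=> D DM.
have -> : tCOMB (size X) (size Y) M =
    1 + (size X * (size Y * (tINS M + 3) + 4 + 2) + 2).
  by rewrite /tCOMB; clear; lia.
apply: reach_ops => //; set s1 := den_ops _ _ _.
have fr1 : frame (Blk [:: IA 22 13 3]) s s1.
  exact: (ev_frame (ev_blk (n := n) (oracle := oracle) _)).
have C1 : ctx s1 by apply: (ctx_frame C fr1) => // k hk; rewrite (frH fr1).
have h1 : hp s1 = hp s by rewrite (frH fr1).
have r1 : rv s1 = rv s by rewrite /s1; case: (s).
have e22 : iv s1 22 = iv s 13.
  by rewrite /s1; move: (ctx_0 C); case: (s) => i t r h /= e; rewrite /upd /= e addn0.
have i1 k : k != 22 -> iv s1 k = iv s k by move=> kk; rewrite (frI fr1) //= inE.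
have tINS_le m : m <= M -> tINS m <= tINS M.
  by move=> mM; rewrite /tINS /tSCAN; have := leq_mul mM (leqnn (@tNEAR n + 6)); clear; lia.
pose Dk k := foldl (comb1 f nr Y) [::] (take k X).
pose good Dc s' := [/\ lst (hp s') (iv s 13) Dc, iv s' 13 = iv s 13 + size Dc * n &
        @keeps R n (iv s 13) (hp s) (hp s')].
apply: (reach_iter (I := fun k s' => good (Dk k) s') (N := size X) (p0 := iv s 18)
  (e := n) (tm := size Y * (tINS M + 3) + 4)) => //.
- by rewrite /good /Dk take0 /= i1 // addn0 h1; split.
- by rewrite i1.
- by rewrite !i1.
- by rewrite /INS /FIL; case: (fl).
- move=> k s2 fr2 [g1 g2 g3] e18 kX.
  have fI j : j \in ctx_regs ++ [:: 20; 21; 22; 24] -> iv s2 j = iv s1 j.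
    move=> jj; rewrite (frI fr2) //; move: jj.
    by apply: notin_all; rewrite /INS /FIL; case: (fl).
  have fR j : j \in [:: 3; 4; 5] -> rv s2 j = rv s j.
    move=> jj; rewrite (frR fr2) ?r1 //; move: jj.
    by apply: notin_all; rewrite /INS /FIL; case: (fl).
  have C2 : ctx s2.
    apply: (ctx_frame C1 fr2); try by rewrite /INS /FIL; case: (fl).
    by move=> j hj; rewrite h1 g3 ?hj.
  have -> : size Y * (tINS M + 3) + 4 = 1 + ((size Y * (tINS M + 1 + 2) + 2) + 1).
    by clear; lia.
  apply: reach_ops => //; set s3 := den_ops _ _ _.
  have fr3 : frame (Blk [:: IA 19 24 3]) s2 s3.
    exact: (ev_frame (ev_blk (n := n) (oracle := oracle) _)).
  have C3 : ctx s3 by apply: (ctx_frame C2 fr3) => // j hj; rewrite (frH fr3).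
  have h3 : hp s3 = hp s2 by rewrite (frH fr3).
  have r3 : rv s3 = rv s2 by rewrite /s3; case: (s2).
  have i3 j : j != 19 -> iv s3 j = iv s2 j by move=> kk; rewrite (frI fr3) //= inE.
  have e19 : iv s3 19 = iv s 24.
    have <- : iv s2 24 = iv s 24 by rewrite fI // i1.
    by rewrite /s3; move: (ctx_0 C2); case: (s2) => i t r h /= e; rewrite /upd /= e addn0.
  apply: (reach_seq (Q1 := fun s' => good (Dk k.+1) s')).
    apply: (reach_iter (I := fun j s' => good (comb1 f nr (take j Y) (Dk k) (nth 0%R X k)) s')
     (N := size Y) (p0 := iv s 24) (e := n) (tm := tINS M + 1)) => //.
    + by rewrite /good take0 /comb1 /= h3 i3 //; split.
    + by rewrite i3 // fI // i1.
    + by rewrite /INS /FIL; case: (fl).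
    + move=> j s4 fr4 [b1 b2 b3] f19 jY.
      have fI4 l : l \in ctx_regs ++ [:: 18; 20; 21; 22; 24] -> iv s4 l = iv s3 l.
        move=> jj; rewrite (frI fr4) //; move: jj.
        by apply: notin_all; rewrite /INS /FIL; case: (fl).
      have fR4 l : l \in [:: 3; 4; 5] -> rv s4 l = rv s l.
        move=> jj; rewrite (frR fr4) ?r3 ?fR //; move: jj.
        by apply: notin_all; rewrite /INS /FIL; case: (fl).
      have C4 : ctx s4.
        apply: (ctx_frame C3 fr4); try by rewrite /INS /FIL; case: (fl).
        move=> l hl; rewrite h3 b3 ?hl //; apply/esym; apply: g3; by rewrite hl.
      set Dc := comb1 _ _ _ _ _ in b1 b2.
      (* The list under construction never exceeds the final one, so each insertion costs at most
         [tINS M]. *)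
      have szD : size Dc <= M.
        have [|] := size_comb_take f nr Y X k j; last by rewrite leqNgt kX.
        by move=> h; apply: leq_trans h DM.
      have f18 : iv s4 18 = iv s 18 + k * n by rewrite fI4 // i3.
      have f22 : iv s4 22 = iv s 13 by rewrite fI4 // i3 // fI.
      have ek : k * n + n <= size X * n by rewrite addnC -mulSn leq_mul2r kX orbT.
      have ej : j * n + n <= size Y * n by rewrite addnC -mulSn leq_mul2r jY orbT.
      apply: reach_seq.
        apply: (reach_le (tm' := tINS (size Dc))); last exact: tINS_le.
        apply: (INS_spec fl (D := Dc) C4); rewrite ?f22 ?f18 ?f19 ?b2 //.
        * by move: pX; clear; lia.
        * by move: ek eX qX; clear; lia.
        * by move: pY; clear; lia.
        * by move: ej eY qY; clear; lia.
      move=> s5 fr5; rewrite f22 f18 f19 !fR4 // -/f -/nr.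
      have -> : read_vec (hp s4) (iv s 18 + k * n) = nth 0%R X k.
        rewrite (keeps_read b3) ?lX //; apply/orP; right.
        by move: pX ek eX qX; clear; lia.
      have -> : read_vec (hp s4) (iv s 24 + j * n) = nth 0%R Y j.
        rewrite (keeps_read b3) ?lY //; apply/orP; right.
        by move: pY ej eY qY; clear; lia.
      have -> : ins f nr Dc (nth 0 X k + nth 0 Y j)%R =
          comb1 f nr (take j.+1 Y) (Dk k) (nth 0%R X k).
        by rewrite (take_nth 0%R) // /comb1 foldl_rcons.
      move=> [c1 c2 c3]; apply: reach_blk => //.
      have c3' : @keeps R n (iv s 13) (hp s4) (hp s5).
        move=> l hl; apply: c3; move: hl b2; clear; lia.
      have f19' : iv s5 19 = iv s 24 + j * n.
        rewrite (frI fr5) ?f19 //; by rewrite /INS /FIL; case: (fl).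
      have f0' : iv s5 0 = n.
        rewrite (frI fr5) ?fI4 ?(ctx_n C3) //; by rewrite /INS /FIL; case: (fl).
      have gg : good (comb1 f nr (take j.+1 Y) (Dk k) (nth 0%R X k)) s5.
        by split => //; exact: keeps_trans b3 c3'.
      move: gg f19' f0'; case: (s5) => i t r h /= gg -> ->; split => //.
      by rewrite /upd /= mulSn; clear; lia.
    + by move=> s4 fr4; rewrite take_size /Dk (take_nth 0%R) // foldl_rcons.
  move=> s4 fr4 gd; apply: reach_blk => //.
  have f18 : iv s4 18 = iv s 18 + k * n.
    rewrite (frI fr4) ?i3 //; by rewrite /INS /FIL; case: (fl).
  have f0' : iv s4 0 = n.
    rewrite (frI fr4) ?(ctx_n C3) //; by rewrite /INS /FIL; case: (fl).
  move: gd f18 f0'; case: (s4) => i t r h /= gd -> ->; split => //.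
  by rewrite /upd /= mulSn; clear; lia.
- move=> s2 fr2; rewrite /Dk take_size => -[g1 g2 g3]; split => //.
  rewrite (frI fr2) //; by rewrite /INS /FIL; case: (fl).
Qed.

End combine.

(** * The covering lists and the grids they start from *)

Local Open Scope ring_scope.

Section algorithm.
Context {R : realType} {n : nat}.
Variables (oracle : 'rV[R]_n -> R) (mo : bool).
Variables (B : 'M[R]_n) (x : 'rV[R]_n) (g : R).

Definition evec (t : nat) : 'rV[R]_n := \row_j (j == t :> nat)%:R.

(** Factors from -4 to 4 are enough: the coordinates to be covered are at most 4 rho h in absolute
    value and the spacing is at least rho h. *)
Definition multiples (st : R) (t : nat) : seq 'rV[R]_n :=
  [seq (st * (k%:R - 4)) *: evec t | k <- iota 0 9].

Definition lcomb (h rho : R) (X Y : seq 'rV[R]_n) : seq 'rV[R]_n :=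
  comb (filb oracle mo B x false (8 * rho) h) (nearb oracle mo B h (rho / 2)) X Y.

(** Always an integer at the initial scale, where rho h is a power of two and hence below 1 or
    integral. This keeps the grid inside the integer vectors without any rounding. *)
Definition spacing (h rho : R) : R := if rho * h < 1 then 1 else rho * h.

(** One coordinate is added at a time. Going through [lcomb] lets the same program and the same size
    bound serve here; [grid_list_mem] shows that no required point is lost. *)
Fixpoint grid_list (h rho : R) (t : nat) : seq 'rV[R]_n :=
  if t is t'.+1 then
    lcomb h rho (grid_list h rho t') (multiples (spacing h rho) t')
  else [:: 0].

(* lists m s covers at scale hscale m and radius lscale m s. Raising m by one
   takes radii 2 and 1/2 times the new one, i.e. slots s + 2 and s. *)
Definition hscale (m : nat) : R := 2 ^+ m / g.
Definition lscale (m s : nat) : R := 2 ^+ (s + m) / g ^+ 7.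

Fixpoint lists (m s : nat) : seq 'rV[R]_n :=
  if m is m'.+1 then
    lcomb (hscale m) (lscale m s) (lists m' (s + 2)) (lists m' s)
  else grid_list (hscale 0) (lscale 0 s) n.

End algorithm.

Local Open Scope nat_scope.

Definition ZLIST : cmd :=
  Blk [:: IA 18 13 3] ;; LIN 13 0 6 0 6 ;; Blk [:: IA 13 13 0; IA 20 13 3].

(** From the radius rho in real variable 6, the filter radius 8 rho and the pruning radius rho /
    2. *)
Definition RADII : seq op :=
  [:: RA 4 6 6; RA 4 4 4; RA 4 4 4; RC 23 2; RD 3 6 23].

Definition YLIST : cmd :=
  Blk [:: IA 37 11 3; RA 24 22 22; RA 24 24 24; RS 24 0 24] ;;
  Wh (CI 37 12) (LIN 37 0 6 0 6 ;;
    Blk [:: IA 39 37 36; RW 39 24; RA 24 24 22; IA 37 37 0]).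

Definition GRID (mo : bool) : cmd :=
  Blk (RX 22 6 5 :: RADII) ;;
  IfC (CR 22 1) (Blk [:: RM 22 1]) (Blk [::]) ;;
  ZLIST ;; Blk [:: IC 36 0] ;;
  Wh (CI 36 0) (YLIST ;; Blk [:: IA 24 11 3; IA 21 12 3] ;; COMB mo false ;;
    Blk [:: IA 18 22 3; IA 20 13 3; IA 36 36 1]).

Section init.
Context {R : realType} {n : nat}.
Hypothesis n_gt0 : 0 < n.
Variables (oracle : 'rV[R]_n -> R) (mo : bool).
Variables (B : 'M[R]_n) (x : 'rV[R]_n) (g : R).
Implicit Types (s : @st R).

Let ctx := @ctx R n B x.

Lemma reach_opsF l c s tm (Q : @st R -> Prop) :
  ok_ops (n := n) oracle l s ->
  (forall s1, s1 = den_ops oracle l s -> frame (Blk l) s s1 ->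
     reach oracle c s1 tm Q) ->
  reach oracle (Blk l ;; c) s (size l + tm) Q.
Proof.
move=> ok H; apply: reach_ops => //; apply: H => //.
exact: (ev_frame (ev_blk (oracle := oracle) ok)).
Qed.

Lemma free0_ge : pO n <= free0 n /\ pY n + 9 * n <= free0 n.
Proof. by have [_ _ _ _ [-> -> -> ->]] := layoutE n; split; lia. Qed.

Lemma ctx_keeps c s s' lo : ctx s -> frame c s s' ->
  all (fun k => k \notin modI c) ctx_regs ->
  all (fun k => k \notin modR c) [:: 0; 1; 2] ->
  @keeps R n lo (hp s) (hp s') -> ctx s'.
Proof.
move=> C fr h1 h2 kp; apply: (ctx_frame C fr) => // k hk.
by apply: kp; rewrite hk.
Qed.

Definition tZLIST := 12 * n + 9.

Lemma ZLIST_spec s : ctx s -> free0 n <= iv s 13 ->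
  reach oracle ZLIST s tZLIST (fun s' =>
    [/\ iv s' 18 = iv s 13, iv s' 13 = iv s 13 + n, iv s' 20 = iv s 13 + n,
        lst (hp s') (iv s 13) [:: 0%R : 'rV_n] &
        @keeps R n (iv s 13) (hp s) (hp s')]).
Proof.
move=> C f13; have [f1 f2] := free0_ge.
have [PZ PD PT PU [PO _ _ _]] := layoutE n.
have -> : tZLIST = 1 + ((12 * n + 6) + 2) by rewrite /tZLIST; clear; lia.
apply: reach_opsF => // s1 E1 fr1.
have C1 : ctx s1 by apply: (ctx_frame C fr1) => // k hk; rewrite (frH fr1).
have e18 : iv s1 18 = iv s 13.
  by rewrite E1; move: (ctx_0 C); case: (s) => i t r h /= e; rewrite /upd /= e addn0.
have e13 : iv s1 13 = iv s 13 by rewrite (frI fr1).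
apply: reach_seq.
  apply: (LIN_spec oracle (d := 13) (a := 0) (p := 6) (b := 0) (q := 6)) => //;
   rewrite ?(ctx_n C1) ?(ctx_1 C1) ?(ctx_Z C1) ?e13 //;
   try (apply: vreg_ge); rewrite /alias_ok; move: f1 f13 PZ PD PT PU PO; clear; lia.
move=> s2 fr2; rewrite (ctx_r0 C1) !scale0r addr0 e13 (frH fr1) // => -[hz so].
have g13 : iv s2 13 = iv s 13 by rewrite (frI fr2).
have g18 : iv s2 18 = iv s 13 by rewrite (frI fr2).
have g0 : iv s2 0 = n by rewrite (frI fr2) // (ctx_n C1).
have g3 : iv s2 3 = 0 by rewrite (frI fr2) // (ctx_0 C1).
apply: reach_blk => //; move: hz so g13 g18 g0 g3.
case: (s2) => i t r h /= hz so g13 g18 g0 g3.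
rewrite /upd /= g13 g18 g0 g3 addn0; split => //.
  by move=> [|k] //= _; rewrite mul0n addn0.
by move=> k hk; apply: so; move: hk f1 f13 PZ PD PT PU PO; clear; lia.
Qed.

Definition tYLIST := 9 * (12 * n + 12) + 6.

Lemma YLIST_spec s : ctx s -> iv s 36 < n ->
  reach oracle YLIST s tYLIST (fun s' =>
    lst (hp s') (pY n) (@multiples R n (rv s 22) (iv s 36)) /\
    same_out (pY n) (pY n + 9 * n) (hp s) (hp s')).
Proof.
move=> C t_n; have [f1 f2] := free0_ge.
have [PZ PD PT PU [PO PY PM PF]] := layoutE n.
have -> : tYLIST = 4 + (9 * (12 * n + 10 + 2) + 2) by rewrite /tYLIST; clear; lia.
apply: reach_opsF => // s1 E1 fr1.
have C1 : ctx s1 by apply: (ctx_frame C fr1) => // k hk; rewrite (frH fr1).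
have [e37 e24] : iv s1 37 = pY n /\ rv s1 24 = (rv s 22 * (0%:R - 4))%R.
  rewrite E1; move: (ctx_0 C) (ctx_Y C) (ctx_r0 C); case: (s) => i t r h /= e0 e1 e2.
  by rewrite /upd /= e0 e1 e2 addn0; split => //; ring.
pose I k s' := [/\ rv s' 24 = (rv s 22 * (k%:R - 4))%R,
  lst (hp s') (pY n) (take k (@multiples R n (rv s 22) (iv s 36))) &
  same_out (pY n) (pY n + 9 * n) (hp s) (hp s')].
have szm : size (@multiples R n (rv s 22) (iv s 36) : seq 'rV[R]_n) = 9 by [].
apply: (reach_iter (I := I) (N := 9) (p0 := pY n) (e := n) (tm := 12 * n + 10)) => //.
- by split => //; rewrite ?take0 // (frH fr1).
- by rewrite (ctx_M C1) PM.
- move=> k s2 fr2 [g24 gl gs] g37 k9.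
  have C2 : ctx s2.
    apply: (ctx_frame C1 fr2) => // j hj; rewrite gs ?(frH fr1) //.
    by move: hj PD PT PU PO PY; clear; lia.
  have g22 : rv s2 22 = rv s 22 by rewrite (frR fr2) // (frR fr1).
  have g36 : iv s2 36 = iv s 36 by rewrite (frI fr2) // (frI fr1).
  have kn9 : k * n + n <= 9 * n by rewrite addnC -mulSn leq_mul2r k9 orbT.
  have -> : 12 * n + 10 = (12 * n + 6) + 4 by clear; lia.
  apply: reach_seq.
    apply: (LIN_spec oracle (d := 37) (a := 0) (p := 6) (b := 0) (q := 6)) => //;
     rewrite ?(ctx_n C2) ?(ctx_1 C2) ?(ctx_Z C2) ?g37 //;
     try (apply: vreg_ge); rewrite /alias_ok; move: PZ PD PT PU PO PY; clear; lia.
  move=> s3 fr3; rewrite (ctx_r0 C2) !scale0r addr0 g37 => -[hz so3].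
  have [q37 q36 q0] : [/\ iv s3 37 = pY n + k * n, iv s3 36 = iv s 36 & iv s3 0 = n].
    by rewrite !(frI fr3) // (ctx_n C2).
  have [q24 q22] : rv s3 24 = (rv s 22 * (k%:R - 4))%R /\ rv s3 22 = rv s 22.
    by rewrite !(frR fr3).
  apply: reach_blk.
    move: q37 q36; case: (s3) => i t r h /= q37 q36.
    rewrite /upd /= q37 q36 /heap_addr; split => //; split => //.
    by move: PZ PD PT PU PO PY; rewrite /inlen; clear; lia.
  move: q37 q36 q0 q24 q22 hz so3; case: (s3) => i t r h /= q37 q36 q0 q24 q22 hz so3.
  rewrite /upd /= q37 q36 q0 q24 q22; split; last by clear; lia.
  have soh : same_out (pY n + k * n) (pY n + k * n + n) (hp s2)
      (upd h (pY n + k * n + iv s 36) (rv s 22 * (k%:R - 4))%R).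
    move=> j hj; rewrite /upd ifF ?so3 //.
    by apply/negP => /eqP e; move: hj t_n; rewrite e; clear; lia.
  have vec : read_vec (upd h (pY n + k * n + iv s 36) (rv s 22 * (k%:R - 4))%R)
      (pY n + k * n) = ((rv s 22 * (k%:R - 4)) *: evec (iv s 36) : 'rV[R]_n)%R.
    apply/rowP => j; rewrite read_vecE /upd eqn_add2l 2!mxE.
    case: eqP => _; rewrite ?mulr1 ?mulr0 //.
    by have := read_vecE h (pY n + k * n) j; rewrite hz mxE.
  split; first by rewrite /= -natr1; ring.
  + suff : lst (upd h (pY n + k * n + iv s 36) (rv s 22 * (k%:R - 4))%R) (pY n)
      (take k.+1 (@multiples R n (rv s 22) (iv s 36))) by [].
    have nthm : nth 0%R (@multiples R n (rv s 22) (iv s 36)) k =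
        ((rv s 22 * (k%:R - 4)) *: evec (iv s 36) : 'rV[R]_n)%R.
      by rewrite /multiples (nth_map 0) ?size_iota // nth_iota.
    rewrite (take_nth 0%R) ?szm // nthm.
    apply: lst_rcons; last by rewrite size_take szm k9.
    move=> j; rewrite size_take szm k9 => jk.
    rewrite (same_out_read soh); first by apply: gl; rewrite size_take szm k9.
    have : j * n + n <= k * n by rewrite addnC -mulSn leq_mul2r jk orbT.
    by clear; lia.
  + by move=> j hj; apply: etrans (soh j _) (gs j hj); move: hj kn9; clear; lia.
- by move=> s2 fr2 [_]; rewrite take_oversize ?szm.
Qed.

Definition tGRID (M : nat) :=
  n * (tYLIST + 2 + @tCOMB n M 9 M + 5) + tZLIST + 12.


Lemma GRID_spec s M : ctx s -> free0 n <= iv s 13 ->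
  (forall t, t <= n ->
     size (grid_list oracle mo B x (rv s 5) (rv s 6) t) <= M) ->
  reach oracle (GRID mo) s (tGRID M) (fun s' =>
    let D := grid_list oracle mo B x (rv s 5) (rv s 6) n in
    [/\ lst (hp s') (iv s' 18) D, iv s' 20 = iv s' 18 + size D * n,
        free0 n <= iv s' 18, iv s' 20 <= iv s' 13 &
        iv s 13 <= iv s' 13 /\
        forall k, (k < pD n) || (free0 n <= k < iv s 13) -> hp s' k = hp s k]).
Proof.
move=> C f13 szM; have [f1 f2] := free0_ge.
have [PZ PD PT PU [PO PY PM PF]] := layoutE n.
set GL := grid_list _ _ _ _ _ _ in szM *.
have -> : tGRID M = 6 + ((1 + 2) + (tZLIST + (1 +
   (n * (tYLIST + (2 + (@tCOMB n M 9 M + 3)) + 2) + 2)))).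
  by rewrite /tGRID; clear; lia.
apply: reach_opsF => // s1 E1 fr1.
have C1 : ctx s1 by apply: (ctx_frame C fr1) => // k hk; rewrite (frH fr1).
have [r4 r3 r22] : [/\ rv s1 4 = (8 * rv s 6)%R, rv s1 3 = (rv s 6 / 2)%R &
    rv s1 22 = (rv s 6 * rv s 5)%R].
  by rewrite E1; case: (s) => i t r h /=; rewrite /upd /=; split => //; ring.
apply: (reach_seq (Q1 := fun s' => [/\ rv s' 22 = spacing (rv s 5) (rv s 6),
    iv s' = iv s1 & hp s' = hp s1])).
  apply: reach_if => /=; rewrite r22 (ctx_r1 C1) /spacing => hlt.
    rewrite hlt; apply: reach_blk => //=; move: (ctx_r1 C1); case: (s1) => i t r h /= e.
    by rewrite /upd /= e.
  by apply: (reach_le (tm' := 0)) => //; apply: reach_blk => //=; rewrite (negPf hlt).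
move=> s2 fr2 [g22 gi gh].
have C2 : ctx s2 by apply: (ctx_frame C1 fr2) => // k hk; rewrite gh.
have e13 : iv s2 13 = iv s 13 by rewrite gi (frI fr1).
apply: reach_seq; first by apply: ZLIST_spec => //; rewrite e13.
move=> s3 fr3; rewrite e13 gh (frH fr1) // => -[g18 g13 g20 gl gk].
have C3 : ctx s3.
  by apply: (ctx_keeps C2 fr3 (lo := iv s 13)) => //; rewrite gh (frH fr1).
have rr j : j \in [:: 3; 4; 5; 22] -> rv s3 j = rv s2 j.
  by move=> jj; rewrite (frR fr3) //; move: jj; rewrite !inE; repeat case/orP; move=> /eqP ->.
have rr1 j : j \in [:: 3; 4; 5] -> rv s3 j = rv s1 j.
  move=> jj; rewrite rr; last by move: jj; rewrite !inE; repeat case/orP; move=> /eqP ->.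
  by rewrite (frR fr2) //; move: jj; rewrite !inE; repeat case/orP; move=> /eqP ->.
apply: reach_opsF => // s4 E4 fr4.
have C4 : ctx s4 by apply: (ctx_frame C3 fr4) => // k hk; rewrite (frH fr4).
have h4 : hp s4 = hp s3 by rewrite (frH fr4).
have rv4 : rv s4 = rv s3 by rewrite E4; case: (s3).
pose I k s' := [/\ lst (hp s') (iv s' 18) (GL k : seq 'rV_n),
   iv s' 20 = iv s' 18 + size (GL k : seq 'rV_n) * n,
   free0 n <= iv s' 18, iv s' 20 <= iv s' 13 &
   iv s 13 <= iv s' 13 /\
   forall k, (k < pD n) || (free0 n <= k < iv s 13) -> hp s' k = hp s k].
apply: (reach_forP (I := I) (N := n)
   (tm := tYLIST + (2 + (@tCOMB n M 9 M + 3)))) => //.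
- rewrite /I h4 !(frI fr4) // g18 g20 g13 /= mul1n; split => //.
  split; first by rewrite leq_addr.
  by move=> k hk; apply: gk; move: hk f1; clear; lia.
- by rewrite E4; case: (s3).
- exact: (ctx_n C4).
- move=> k s5 fr5 [l1 l2 l3 l4 [l5 l6]] e36 kn.
  have C5 : ctx s5.
    apply: (ctx_frame C4 fr5) => // j hj; rewrite l6 ?hj // h4 gk ?hj //.
  have R5 j : j \in [:: 3; 4; 5; 22] -> rv s5 j = rv s3 j.
    move=> jj; rewrite (frR fr5) ?rv4 //.
    by move: jj; rewrite !inE; repeat case/orP; move=> /eqP ->.
  apply: reach_seq; first by apply: YLIST_spec => //; rewrite e36.
  move=> s6 fr6; rewrite e36 R5 // rr // g22 => -[lY so6].
  have C6 : ctx s6.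
    apply: (ctx_frame C5 fr6) => // j hj; rewrite so6 //.
    by move: hj PD PT PU PO PY; clear; lia.
  have I6 j : j \in [:: 13; 18; 20; 36] -> iv s6 j = iv s5 j.
    by move=> jj; rewrite (frI fr6) //; move: jj; rewrite !inE; repeat case/orP; move=> /eqP ->.
  apply: reach_opsF => // s7 E7 fr7.
  have C7 : ctx s7 by apply: (ctx_frame C6 fr7) => // j hj; rewrite (frH fr7).
  have h7 : hp s7 = hp s6 by rewrite (frH fr7).
  have I7 j : j \in [:: 13; 18; 20; 36] -> iv s7 j = iv s5 j.
    move=> jj; rewrite -I6 // (frI fr7) //; move: jj; rewrite !inE; repeat case/orP; by move=> /eqP ->.
  have [i24 i21] : iv s7 24 = pY n /\ iv s7 21 = pM n.
    rewrite E7; move: (ctx_0 C6) (ctx_Y C6) (ctx_M C6); case: (s6) => i t r h /= e0 e1 e2.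
    by rewrite /upd /= e0 e1 e2 !addn0.
  have rv7 j : j \in [:: 3; 4; 5] -> rv s7 j = rv s1 j.
    move=> jj; rewrite -rr1 // -R5; last by move: jj; rewrite !inE; repeat case/orP; move=> /eqP ->.
    have -> : rv s7 = rv s6 by rewrite E7; case: (s6).
    rewrite (frR fr6) //; move: jj; rewrite !inE; repeat case/orP; by move=> /eqP ->.
  have r5 : rv s1 5 = rv s 5 by rewrite (frR fr1).
  have lX : lst (hp s7) (iv s5 18) (GL k : seq 'rV_n).
    move=> j jk; rewrite h7 (same_out_read so6) ?l1 //.
    by move: l3 f2; clear; lia.
  have key : comb (filb oracle mo B x false (rv s7 4) (rv s7 5))
     (nearb oracle mo B (rv s7 5) (rv s7 3)) (GL k)
       (@multiples R n (spacing (rv s 5) (rv s 6)) k) = GL k.+1.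
    by rewrite !rv7 // r4 r3 r5.
  apply: reach_seq.
    apply: (reach_le (tm' := @tCOMB n (size (GL k : seq 'rV_n)) 9 M)).
      apply: (COMB_spec n_gt0 (fl := false) (X := GL k)
        (Y := @multiples R n (spacing (rv s 5) (rv s 6)) k) (M := M) C7);
        rewrite ?key ?i24 ?i21 ?I7 ?h7 //.
      + by apply: leq_trans f1 _; apply: leq_trans l3 _; apply: leq_trans l4;
          rewrite l2 leq_addr.
      + by rewrite -h7.
      + by apply: leq_trans f1 l3.
      + by move: PY; clear; lia.
      + by move: f2 l3 l4 l2 PM; clear; lia.
      + exact: szM.
    rewrite /tCOMB; have := leq_mul (szM k (ltnW kn))
      (leqnn (9 * (@tINS n M + 3) + 6)); by clear; lia.
  move=> s8 fr8; rewrite key I7 // h7 => -[m1 m2 m3 m4].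
  apply: reach_blk => //.
  have q3 : iv s8 3 = 0 by rewrite (frI fr8) // (ctx_0 C7).
  have q1 : iv s8 1 = 1 by rewrite (frI fr8) // (ctx_1 C7).
  have q36 : iv s8 36 = k by rewrite (frI fr8) // I7.
  have l7 : iv s5 18 <= iv s5 13 by apply: leq_trans l4; rewrite l2 leq_addr.
  move: m1 m2 m3 m4 q3 q1 q36; case: (s8) => i t r h /= m1 m2 m3 m4 q3 q1 q36.
  rewrite /upd /I /= m2 m3 q3 q1 q36 !addn0 addn1; split => //; split => //.
  + by rewrite (leq_trans l3 l7).
  + split; first by rewrite (leq_trans l5) // leq_addr.
    move=> j hj; rewrite m4; last by move: hj l5 f1; clear; lia.
    rewrite so6 ?l6 //; by move: hj PD PT PU PO PY f2; clear; lia.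
Qed.

End init.

Local Open Scope ring_scope.

(** * The table of lists over all scales and radii *)

Local Open Scope nat_scope.

(** A table entry consists of two index cells, the two ends of a list. The table starts with 12 Q
    entries because each of the 2 Q doublings of the scale loses the two largest radii and 8 Q
    entries are wanted at the end. *)
Definition INITL (mo : bool) : cmd :=
  Blk [:: IA 31 15 15; IA 32 31 31; IA 33 32 32; IA 34 33 33; IA 31 34 33;
          IA 31 31 14; IA 30 14 3; RX 18 17 17; RX 19 18 18; RX 19 19 18;
          RX 19 19 17; RD 6 1 19; RD 5 1 17] ;;
  Wh (CI 30 31) (GRID mo ;;
    Blk [:: IW 30 18; IA 40 30 1; IW 40 20; IA 30 40 1; RA 6 6 6]).

(** The table is updated in place: slot s needs the old slots s and s + 2 only, and slots are
    treated in increasing order, so neither has been replaced when it is read. *)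
Definition SLOT (mo : bool) : cmd :=
  Blk ([:: IC 40 4; IA 40 30 40; IL 18 40; IA 40 40 1; IL 20 40; IL 24 30;
           IA 40 30 1; IL 21 40] ++ RADII) ;;
  COMB mo false ;;
  Blk [:: IW 30 22; IA 40 30 1; IW 40 13; IA 30 40 1; RA 6 6 6].

Definition STEP (mo : bool) : cmd :=
  Blk [:: RA 5 5 5; RA 25 25 25; RM 6 25; IC 40 4; IS 31 31 40; IA 30 14 3] ;;
  Wh (CI 30 31) (SLOT mo).

Definition STEPS (mo : bool) : cmd :=
  Blk [:: IC 41 0; IA 42 15 15; RD 25 1 19] ;;
  Wh (CI 41 42) (STEP mo ;; Blk [:: IA 41 41 1]).

Ltac mem_cases := rewrite ?inE; repeat case/orP; by move=> /eqP ->.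

Section tables.
Context {R : realType} {n : nat}.
Hypothesis n_gt0 : 0 < n.
Variables (oracle : 'rV[R]_n -> R) (mo : bool).
Variables (B : 'M[R]_n) (x : 'rV[R]_n) (g : R) (Q : nat).
Implicit Types (s : @st R).

Let ctx := @ctx R n B x.
Let lists := @lists R n oracle mo B x g.

Definition tbl s (cnt : nat) (W : nat -> seq 'rV[R]_n) : Prop :=
  forall k, k < cnt ->
  [/\ free0 n <= it s (96 + 2 * k), lst (hp s) (it s (96 + 2 * k)) (W k),
      it s (97 + 2 * k) = it s (96 + 2 * k) + size (W k) * n &
      it s (97 + 2 * k) <= iv s 13].

Lemma lst_same (h h' : nat -> R) p (D : seq 'rV[R]_n) lo hi :
  lst h p D -> lo <= p -> p + size D * n <= hi ->
  (forall k, lo <= k < hi -> h' k = h k) -> lst h' p D.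
Proof.
move=> lD lop hip hh k kD; rewrite -lD //; apply/rowP => j; rewrite !read_vecE hh //.
have := ltn_ord j.
have : k * n + n <= size D * n by rewrite addnC -mulSn leq_mul2r kD orbT.
by move: lop hip; clear; lia.
Qed.

Lemma tbl_pres s s' cnt W : tbl s cnt W ->
  (forall k, k < cnt -> it s' (96 + 2 * k) = it s (96 + 2 * k)
     /\ it s' (97 + 2 * k) = it s (97 + 2 * k)) ->
  iv s 13 <= iv s' 13 ->
  (forall k, free0 n <= k < iv s 13 -> hp s' k = hp s k) -> tbl s' cnt W.
Proof.
move=> T ii le13 hh k kc; have [e1 e2] := ii k kc; have [t1 t2 t3 t4] := T k kc.
rewrite e1 e2; split => //; last exact: leq_trans t4 le13.
by apply: (lst_same t2 t1 _ hh); rewrite -t3.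
Qed.

Lemma it_old s s' k j : (forall a, a != 96 + 2 * j -> a != 97 + 2 * j -> it s' a = it s a) ->
  k != j -> it s' (96 + 2 * k) = it s (96 + 2 * k) /\ it s' (97 + 2 * k) = it s (97 + 2 * k).
Proof. by move=> h kj; split; apply: h; move: kj; clear; lia. Qed.

Definition tINITL M := 12 * Q * (@tGRID n M + 7) + 15.

Lemma INITL_spec s M : ctx s -> free0 n <= iv s 13 -> iv s 15 = Q -> rv s 17 = g ->
  (forall k t, k < 12 * Q -> t <= n ->
     size (grid_list oracle mo B x (hscale g 0) (lscale g 0 k) t) <= M) ->
  reach oracle (INITL mo) s (tINITL M) (fun s' =>
    [/\ tbl s' (12 * Q) (lists 0), free0 n <= iv s' 13, iv s' 31 = 96 + 12 * Q * 2,
        rv s' 5 = hscale g 0 /\ rv s' 19 = (g ^+ 7)%R &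
        forall k, k < pD n -> hp s' k = hp s k]).
Proof.
move=> C f13 eQ eg szM.
have -> : tINITL M = 13 + ((12 * Q) * ((@tGRID n M + 5) + 2) + 2).
  by rewrite /tINITL; clear; lia.
apply: reach_opsF => // s1 E1 fr1.
have C1 : ctx s1 by apply: (ctx_frame C fr1) => // k hk; rewrite (frH fr1).
have [e31 e30 r6 [r5 r19]] : [/\ iv s1 31 = 96 + 12 * Q * 2, iv s1 30 = 96,
    rv s1 6 = lscale g 0 0 & rv s1 5 = hscale g 0 /\ rv s1 19 = (g ^+ 7)%R].
  rewrite E1; move: eQ eg (ctx_tb C) (ctx_0 C) (ctx_r1 C).
  case: (s) => i t r h /= e15 e17 e14 e3 e1.
  rewrite /upd /= e14 e3 e1 e15 e17 /hscale /lscale.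
  rewrite expr0; split; [by clear; lia|by []|by congr (_ / _)%R; ring|].
  by split; [|ring].
have e13 : iv s1 13 = iv s 13 by rewrite (frI fr1).
have h1 : hp s1 = hp s by rewrite (frH fr1).
pose I k s' := [/\ tbl s' k (lists 0), iv s 13 <= iv s' 13, rv s' 6 = lscale g 0 k &
   forall a, a < pD n -> hp s' a = hp s a].
apply: (reach_iter (I := I) (N := 12 * Q) (p0 := 96) (e := 2)
   (tm := @tGRID n M + 5)) => //.
- by split => //; rewrite ?e13 ?h1.
- move=> k s2 fr2 [T2 le2 g6 g9] e30' kQ.
  have C2 : ctx s2.
    apply: (ctx_frame C1 fr2) => // j hj; rewrite h1; exact: g9.
  have g5 : rv s2 5 = hscale g 0 by rewrite (frR fr2) // r5.
  apply: reach_seq.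
    apply: (GRID_spec n_gt0 C2 (M := M)).
      exact: leq_trans f13 le2.
    by move=> t tn; rewrite g5 g6; exact: szM.
  move=> s3 fr3; rewrite g5 g6 => -[l1 l2 l3 l4 [l5 l6]].
  have q1 : iv s3 1 = 1 by rewrite (frI fr3) // (ctx_1 C2).
  have q30 : iv s3 30 = 96 + k * 2 by rewrite (frI fr3).
  have qit : it s3 = it s2 by rewrite (frT fr3).
  have q6 : rv s3 6 = lscale g 0 k by rewrite (frR fr3) // g6.
  apply: reach_blk.
    case: (s3) q1 q30 => i t r h /= q1 q30; rewrite /upd /= q1 q30.
    by do !split => //; clear; lia.
  set s4 := den_ops _ _ _.
  have [i13 h4 i30 r6' itE] : [/\ iv s4 13 = iv s3 13, hp s4 = hp s3,
    iv s4 30 = 96 + k.+1 * 2, rv s4 6 = lscale g 0 k.+1 &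
    it s4 = upd (upd (it s3) (96 + 2 * k) (iv s3 18)) (97 + 2 * k) (iv s3 20)].
    rewrite /s4; case: (s3) q1 q30 q6 => i t r h /= q1 q30 q6.
    rewrite /upd /= q1 q30 q6; split => //; try (clear; lia).
      by rewrite /lscale addSn (exprS 2%:R); ring.
    have -> : 96 + k * 2 = 96 + 2 * k by clear; lia.
    by have -> : 96 + 2 * k + 1 = 97 + 2 * k by clear; lia.
  split => //; split => //; last 1 first.
  + by move=> a ha; rewrite h4 l6 ?g9 // ha.
  + move=> j; rewrite ltnS leq_eqVlt => /orP[/eqP ->|jk].
      rewrite itE /upd eqxx ifF; last by clear; lia.
      by rewrite eqxx h4 i13; split.
    apply: (tbl_pres T2 (s' := s4)) => //.
    * move=> j' jk'; rewrite -qit; apply: (it_old (j := k)).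
        by move=> a a1 a2; rewrite itE /upd (negPf a1) (negPf a2).
      by rewrite neq_ltn jk'.
    * by rewrite i13.
    * by move=> a ha; rewrite h4 l6 // ha orbT.
  + by rewrite i13 (leq_trans le2).
- move=> s2 fr2 [T2 le2 _ g9]; split => //.
  + exact: leq_trans f13 le2.
  + by rewrite (frI fr2) //.
  + rewrite !(frR fr2) //.
Qed.

Definition tSLOT M := @tCOMB n M M M + 18.

Lemma SLOT_spec s M m j cnt : ctx s -> free0 n <= iv s 13 ->
  j < cnt -> iv s 30 = 96 + j * 2 ->
  rv s 5 = hscale g m.+1 -> rv s 6 = lscale g m.+1 j ->
  tbl s (cnt + 2) (fun k => if k < j then lists m.+1 k else lists m k) ->
  (forall k, size (lists m k) <= M) -> (forall k, size (lists m.+1 k) <= M) ->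
  reach oracle (SLOT mo) s (tSLOT M) (fun s' =>
    [/\ tbl s' (cnt + 2) (fun k => if k < j.+1 then lists m.+1 k else lists m k),
        iv s' 30 = 96 + j.+1 * 2, iv s 13 <= iv s' 13, rv s' 6 = lscale g m.+1 j.+1 &
        forall k, k < pD n -> hp s' k = hp s k]).
Proof.
move=> C f13 jc e30 r5 r6 T szM szM'.
have [f1 f2] := free0_ge n_gt0.
have [t1 t2 t3 t4] : [/\ free0 n <= it s (96 + j * 2),
   lst (hp s) (it s (96 + j * 2)) (lists m j),
   it s (97 + j * 2) = it s (96 + j * 2) + size (lists m j) * n &
   it s (97 + j * 2) <= iv s 13].
  have := T j; rewrite ltnn [2 * j]mulnC; apply.
  by move: jc; clear; lia.
have [u1 u2 u3 u4] : [/\ free0 n <= it s (96 + j * 2 + 4),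
   lst (hp s) (it s (96 + j * 2 + 4)) (lists m (j + 2)),
   it s (97 + j * 2 + 4) = it s (96 + j * 2 + 4) + size (lists m (j + 2)) * n &
   it s (97 + j * 2 + 4) <= iv s 13].
  have := T (j + 2); rewrite ifF; last by clear; lia.
  have -> : 96 + 2 * (j + 2) = 96 + j * 2 + 4 by clear; lia.
  have -> : 97 + 2 * (j + 2) = 97 + j * 2 + 4 by clear; lia.
  by apply; move: jc; clear; lia.
have -> : tSLOT M = 13 + (@tCOMB n M M M + 5) by rewrite /tSLOT; clear; lia.
apply: reach_opsF.
  case: (s) e30 => i t r h /= e30 ; rewrite /upd /= e30.
  by do !split => //; clear; lia.
move=> s1 E1 fr1.
have C1 : ctx s1 by apply: (ctx_frame C fr1) => // k hk; rewrite (frH fr1).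
have [i18 i20 i24 [i21 r4 r3]] : [/\ iv s1 18 = it s (96 + j * 2 + 4),
   iv s1 20 = it s (97 + j * 2 + 4), iv s1 24 = it s (96 + j * 2) &
   [/\ iv s1 21 = it s (97 + j * 2), rv s1 4 = (8 * lscale g m.+1 j)%R &
       rv s1 3 = (lscale g m.+1 j / 2)%R]].
  rewrite E1; move: (ctx_1 C) e30 r6; case: (s) => i t r h /= e1 e30' e6.
  rewrite /upd /= e30' e1 e6.
  have -> : 96 + j * 2 + 4 + 1 = 97 + j * 2 + 4 by clear; lia.
  have -> : 96 + j * 2 + 1 = 97 + j * 2 by clear; lia.
  by split => //; split => //; ring.
have g5 : rv s1 5 = hscale g m.+1 by rewrite (frR fr1).
have e13 : iv s1 13 = iv s 13 by rewrite (frI fr1).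
have h1 : hp s1 = hp s by rewrite (frH fr1).
have key : comb (filb oracle mo B x false (rv s1 4) (rv s1 5))
     (nearb oracle mo B (rv s1 5) (rv s1 3)) (lists m (j + 2)) (lists m j)
   = lists m.+1 j by rewrite r4 r3 g5.
apply: reach_seq.
  apply: (reach_le (tm' := @tCOMB n (size (lists m (j + 2))) (size (lists m j)) M)).
    apply: (COMB_spec n_gt0 (fl := false) (X := lists m (j + 2)) (Y := lists m j)
      (M := M) C1); rewrite ?key ?i18 ?i20 ?i24 ?i21 ?e13 ?h1 //.
    - exact: leq_trans f1 f13.
    - exact: leq_trans f1 u1.
    - exact: leq_trans f1 t1.
  have l1 := leq_mul (szM j) (leqnn (@tINS n M + 3)).
  have l2 := leq_mul (szM (j + 2)) (leq_add l1 (leqnn 6)).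
  by rewrite /tCOMB leq_add2r.
move=> s2 fr2; rewrite key e13 h1 => -[m1 m2 m3 m4].
have q1 : iv s2 1 = 1 by rewrite (frI fr2) // (ctx_1 C1).
have q30 : iv s2 30 = 96 + j * 2.
  by rewrite (frI fr2) ?(frI fr1) //.
have qit : it s2 = it s.
  by rewrite (frT fr2) ?(frT fr1) //.
have q6 : rv s2 6 = lscale g m.+1 j.
  by rewrite (frR fr2) ?(frR fr1) //.
apply: reach_blk.
  case: (s2) q1 q30 => i t r h /= q1 q30; rewrite /upd /= q1 q30.
  by do !split => //; clear; lia.
set s4 := den_ops _ _ _.
have [i13 h4 i30 r6' itE] : [/\ iv s4 13 = iv s2 13, hp s4 = hp s2,
    iv s4 30 = 96 + j.+1 * 2, rv s4 6 = lscale g m.+1 j.+1 &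
    it s4 = upd (upd (it s2) (96 + 2 * j) (iv s2 22)) (97 + 2 * j) (iv s2 13)].
  rewrite /s4; case: (s2) q1 q30 q6 => i t r h /= q1 q30 q6.
  rewrite /upd /= q1 q30 q6; split => //; try (clear; lia).
    by rewrite /lscale addSn (exprS 2%:R); ring.
  have -> : 96 + j * 2 = 96 + 2 * j by clear; lia.
  by have -> : 96 + 2 * j + 1 = 97 + 2 * j by clear; lia.
have le13 : iv s 13 <= iv s4 13 by rewrite i13 m3 leq_addr.
split => //; last by move=> k hk; rewrite h4 m4 ?hk.
move=> k kc; have [->|kj] := eqVneq k j.
  rewrite ltnSn itE /upd eqxx ifF; last by clear; lia.
  rewrite eqxx h4 i13 m2; split => //.
have -> : (k < j.+1) = (k < j) by rewrite ltnS leq_eqVlt (negPf kj).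
have itk := @it_old s2 s4 k j.
have {itk}[k1 k2] : it s4 (96 + 2 * k) = it s2 (96 + 2 * k) /\
    it s4 (97 + 2 * k) = it s2 (97 + 2 * k).
  apply: itk => //; by move=> a a1 a2; rewrite itE /upd (negPf a1) (negPf a2).
have [v1 v2 v3 v4] := T k kc; rewrite k1 k2 qit; split => //.
  apply: (lst_same v2 v1 (hi := iv s 13)); first by rewrite -v3.
  move=> a ha; rewrite h4 m4 //.
  by apply/orP; right; move: ha f1; clear; lia.
exact: leq_trans v4 le13.
Qed.

Definition tSTEP M := 12 * Q * (tSLOT M + 2) + 8.

Lemma STEP_spec s M m cnt : ctx s -> free0 n <= iv s 13 -> cnt <= 12 * Q ->
  iv s 31 = 96 + (cnt + 2) * 2 ->
  rv s 5 = hscale g m -> rv s 25 = lscale g m 0 ->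
  tbl s (cnt + 2) (lists m) ->
  (forall k, size (lists m k) <= M) -> (forall k, size (lists m.+1 k) <= M) ->
  reach oracle (STEP mo) s (tSTEP M) (fun s' =>
    [/\ tbl s' cnt (lists m.+1), iv s' 31 = 96 + cnt * 2,
        free0 n <= iv s' 13, rv s' 5 = hscale g m.+1 /\ rv s' 25 = lscale g m.+1 0 &
        forall k, k < pD n -> hp s' k = hp s k]).
Proof.
move=> C f13 cQ e31 r5 r25 T szM szM'.
apply: (reach_le (tm' := 6 + (cnt * (tSLOT M + 2) + 2))); last first.
  by have := leq_mul cQ (leqnn (tSLOT M + 2)); rewrite /tSTEP; clear; lia.
apply: reach_opsF => // s1 E1 fr1.
have C1 : ctx s1 by apply: (ctx_frame C fr1) => // k hk; rewrite (frH fr1).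
have [g5 g25 g6 [i31 i30]] : [/\ rv s1 5 = hscale g m.+1, rv s1 25 = lscale g m.+1 0,
    rv s1 6 = lscale g m.+1 0 & iv s1 31 = 96 + cnt * 2 /\ iv s1 30 = 96].
  rewrite E1; move: r5 r25 e31 (ctx_0 C) (ctx_tb C).
  case: (s) => i t r h /= r5' r25' e31' e3 e14; rewrite /upd /= r5' r25' e31' e3 e14.
  have d2 : (forall a : R, a + a = 2 * a)%R by move=> a; ring.
  rewrite /hscale /lscale !d2 !add0n exprS !mulrA; split => //; split; clear; lia.
have e13 : iv s1 13 = iv s 13 by rewrite (frI fr1).
have h1 : hp s1 = hp s by rewrite (frH fr1).
pose I j s' := [/\ tbl s' (cnt + 2) (fun k => if k < j then lists m.+1 k else lists m k),
   iv s 13 <= iv s' 13, rv s' 6 = lscale g m.+1 j &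
   forall a, a < pD n -> hp s' a = hp s a].
apply: (reach_iter (I := I) (N := cnt) (p0 := 96) (e := 2) (tm := tSLOT M)) => //.
- split; rewrite ?e13 ?h1 //.
  apply: (tbl_pres T (s' := s1)); rewrite ?e13 ?h1 // => k kc.
  by rewrite (frT fr1).
- move=> j s2 fr2 [T2 le2 q6 q9] e30 jc.
  have C2 : ctx s2.
    apply: (ctx_frame C1 fr2) => //.
    by move=> a ha; rewrite h1 q9.
  apply: reach_post.
    apply: (SLOT_spec (M := M) (m := m) (j := j) (cnt := cnt) C2) => //.
      exact: leq_trans f13 le2.
    by rewrite (frR fr2) //.
  move=> s3 fr3 [b1 b2 b3 b4 b5]; split => //; split => //.
    exact: leq_trans le2 b3.
  by move=> a ha; rewrite b5 ?q9.
- move=> s2 fr2 [T2 le2 q6 q9]; split => //.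
  + move=> k kc; have := T2 k; rewrite kc; apply.
    exact: leq_trans kc (leq_addr _ _).
  + by rewrite (frI fr2) //.
  + exact: leq_trans f13 le2.
  + by rewrite !(frR fr2) //.
Qed.

Definition tSTEPS M := 2 * Q * (tSTEP M + 3) + 5.

Lemma STEPS_spec s M : ctx s -> free0 n <= iv s 13 -> iv s 15 = Q ->
  iv s 31 = 96 + 12 * Q * 2 -> rv s 5 = hscale g 0 -> rv s 19 = (g ^+ 7)%R ->
  tbl s (12 * Q) (lists 0) ->
  (forall m k, m <= 2 * Q -> size (lists m k) <= M) ->
  reach oracle (STEPS mo) s (tSTEPS M) (fun s' =>
    [/\ tbl s' (8 * Q) (lists (2 * Q)), iv s' 31 = 96 + 8 * Q * 2,
        free0 n <= iv s' 13, rv s' 5 = hscale g (2 * Q) /\ iv s' 42 = 2 * Q &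
        forall k, k < pD n -> hp s' k = hp s k]).
Proof.
move=> C f13 eQ e31 r5 r19 T szM.
have -> : tSTEPS M = 3 + (2 * Q * (tSTEP M + 1 + 2) + 2).
  by rewrite /tSTEPS; clear; lia.
apply: reach_opsF => // s1 E1 fr1.
have C1 : ctx s1 by apply: (ctx_frame C fr1) => // k hk; rewrite (frH fr1).
have [i41 i42 g25] : [/\ iv s1 41 = 0, iv s1 42 = 2 * Q & rv s1 25 = lscale g 0 0].
  rewrite E1; move: eQ r19 (ctx_r1 C); case: (s) => i t r h /= eQ' r19' e1.
  by rewrite /upd /= eQ' r19' e1; split => //; clear; lia.
pose I m s' := [/\ tbl s' (12 * Q - 2 * m) (lists m),
  iv s' 31 = 96 + (12 * Q - 2 * m) * 2, free0 n <= iv s' 13,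
  rv s' 5 = hscale g m /\ rv s' 25 = lscale g m 0 &
  forall k, k < pD n -> hp s' k = hp s k].
apply: (reach_forP (I := I) (N := 2 * Q) (tm := tSTEP M + 1)) => //.
- have i31 : iv s1 31 = iv s 31 by rewrite (frI fr1).
  have i13 : iv s1 13 = iv s 13 by rewrite (frI fr1).
  have g5 : rv s1 5 = rv s 5 by rewrite (frR fr1).
  have h1 : hp s1 = hp s by rewrite (frH fr1).
  rewrite /I muln0 subn0 i31 i13 g5 g25 h1; split => //.
  apply: (tbl_pres T (s' := s1)); rewrite ?i13 ?h1 // => k kc.
  by rewrite (frT fr1).
- move=> m s2 fr2 [T2 q31 q13 [q5 q25] q9] e41 mQ.
  have C2 : ctx s2.
    apply: (ctx_frame C1 fr2) => //.
    by move=> a ha; rewrite (frH fr1) // q9.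
  have ecnt : 12 * Q - 2 * m = 12 * Q - 2 * m.+1 + 2 by move: mQ; clear; lia.
  apply: reach_seq.
    apply: (STEP_spec (M := M) (m := m) (cnt := 12 * Q - 2 * m.+1) C2) => //.
    + exact: leq_subr.
    + by rewrite -ecnt.
    + by rewrite -ecnt.
    + by move=> k; apply: szM; exact: ltnW.
    + by move=> k; apply: szM.
  move=> s3 fr3 [b1 b2 b3 [b4 b5] b6]; apply: reach_blk => //.
  have k1 : iv s3 1 = 1.
    by rewrite (frI fr3) ?(ctx_1 C2) //.
  have k41 : iv s3 41 = m.
    by rewrite (frI fr3) //.
  have -> : I m.+1 (den_ops oracle [:: IA 41 41 1] s3) = I m.+1 s3.
    by rewrite /I /tbl; case: (s3).
  split; last by move: k1 k41; case: (s3) => i t r h /= a1 a2; rewrite /upd /= a1 a2 addn1.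
  by split => // k hk; rewrite b6 ?q9.
- move=> s2 fr2 [T2 q31 q13 [q5 q25] q9].
  have e8 : 12 * Q - 2 * (2 * Q) = 8 * Q by clear; lia.
  rewrite e8 in T2 q31; split => //; split => //.
  by rewrite (frI fr2) //.
Qed.

End tables.

(** * Search for a close lattice vector *)

Local Open Scope ring_scope.

Section search.
Context {R : realType} {n : nat}.
Variables (oracle : 'rV[R]_n -> R) (mo : bool).
Variables (B : 'M[R]_n) (x : 'rV[R]_n) (g eps : R) (Q : nat).

(** Accuracy after k refinements. The initial g^3 is so coarse that 0 alone covers every lattice
    vector in question. *)
Definition res (k : nat) : R := g ^+ 3 / 2 ^+ k.

Definition scomb (d rho : R) (X Y : seq 'rV[R]_n) : seq 'rV[R]_n :=
  comb (filb oracle mo B x true (d + rho) (hscale g (2 * Q)))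
       (nearb oracle mo B (hscale g (2 * Q)) (rho / 2)) X Y.

(** By [lscale_res] the slot used here has half the new accuracy as its radius, that is, the pruning
    radius; covering error and pruning error then add up to the new accuracy. *)
Fixpoint slist (d : R) (k : nat) : seq 'rV[R]_n :=
  if k is k'.+1 then
    scomb d (res k) (slist d k') (lists oracle mo B x g (2 * Q) (8 * Q - 2 - k'))
  else [:: 0].

(** If no accuracy in the range were fine enough, [find] would return 8 Q; [kstopP] rules this out
    for every guess that occurs. *)
Definition kstop (d : R) : nat := find (fun k => res k <= eps * d) (iota 0 (8 * Q)).

(** Returning the upper end makes the estimate err upwards only, so a recorded value always bounds
    the true gauge. *)
Fixpoint bisect (k : nat) (lo hi : R) (v : 'rV[R]_n) : R :=
  if k is k'.+1 then
    let mid := (lo + hi) / 2 in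
    if tst oracle mo (mid^-1 *: v) then bisect k' lo mid v else bisect k' mid hi v
  else hi.

(** The search interval ends at 2 d because a listed vector lies in (d + rho) C with rho at most e
    d. *)
Definition value (d : R) (z : 'rV[R]_n) : R :=
  if mo then bisect Q 0 (d + d) (amb B z 0 x) else oracle (amb B z 0 x).

Definition better (d : R) (bo : R * 'rV[R]_n) (z : 'rV[R]_n) : R * 'rV[R]_n :=
  if value d z < bo.1 then (value d z, z) else bo.

Definition dist_guess (k : nat) : R := 2 ^+ k / g ^+ 3.

Definition round (bo : R * 'rV[R]_n) (k : nat) : R * 'rV[R]_n :=
  foldl (better (dist_guess k)) bo (slist (dist_guess k) (kstop (dist_guess k))).

(** The guesses double from g^-3 up to g. The starting value g is legitimate for the vector 0, since
    -x lies in g C. *)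
Definition result : R * 'rV[R]_n := foldl round (g, 0) (iota 0 (4 * Q + 1)).

End search.

Local Open Scope nat_scope.

Definition BIS (mo : bool) : cmd :=
  Blk [:: RC 14 0; RA 15 7 7; IC 46 0] ;;
  Wh (CI 46 15) (Blk [:: RA 16 14 15; RC 23 2; RD 16 16 23; IC 2 1] ;;
    TST mo 16 ;; IfC (CI 3 2) (Blk [:: RM 15 16]) (Blk [:: RM 14 16]) ;;
    Blk [:: IA 46 46 1]) ;;
  Blk [:: RM 13 15].

Definition UPD (mo : bool) : cmd :=
  AMB 16 6 5 ;; (if mo then BIS mo else Blk [:: RQ 13 8]) ;;
  IfC (CR 13 8) (Blk [:: RM 8 13] ;; LIN 10 1 16 0 16) (Blk [::]).

Definition REFINE (mo : bool) : cmd :=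
  Blk [:: RC 23 2; RD 6 6 23; RA 4 7 6; RD 3 6 23; IL 24 30; IA 40 30 1;
          IL 21 40] ;;
  COMB mo true ;; Blk [:: IA 18 22 3; IA 20 13 3; IC 40 2; IS 30 30 40].

(** Variable 30 starts at the entry of slot 8 Q - 2 and moves down one slot per refinement,
    following the halving of the radius. *)
Definition ROUND (mo : bool) : cmd :=
  ZLIST ;; Blk [:: RM 6 18; IC 40 4; IS 30 31 40; RX 24 9 7] ;;
  Wh (CR 24 6) (REFINE mo) ;; Blk [:: IA 16 18 3] ;;
  Wh (CI 16 20) (UPD mo ;; Blk [:: IA 16 16 0]) ;;
  Blk [:: RA 7 7 7; IA 43 43 1].

Definition FINAL (mo : bool) : cmd :=
  Blk [:: RM 8 17] ;; LIN 10 0 6 0 6 ;;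
  Blk [:: RX 18 17 17; RX 18 18 17; RD 7 1 18; IC 43 0; IA 44 42 42;
          IA 44 44 1] ;;
  Wh (CI 43 44) (ROUND mo).

(** Index variable 3 holds zero and so doubles as the address of the output, which overwrites the
    beginning of the input. *)
Definition OUTPUT : cmd := AMB 10 6 6 ;; LIN 3 1 8 0 8.

Section final.
Context {R : realType} {n : nat}.
Hypothesis n_gt0 : 0 < n.
Variables (oracle : 'rV[R]_n -> R) (mo : bool).
Variables (B : 'M[R]_n) (x : 'rV[R]_n) (g eps : R) (Q : nat).
Implicit Types (s : @st R).

Let ctx := @ctx R n B x.
Let lists := @lists R n oracle mo B x g.
Let slist := @slist R n oracle mo B x g Q.
Let kstop := @kstop R g eps Q.

Definition tBIS := Q * (@tTST n + 10) + 6.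

Lemma BIS_spec s d v : ctx s -> iv s 15 = Q -> rv s 7 = d ->
  read_vec (hp s) (pT n) = v ->
  reach oracle (BIS mo) s tBIS (fun s' =>
    rv s' 13 = bisect oracle mo Q 0 (d + d)%R v /\
    same_out (pU n) (pO n) (hp s) (hp s')).
Proof.
move=> C eQ ed ev.
have [PZ PD PT PU [PO _ _ _]] := layoutE n.
have -> : tBIS = 3 + ((Q * (@tTST n + 8 + 2) + 2) + 1) by rewrite /tBIS; clear; lia.
apply: reach_opsF => // s1 E1 fr1.
have C1 : ctx s1 by apply: (ctx_frame C fr1) => // k hk; rewrite (frH fr1).
have [r14 r15 i46] : [/\ rv s1 14 = 0%R, rv s1 15 = (d + d)%R & iv s1 46 = 0].
  by rewrite E1; move: ed; case: (s) => i t r h /= e; rewrite /upd /= e.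
have h1 : hp s1 = hp s by rewrite (frH fr1).
apply: reach_seq.
  pose I k s' := [/\ bisect oracle mo (Q - k) (rv s' 14) (rv s' 15) v =
      bisect oracle mo Q 0 (d + d)%R v, read_vec (hp s') (pT n) = v &
      same_out (pU n) (pO n) (hp s) (hp s')].
  apply: (reach_forP (I := I) (N := Q) (tm := @tTST n + 8)
    (Q := fun s' => rv s' 15 = bisect oracle mo Q 0 (d + d)%R v /\
       same_out (pU n) (pO n) (hp s) (hp s'))) => //.
  - by rewrite /I subn0 r14 r15 h1.
  - by rewrite (frI fr1).
  - move=> k s2 fr2 [b1 b2 b3] e46 kQ.
    have C2 : ctx s2.
      apply: (ctx_frame C1 fr2) => // j hj; rewrite h1 b3 //.
      by move: hj PD PT PU PO; clear; lia.
    have -> : @tTST n + 8 = 4 + (@tTST n + ((1 + 2) + 1)) by clear; lia.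
    apply: reach_opsF => // s3 E3 fr3.
    have C3 : ctx s3 by apply: (ctx_frame C2 fr3) => // j hj; rewrite (frH fr3).
    have [i2 r16] : iv s3 2 = 1 /\ rv s3 16 = ((rv s2 14 + rv s2 15) / 2)%R.
      by rewrite E3; case: (s2) => i t r h; rewrite /= /upd /=.
    have h3 : hp s3 = hp s2 by rewrite (frH fr3).
    apply: reach_seq; first by apply: (TST_spec oracle mo C3 (a := 16)).
    move=> s4 fr4; rewrite r16 h3 b2 i2 => -[f2 so4].
    set mid := ((_ + _) / 2)%R in r16 f2.
    have C4 : ctx s4.
      apply: (ctx_frame C3 fr4) => // j hj; rewrite so4 ?h3 //.
      by move: hj PD PT PU PO; clear; lia.
    have g16 : rv s4 16 = mid by rewrite (frR fr4).
    have g14 : rv s4 14 = rv s2 14 by rewrite (frR fr4) // (frR fr3).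
    have g15 : rv s4 15 = rv s2 15 by rewrite (frR fr4) // (frR fr3).
    have g46 : iv s4 46 = k by rewrite (frI fr4) // (frI fr3).
    have hT4 : read_vec (hp s4) (pT n) = v.
      by rewrite (same_out_read so4) ?b2 //; move: PU; clear; lia.
    have so5 : same_out (pU n) (pO n) (hp s) (hp s4).
      exact: same_out_trans b3 so4.
    have step : bisect oracle mo (Q - k) (rv s2 14) (rv s2 15) v =
      if tst oracle mo (mid^-1 *: v) then bisect oracle mo (Q - k.+1) (rv s2 14) mid v
      else bisect oracle mo (Q - k.+1) mid (rv s2 15) v.
      by rewrite -(subnSK kQ).
    apply: (reach_seq (Q1 := fun s' => [/\ I k.+1 s', iv s' 46 = k & iv s' 1 = 1])).
      apply: reach_if => /=; rewrite (ctx_0 C4) f2.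
        case: tst step => // step _; apply: reach_blk => //=.
        move: g16 g14 g15 g46 hT4 so5 (ctx_1 C4).
        case: (s4) => i t r h /= g16 g14 g15 g46 hT4 so5 q1.
        by split => //; split => //; rewrite /upd /= g16 g14 -step.
      case: tst step => // step _; apply: reach_blk => //=.
      move: g16 g14 g15 g46 hT4 so5 (ctx_1 C4).
      case: (s4) => i t r h /= g16 g14 g15 g46 hT4 so5 q1.
      by split => //; split => //; rewrite /upd /= g16 g15 -step.
    move=> s5 fr5 [I5 k46 k1]; apply: reach_blk => //.
    have -> : I k.+1 (den_ops oracle [:: IA 46 46 1] s5) = I k.+1 s5.
      by rewrite /I; case: (s5).
    by split => //; move: k46 k1; case: (s5) => i t r h /= a1 a2; rewrite /upd /= a1 a2 addn1.
  - by move=> s2 fr2 []; rewrite subnn.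
move=> s2 fr2 [e1 e2]; apply: reach_blk => //.
by move: e1 e2; case: (s2) => i t r h /= a1 a2; split => //; rewrite /upd /= a1.
Qed.

Definition tUPD := @tAMB n + tBIS + 12 * n + 10.

Lemma UPD_spec s d z : ctx s -> iv s 15 = Q -> rv s 7 = d ->
  pY n <= iv s 16 -> read_vec (hp s) (iv s 16) = z ->
  reach oracle (UPD mo) s tUPD (fun s' =>
    (rv s' 8, read_vec (hp s') (pO n)) =
      better oracle mo B x Q d (rv s 8, read_vec (hp s) (pO n)) z /\
    same_out (pD n) (pY n) (hp s) (hp s')).
Proof.
move=> C eQ ed p16 hz.
have [PZ PD PT PU [PO PY _ _]] := layoutE n.
have -> : tUPD = @tAMB n + ((tBIS + 1) + ((1 + (12 * n + 6)) + 2)).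
  by rewrite /tUPD; clear; lia.
apply: reach_seq.
  apply: (AMB_spec oracle C (z := 16) (q := 6) (w := 5)) => //.
  rewrite (ctx_Z C) (ctx_X C); split; [right|by left|by right].
  by move: p16 PY; clear; lia.
move=> s1 fr1; rewrite (ctx_Z C) (ctx_hZ C) (ctx_X C) (ctx_hX C) hz.
move=> -[hT _ so1].
have C1 : ctx s1 by apply: (ctx_frame C fr1) => // j hj; rewrite so1 ?hj.
have so1' : same_out (pD n) (pO n) (hp s) (hp s1).
  by apply: (same_out_sub so1); move: PU PO; clear; lia.
apply: (reach_seq (Q1 := fun s' => [/\ rv s' 13 = value oracle mo B x Q d z,
   same_out (pD n) (pO n) (hp s) (hp s'), rv s' 8 = rv s 8, iv s' 16 = iv s 16 & ctx s'])).
  have [E|E] : mo = true \/ mo = false by case: (mo); [left|right].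
    rewrite (_ : (if mo then BIS mo else _) = BIS mo); last by rewrite E.
    have vE : value oracle mo B x Q d z = bisect oracle mo Q 0 (d + d)%R (amb B z 0%R x).
      by rewrite /value E.
    apply: (reach_le (tm' := tBIS)); last by rewrite leq_addr.
    apply: reach_post.
      apply: (BIS_spec (d := d) C1 _ _ hT).
        by rewrite (frI fr1).
      by rewrite (frR fr1).
    move=> s2 fr2 [b1 b2].
    have so2 : same_out (pD n) (pO n) (hp s1) (hp s2).
      by apply: (same_out_sub b2); move: PU PO PT PD; clear; lia.
    split; rewrite ?b1 ?vE //.
    - exact: same_out_trans so1' so2.
    - by rewrite (frR fr2) // (frR fr1).
    - by rewrite (frI fr2) // (frI fr1).
    - by apply: (ctx_frame C1 fr2) => // j hj; rewrite so2 ?hj.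
  rewrite (_ : (if mo then BIS mo else _) = Blk [:: RQ 13 8]); last by rewrite E.
  have vE : value oracle mo B x Q d z = oracle (amb B z 0%R x) by rewrite /value E.
  rewrite vE; apply: (reach_le (tm' := 1)); last by rewrite addn1.
  apply: reach_blk => /=.
    by split => //; rewrite (ctx_T C1); move: PZ PD PT; rewrite /inlen; clear; lia.
  have r8 : rv s1 8 = rv s 8 by rewrite (frR fr1).
  have i16 : iv s1 16 = iv s 16 by rewrite (frI fr1).
  have e8 := ctx_T C1.
  split.
  - by move: hT e8; case: (s1) => i t r h /= hT e8'; rewrite /upd /= e8' hT.
  - by move: so1'; case: (s1).
  - by move: r8; case: (s1).
  - by move: i16; case: (s1).
  - have fr2 : frame (Blk [:: RQ 13 8]) s1 (den_op oracle (RQ 13 8) s1).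
      apply: (ev_frame (ev_blk (oracle := oracle) (n := n) (l := [:: RQ 13 8]) _)).
      by split => //=; rewrite (ctx_T C1); move: PZ PD PT; rewrite /inlen; clear; lia.
    by apply: (ctx_frame C1 fr2) => // j hj; rewrite (frH fr2).
move=> s2 fr2 [v1 so2 r8 i16 C2].
have ez : read_vec (hp s2) (iv s 16) = z.
  rewrite (same_out_read so2) //; move: p16 PY; clear; lia.
have so2' : same_out (pD n) (pY n) (hp s) (hp s2).
  by apply: (same_out_sub so2); move: PY; clear; lia.
have hO : read_vec (hp s2) (pO n) = read_vec (hp s) (pO n) :> 'rV_n.
  by rewrite (same_out_read so2) // leqnn orbT.
apply: reach_if => /=; rewrite v1 r8 /better /=.
  move=> ->; apply: reach_opsF => // s3 E3 fr3.
  have C3 : ctx s3 by apply: (ctx_frame C2 fr3) => // j hj; rewrite (frH fr3).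
  have h3 : hp s3 = hp s2 by rewrite (frH fr3).
  have k16 : iv s3 16 = iv s 16 by rewrite (frI fr3).
  have k8 : rv s3 8 = value oracle mo B x Q d z.
    by rewrite E3; move: v1; case: (s2) => i t r h /= e; rewrite /upd /= e.
  apply: reach_post.
    apply: (LIN_spec oracle (d := 10) (a := 1) (p := 16) (b := 0) (q := 16)) => //;
     rewrite ?(ctx_n C3) ?(ctx_1 C3) ?(ctx_O C3) ?k16 //;
     try (apply: vreg_ge); rewrite /alias_ok; move: p16 PY PO PU PT PD; clear; lia.
  move=> s4 fr4; rewrite (ctx_r1 C3) (ctx_r0 C3) scale1r scale0r addr0 k16 h3 ez.
  rewrite (ctx_O C3) => -[e4 so4]; split.
    by rewrite (frR fr4) // k8 e4.
  apply: (same_out_trans so2'); apply: (same_out_sub so4); move: PY PO PU PT PD; clear; lia.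
move=> /negPf ->; apply: (reach_le (tm' := 0)) => //; apply: reach_blk => //=.
by rewrite r8 hO.
Qed.

Definition tREF MS ML := @tCOMB n MS ML MS + 11.

Definition tROUND MS ML := @tZLIST n + 8 * Q * (tREF MS ML + 2) + MS * (tUPD + 3) + 11.

Record inv s : Prop := Inv {
  inv_ctx : ctx s;
  inv_fp : free0 n <= iv s 13;
  inv_Q : iv s 15 = Q;
  inv_31 : iv s 31 = 96 + 8 * Q * 2;
  inv_h : rv s 5 = hscale g (2 * Q);
  inv_eps : rv s 9 = eps;
  inv_18 : rv s 18 = (g ^+ 3)%R;
  inv_tbl : @tbl R n s (8 * Q) (lists (2 * Q)) }.

Lemma resS k : res g k.+1 = (res g k / 2)%R.
Proof. by rewrite /res (exprS 2%:R) invfM mulrA mulrAC. Qed.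

Lemma ROUND_spec s d MS ML : inv s -> rv s 7 = d -> 0 < Q ->
  kstop d < 8 * Q ->
  (forall k, size (lists (2 * Q) k) <= ML) ->
  (forall k, k <= kstop d -> size (slist d k) <= MS) ->
  reach oracle (ROUND mo) s (tROUND MS ML) (fun s' =>
    [/\ inv s', rv s' 7 = (d + d)%R, iv s' 43 = iv s 43 + 1 &
     (rv s' 8, read_vec (hp s') (pO n)) =
      foldl (better oracle mo B x Q d) (rv s 8, read_vec (hp s) (pO n))
        (slist d (kstop d))]).
Proof.
move=> [C f13 eQ e31 e5 e9 e18 T] ed Q0 kQ szL szS.
have [PZ PD PT PU [PO PY PM PF]] := layoutE n.
have [f1 f2] := free0_ge n_gt0.
have pYf : pY n <= free0 n by move: f2; clear; lia.
have -> : tROUND MS ML = @tZLIST n + (4 + ((8 * Q * (tREF MS ML + 2) + 2) +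
  (1 + ((MS * (tUPD + 1 + 2) + 2) + 2)))) by rewrite /tROUND; clear; lia.
apply: reach_seq; first by apply: (ZLIST_spec n_gt0 oracle C).
move=> s1 fr1 [a18 a13 a20 al ak].
have C1 : ctx s1 by apply: (ctx_keeps C fr1) ak.
have T1 : tbl (n := n) s1 (8 * Q) (lists (2 * Q)).
  apply: (tbl_pres T (s' := s1)).
  - by move=> k kc; rewrite (frT fr1).
  - by rewrite a13 leq_addr.
  - by move=> k hk; apply: ak; apply/orP; right; move: hk f1; clear; lia.
have hO1 : read_vec (hp s1) (pO n) = read_vec (hp s) (pO n) :> 'rV_n.
  rewrite (keeps_read ak) // leqnn /=; apply/orP; right.
  by move: f13 pYf PY; clear; lia.
have f13' : free0 n <= iv s1 13 by rewrite a13; move: f13; clear; lia.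
apply: reach_opsF => // s2 E2 fr2.
have C2 : ctx s2 by apply: (ctx_frame C1 fr2) => // j hj; rewrite (frH fr2).
have h2 : hp s2 = hp s1 by rewrite (frH fr2).
have I2 j : j \in [:: 13; 15; 18; 20; 31; 43] -> iv s2 j = iv s1 j.
  by move=> jj; rewrite (frI fr2) //; move: jj; mem_cases.
have R2 j : j \in [:: 5; 7; 8; 9; 18] -> rv s2 j = rv s j.
  move=> jj; rewrite (frR fr2) ?(frR fr1) //; move: jj; mem_cases.
have [r6 r24 i30] : [/\ rv s2 6 = res g 0, rv s2 24 = (eps * d)%R &
    iv s2 30 = 92 + 8 * Q * 2].
  have q18 : rv s1 18 = (g ^+ 3)%R by rewrite (frR fr1).
  have q9 : rv s1 9 = eps by rewrite (frR fr1).
  have q7 : rv s1 7 = d by rewrite (frR fr1).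
  have q31 : iv s1 31 = 96 + 8 * Q * 2 by rewrite (frI fr1).
  rewrite E2; move: q18 q9 q7 q31; case: (s1) => i t r h /= q18 q9 q7 q31.
  rewrite /upd /= q18 q9 q7 q31 /res expr0 divr1; split => //; clear; lia.
pose bo := (rv s 8, read_vec (hp s) (pO n) : 'rV[R]_n).
(* The machine never computes [kstop d]: its loop guard first fails exactly there. *)
have holdE k : (k <= kstop d)%N -> (eps * d < res g k)%R = (k < kstop d).
  move=> kk; rewrite ltNge; have [lk|ge] := ltnP k (kstop d).
    have := before_find 0 lk; rewrite nth_iota ?add0n ?(ltn_trans lk) // => ->.
    by [].
  have -> : k = kstop d by apply/eqP; rewrite eqn_leq kk ge.
  have := nth_find 0 (a := fun k => (res g k <= eps * d)%R) (s := iota 0 (8 * Q)).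
  rewrite has_find size_iota -/kstop => /(_ kQ).
  by rewrite nth_iota // add0n => ->.
apply: (reach_seq (Q1 := fun s' => [/\ lst (hp s') (iv s' 18) (slist d (kstop d)),
   iv s' 20 = iv s' 18 + size (slist d (kstop d)) * n, free0 n <= iv s' 18,
   iv s' 20 <= iv s' 13 & [/\ ctx s', tbl (n := n) s' (8 * Q) (lists (2 * Q)) &
   read_vec (hp s') (pO n) = bo.2]])).
  pose I k s' := [/\ k <= kstop d, rv s' 6 = res g k, iv s' 30 = 92 + 8 * Q * 2 - 2 * k,
    lst (hp s') (iv s' 18) (slist d k) & [/\
    iv s' 20 = iv s' 18 + size (slist d k) * n, free0 n <= iv s' 18,
    iv s' 20 <= iv s' 13 & [/\ ctx s', tbl (n := n) s' (8 * Q) (lists (2 * Q)) &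
    read_vec (hp s') (pO n) = bo.2]]].
  have HW := @reach_while R n oracle (CR 24 6) (REFINE mo) s2 I (8 * Q) (tREF MS ML).
  apply: (reach_post (HW _ _ _)).
  - rewrite /I r6 i30 muln0 subn0 h2 !I2 // a18 a20 /= mul1n; split => //; split => //.
      by rewrite a13.
    split => //; apply: (tbl_pres T1 (s' := s2)); rewrite ?I2 ?h2 // => k kc.
    by rewrite (frT fr2).
  - move=> k s3 fr3 [k1 k2 _ _ _] /=; rewrite k2 (frR fr3) // r24 holdE // => k3.
    exact: ltn_trans k3 kQ.
  - move=> k s3 fr3 [k1 k2 k3 k4 [k5 k6 k7 [C3 T3 k8]]] /=.
    rewrite k2 (frR fr3) // r24 holdE // => lk.
    have kQ2 : k <= 8 * Q - 2 by move: lk kQ; clear; lia.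
    pose j := 8 * Q - 2 - k.
    have ej : 92 + 8 * Q * 2 - 2 * k = 96 + 2 * j by rewrite /j; move: kQ2 Q0; clear; lia.
    have [t1 t2 t3 t4] : [/\ free0 n <= it s3 (96 + 2 * j),
       lst (hp s3) (it s3 (96 + 2 * j)) (lists (2 * Q) j),
       it s3 (97 + 2 * j) = it s3 (96 + 2 * j) + size (lists (2 * Q) j) * n &
       it s3 (97 + 2 * j) <= iv s3 13].
      by apply: T3; rewrite /j; move: kQ2 Q0; clear; lia.
    have -> : tREF MS ML = 7 + (@tCOMB n MS ML MS + 4) by rewrite /tREF; clear; lia.
    have g1 := ctx_1 C3.
    apply: reach_opsF.
      move: k3 g1; rewrite ej; case: (s3) => i t r h /= e30 e1; rewrite /upd /= e30 e1.
      by do !split => //; clear; lia.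
    move=> s4 E4 fr4.
    have C4 : ctx s4 by apply: (ctx_frame C3 fr4) => // l hl; rewrite (frH fr4).
    have h4 : hp s4 = hp s3 by rewrite (frH fr4).
    have g7 : rv s3 7 = d by rewrite (frR fr3) // R2.
    have g5 : rv s4 5 = hscale g (2 * Q) by rewrite (frR fr4) // (frR fr3) // R2.
    have I4 l : l \in [:: 13; 18; 20; 30] -> iv s4 l = iv s3 l.
      by move=> jj; rewrite (frI fr4) //; move: jj; mem_cases.
    have [q6 q4 q3 [q24 q21]] : [/\ rv s4 6 = res g k.+1, rv s4 4 = (d + res g k.+1)%R,
       rv s4 3 = (res g k.+1 / 2)%R & iv s4 24 = it s3 (96 + 2 * j) /\
       iv s4 21 = it s3 (97 + 2 * j)].
      rewrite E4 resS; move: k2 k3 g1 g7; rewrite ej.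
      case: (s3) => i t r h /= k2' e30 e1 e7.
      rewrite /upd /= k2' e30 e1 e7; split => //; split => //.
      by have -> : 96 + 2 * j + 1 = 97 + 2 * j by clear; lia.
    have key : comb (filb oracle mo B x true (rv s4 4) (rv s4 5))
       (nearb oracle mo B (rv s4 5) (rv s4 3)) (slist d k) (lists (2 * Q) j)
       = slist d k.+1 by rewrite q4 q3 g5.
    have s13 : free0 n <= iv s3 13.
      by apply: leq_trans k6 _; apply: leq_trans k7; rewrite k5 leq_addr.
    apply: reach_seq.
      apply: (reach_le (tm' := @tCOMB n (size (slist d k)) (size (lists (2 * Q) j)) MS)).
        apply: (COMB_spec n_gt0 (fl := true) (X := slist d k) (Y := lists (2 * Q) j)
          (M := MS) C4); rewrite ?key ?q24 ?q21 ?I4 ?h4 //.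
        + exact: leq_trans f1 s13.
        + exact: leq_trans f1 k6.
        + exact: leq_trans f1 t1.
        + exact: szS.
      have l1 := leq_mul (szL j) (leqnn (@tINS n MS + 3)).
      have l2 := leq_mul (szS k k1) (leq_add l1 (leqnn 6)).
      by rewrite /tCOMB leq_add2r.
    move=> s5 fr5; rewrite key I4 // h4 => -[m1 m2 m3 m4].
    have le5 : iv s3 13 <= iv s5 13 by rewrite m3 leq_addr.
    have C5 : ctx s5 by apply: (ctx_keeps C4 fr5 (lo := iv s3 13)) => //; rewrite h4.
    have T5 : tbl (n := n) s5 (8 * Q) (lists (2 * Q)).
      apply: (tbl_pres T3 (s' := s5)) => //.
      + by move=> l lc; rewrite (frT fr5) // (frT fr4).
      + by move=> l hl; apply: m4; apply/orP; right; move: hl f1; clear; lia.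
    have hO5 : read_vec (hp s5) (pO n) = bo.2.
      rewrite -k8 (keeps_read m4) // leqnn /=; apply/orP; right.
      by move: s13 pYf PY; clear; lia.
    have q30 : iv s5 30 = 92 + 8 * Q * 2 - 2 * k by rewrite (frI fr5) // I4.
    have q6' : rv s5 6 = res g k.+1 by rewrite (frR fr5).
    apply: reach_blk => //.
    set s6 := den_ops _ _ _.
    have fr6 : frame (Blk [:: IA 18 22 3; IA 20 13 3; IC 40 2; IS 30 30 40]) s5 s6.
      exact: (ev_frame (ev_blk (oracle := oracle) (n := n) _)).
    have [w18 w20 w30] : [/\ iv s6 18 = iv s3 13, iv s6 20 = iv s5 13 &
       iv s6 30 = 92 + 8 * Q * 2 - 2 * k.+1].
      rewrite /s6; move: m2 q30 (ctx_0 C5); case: (s5) => i t r h /= e22 e30 e3.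
      by rewrite /upd /= e22 e30 e3 !addn0; split => //; clear; lia.
    have w13 : iv s6 13 = iv s5 13 by rewrite (frI fr6).
    have wh : hp s6 = hp s5 by rewrite (frH fr6).
    have wt : it s6 = it s5 by rewrite (frT fr6).
    rewrite /I w18 w20 w30 w13 wh; split => //.
      by rewrite (frR fr6).
    split => //; split => //.
      by apply: (ctx_frame C5 fr6) => // l hl; rewrite wh.
    apply: (tbl_pres T5 (s' := s6)); rewrite ?w13 ?wh // => l lc.
    by rewrite wt.
  - move=> s3 fr3 [k [k1 k2 _ k4 [k5 k6 k7 k8]]] /=.
    rewrite k2 (frR fr3) // r24 holdE // -leqNgt => k9.
    by have -> : kstop d = k by apply/eqP; rewrite eqn_leq k9 k1.
move=> s3 fr3 [l1 l2 l3 l4 [C3 T3 hO3]].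
have R3 j : j \in [:: 5; 7; 8; 9; 18] -> rv s3 j = rv s j.
  move=> jj; rewrite (frR fr3) ?R2 //; move: jj; mem_cases.
have I3 j : j \in [:: 15; 31; 43] -> iv s3 j = iv s j.
  move=> jj; rewrite (frI fr3) ?I2 ?(frI fr1) //; move: jj; mem_cases.
apply: reach_opsF => // s4 E4 fr4.
have C4 : ctx s4 by apply: (ctx_frame C3 fr4) => // l hl; rewrite (frH fr4).
have h4 : hp s4 = hp s3 by rewrite (frH fr4).
have t4 : it s4 = it s3 by rewrite (frT fr4).
have i16 : iv s4 16 = iv s3 18.
  by rewrite E4; move: (ctx_0 C3); case: (s3) => i t r h /= e; rewrite /upd /= e addn0.
have I4 j : j != 16 -> iv s4 j = iv s3 j.
  by move=> jj; rewrite (frI fr4) //= inE.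
have r4 : rv s4 = rv s3 by rewrite E4; case: (s3).
set S := slist d (kstop d) in l1 l2.
apply: (reach_seq (Q1 := fun s' => [/\ same_out (pD n) (pY n) (hp s3) (hp s'), ctx s' &
   (rv s' 8, read_vec (hp s') (pO n)) = foldl (better oracle mo B x Q d) bo S])).
  pose I k s' := [/\ same_out (pD n) (pY n) (hp s3) (hp s'), ctx s' &
   (rv s' 8, read_vec (hp s') (pO n)) = foldl (better oracle mo B x Q d) bo (take k S)].
  apply: (reach_iter (I := I) (N := size S) (p0 := iv s3 18) (e := n) (tm := tUPD + 1)) => //.
  - by rewrite leq_add2r leq_mul2r szS ?orbT.
  - by rewrite /I h4 take0 /= r4 hO3 R3.
  - by rewrite I4.
  - by rewrite /UPD; case: (mo).
  - move=> k s5 fr5 [so5 C5 b5] e16 kS.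
    have kn : k * n + n <= size S * n by rewrite addnC -mulSn leq_mul2r kS orbT.
    have Fr j : j \in [:: 7] -> rv s5 j = rv s4 j.
      by move=> jj; rewrite (frR fr5) //; move: jj; rewrite /UPD; case: (mo); mem_cases.
    have Fi : iv s5 15 = Q.
      by rewrite (frI fr5) ?I4 ?I3 //; rewrite /UPD; case: (mo).
    apply: reach_seq.
      apply: (UPD_spec (d := d) (z := nth 0%R S k) C5) => //.
      + by rewrite Fr // r4 R3.
      + by rewrite e16; move: l3 pYf; clear; lia.
      + rewrite e16 (same_out_read so5) ?l1 //.
        by move: l3 pYf; clear; lia.
    move=> s6 fr6; rewrite b5 => -[b6 so6].
    have C6 : ctx s6.
      apply: (ctx_frame C5 fr6); try by rewrite /UPD; case: (mo).
      by move=> l hl; rewrite so6 ?hl.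
    have w16 : iv s6 16 = iv s3 18 + k * n.
      by rewrite (frI fr6) // /UPD; case: (mo).
    apply: reach_blk => //.
    set s7 := den_ops _ _ _.
    have fr7 : frame (Blk [:: IA 16 16 0]) s6 s7.
      exact: (ev_frame (ev_blk (oracle := oracle) (n := n) _)).
    split.
      split.
      + by rewrite (frH fr7) //; exact: same_out_trans so5 so6.
      + by apply: (ctx_frame C6 fr7) => // l hl; rewrite (frH fr7).
      + by rewrite (frH fr7) // (frR fr7) // b6 (take_nth 0%R) // foldl_rcons.
    rewrite /s7; move: w16 (ctx_n C6); case: (s6) => i t r h /= w16 w0.
    by rewrite /upd /= w16 w0 mulSn; clear; lia.
  - by move=> s5 fr5 [so5 C5 b5]; split => //; rewrite b5 take_size.
move=> s5 fr5 [so5 C5 b5].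
have Fr j : j \in [:: 5; 7; 9; 18] -> rv s5 j = rv s j.
  move=> jj; rewrite (frR fr5) ?r4 ?R3 //; move: jj; rewrite /UPD; case: (mo); mem_cases.
have Fi j : j \in [:: 13; 15; 31; 43] -> iv s5 j = iv s4 j.
  move=> jj; rewrite (frI fr5) //; move: jj; rewrite /UPD; case: (mo); mem_cases.
have g1 := ctx_1 C5.
have g7 : rv s5 7 = d by rewrite Fr.
have g43 : iv s5 43 = iv s 43 by rewrite Fi // I4 // I3.
apply: reach_blk => //.
set s6 := den_ops _ _ _.
have fr6 : frame (Blk [:: RA 7 7 7; IA 43 43 1]) s5 s6.
  exact: (ev_frame (ev_blk (oracle := oracle) (n := n) _)).
have it6 : it s6 = it s3.
  rewrite (frT fr6) // (frT fr5) // /UPD; by case: (mo).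
have i13 : iv s6 13 = iv s3 13 by rewrite (frI fr6) // Fi // I4.
have h6 : hp s6 = hp s5 by rewrite (frH fr6).
split.
- split.
  + by apply: (ctx_frame C5 fr6) => // l hl; rewrite h6.
  + rewrite i13; apply: leq_trans l3 _; apply: leq_trans l4; by rewrite l2 leq_addr.
  + by rewrite (frI fr6) // Fi // I4 // I3.
  + by rewrite (frI fr6) // Fi // I4 // I3.
  + by rewrite (frR fr6) // Fr.
  + by rewrite (frR fr6) // Fr.
  + by rewrite (frR fr6) // Fr.
  + apply: (tbl_pres T3 (s' := s6)); rewrite ?i13 ?it6 // => l hl.
    by rewrite h6 so5 //; move: hl f2; clear; lia.
- by rewrite /s6; move: g7; case: (s5) => i t r h /= e; rewrite /upd /= e.
- by rewrite -g43 /s6; move: g1; case: (s5) => i t r h /= e; rewrite /upd /= e.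
- by rewrite h6 (frR fr6).
Qed.

Definition tFINAL MS ML := (4 * Q + 1) * (tROUND MS ML + 2) + 12 * n + 15.

Lemma FINAL_spec s MS ML : ctx s -> free0 n <= iv s 13 -> iv s 15 = Q ->
  iv s 31 = 96 + 8 * Q * 2 -> rv s 5 = hscale g (2 * Q) -> rv s 9 = eps ->
  rv s 17 = g -> iv s 42 = 2 * Q -> @tbl R n s (8 * Q) (lists (2 * Q)) -> 0 < Q ->
  (forall k, k <= 4 * Q -> kstop (dist_guess g k) < 8 * Q) ->
  (forall k, size (lists (2 * Q) k) <= ML) ->
  (forall k j, k <= 4 * Q -> j <= kstop (dist_guess g k) ->
     size (slist (dist_guess g k) j) <= MS) ->
  reach oracle (FINAL mo) s (tFINAL MS ML) (fun s' =>
    ctx s' /\ read_vec (hp s') (pO n) = (result oracle mo B x g eps Q).2).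
Proof.
move=> C f13 eQ e31 e5 e9 e17 e42 T Q0 kQ szL szS.
have [PZ PD PT PU [PO PY PM PF]] := layoutE n.
have [f1 f2] := free0_ge n_gt0.
have -> : tFINAL MS ML = 1 + ((12 * n + 6) + (6 + ((4 * Q + 1) * (tROUND MS ML + 2) + 2))).
  by rewrite /tFINAL; clear; lia.
apply: reach_opsF => // s1 E1 fr1.
have C1 : ctx s1 by apply: (ctx_frame C fr1) => // k hk; rewrite (frH fr1).
have r8 : rv s1 8 = g.
  by rewrite E1; move: e17; case: (s) => i t r h /= e; rewrite /upd /= e.
apply: reach_seq.
  apply: (LIN_spec oracle (d := 10) (a := 0) (p := 6) (b := 0) (q := 6)) => //;
   rewrite ?(ctx_n C1) ?(ctx_1 C1) ?(ctx_O C1) ?(ctx_Z C1) //;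
   try (apply: vreg_ge); rewrite /alias_ok; move: PZ PO PU PT PD; clear; lia.
move=> s2 fr2; rewrite (ctx_r0 C1) !scale0r addr0 (ctx_O C1) (frH fr1) // => -[hO so2].
have C2 : ctx s2.
  apply: (ctx_frame C1 fr2) => // k hk; rewrite (frH fr1) // so2 //.
  by move: hk PO PU PT; clear; lia.
have I2 j : j \in [:: 13; 15; 31; 42] -> iv s2 j = iv s j.
  by move=> jj; rewrite (frI fr2) ?(frI fr1) //; move: jj; mem_cases.
have R2 j : j \in [:: 5; 9; 17] -> rv s2 j = rv s j.
  by move=> jj; rewrite (frR fr2) ?(frR fr1) //; move: jj; mem_cases.
apply: reach_opsF => // s3 E3 fr3.
have C3 : ctx s3 by apply: (ctx_frame C2 fr3) => // k hk; rewrite (frH fr3).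
have [r18 r7 i43 i44] : [/\ rv s3 18 = (g ^+ 3)%R, rv s3 7 = dist_guess g 0,
    iv s3 43 = 0 & iv s3 44 = 4 * Q + 1].
  have q17 : rv s2 17 = g by rewrite R2.
  have q42 : iv s2 42 = 2 * Q by rewrite I2.
  rewrite E3; move: q17 q42 (ctx_1 C2) (ctx_r1 C2).
  case: (s2) => i t r h /= q17 q42 q1 p1; rewrite /upd /= q17 q42 q1 p1.
  rewrite /dist_guess expr0; split => //; [ring|congr (_ / _)%R; ring|clear; lia].
have I3 j : j \in [:: 13; 15; 31] -> iv s3 j = iv s j.
  move=> jj; rewrite (frI fr3) ?I2 //; move: jj; mem_cases.
have R3 j : j \in [:: 5; 9] -> rv s3 j = rv s j.
  move=> jj; rewrite (frR fr3) ?R2 //; move: jj; mem_cases.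
have h3 : hp s3 = hp s2 by rewrite (frH fr3).
pose I k s' := [/\ inv s', rv s' 7 = dist_guess g k &
  (rv s' 8, read_vec (hp s') (pO n)) =
   foldl (round oracle mo B x g eps Q) (g, 0%R) (iota 0 k)].
apply: (reach_forP (I := I) (N := 4 * Q + 1) (tm := tROUND MS ML)) => //.
- split => //.
  + have [q5 q9] : rv s3 5 = rv s 5 /\ rv s3 9 = rv s 9 by rewrite !R3.
    split; rewrite ?I3 ?q5 ?q9 //.
    have hk : forall k, free0 n <= k < iv s 13 -> hp s3 k = hp s k.
      move=> k hk; rewrite h3 so2 ?(frH fr1) //; move: hk f2 PY PO; clear; lia.
    have ht : it s3 = it s by rewrite (frT fr3) // (frT fr2) // (frT fr1).
    have h13 : iv s3 13 = iv s 13 by rewrite I3.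
    by apply: (tbl_pres T (s' := s3)) => //; rewrite ?h13 // => k kc; rewrite ht.
  + by rewrite h3 hO (frR fr3) // (frR fr2) // r8.
- by rewrite /ROUND /UPD; case: (mo).
- move=> k s4 fr4 [I4 e7 eb] e43 kN.
  have k4 : k <= 4 * Q by move: kN; clear; lia.
  apply: reach_post.
    apply: (ROUND_spec (MS := MS) (ML := ML) I4 e7 Q0 (kQ _ k4) szL).
    by move=> j jk; exact: szS.
  move=> s5 fr5 [I5 f7 f43]; rewrite eb => fb; split; last first.
    by rewrite f43 e43 addn1.
  split => //.
    by rewrite f7 /dist_guess (exprS 2%:R); ring.
  have -> : iota 0 k.+1 = iota 0 k ++ [:: k] by rewrite -[k.+1]addn1 iotaD.
  by rewrite fb foldl_cat.
- move=> s4 fr4 [I4 _ eb]; split; first exact: (inv_ctx I4).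
  by rewrite /result -eb.
Qed.

Definition tOUTPUT := @tAMB n + 12 * n + 6.

Lemma OUTPUT_spec s : ctx s ->
  reach oracle OUTPUT s tOUTPUT (fun s' =>
    read_vec (hp s') 0 = (read_vec (hp s) (pO n) *m B)%R).
Proof.
move=> C; have [PZ PD PT PU [PO PY PM PF]] := layoutE n.
have -> : tOUTPUT = @tAMB n + (12 * n + 6) by rewrite /tOUTPUT; clear; lia.
apply: reach_seq.
  apply: (AMB_spec oracle C (z := 10) (q := 6) (w := 6)) => //.
  rewrite (ctx_O C) (ctx_Z C); split; [by right|by left|by left].
move=> s1 fr1; rewrite (ctx_O C) (ctx_Z C) (ctx_hZ C) => -[hT _ so1].
have C1 : ctx s1 by apply: (ctx_frame C fr1) => // j hj; rewrite so1 ?hj.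
apply: reach_post.
  apply: (LIN_spec oracle (d := 3) (a := 1) (p := 8) (b := 0) (q := 8)) => //;
   rewrite ?(ctx_n C1) ?(ctx_1 C1) ?(ctx_0 C1) ?(ctx_T C1) //;
   try (by apply: vreg_ge; move: PZ PD PT; clear; lia);
   rewrite /vreg /inlen; clear; lia.
move=> s2 fr2; rewrite (ctx_0 C1) (ctx_T C1) (ctx_r1 C1) (ctx_r0 C1).
by rewrite scale1r scale0r addr0 hT /amb !subr0 => -[].
Qed.

End final.

Local Open Scope ring_scope.

(** * Preparation: memory layout, determinant, choice of g *)

Local Open Scope nat_scope.

(** Addresses are formed by additions and subtractions only: 8 n by doubling, and n * n as the
    address of x minus 4. Variable 3 supplies the input length before it is reset to zero. The zero
    vector is written as 0 x + 0 x. *)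
Definition SETUP : cmd :=
  Blk [:: IC 40 32; IA 6 3 40; IA 7 6 0; IA 8 7 0; IA 9 8 0] ;;
  Blk [:: IA 10 9 0; IA 11 10 0; IA 41 0 0; IA 41 41 41; IA 41 41 41] ;;
  Blk [:: IA 41 41 0; IA 12 11 41; IS 5 3 0; IC 3 0; IC 4 4; IC 14 96] ;;
  Blk [:: IA 13 12 5; IS 13 13 4; RC 0 0; RC 1 1; RC 2 (-1)] ;;
  LIN 6 0 5 0 5.

(** The elimination destroys its matrix, while B is needed later, hence the copy. The loop also
    counts n as a real, because no instruction converts an index to a real. *)
Definition COPY : cmd :=
  Blk [:: RM 24 0; IC 40 0; IA 41 12 3; IA 42 4 3] ;;
  Wh (CI 40 0) (LIN 41 1 42 0 42 ;;
    Blk [:: IA 41 41 0; IA 42 42 0; IA 40 40 1; RA 24 24 1]).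

Definition ELIM : cmd :=
  Blk [:: RX 19 19 22; IA 42 41 0] ;;
  Wh (CI 42 13) (DOT 23 41 42 ;; Blk [:: RD 23 23 22; RS 23 0 23] ;;
    LIN 42 1 42 23 41 ;; Blk [:: IA 42 42 0]).

(** Gram-Schmidt without normalisation: the product of the squared row norms becomes the square of
    the determinant. Unlike Gaussian elimination it requires no pivot search, and it takes no
    roots. *)
Definition MGS : cmd :=
  Blk [:: RM 19 1; IA 41 12 3] ;;
  Wh (CI 41 13) (DOT 22 41 41 ;; ELIM ;; Blk [:: IA 41 41 0]).

Definition ROWS : cmd :=
  Blk [:: RM 18 1; IC 40 0; IA 42 4 3] ;;
  Wh (CI 40 0) (DOT 22 42 42 ;;
    Blk [:: RA 22 22 24; RA 22 22 1; RA 22 22 22; RX 18 18 22; IA 42 42 0;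
            IA 40 40 1]).

Definition EPS (mo : bool) : seq op :=
  if mo then [:: RC 27 8; RD 9 5 27] else [:: RC 27 16; RX 27 27 5; RD 9 1 27].

(** The real g and its exponent Q grow in the same loop, since a real cannot be turned into an index
    afterwards. *)
Definition BOUND (mo : bool) : cmd :=
  DOT 25 5 5 ;;
  Blk [:: IC 40 0; RL 3 40; RL 4 1; IC 40 3; RL 5 40] ;;
  IfC (CR 4 0) (Blk [:: RS 4 0 4]) (Blk [::]) ;;
  Blk (EPS mo) ;;
  Blk [:: RD 26 1 19; RA 26 26 1; RX 28 4 18; RX 28 28 26] ;;
  Blk [:: RA 29 18 4; RA 29 29 1; RA 29 29 25; RD 29 29 3; RA 28 28 29] ;;
  Blk [:: RD 29 1 9; RA 28 28 29; RC 29 8; RA 28 28 29; RM 17 1; IC 15 0] ;;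
  Wh (CR 17 28) (Blk [:: RA 17 17 17; IA 15 15 1]).

Definition MAIN (mo : bool) : cmd :=
  SETUP ;; COPY ;; MGS ;; ROWS ;; BOUND mo ;; INITL mo ;; STEPS mo ;;
  FINAL mo ;; OUTPUT.

Section elimination.
Context {R : realType} {n : nat}.
Implicit Types (W : 'M[R]_n).

Definition rdot W (a b : 'I_n) : R := (\sum_j W a j * W b j)%R.

Definition add_row W (i j : 'I_n) (c : R) : 'M[R]_n :=
  (\matrix_(a, b) (W a b + (a == j)%:R * c * W i b))%R.

(** A row is added to a later one, so the elementary matrix is lower triangular with unit
    diagonal. *)
Lemma det_add_row W (i j : 'I_n) c : (i < j)%N -> (\det (add_row W i j c) = \det W)%R.
Proof.
move=> ij; have -> : add_row W i j c = ((1%:M + c *: delta_mx j i) *m W)%R.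
  apply/matrixP => a b; rewrite mulmxDl mul1mx -scalemxAl mxE [RHS]mxE; congr (_ + _)%R.
  rewrite !mxE (bigD1 i) //= big1 => [|k ki]; last first.
    by rewrite !mxE (negPf ki) andbF mul0r.
  by rewrite !mxE eqxx andbT addr0; case: (a == j) => /=; ring.
rewrite det_mulmx det_trig ?big1 ?mul1r // => [k _|].
  rewrite !mxE eqxx; have [->|] := eqVneq k j; last by rewrite mulr0 addr0.
  by rewrite -val_eqE /= gtn_eqF //= mulr0 addr0.
apply/is_trig_mxP => a b ab; rewrite !mxE -!val_eqE /= ltn_eqF //= add0r.
case: (b =P i :> nat) => [bi|_]; last by rewrite andbF mulr0.
by rewrite ltn_eqF ?mulr0 //; apply: ltn_trans ab _; rewrite bi.
Qed.

Lemma rdotC W a b : rdot W a b = rdot W b a.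
Proof. by apply: eq_bigr => j _; rewrite mulrC. Qed.

(** A vanishing norm would mean a zero row. Hence the elimination, which divides by these norms,
    never divides by zero. *)
Lemma rdot_gt0 W i : (\det W != 0)%R -> (0 < rdot W i i)%R.
Proof.
have ge0 j : true -> (0 <= W i j * W i j)%R by rewrite -expr2 sqr_ge0.
move=> dW; rewrite lt0r sumr_ge0 ?andbT //.
apply: contraNneq dW => e0; have H := psumr_eq0P ge0 e0.
rewrite (expand_det_row _ i) big1 // => j _.
by have /eqP := H j isT; rewrite mulf_eq0 orbb => /eqP ->; rewrite mul0r.
Qed.

Lemma det_orthogonal W : (forall a b, a != b -> rdot W a b = 0%R) ->
  ((\det W) ^+ 2 = \prod_i rdot W i i)%R.
Proof.
move=> ort; rewrite expr2 -[in X in (_ * X)%R]det_tr -det_mulmx.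
have -> : (W *m W^T = diag_mx (\row_i rdot W i i))%R.
  apply/matrixP => a b; rewrite !mxE.
  have -> : (\sum_j W a j * W^T j b = rdot W a b)%R.
    by apply: eq_bigr => j _; rewrite !mxE.
  by have [->|/ort ->] := eqVneq a b; rewrite ?mulr1n ?mulr0n.
by rewrite det_diag; apply: eq_bigr => i _; rewrite mxE.
Qed.

End elimination.

Section main.
Context {R : realType} {n : nat}.
Hypothesis n_gt0 : 0 < n.
Variables (oracle : 'rV[R]_n -> R) (mo : bool).
Variables (B : 'M[R]_n) (x : 'rV[R]_n).
Variables (r Rad gamma par : R).
Hypothesis B_unit : B \in unitmx.
Implicit Types (s : @st R).

Let ctx := @ctx R n B x.
Let input := cvp_input r Rad gamma par B x.

Lemma nth_allpairs (I J : Type) (T : Type) (f : I -> J -> T) (i0 : I) (j0 : J)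
    (t0 : T) (p : seq I) (q : seq J) a b : a < size p -> b < size q ->
  nth t0 [seq f i j | i <- p, j <- q] (a * size q + b) = f (nth i0 p a) (nth j0 q b).
Proof.
elim: p a => //= i p IH [|a] ap bq.
  by rewrite mul0n add0n nth_cat size_map bq (nth_map j0).
rewrite nth_cat size_map mulSn -addnA ltnNge leq_addr /= addKn.
exact: IH.
Qed.

Lemma input_B (i j : 'I_n) : nth 0%R input (4 + i * n + j) = B i j.
Proof.
have sB : size [seq B i j | i <- enum 'I_n, j <- enum 'I_n] = n * n.
  by rewrite size_allpairs !size_enum_ord.
rewrite -addnA -[LHS]/(nth 0%R ([seq B i j | i <- enum 'I_n, j <- enum 'I_n]
  ++ [seq x 0%R j | j <- enum 'I_n]) (i * n + j)) nth_cat sB.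
have := row_end (ltn_ord i); have := ltn_ord j => jn ie.
rewrite ifT; last by move: ie jn; clear; lia.
have := nth_allpairs (fun i j => B i j) i j 0%R (p := enum 'I_n)
  (q := enum 'I_n) (a := i) (b := j).
by rewrite size_enum_ord !nth_ord_enum; apply.
Qed.

Lemma input_x (j : 'I_n) : nth 0%R input (4 + n * n + j) = x 0%R j.
Proof.
have sB : size [seq B i j | i <- enum 'I_n, j <- enum 'I_n] = n * n.
  by rewrite size_allpairs !size_enum_ord.
rewrite -addnA -[LHS]/(nth 0%R ([seq B i j | i <- enum 'I_n, j <- enum 'I_n]
  ++ [seq x 0%R j | j <- enum 'I_n]) (n * n + j)) nth_cat sB.
rewrite ltnNge leq_addr /= addKn (nth_map j) ?size_enum_ord //.
by rewrite nth_ord_enum.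
Qed.

Definition params s := [/\ hp s 0 = r, hp s 1 = Rad & hp s 3 = par].

Lemma SETUP_spec s : iv s 0 = n -> iv s 1 = 1 -> iv s 3 = inlen n ->
  (forall a, @heap_addr n a -> hp s a = nth 0%R input a) ->
  reach oracle SETUP s (12 * n + 31) (fun s' =>
    [/\ ctx s', iv s' 13 = free0 n & params s']).
Proof.
move=> e0 e1 e3 hh.
have [PZ PD PT PU [PO PY PM PF]] := layoutE n.
have -> : 12 * n + 31 = 5 + (5 + (6 + (5 + (12 * n + 10)))) by clear; lia.
apply: reach_opsF; first by case: (s).
move=> sa Ea fra.
have [a0 a1 a3 [a6 a7 a8 a9]] : [/\ iv sa 0 = n, iv sa 1 = 1, iv sa 3 = inlen n &
    [/\ iv sa 6 = pZ n, iv sa 7 = pD n, iv sa 8 = pT n & iv sa 9 = pU n]].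
  rewrite Ea; move: e0 e1 e3; case: (s) => i t rr h /= e0' e1' e3'.
  by rewrite /upd /= e0' e3' PU PT PD PZ.
apply: reach_opsF; first by case: (sa).
move=> sb Eb frb.
have [b10 b11 b41] : [/\ iv sb 10 = pO n, iv sb 11 = pY n & iv sb 41 = 8 * n].
  rewrite Eb; move: a0 a9; case: (sa) => i t rr h /= w0 w9.
  rewrite /upd /= w0 w9 PY PO; split => //; clear; lia.
have Ib j : j \in [:: 0; 1; 3; 6; 7; 8; 9] -> iv sb j = iv sa j.
  by move=> jj; rewrite (frI frb) //; move: jj; mem_cases.
apply: reach_opsF; first by case: (sb).
move=> sc Ec frc.
have [c12 c5 c3 [c4 c14]] : [/\ iv sc 12 = pM n, iv sc 5 = 4 + n * n, iv sc 3 = 0 &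
    iv sc 4 = 4 /\ iv sc 14 = 96].
  have [w0 w3] : iv sb 0 = n /\ iv sb 3 = inlen n by rewrite !Ib.
  rewrite Ec; move: w0 w3 b11 b41; case: (sb) => i t rr h /= w0 w3 w11 w41.
  rewrite /upd /= w0 w3 w11 w41 PM; split => //; rewrite /inlen; clear; lia.
have Ic j : j \in [:: 0; 1; 6; 7; 8; 9; 10; 11] -> iv sc j = iv sb j.
  by move=> jj; rewrite (frI frc) //; move: jj; mem_cases.
apply: (reach_le (tm' := 5 + (12 * n + 6))); last by clear; lia.
apply: reach_opsF; first by case: (sc).
move=> s1 E1 fr1.
have h1 : hp s1 = hp s by rewrite (frH fr1) // (frH frc) // (frH frb) // (frH fra).
have I1 j : j \in [:: 0; 1; 3; 4; 5; 6; 7; 8; 9; 10; 11; 12; 14] -> iv s1 j = iv sc j.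
  by move=> jj; rewrite (frI fr1) //; move: jj; mem_cases.
have i13 : iv s1 13 = free0 n.
  rewrite E1; move: c12 c5 c4; case: (sc) => i t rr h /= w12 w5 w4.
  by rewrite /upd /= w12 w5 w4 PF; clear; lia.
have [i0 i1 i3 [i4 i5 i6 i7]] : [/\ iv s1 0 = n, iv s1 1 = 1, iv s1 3 = 0 &
    [/\ iv s1 4 = 4, iv s1 5 = 4 + n * n, iv s1 6 = pZ n & iv s1 7 = pD n]].
  rewrite !I1 // c4 c5; do !split => //; by rewrite Ic // Ib.
have [i8 i9 i10 [i11 i12 i14]] : [/\ iv s1 8 = pT n, iv s1 9 = pU n, iv s1 10 = pO n &
    [/\ iv s1 11 = pY n, iv s1 12 = pM n & iv s1 14 = 96]].
  rewrite !I1 // c12; do !split => //; rewrite Ic //; by rewrite Ib.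
have [r0 r1 r2] : [/\ rv s1 0 = 0%R, rv s1 1 = 1%R & rv s1 2 = (-1)%R].
  by rewrite E1; case: (sc).
apply: reach_post.
  apply: (LIN_spec oracle (d := 6) (a := 0) (p := 5) (b := 0) (q := 5)) => //;
   rewrite ?i6 ?i5 //; rewrite /vreg /alias_ok /inlen; move: PZ; clear; lia.
move=> s2 fr2; rewrite r0 !scale0r addr0 i6 h1 => -[hZ so2].
have hin a : a < inlen n -> hp s2 a = nth 0%R input a.
  move=> ha; rewrite so2; last by move: ha PZ; rewrite /inlen; clear; lia.
  by rewrite hh // /heap_addr ha.
split.
- split; rewrite ?(frI fr2) ?(frR fr2) //.
  + move=> i; apply/rowP => j; rewrite read_vecE hin ?input_B ?mxE //.
    by have := row_end (ltn_ord i); have := ltn_ord j; rewrite /inlen; clear; lia.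
  + apply/rowP => j; rewrite read_vecE hin ?input_x //.
    by have := ltn_ord j; rewrite /inlen; clear; lia.
- by rewrite (frI fr2).
- by split; rewrite hin // /inlen; clear; lia.
Qed.

Lemma COPY_spec s : ctx s -> iv s 13 = free0 n -> params s ->
  reach oracle COPY s (n * (12 * n + 12) + 6) (fun s' =>
    [/\ ctx s', params s', rv s' 24 = n%:R%R &
     forall i : 'I_n, read_vec (hp s') (pM n + i * n) = row i B]).
Proof.
move=> C e13 [p0 p1 p3].
have [PZ PD PT PU [PO PY PM PF]] := layoutE n.
have -> : n * (12 * n + 12) + 6 = 4 + (n * (12 * n + 10 + 2) + 2) by clear; lia.
apply: reach_opsF => // s1 E1 fr1.
have C1 : ctx s1 by apply: (ctx_frame C fr1) => // k hk; rewrite (frH fr1).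
have h1 : hp s1 = hp s by rewrite (frH fr1).
have [i40 i41 i42 r24] : [/\ iv s1 40 = 0, iv s1 41 = pM n, iv s1 42 = 4 & rv s1 24 = 0%R].
  rewrite E1; move: (ctx_0 C) (ctx_M C) (ctx_B C) (ctx_r0 C).
  by case: (s) => i t rr h /= q3 q12 q4 q0; rewrite /upd /= q3 q12 q4 q0 !addn0.
pose I k s' := [/\ iv s' 41 = pM n + k * n, iv s' 42 = 4 + k * n, rv s' 24 = k%:R%R,
   forall i : 'I_n, i < k -> read_vec (hp s') (pM n + i * n) = row i B &
   forall a, a < pM n -> hp s' a = hp s a].
apply: (reach_forP (I := I) (N := n) (tm := 12 * n + 10)) => //.
- by split => //; rewrite ?mul0n ?addn0 ?h1.
- exact: (ctx_n C1).
- move=> k s2 fr2 [j41 j42 j24 jr ja] e40 kn.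
  have C2 : ctx s2.
    apply: (ctx_frame C1 fr2) => // a ha; rewrite h1 ja //.
    by move: ha PM PY PO PU PT; clear; lia.
  have kk := row_end kn.
  have -> : 12 * n + 10 = (12 * n + 6) + 4 by clear; lia.
  apply: reach_seq.
    apply: (LIN_spec oracle (d := 41) (a := 1) (p := 42) (b := 0) (q := 42)) => //;
     rewrite ?(ctx_n C2) ?(ctx_1 C2) ?j41 ?j42 //;
     rewrite /vreg /alias_ok /inlen; move: kk PZ PM PY PO PU PT PD; clear; lia.
  move=> s3 fr3; rewrite j41 j42 (ctx_r1 C2) (ctx_r0 C2) scale1r scale0r addr0.
  rewrite (ctx_hB C2 (Ordinal kn)) => -[hz so3].
  have C3 : ctx s3.
    apply: (ctx_frame C2 fr3) => // a ha; rewrite so3 //.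
    by move: ha PM PY PO PU PT; clear; lia.
  have K j : j \in [:: 41; 42; 40] -> iv s3 j = iv s2 j.
    move=> jj; rewrite (frI fr3) //; move: jj; mem_cases.
  have R3 : rv s3 24 = k%:R%R by rewrite (frR fr3).
  apply: reach_blk => //; set s4 := den_ops _ _ _.
  have h4 : hp s4 = hp s3 by rewrite /s4; case: (s3).
  have [q1 q2 q3 q4] : [/\ iv s4 41 = pM n + k.+1 * n, iv s4 42 = 4 + k.+1 * n,
     rv s4 24 = k.+1%:R%R & iv s4 40 = k.+1].
    rewrite /s4; move: (K 41 isT) (K 42 isT) (K 40 isT) R3 (ctx_n C3) (ctx_1 C3) (ctx_r1 C3).
    rewrite j41 j42 e40; case: (s3) => i t rr h /= b1 b2 b3 b4 b5 b6 b7.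
    rewrite /upd /= b1 b2 b3 b4 b5 b6 b7 mulSn -natr1; split => //; clear; lia.
  split => //; split => //.
  + move=> i; rewrite ltnS leq_eqVlt h4 => /orP[/eqP ei|ik].
      by rewrite ei hz; congr row; apply: val_inj.
    rewrite (same_out_read so3) ?jr //.
    have : i * n + n <= k * n by rewrite addnC -mulSn leq_mul2r ik orbT.
    by clear; lia.
  + by move=> a ha; rewrite h4 so3 ?ja //; move: ha; clear; lia.
- move=> s2 fr2 [_ _ q24 q qa]; split => //.
  + apply: (ctx_frame C1 fr2) => // a ha; rewrite h1 qa //.
    by move: ha PM PY PO PU PT; clear; lia.
  + by split; rewrite qa ?p0 ?p1 ?p3 //; move: PM PY PO PU PT PD PZ; clear; lia.
  + by move=> i; apply: q; exact: ltn_ord.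
Qed.

Definition memM (h : nat -> R) (W : 'M[R]_n) : Prop :=
  forall i : 'I_n, read_vec h (pM n + i * n) = row i W.

(** Removing from a later row its projection on row i does not disturb the orthogonality to earlier
    rows, since row i is itself orthogonal to them. *)
Lemma ELIM_spec s (W : 'M[R]_n) (i : 'I_n) p : ctx s -> iv s 13 = free0 n ->
  iv s 41 = pM n + i * n -> memM (hp s) W -> (\det W != 0)%R ->
  rv s 22 = rdot W i i -> rv s 19 = p ->
  (forall a b : 'I_n, a < i -> a != b -> rdot W a b = 0%R) ->
  reach oracle ELIM s (n * (21 * n + 17) + 4) (fun s' =>
    [/\ rv s' 19 = (p * rdot W i i)%R, forall a, a < pM n -> hp s' a = hp s a &
     exists W', [/\ memM (hp s') W', \det W' = \det W,
       forall a b : 'I_n, a <= i -> a != b -> rdot W' a b = 0%R &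
       forall a : 'I_n, a <= i -> rdot W' a a = rdot W a a]]).
Proof.
move=> C e13 e41 mW dW e22 e19 ortW.
have [PZ PD PT PU [PO PY PM PF]] := layoutE n.
have ii := row_end (ltn_ord i).
apply: (reach_le (tm' := 2 + ((n - i.+1) * (21 * n + 15 + 2) + 2))); last first.
  rewrite (_ : 21 * n + 15 + 2 = 21 * n + 17); last by clear; lia.
  by have := leq_mul (leq_subr i.+1 n) (leqnn (21 * n + 17)); clear; lia.
have qi := rdot_gt0 i dW.
apply: reach_opsF => // s1 E1 fr1.
have C1 : ctx s1 by apply: (ctx_frame C fr1) => // k hk; rewrite (frH fr1).
have h1 : hp s1 = hp s by rewrite (frH fr1).
have [i42 r19] : iv s1 42 = pM n + i.+1 * n /\ rv s1 19 = (p * rdot W i i)%R.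
  rewrite E1; move: e41 e22 e19 (ctx_n C); case: (s) => i' t rr h /= q1 q2 q3 q4.
  by rewrite /upd /= q1 q2 q3 q4 mulSn; split => //; clear; lia.
pose I k s' := (forall a, a < pM n -> hp s' a = hp s a) /\
  exists W', [/\ memM (hp s') W', \det W' = \det W,
    forall a b : 'I_n, a < i -> a != b -> rdot W' a b = 0%R,
    forall b : 'I_n, i < b -> b < i.+1 + k -> rdot W' i b = 0%R &
    forall a : 'I_n, a <= i -> row a W' = row a W].
have ni : i.+1 + (n - i.+1) = n by rewrite subnKC.
apply: (reach_iter (I := I) (N := n - i.+1) (p0 := pM n + i.+1 * n) (e := n)
  (tm := 21 * n + 15)) => //.
- split; first by rewrite h1.
  exists W; rewrite h1; split => //.
  by move=> b b1; rewrite addn0 ltnS leqNgt b1.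
- rewrite (frI fr1) // e13 PF -addnA -mulnDl ni //.
- move=> k s2 fr2 [ja [W2 [m2 d2 o2 z2 c2]]] e42 kN.
  have C2 : ctx s2.
    apply: (ctx_frame C1 fr2) => // a ha; rewrite h1 ja //.
    by move: ha PM PY PO PU PT; clear; lia.
  have jn : i.+1 + k < n by move: kN (ltn_ord i); clear; lia.
  pose j := Ordinal jn.
  have ej : pM n + i.+1 * n + k * n = pM n + j * n by rewrite -addnA -mulnDl.
  have jj := row_end (ltn_ord j).
  have ij : i < j by rewrite /= ltn_addr.
  have k41 : iv s2 41 = pM n + i * n by rewrite (frI fr2) // (frI fr1).
  have -> : 21 * n + 15 = (9 * n + 6) + (2 + ((12 * n + 6) + 1)) by clear; lia.
  apply: reach_seq.
    apply: (DOT_spec oracle (r := 23) (p := 41) (q := 42)) => //;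
     rewrite ?(ctx_n C2) ?(ctx_1 C2) ?k41 ?e42 ?ej //; apply: vreg_ge;
     move: PZ PM PY PO PU PT PD; clear; lia.
  move=> s3 fr3; rewrite k41 e42 ej m2 m2 => e23.
  have C3 : ctx s3 by apply: (ctx_frame C2 fr3) => // a ha; rewrite (frH fr3).
  apply: reach_opsF => // s4 E4 fr4.
  have C4 : ctx s4 by apply: (ctx_frame C3 fr4) => // a ha; rewrite (frH fr4).
  have h4 : hp s4 = hp s2 by rewrite (frH fr4) // (frH fr3).
  have q22 : rv s3 22 = rdot W i i by rewrite (frR fr3) // (frR fr2) // (frR fr1).
  pose c := (- (rdot W2 i j / rdot W i i))%R.
  have r23 : rv s4 23 = c.
    have e23' : rv s3 23 = rdot W2 i j.
      by rewrite e23; apply: eq_bigr => l _; rewrite !mxE.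
    rewrite E4; move: e23' q22 (ctx_r0 C3); case: (s3) => i' t rr h /= w1 w2 w3.
    by rewrite /upd /= w1 w2 w3 sub0r.
  have l41 : iv s4 41 = pM n + i * n by rewrite (frI fr4) // (frI fr3).
  have l42 : iv s4 42 = pM n + j * n by rewrite (frI fr4) // (frI fr3) // e42.
  have iln : i * n + n <= j * n by rewrite addnC -mulSn leq_mul2r ij orbT.
  apply: reach_seq.
    apply: (LIN_spec oracle (d := 42) (a := 1) (p := 42) (b := 23) (q := 41)) => //;
     rewrite ?(ctx_n C4) ?(ctx_1 C4) ?l41 ?l42 //;
     try (apply: vreg_ge); rewrite /alias_ok; move: iln PZ PM PY PO PU PT PD; clear; lia.
  move=> s5 fr5; rewrite l41 l42 h4 !m2 (ctx_r1 C4) r23 scale1r => -[hz so5].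
  have C5 : ctx s5.
    apply: (ctx_frame C4 fr5) => // a ha; rewrite h4 so5 //.
    by move: ha PM PY PO PU PT; clear; lia.
  have l5 : iv s5 42 = pM n + j * n by rewrite (frI fr5).
  apply: reach_blk => //; set s6 := den_ops _ _ _.
  have h6 : hp s6 = hp s5 by rewrite /s6; case: (s5).
  split; last first.
    rewrite /s6; move: l5 (ctx_n C5); case: (s5) => i' t rr h /= w1 w2.
    by rewrite /upd /= w1 w2 -ej mulSn; clear; lia.
  split; first by move=> a ha; rewrite h6 so5 ?ja //; move: ha; clear; lia.
  have rowi : row i W2 = row i W by apply: c2.
  have dotii : rdot W2 i i = rdot W i i.
    apply: eq_bigr => l _; have := congr1 (fun v : 'rV_n => v 0%R l) rowi.
    by rewrite !mxE => ->.
  have jE a b : (a != j) -> add_row W2 i j c a b = W2 a b.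
    by move=> aj; rewrite mxE (negPf aj) !mul0r addr0.
  have jj' b : add_row W2 i j c j b = (W2 j b + c * W2 i b)%R.
    by rewrite mxE eqxx mul1r.
  have dj a : a != j -> rdot (add_row W2 i j c) a j = (rdot W2 a j + c * rdot W2 a i)%R.
    move=> aj; rewrite /rdot mulr_sumr -big_split; apply: eq_bigr => l _ /=.
    by rewrite jE // jj'; ring.
  have da a b : a != j -> b != j -> rdot (add_row W2 i j c) a b = rdot W2 a b.
    by move=> aj bj; apply: eq_bigr => l _; rewrite !jE.
  have ltj (a : 'I_n) : a <= i -> a != j.
    move=> ai; apply/eqP => e; move: ij; rewrite -e; by rewrite ltnNge ai.
  exists (add_row W2 i j c); split.
  + move=> a; rewrite h6; have [->|aj] := eqVneq a j.
      by rewrite hz; apply/rowP => l; rewrite !mxE eqxx mul1r.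
    have -> : row a (add_row W2 i j c) = row a W2.
      by apply/rowP => l; rewrite mxE [RHS]mxE jE.
    rewrite (same_out_read so5) ?h4 ?m2 //.
    have [aj'|ja'|e] := ltngtP a j.
    * have : a * n + n <= j * n by rewrite addnC -mulSn leq_mul2r aj' orbT.
      by clear; lia.
    * have : j * n + n <= a * n by rewrite addnC -mulSn leq_mul2r ja' orbT.
      by clear; lia.
    * by move: aj; rewrite -val_eqE /= e eqxx.
  + by rewrite det_add_row.
  + move=> a b ai ab; have aj : a != j by apply: ltj; exact: ltnW.
    have ani : a != i by rewrite -val_eqE /= ltn_eqF.
    have [->|bj] := eqVneq b j; last by rewrite da // o2.
    by rewrite dj // !o2 // mulr0 addr0.
  + move=> b ib bk; have [->|bj] := eqVneq b j; last first.
      rewrite da //; last exact: ltj.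
      apply: z2 => //.
      have : (b : nat) != i.+1 + k by [].
      by move: bk; clear; lia.
    rewrite dj; last exact: ltj.
    rewrite dotii /c mulNr -mulrA mulVf ?mulr1 ?subrr //.
    by rewrite gt_eqF.
  + move=> a ai; rewrite -c2 //; apply/rowP => l; by rewrite mxE [RHS]mxE jE // ltj.
- move=> s2 fr2 [ja [W2 [m2 d2 o2 z2 c2]]].
  have cc (a : 'I_n) : a <= i -> rdot W2 a a = rdot W a a.
    move=> ai; apply: eq_bigr => l _.
    by have := congr1 (fun v : 'rV_n => v 0%R l) (c2 a ai); rewrite !mxE => ->.
  split => //; first by rewrite (frR fr2).
  exists W2; split => // a b; rewrite leq_eqVlt => /orP[/eqP ai|ai] ab; last exact: o2.
  have {ai}ai : a = i by apply: val_inj.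
  rewrite ai in ab *; have [bi|ib|e] := ltngtP b i.
  + by rewrite rdotC o2 // eq_sym.
  + by apply: z2 => //; rewrite ni.
  + by move: ab; rewrite -val_eqE /= e eqxx.
Qed.

Lemma MGS_spec s : ctx s -> iv s 13 = free0 n -> params s -> memM (hp s) B ->
  reach oracle MGS s (n * (n * (21 * n + 17) + 9 * n + 13) + 4) (fun s' =>
    [/\ ctx s', params s' & rv s' 19 = ((\det B) ^+ 2)%R]).
Proof.
move=> C e13 [p0 p1 p3] mB.
have [PZ PD PT PU [PO PY PM PF]] := layoutE n.
have -> : n * (n * (21 * n + 17) + 9 * n + 13) + 4 =
  2 + (n * ((9 * n + 6 + ((n * (21 * n + 17) + 4) + 1)) + 2) + 2) by clear; lia.
apply: reach_opsF => // s1 E1 fr1.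
have C1 : ctx s1 by apply: (ctx_frame C fr1) => // k hk; rewrite (frH fr1).
have h1 : hp s1 = hp s by rewrite (frH fr1).
have [i41 r19] : iv s1 41 = pM n /\ rv s1 19 = 1%R.
  rewrite E1; move: (ctx_M C) (ctx_0 C) (ctx_r1 C); case: (s) => i' t rr h /= q1 q2 q3.
  by rewrite /upd /= q1 q2 q3 addn0.
have dB : (\det B != 0)%R by rewrite -unitfE -unitmxE.
pose I k s' := (forall a, a < pM n -> hp s' a = hp s a) /\
  exists W', [/\ memM (hp s') W', \det W' = \det B,
    forall a b : 'I_n, a < k -> a != b -> rdot W' a b = 0%R &
    rv s' 19 = (\prod_(a < n | (a < k)%N) rdot W' a a)%R].
apply: (reach_iter (I := I) (N := n) (p0 := pM n) (e := n)
  (tm := 9 * n + 6 + ((n * (21 * n + 17) + 4) + 1))) => //.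
- split; first by rewrite h1.
  by exists B; rewrite h1 r19; split => //; rewrite big1.
- by rewrite (frI fr1) // e13 PF.
- move=> k s2 fr2 [ja [W2 [m2 d2 o2 q19]]] e41 kn.
  have C2 : ctx s2.
    apply: (ctx_frame C1 fr2) => // a ha; rewrite h1 ja //.
    by move: ha PM PY PO PU PT; clear; lia.
  pose i := Ordinal kn.
  have d2' : (\det W2 != 0)%R by rewrite d2.
  apply: reach_seq.
    apply: (DOT_spec oracle (r := 22) (p := 41) (q := 41)) => //;
     rewrite ?(ctx_n C2) ?(ctx_1 C2) ?e41 //; apply: vreg_ge;
     move: PZ PM PY PO PU PT PD; clear; lia.
  move=> s3 fr3; rewrite e41 (m2 i) => e22.
  have C3 : ctx s3 by apply: (ctx_frame C2 fr3) => // a ha; rewrite (frH fr3).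
  have h3 : hp s3 = hp s2 by rewrite (frH fr3).
  apply: reach_seq.
    apply: (ELIM_spec (W := W2) (i := i)
       (p := (\prod_(a < n | (a < k)%N) rdot W2 a a)%R) C3) => //.
    + by rewrite (frI fr3) // (frI fr2) // (frI fr1).
    + by rewrite (frI fr3).
    + by rewrite h3.
    + by rewrite e22; apply: eq_bigr => l _; rewrite !mxE.
    + by rewrite (frR fr3).
  move=> s4 fr4 [q1 q2 [W3 [m3 d3 o3 c3]]].
  have g41 : iv s4 41 = pM n + k * n by rewrite (frI fr4) // (frI fr3).
  have C4 : ctx s4.
    apply: (ctx_frame C3 fr4) => // a ha; rewrite q2 //.
    by move: ha PM PY PO PU PT; clear; lia.
  apply: reach_blk => //; set s6 := den_ops _ _ _.
  have h6 : hp s6 = hp s4 by rewrite /s6; case: (s4).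
  have r6 : rv s6 = rv s4 by rewrite /s6; case: (s4).
  split; last first.
    rewrite /s6; move: g41 (ctx_n C4); case: (s4) => i' t rr h /= w1 w2.
    by rewrite /upd /= w1 w2 mulSn; clear; lia.
  split; first by move=> a ha; rewrite h6 q2 // h3 ja.
  exists W3; split; rewrite ?h6 ?r6 //; first by rewrite d3.
  rewrite q1 [RHS](bigD1 i) //= mulrC c3 //; congr (_ * _)%R.
  apply: eq_big => a; first by rewrite -val_eqE /= ltnS ltn_neqAle andbC.
  by move=> ak; rewrite c3 //= ltnW.
- move=> s2 fr2 [ja [W2 [m2 d2 o2 q19]]]; split.
  + apply: (ctx_frame C1 fr2) => // a ha; rewrite h1 ja //.
    by move: ha PM PY PO PU PT; clear; lia.
  + by split; rewrite ja ?p0 ?p1 ?p3 //; move: PM PY PO PU PT PD PZ; clear; lia.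
  + rewrite q19 -d2 det_orthogonal; last by move=> a b; exact: o2.
    by apply: eq_bigl => a; rewrite ltn_ord.
Qed.

Definition rows_prod : R :=
  (\prod_(i < n) (2 * (rdot B i i + n%:R + 1)))%R.

Lemma ROWS_spec s : ctx s -> rv s 24 = n%:R%R ->
  reach oracle ROWS s (n * (9 * n + 14) + 5) (fun s' => rv s' 18 = rows_prod).
Proof.
move=> C e24.
have -> : n * (9 * n + 14) + 5 = 3 + (n * ((9 * n + 6) + 6 + 2) + 2) by clear; lia.
apply: reach_opsF => // s1 E1 fr1.
have C1 : ctx s1 by apply: (ctx_frame C fr1) => // k hk; rewrite (frH fr1).
have [i40 i42 r18] : [/\ iv s1 40 = 0, iv s1 42 = 4 & rv s1 18 = 1%R].
  rewrite E1; move: (ctx_B C) (ctx_0 C) (ctx_r1 C); case: (s) => i' t rr h /= q1 q2 q3.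
  by rewrite /upd /= q1 q2 q3.
pose I k s' := iv s' 42 = 4 + k * n /\
  rv s' 18 = (\prod_(i < n | (i < k)%N) (2 * (rdot B i i + n%:R + 1)))%R.
apply: (reach_forP (I := I) (N := n) (tm := 9 * n + 6 + 6)) => //.
- by rewrite /I r18 i42 big1.
- exact: (ctx_n C1).
- move=> k s2 fr2 [j42 j18] e40 kn.
  have C2 : ctx s2 by apply: (ctx_frame C1 fr2) => // a ha; rewrite (frH fr2).
  pose i := Ordinal kn.
  apply: reach_seq.
    apply: (DOT_spec oracle (r := 22) (p := 42) (q := 42)) => //;
     rewrite ?(ctx_n C2) ?(ctx_1 C2) ?j42 //; exact: (vreg_B i).
  move=> s3 fr3; rewrite j42 (ctx_hB C2 i) => e22.
  have C3 : ctx s3 by apply: (ctx_frame C2 fr3) => // a ha; rewrite (frH fr3).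
  have e22' : rv s3 22 = rdot B i i.
    by rewrite e22; apply: eq_bigr => l _; rewrite !mxE.
  have e24' : rv s3 24 = n%:R%R by rewrite (frR fr3) // (frR fr2) // (frR fr1).
  have f18 : rv s3 18 = rv s2 18 by rewrite (frR fr3).
  have f42 : iv s3 42 = 4 + k * n by rewrite (frI fr3).
  have f40 : iv s3 40 = k by rewrite (frI fr3).
  rewrite j18 in f18.
  apply: reach_blk => //; set s6 := den_ops _ _ _.
  have [q1 q2 q3] : [/\ iv s6 42 = 4 + k.+1 * n, iv s6 40 = k.+1 &
     rv s6 18 = (rv s3 18 * (2 * (rdot B i i + n%:R + 1)))%R].
    rewrite /s6; move: e22' e24' f42 f40 (ctx_n C3) (ctx_1 C3) (ctx_r1 C3).
    case: (s3) => i' t rr h /= w1 w2 w3 w4 w5 w6 w7.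
    rewrite /upd /= w1 w2 w3 w4 w5 w6 w7 mulSn; split; [by clear; lia|by clear; lia|ring].
  split => //; split => //.
  rewrite q3 f18 [RHS](bigD1 i) //= mulrC; congr (_ * _)%R.
  by apply: eq_bigl => a; rewrite -val_eqE /= ltnS ltn_neqAle andbC.
- by move=> s2 fr2 [_ ->]; apply: eq_bigl => a; rewrite ltn_ord.
Qed.

Definition precision : R := if mo then (par / 8)%R else (1 / (16 * par))%R.

(** Each summand secures one property of g. The first bounds the coefficients of lattice vectors in
    C by Cramer's rule; the second puts the image of the cube of radius 1 / g into C and puts -C, x
    and -x into g C; the third gives 1 / e <= g; the last gives Q >= 3. All summands are
    nonnegative, so each is at most g. *)
Definition size_bound : R :=
  (`|Rad| * rows_prod * (1 / (\det B) ^+ 2 + 1)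
   + (rows_prod + `|Rad| + 1 + \sum_j x 0 j * x 0 j) / r + 1 / precision + 8)%R.

Lemma BOUND_spec s N : ctx s -> params s -> rv s 18 = rows_prod ->
  rv s 19 = ((\det B) ^+ 2)%R -> (size_bound <= 2 ^+ N)%R ->
  reach oracle (BOUND mo) s (9 * n + N * 4 + 40) (fun s' =>
    exists Q, [/\ Q <= N, (size_bound <= 2 ^+ Q)%R, iv s' 15 = Q,
      rv s' 17 = (2 ^+ Q)%R & rv s' 9 = precision]).
Proof.
move=> C [p0 p1 p3] e18 e19 lN.
have [PZ PD PT PU [PO PY PM PF]] := layoutE n.
apply: (reach_le (tm' := (9 * n + 6) + (5 + ((1 + 2) + (size (EPS mo) +
  (4 + (5 + (6 + (N * (2 + 2) + 2)))))))));
  last first.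
  have : size (EPS mo) <= 3 by rewrite /EPS; case: (mo).
  by clear; lia.
apply: reach_seq.
  apply: (DOT_spec oracle (r := 25) (p := 5) (q := 5)) => //;
   rewrite ?(ctx_n C) ?(ctx_1 C) ?(ctx_X C) //; rewrite /vreg /inlen; clear; lia.
move=> s1 fr1; rewrite (ctx_X C) (ctx_hX C) => e25.
have C1 : ctx s1 by apply: (ctx_frame C fr1) => // k hk; rewrite (frH fr1).
have [f18 f19 fh] : [/\ rv s1 18 = rows_prod, rv s1 19 = ((\det B) ^+ 2)%R & hp s1 = hp s].
  by rewrite !(frR fr1) // (frH fr1).
have g1 := ctx_1 C1.
apply: reach_opsF.
  case: (s1) g1 => i t rr h /= g1; rewrite /upd /= g1 /heap_addr /inlen.
  by do !split => //; clear -n_gt0; lia.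
move=> s2 E2 fr2.
have C2 : ctx s2 by apply: (ctx_frame C1 fr2) => // k hk; rewrite (frH fr2).
have [r3 r4 r5] : [/\ rv s2 3 = r, rv s2 4 = Rad & rv s2 5 = par].
  rewrite E2; move: fh g1; case: (s1) => i t rr h /= fh g1'.
  by rewrite /upd /= g1' fh.
have R2 j : j \in [:: 18; 19; 25] -> rv s2 j = rv s1 j.
  by move=> jj; rewrite (frR fr2) //; move: jj; mem_cases.
apply: (reach_seq (Q1 := fun s' => rv s' 4 = `|Rad|%R /\ forall j, j != 4 -> rv s' j = rv s2 j)).
  apply: reach_if => /=; rewrite r4 (ctx_r0 C2).
    move=> neg; apply: reach_blk => //=; move: r4 (ctx_r0 C2).
    case: (s2) => i t rr h /= w1 w2; rewrite /upd /= w1 w2 sub0r ltr0_norm //.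
    by split => // j /negPf ->.
  rewrite -leNgt => pos; apply: (reach_le (tm' := 0)) => //; apply: reach_blk => //=.
  by rewrite r4 ger0_norm.
move=> s3 fr3 [t4 t].
have C3 : ctx s3 by apply: (ctx_frame C2 fr3) => // k hk; rewrite (frH fr3).
apply: reach_opsF.
  by rewrite /EPS; case: (mo); case: (s3).
move=> s4 E4 fr4.
have C4 : ctx s4.
  apply: (ctx_frame C3 fr4); try by rewrite /EPS; case: (mo).
  by move=> k hk; rewrite (frH fr4) // /EPS; case: (mo).
have r9 : rv s4 9 = precision.
  have t5 : rv s3 5 = par by rewrite t.
  rewrite E4 /EPS /precision; move: t5 (ctx_r1 C3); case: (mo).
    by case: (s3) => i t' rr h /= w1 w2; rewrite /upd /= w1.
  by case: (s3) => i t' rr h /= w1 w2; rewrite /upd /= w1 w2.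
have R4 j : j \in [:: 3; 4; 18; 19; 25] -> rv s4 j = rv s3 j.
  by move=> jj; rewrite (frR fr4) //; move: jj; rewrite /EPS; case: (mo); mem_cases.
have v3 : rv s4 3 = r by rewrite R4 // t.
have v4 : rv s4 4 = `|Rad|%R by rewrite R4.
have v18 : rv s4 18 = rows_prod by rewrite R4 // t // R2.
have v19 : rv s4 19 = ((\det B) ^+ 2)%R by rewrite R4 // t // R2.
have v25 : rv s4 25 = (\sum_j x 0 j * x 0 j)%R by rewrite R4 // t // R2.
apply: reach_opsF; first by case: (s4).
move=> sa Ea fra.
have Ca : ctx sa by apply: (ctx_frame C4 fra) => // k hk; rewrite (frH fra).
have a28 : rv sa 28 = (`|Rad| * rows_prod * (1 / (\det B) ^+ 2 + 1))%R.
  rewrite Ea; move: v4 v18 v19 (ctx_r1 C4); case: (s4) => i t' rr h /= v4' v18' v19' v1.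
  by rewrite /upd /= v4' v18' v19' v1.
have Ra j : j \in [:: 3; 4; 9; 18; 25] -> rv sa j = rv s4 j.
  by move=> jj; rewrite (frR fra) //; move: jj; mem_cases.
apply: reach_opsF; first by case: (sa).
move=> sb Eb frb.
have Cb : ctx sb by apply: (ctx_frame Ca frb) => // k hk; rewrite (frH frb).
have b28 : rv sb 28 = (`|Rad| * rows_prod * (1 / (\det B) ^+ 2 + 1)
   + (rows_prod + `|Rad| + 1 + \sum_j x 0 j * x 0 j) / r)%R.
  have [w3 w4 w18 w25] : [/\ rv sa 3 = r, rv sa 4 = `|Rad|%R, rv sa 18 = rows_prod &
     rv sa 25 = (\sum_j x 0 j * x 0 j)%R] by rewrite !Ra.
  rewrite Eb; move: a28 w3 w4 w18 w25 (ctx_r1 Ca).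
  case: (sa) => i t' rr h /= w28 w3 w4 w18 w25 w1.
  by rewrite /upd /= w28 w3 w4 w18 w25 w1.
have b9 : rv sb 9 = precision by rewrite (frR frb) // Ra.
apply: reach_opsF; first by case: (sb).
move=> s5 E5 fr5.
have C5 : ctx s5 by apply: (ctx_frame Cb fr5) => // k hk; rewrite (frH fr5).
have [u28 u17 u15 u9] : [/\ rv s5 28 = size_bound, rv s5 17 = 1%R, iv s5 15 = 0 &
    rv s5 9 = precision].
  rewrite E5; move: b28 b9 (ctx_r1 Cb); case: (sb) => i t' rr h /= w28 w9 w1.
  by rewrite /upd /= w28 w9 w1 /size_bound.
pose I k s' := [/\ rv s' 17 = (2 ^+ k)%R, iv s' 15 = k & k <= N].
have lt_N k : (2 ^+ k < size_bound)%R -> k < N.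
  by move=> lk; have := lt_le_trans lk lN; rewrite ltr_eXn2l // ltr1n.
have H := @reach_while R n oracle (CR 17 28) (Blk [:: RA 17 17 17; IA 15 15 1]) s5 I N 2.
apply: (reach_post (H _ _ _)).
- by rewrite /I u17 u15.
- by move=> k s6 fr6 [w17 w15 _] /=; rewrite w17 (frR fr6) // u28; exact: lt_N.
- move=> k s6 fr6 [w17 w15 _] /=; rewrite w17 (frR fr6) // u28 => /lt_N kN.
  apply: reach_blk => //.
  have C6 : ctx s6 by apply: (ctx_frame C5 fr6) => // a ha; rewrite (frH fr6).
  move: w17 w15 (ctx_1 C6); case: (s6) => i t' rr h /= a1 a2 a3.
  by rewrite /I /= /upd /= a1 a2 a3 addn1 exprS; split => //; ring.
- move=> s6 fr6 [k [w17 w15 kN]] /=; rewrite w17 (frR fr6) // u28 -leNgt => le.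
  by exists k; split => //; rewrite (frR fr6).
Qed.

End main.

Local Open Scope ring_scope.

(** * The whole program and its running time *)

Local Open Scope nat_scope.

Section total.
Context {R : realType} {n : nat}.
Hypothesis n_gt0 : 0 < n.
Variables (oracle : 'rV[R]_n -> R) (mo : bool).
Variables (B : 'M[R]_n) (x : 'rV[R]_n).
Variables (r Rad gamma par : R).
Hypothesis B_unit : B \in unitmx.

Definition tMAIN (N ML MS : nat) :=
  (12 * n + 31) + ((n * (12 * n + 12) + 6) +
  ((n * (n * (21 * n + 17) + 9 * n + 13) + 4) + ((n * (9 * n + 14) + 5) +
  ((9 * n + N * 4 + 40) + (@tINITL n N ML + (@tSTEPS n N ML +
  (@tFINAL n N MS ML + @tOUTPUT n))))))).

Lemma tINITL_mono Q N ML : Q <= N -> @tINITL n Q ML <= @tINITL n N ML.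
Proof. by move=> QN; rewrite /tINITL leq_add2r leq_mul2r leq_mul2l QN !orbT. Qed.

Lemma tSTEPS_mono Q N ML : Q <= N -> @tSTEPS n Q ML <= @tSTEPS n N ML.
Proof.
move=> QN; rewrite /tSTEPS leq_add2r leq_mul ?leq_mul2l ?QN //.
by rewrite leq_add2r /tSTEP leq_add2r leq_mul2r leq_mul2l QN !orbT.
Qed.

Lemma tFINAL_mono Q N MS ML : Q <= N -> @tFINAL n Q MS ML <= @tFINAL n N MS ML.
Proof.
move=> QN; rewrite /tFINAL !leq_add2r leq_mul //.
  by rewrite leq_add2r leq_mul2l QN.
rewrite leq_add2r /tROUND leq_add2r leq_add //.
  by rewrite leq_add2l leq_mul2r leq_mul2l QN !orbT.
by rewrite leq_mul2l leq_add2r /tUPD !leq_add2r leq_add2l /tBIS leq_add2r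
  leq_mul2r QN !orbT.
Qed.

(** The exponent Q is found at run time and only Q <= N is known beforehand; so the list bounds and
    the quality of the result are assumed for every admissible Q, and the time is stated with N. *)
Lemma MAIN_spec N ML MS (good : 'rV[R]_n -> Prop) :
  (size_bound mo B x r Rad par <= 2 ^+ N)%R ->
  (forall Q, Q <= N -> (size_bound mo B x r Rad par <= 2 ^+ Q)%R ->
    let g := (2 ^+ Q)%R : R in let e := precision mo par in
    [/\ 0 < Q,
     forall k t, k < 12 * Q -> t <= n ->
       size (grid_list oracle mo B x (hscale g 0) (lscale g 0 k) t) <= ML,
     forall m k, m <= 2 * Q -> size (lists oracle mo B x g m k) <= ML,
     forall k, k <= 4 * Q -> kstop g e Q (dist_guess g k) < 8 * Q /\
       forall j, j <= kstop g e Q (dist_guess g k) ->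
         size (slist oracle mo B x g Q (dist_guess g k) j) <= MS &
     good ((result oracle mo B x g e Q).2 *m B)%R]) ->
  forall s0 : @st R, iv s0 0 = n -> iv s0 1 = 1 -> iv s0 3 = inlen n ->
  (forall a, @heap_addr n a -> hp s0 a = nth 0%R (cvp_input r Rad gamma par B x) a) ->
  exists s' t, [/\ ev oracle (MAIN mo) s0 s' t, t <= tMAIN N ML MS &
                   good (read_vec (hp s') 0)].
Proof.
move=> lN H s0 e0 e1 e3 hh.
suff [s' t e lt g] : reach oracle (MAIN mo) s0 (tMAIN N ML MS)
    (fun s' => good (read_vec (hp s') 0)) by exists s', t.
rewrite /tMAIN.
apply: reach_seq; first exact: (SETUP_spec oracle e0 e1 e3 hh).
move=> s1 fr1 [C1 i13 pp1].
apply: reach_seq; first exact: (COPY_spec oracle C1 i13 pp1).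
move=> s2 fr2 [C2 pp2 r24 mB].
have j13 : iv s2 13 = free0 n by rewrite (frI fr2).
apply: reach_seq; first exact: (MGS_spec n_gt0 oracle B_unit C2 j13 pp2 mB).
move=> s3 fr3 [C3 pp3 r19].
apply: reach_seq.
  by apply: (ROWS_spec oracle C3); rewrite (frR fr3).
move=> s4 fr4 r18.
have C4 : ctx B x s4 by apply: (ctx_frame C3 fr4) => // k hk; rewrite (frH fr4).
have pp4 : params r Rad par s4 by case: pp3 => a b c; split; rewrite (frH fr4).
apply: reach_seq.
  apply: (BOUND_spec oracle (mo := mo) C4 pp4 r18 _ lN).
  by rewrite (frR fr4).
move=> s5 fr5 [Q [QN lQ i15 r17 r9]].
have [Q0 gl ll kk gd] := H Q QN lQ.
set g := (2 ^+ Q)%R in r17 gl ll kk gd; set e := precision mo par in r9 kk gd.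
have C5 : ctx B x s5.
  apply: (ctx_frame C4 fr5); try by rewrite /BOUND /EPS; case: (mo).
  by move=> k hk; rewrite (frH fr5) // /BOUND /EPS; case: (mo).
have k13 : iv s5 13 = free0 n.
  rewrite (frI fr5) ?(frI fr4) ?(frI fr3) //.
  by rewrite /BOUND /EPS; case: (mo).
apply: reach_seq.
  apply: (reach_le (tm' := @tINITL n Q ML)); last exact: tINITL_mono.
  by apply: (INITL_spec n_gt0 (g := g) C5) => //; rewrite k13.
move=> s6 fr6 [T6 f6 i31 [r5 r19'] h6].
have C6 : ctx B x s6 by apply: (ctx_frame C5 fr6).
apply: reach_seq.
  apply: (reach_le (tm' := @tSTEPS n Q ML)); last exact: tSTEPS_mono.
  by apply: (STEPS_spec n_gt0 (g := g) C6) => //; rewrite (frI fr6).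
move=> s7 fr7 [T7 i31' f7 [r5' i42] h7].
have C7 : ctx B x s7 by apply: (ctx_frame C6 fr7).
apply: reach_seq.
  apply: (reach_le (tm' := @tFINAL n Q MS ML)); last exact: tFINAL_mono.
  apply: (FINAL_spec n_gt0 (g := g) (eps := e) C7) => //.
  - by rewrite (frI fr7) // (frI fr6).
  - by rewrite (frR fr7) // (frR fr6).
  - by rewrite (frR fr7) // (frR fr6).
  - by move=> k hk; have [] := kk k hk.
  - by move=> k; apply: ll.
  - by move=> k j hk; have [_] := kk k hk; apply.
move=> s8 fr8 [C8 hO].
apply: reach_post; first exact: (OUTPUT_spec oracle C8).
by move=> s9 fr9; rewrite hO => ->.
Qed.

End total.

Lemma tCOMB_le n nX nY M : 0 < n -> 0 < nX -> 0 < nY -> 0 < M ->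
  @tCOMB n nX nY M <= 396 * (n * n * (nX * nY * M)).
Proof.
move=> n0 X0 Y0 M0.
have n1 : n <= n * n by rewrite leq_pmulr.
have n2 : 0 < n * n by rewrite muln_gt0 n0.
have hN : @tNEAR n <= 131 * (n * n) by rewrite /tNEAR /tAMB /tTST; lia.
have hF : @tFIL n <= 220 * (n * n).
  by rewrite /tFIL /tFILC /tNEAR /tAMB /tTST; lia.
have hM : n * n <= n * n * M by rewrite leq_pmulr.
have hS : M * (@tNEAR n + 6) <= 137 * (n * n * M).
  have h : @tNEAR n + 6 <= 137 * (n * n) by lia.
  apply: leq_trans (leq_mul (leqnn M) h) _; apply: eq_leq; lia.
have hI : @tINS n M + 3 <= 387 * (n * n * M) by rewrite /tINS /tSCAN; lia.
have h1 : nY * (@tINS n M + 3) <= 387 * (n * n * (nY * M)).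
  apply: leq_trans (leq_mul (leqnn nY) hI) _; apply: eq_leq; lia.
have p1 : 0 < n * n * (nY * M) by rewrite !muln_gt0 n0 Y0 M0.
have h2 : nX * (nY * (@tINS n M + 3) + 6) <= 393 * (n * n * (nX * nY * M)).
  have h3 : nY * (@tINS n M + 3) + 6 <= 393 * (n * n * (nY * M)) by lia.
  apply: leq_trans (leq_mul (leqnn nX) h3) _; apply: eq_leq; lia.
have p2 : 0 < n * n * (nX * nY * M) by rewrite !muln_gt0 n0 X0 Y0 M0.
by rewrite /tCOMB; lia.
Qed.

(** N * N accounts for the passes over scales and radii and for those over guesses and refinements.
    One combination of covering lists costs up to ML^3, one refinement MS * ML * MS, and a single
    test n^2; the third factor n comes from the grids and the elimination. *)
Lemma tMAIN_le n N ML MS : 0 < n -> 0 < N -> 0 < ML -> 0 < MS ->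
  @tMAIN n N ML MS <= (100 * 1000) * (N * N * (n * n * n) * (ML * ML * ML * (MS * MS))).
Proof.
move=> n0 N0 L0 S0.
(* Naming the nonlinear products leaves goals that [lia] can treat as linear. *)
have [n3 En3] : exists k, k = n * n * n by exists (n * n * n).
have [K EK] : exists k, k = ML * ML * ML * (MS * MS) by eexists.
rewrite -En3 -EK.
have nn : n <= n3 /\ n * n <= n3.
  rewrite En3 -mulnA; split; first by rewrite leq_pmulr // muln_gt0 n0.
  by rewrite leq_mul2l leq_pmulr ?orbT.
have K1 : [/\ 0 < K, ML * 9 * ML <= 9 * K, ML * ML * ML <= K & MS * ML * MS <= K].
  have S2 : 0 < MS * MS by rewrite muln_gt0 S0.
  have L2 : 0 < ML * ML by rewrite muln_gt0 L0.
  have L3 : 0 < ML * ML * ML by rewrite muln_gt0 L2.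
  split.
  - by rewrite EK muln_gt0 L3.
  - have : ML * ML <= K by rewrite EK -mulnA leq_pmulr // muln_gt0 L0.
    by lia.
  - by rewrite EK leq_pmulr.
  - have : ML * (MS * MS) <= K by rewrite EK -mulnA leq_pmull.
    by lia.
have [K0 c9 c3 cS] := K1.
have [E EE0] : exists k, k = N * N * n3 * K by eexists.
rewrite -EE0.
have n30 : 0 < n3 by rewrite En3 !muln_gt0 n0.
have N2 : N <= N * N by rewrite leq_pmulr.
have NN0 : 0 < N * N by rewrite muln_gt0 N0.
have nK : n3 <= n3 * K by rewrite leq_pmulr.
have n3K0 : 0 < n3 * K by rewrite muln_gt0 n30.
have EE : n3 * K <= E by rewrite EE0 -mulnA leq_pmull.
have NE : N * (n3 * K) <= E by rewrite EE0 -mulnA leq_mul2r N2 orbT.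
have n2K : n * n * K <= n3 * K by rewrite leq_mul2r (proj2 nn) orbT.
have tG : @tGRID n ML + 7 <= 3833 * (n3 * K).
  have h := tCOMB_le n0 L0 (isT : 0 < 9) L0.
  have h' : @tCOMB n ML 9 ML <= 3564 * (n * n * K).
    by have := leq_mul (leqnn (n * n)) c9; lia.
  have h2 : n * (@tYLIST n + 2 + @tCOMB n ML 9 ML + 5) <= 3793 * (n3 * K).
    have h3 : @tYLIST n + 2 + @tCOMB n ML 9 ML + 5 <= 3793 * (n * n * K).
      have : n <= n * n * K.
        by apply: leq_trans (leq_pmulr _ K0) _; rewrite leq_mul2r leq_pmulr ?orbT.
      by rewrite /tYLIST; lia.
    apply: leq_trans (leq_mul (leqnn n) h3) _; apply: eq_leq; rewrite En3; lia.
  by rewrite /tGRID /tZLIST; have [a b] := nn; lia.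
have hI : @tINITL n N ML <= (12 * 3835) * E.
  have h : 12 * N * (@tGRID n ML + 7) <= 12 * 3833 * (N * (n3 * K)).
    apply: leq_trans (leq_mul (leqnn (12 * N)) tG) _; apply: eq_leq; lia.
  have E0 : 0 < E by apply: leq_trans n3K0 EE.
  by rewrite /tINITL; move: h NE E0; clear; lia.
have hS : @tSTEPS n N ML <= (101 * 100) * E.
  have h1 : @tSLOT n ML + 2 <= 416 * (n3 * K).
    have h := tCOMB_le n0 L0 L0 L0.
    have h' : @tCOMB n ML ML ML <= 396 * (n * n * K).
      by have := leq_mul (leqnn (n * n)) c3; lia.
    by rewrite /tSLOT; lia.
  have h2 : @tSTEP n N ML + 3 <= (5 * 1001) * (N * (n3 * K)).
    have h : 12 * N * (@tSLOT n ML + 2) <= 12 * 416 * (N * (n3 * K)).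
      apply: leq_trans (leq_mul (leqnn (12 * N)) h1) _; apply: eq_leq; lia.
    have : 0 < N * (n3 * K) by rewrite muln_gt0 N0.
    by rewrite /tSTEP; lia.
  have h3 : 2 * N * (@tSTEP n N ML + 3) <= (2 * 5 * 1001) * E.
    apply: leq_trans (leq_mul (leqnn (2 * N)) h2) _; apply: eq_leq; rewrite EE0; lia.
  by rewrite /tSTEPS; lia.
have hF : @tFINAL n N MS ML <= (173 * 100) * E.
  have h1 : @tREF n MS ML + 2 <= 409 * (n3 * K).
    have h := tCOMB_le n0 S0 L0 S0.
    have h' : @tCOMB n MS ML MS <= 396 * (n * n * K).
      by have := leq_mul (leqnn (n * n)) cS; lia.
    by rewrite /tREF; lia.
  have h2 : @tUPD n N + 3 <= 129 * (N * n3).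
    have a1 : N * n <= N * n3 by rewrite leq_mul2l (proj1 nn) orbT.
    have a2 : n3 <= N * n3 by rewrite leq_pmull.
    rewrite /tUPD /tBIS /tTST /tAMB; have [a b] := nn.
    have -> : N * (12 * n + 11 + 10) = 12 * (N * n) + 21 * N by lia.
    have : N <= N * n by rewrite leq_pmulr.
    by lia.
  have SK : MS <= K.
    by rewrite EK mulnA leq_pmull // !muln_gt0 L0 S0.
  have h3 : MS * (@tUPD n N + 3) <= 129 * (N * (n3 * K)).
    apply: leq_trans (leq_mul SK h2) _; apply: eq_leq; lia.
  have h4 : 8 * N * (@tREF n MS ML + 2) <= 8 * 409 * (N * (n3 * K)).
    apply: leq_trans (leq_mul (leqnn (8 * N)) h1) _; apply: eq_leq; lia.
  have p1 : n3 * K <= N * (n3 * K) by rewrite leq_pmull.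
  have h5 : @tROUND n N MS ML + 2 <= 3435 * (N * (n3 * K)).
    by rewrite /tROUND /tZLIST; have [a b] := nn; lia.
  have h6 : (4 * N + 1) * (@tROUND n N MS ML + 2) <= 5 * 3435 * E.
    have h7 : 4 * N + 1 <= 5 * N by lia.
    apply: leq_trans (leq_mul h7 h5) _; apply: eq_leq; rewrite EE0; lia.
  by rewrite /tFINAL; have [a b] := nn; lia.
have NE' : N <= E by apply: leq_trans NE; rewrite leq_pmulr.
have hM : n * (n * (21 * n + 17) + 9 * n + 13) = 21 * n3 + 26 * (n * n) + 13 * n.
  by rewrite En3; lia.
by rewrite /tMAIN hM /tOUTPUT /tAMB; have [a b] := nn; lia.
Qed.

Local Open Scope ring_scope.

(** * Packing bound *)

Section counting.
Context {R : realType}.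

(** Continuity at 0 of the product as a function of d; it gives the room for enlarging a box of a
    cover. *)
Lemma prod_widen n (f : 'I_n -> R) (e : R) : 0 < e ->
  exists2 d : R, 0 < d & \prod_i (f i + d) <= \prod_i f i + e.
Proof.
move=> e0.
have mulc : continuous (fun z : R * R => z.1 * z.2) by exact: mul_continuous.
have h : (fun t : R => \prod_i (f i + t)) @ (0 : R) --> \prod_i (f i + 0 : R).
  apply: (cvg_big mulc) => i _.
  by apply: cvgD; [exact: cvg_cst|exact: cvg_id].
move/cvgrPdist_le : h => /(_ _ e0); move=> /nbhs_ballP[d /= d0] /(_ (d / 2)) H.
exists (d / 2); first by rewrite divr_gt0.
have := H _; rewrite -ball_normE /= sub0r normrN gtr0_norm ?divr_gt0 // => /(_ _).
have -> : \prod_i (f i + 0) = \prod_i f i by apply: eq_bigr => i _; rewrite addr0.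
move=> /(_ ltac:(lra)); rewrite ler_norml; lra.
Qed.

(** Along axis i the grid takes at most (g i - f i) / eta + 1 values. After a shift by the least
    admissible coordinate, the points of [s] embed into a product of finite ordinals. *)
Lemma box_count n (f g : 'I_n -> R) (eta : R) (s : seq 'rV[int]_n) :
  0 < eta -> uniq s -> (forall i, f i <= g i) ->
  (forall u, u \in s -> forall i, f i <= eta * (u 0 i)%:~R <= g i) ->
  (size s)%:R * eta ^+ n <= \prod_i (g i - f i + eta).
Proof.
move=> e0 us fg hs.
pose m i := (Num.truncn ((g i - f i) / eta)).+1.
pose c i := Num.ceil (f i / eta).
have hm u i : u \in s -> 0 <= u 0 i - c i /\ (absz (u 0 i - c i)%R < m i)%N.
  move=> us'; have /andP[h1 h2] := hs u us' i.
  have h3 : 0 <= u 0 i - c i.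
    by rewrite subr_ge0 ceil_le_int ler_pdivrMr // mulrC.
  split => //; rewrite ltnS truncn_ge_nat; last first.
    by rewrite divr_ge0 ?subr_ge0 // ltW.
  have -> : (absz (u 0 i - c i)%R)%:R = (u 0 i - c i)%:~R :> R.
    by rewrite natr_absz ger0_norm.
  rewrite intrB ler_pdivlMr //.
  have := ceil_ge (f i / eta); rewrite -/(c i) ler_pdivrMr // => h4.
  by rewrite mulrBl [_ * eta]mulrC; lra.
(* The default [ord0] is never reached for points of [s], by [hm]. *)
pose phi (u : 'rV[int]_n) : {dffun forall i : 'I_n, 'I_(m i)} :=
  [ffun i => insubd ord0 (absz (u 0 i - c i)%R)].
have phiE u i : u \in s -> val (phi u i) = absz (u 0 i - c i)%R.
  by move=> us'; rewrite ffunE val_insubd; have [_ ->] := hm u i us'.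
have inj : {in s &, injective phi}.
  move=> u v us' vs' E; apply/rowP => i.
  have := phiE u i us'; rewrite E phiE //.
  have [a _] := hm u i us'; have [b _] := hm v i vs'; move: a b.
  by move: (fun_of_matrix u 0 i) (fun_of_matrix v 0 i) (c i) => p q r; lia.
have up : uniq (map phi s) by rewrite map_inj_in_uniq.
have sz : (size s <= \prod_i m i)%N.
  rewrite -(size_map phi) -(card_uniqP up); apply: leq_trans (max_card _) _.
  rewrite card_dep_ffun foldrE big_map /index_enum -enumT.
  by under eq_bigr do rewrite card_ord; rewrite big_enum.
have -> : eta ^+ n = \prod_(i < n) eta by rewrite prodr_const card_ord.
apply: le_trans (_ : (\prod_i m i)%:R * \prod_(i < n) eta <= _).
  by rewrite ler_wpM2r ?ler_nat //; apply: prodr_ge0 => i _; exact: ltW.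
rewrite natr_prod -big_split /=; apply: ler_prod => i _.
apply/andP; split; first by rewrite mulr_ge0 // ltW.
rewrite /m -natr1 mulrDl mul1r lerD2r.
by rewrite -ler_pdivlMr // truncn_le // divr_ge0 ?subr_ge0 // ltW.
Qed.

Definition cube n (M : nat) : seq 'rV[int]_n :=
  [seq \row_i ((f i)%:Z - M%:Z) | f : {ffun 'I_n -> 'I_(M + M).+1}].

Lemma cube_uniq n M : uniq (cube n M).
Proof.
rewrite map_inj_uniq ?enum_uniq // => f g /rowP E.
by apply/ffunP => i; apply: val_inj; have := E i; rewrite !mxE => /addIr[].
Qed.

Lemma mem_cube n M (u : 'rV[int]_n) : (u \in cube n M) = [forall i, (absz (u 0%R i) <= M)%N].
Proof.
apply/mapP/forallP => [[f _ ->] i|H].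
  by rewrite mxE; case: (f i) => k /= hk; lia.
exists [ffun i => inord (absz (u 0 i + M%:Z)%R)]; first by rewrite mem_enum.
apply/rowP => i; have := H i; rewrite mxE ffunE.
by move: (fun_of_matrix u 0 i) => p hp; rewrite inordK; lia.
Qed.

Lemma size_cube n M : size (cube n M) = ((M + M).+1 ^ n)%N.
Proof. by rewrite size_map -cardE card_ffun !card_ord. Qed.

Lemma real_grid n (v : 'rV[R]_n) (eta : R) : 0 < eta ->
  exists u : 'rV[int]_n, forall i, 0 <= v 0 i - eta * (u 0 i)%:~R < eta.
Proof.
move=> e0; exists (\row_i Num.floor (v 0 i / eta)) => i; rewrite mxE.
have := floor_le (v 0 i / eta); have := floorD1_gt (v 0 i / eta).
rewrite ltr_pdivrMr // ler_pdivlMr // intrD mulrDl mul1r ![_%:~R * eta]mulrC => h1 h2.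
by apply/andP; split; lra.
Qed.

End counting.

Section volume.
Context {R : realType} {n : nat}.
Hypothesis n_gt0 : (0 < n)%N.
Implicit Types (C S : set 'rV[R]_n) (s : seq 'rV[int]_n).

Lemma vol_le_grid S (eta : R) s : 0 < eta ->
  (forall v, S v -> exists2 u, u \in s &
     forall i, 0 <= v 0 i - eta * (u 0 i)%:~R < eta) ->
  (vol S <= ((size s)%:R * eta ^+ n)%:E)%E.
Proof.
move=> e0 H.
(* A cover has to be an infinite sequence of boxes: beyond [size s] it continues with the single
   point 0, a box of volume 0 because n > 0. *)
pose a k : 'rV[R]_n := if (k < size s)%N then eta *: map_mx intr (nth 0 s k) else 0.
pose b k : 'rV[R]_n := if (k < size s)%N then a k + const_mx eta else 0.
apply: ereal_inf_lbound; exists a, b; split.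
- move=> k i; rewrite /b /a; case: ifP => _ //.
  by rewrite !mxE lerDl ltW.
- move=> v /H[u us hu]; exists (index u s) => //= i.
  rewrite /b /a index_mem us nth_index // !mxE.
  by have /andP[h1 h2] := hu i; apply/andP; split; lra.
- have prE k : \prod_i (b k 0 i - a k 0 i) = if (k < size s)%N then eta ^+ n else 0.
    rewrite /b /a; case: (k < size s)%N.
      rewrite -[n in RHS]card_ord -prodr_const; apply: eq_bigr => i _.
      by rewrite !mxE [_ + eta]addrC addrK.
    by rewrite (bigD1 (Ordinal n_gt0)) //= !mxE subr0 mul0r.
  rewrite (nneseries_split 0%N (size s)); last first.
    move=> k _; rewrite lee_fin prE; case: ifP => // _; exact: exprn_ge0 (ltW e0).
  rewrite add0n [X in (_ + X)%E]eseries0 ?adde0; last first.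
    by move=> k hk _; rewrite prE ltnNge hk.
  rewrite sumEFin; congr EFin; rewrite big_nat (eq_bigr (fun=> eta ^+ n)).
    by rewrite -big_nat sumr_const_nat subn0 mulr_natl.
  by move=> k /andP[_ hk]; rewrite prE hk.
Qed.

Lemma size_le_sum_count (T : eqType) (s : seq T) (p : nat -> pred T) K :
  (forall u, u \in s -> exists2 k, (k < K)%N & p k u) ->
  (size s <= \sum_(k < K) count (p k) s)%N.
Proof.
move=> H; rewrite -sum1_size.
under [leqRHS]eq_bigr do rewrite -sum1_count big_mkcond /=.
rewrite exchange_big /= !big_seq; apply: leq_sum => u /H[k kK pk].
by rewrite (bigD1 (Ordinal kK)) //= pk.
Qed.

Lemma open_box (a b : 'rV[R]_n) :
  open [set v : 'rV[R]_n | forall i, a 0 i < v 0 i < b 0 i].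
Proof.
rewrite openE => v /= hv.
exists (fun _ j => `]a 0 j, b 0 j[%classic : set R) => /=; last first.
  by move=> w /= hw i; have := hw 0 i; rewrite in_itv.
move=> k j; rewrite ord1; apply: open_nbhs_nbhs; split; first exact: interval_open.
by rewrite /= in_itv /= hv.
Qed.

(* Enlarging the boxes of a countable cover makes it open, hence finite by
   compactness, and leaves room for the boundary effect in counting. *)
Lemma grid_le_vol C (v : R) : compact C -> (vol C < v%:E)%E ->
  exists2 eta0 : R, 0 < eta0 & forall eta s, 0 < eta <= eta0 -> uniq s ->
    (forall u, u \in s -> C (eta *: map_mx intr u)) ->
    (size s)%:R * eta ^+ n <= v.
Proof.
move=> cC /ereal_inf_lt[_ [a [b [ab Cab ->]]]] lt_v.
pose F k := \prod_i (b k 0 i - a k 0 i).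
have F0 k : 0 <= F k by apply: prodr_ge0 => i _; rewrite subr_ge0.
(* The gap between v and the total volume of the boxes is divided geometrically among the boxes. *)
have [e e0 he] : exists2 e : R, 0 < e &
    (\sum_(0 <= k <oo) ((F k)%:E + (e / (2 ^ k.+1)%:R)%:E) <= v%:E)%E.
  have fin : (\sum_(0 <= k <oo) (F k)%:E)%E \is a fin_num.
    rewrite ge0_fin_numE; first exact: lt_trans lt_v (ltry _).
    by apply: nneseries_ge0 => k _ _; rewrite lee_fin.
  rewrite -(fineK fin) lte_fin in lt_v.
  exists (v - fine (\sum_(0 <= k <oo) (F k)%:E)%E); first by rewrite subr_gt0.
  apply: le_trans (epsilon_trick _ _ _) _ => //.
  - by rewrite subr_ge0 ltW.
  - by rewrite -[X in (X + _)%E](fineK fin) -EFinD lee_fin; lra.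
have hd k : exists d : R, 0 < d /\
    \prod_i (b k 0 i - a k 0 i + d) <= F k + e / (2 ^ k.+1)%:R.
  have [|d d0 hd] := @prod_widen R n (fun i => b k 0 i - a k 0 i) (e / (2 ^ k.+1)%:R).
    by rewrite divr_gt0 // ltr0n expn_gt0.
  by exists d.
have [d {}hd] := choice hd.
pose U k := [set w : 'rV[R]_n | forall i,
  (a k - const_mx (d k / 3)) 0 i < w 0 i < (b k + const_mx (d k / 3)) 0 i].
move: cC; rewrite compact_cover => /(_ _ setT U).
case=> [k _||D _ CD]; first exact: open_box.
  move=> w /Cab[k _ hk]; exists k => // i; rewrite !mxE.
  by have [d0 _] := hd k; have /andP[] := hk i; move=> ? ?; apply/andP; split; lra.
pose K := (\max_(k <- finmap.enum_fset D) k).+1.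
have DK k : k \in finmap.enum_fset D -> (k < K)%N.
  by move=> kD; rewrite ltnS /K (big_rem k) //= leq_maxl.
pose eta0 := (\big[Order.min/1]_(k < K) (d k / 3)).
exists eta0.
  apply: (big_ind (fun z : R => 0 < z)) => // [y z y0 z0|k _].
    by rewrite lt_min y0.
  by have [d0 _] := hd k; rewrite divr_gt0.
move=> eta s /andP[h0 h1] us sC.
pose p k (u : 'rV[int]_n) := `[< U k (eta *: map_mx intr u) >].
have sz : (size s <= \sum_(k < K) count (p k) s)%N.
  apply: size_le_sum_count => u /sC/CD[k kD kU].
  by exists k; [exact: DK|apply/asboolP].
have n0 : 0 <= eta ^+ n by exact: exprn_ge0 (ltW h0).
have cnt k : (k < K)%N -> (count (p k) s)%:R * eta ^+ n <= F k + e / (2 ^ k.+1)%:R.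
  move=> kK; have [d0 hk] := hd k; rewrite -size_filter.
  (* Box k gains d k / 3 at either end by the enlargement; the third share pays for the extra [eta]
     in [box_count]. *)
  have hm : eta <= d k / 3.
    by apply: le_trans h1 _; rewrite /eta0 (bigD1 (Ordinal kK)) //= ge_min lexx.
  apply: le_trans (box_count (f := fun i => a k 0 i - d k / 3)
    (g := fun i => b k 0 i + d k / 3) h0 _ _ _) _.
  - exact: filter_uniq.
  - by move=> i; have := ab k i; lra.
  - move=> u; rewrite mem_filter => /andP[/asboolP hu _] i.
    by have /andP[] := hu i; rewrite !mxE => ? ?; apply/andP; split; lra.
  - apply: le_trans hk; apply: ler_prod => i _.
    by have := ab k i; move=> ?; apply/andP; split; lra.
apply: le_trans (_ : \sum_(k < K) ((count (p k) s)%:R * eta ^+ n) <= _).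
  by rewrite -mulr_suml -natr_sum ler_wpM2r // ler_nat.
apply: le_trans (_ : \sum_(k < K) (F k + e / (2 ^ k.+1)%:R) <= _).
  by apply: ler_sum => k _; exact: cnt.
rewrite -lee_fin; apply: le_trans he; rewrite -sumEFin -(big_mkord xpredT
  (fun k => (F k + e / (2 ^ k.+1)%:R)%:E)).
apply: (nneseries_lim_ge (u_ := fun k => ((F k)%:E + (e / (2 ^ k.+1)%:R)%:E)%E) K).
move=> k _ _; rewrite -EFinD lee_fin addr_ge0 // divr_ge0 // ?ler0n // ltW //.
Qed.

End volume.

(** * Dilates of convex sets *)

Section dilation.
Context {R : realType} {n : nat}.
Implicit Types (C : set 'rV[R]_n) (u v : 'rV[R]_n) (s t : R).

(** The dilate s C as a preimage, which is what an oracle query at v / s decides. The reading as a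
    dilate is valid for s != 0; most facts below assume s > 0. *)
Definition dil C s : set 'rV[R]_n := [set v | C (s^-1 *: v)].

Definition cvx C : Prop :=
  forall u v t, 0 <= t <= 1 -> C u -> C v -> C (t *: u + (1 - t) *: v).

Lemma convex_set_cvx C : convex_set C -> cvx C.
Proof.
move=> /convex_setW cC u v t /andP[t0 t1] Cu Cv.
move: t0; rewrite le_eqVlt => /orP[/eqP <-|t0].
  by rewrite scale0r add0r subr0 scale1r.
move: t1; rewrite le_eqVlt => /orP[/eqP ->|t1].
  by rewrite scale1r subrr scale0r addr0.
have := cC u v (mem_set Cu) (mem_set Cv) (Itv01 (ltW t0) (ltW t1)) t0 t1.
by rewrite inE.
Qed.

Lemma dil1 C : dil C 1 = C.
Proof. by apply/seteqP; split=> v; rewrite /dil /= invr1 scale1r. Qed.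

Lemma dil0 C s : C 0 -> dil C s 0.
Proof. by rewrite /dil /= scaler0. Qed.

Lemma dilZ C s t v : t != 0 -> dil C (t * s) (t *: v) = dil C s v.
Proof. by move=> t0; rewrite /dil /= scalerA invfM mulrAC mulVf // mul1r. Qed.

(** The inclusion of s C + t C in (s + t) C, from the convex combination with weight s / (s + t). *)
Lemma dil_add C s t u v : cvx C -> 0 < s -> 0 < t ->
  dil C s u -> dil C t v -> dil C (s + t) (u + v).
Proof.
move=> cC s0 t0 Cu Cv; have st0 : 0 < s + t by rewrite addr_gt0.
have := cC _ _ (s / (s + t)) _ Cu Cv; rewrite /dil /= !scalerA => H.
have -> : (s + t)^-1 *: (u + v) =
  (s / (s + t) / s) *: u + ((1 - s / (s + t)) / t) *: v.
  rewrite scalerDr; congr (_ *: _ + _ *: _); field; first by lra.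
  by apply/andP; split; lra.
apply: H; apply/andP; split; first by rewrite divr_ge0 // ltW.
by rewrite ler_pdivrMr // mul1r lerDl ltW.
Qed.

Lemma dil_le C s t v : cvx C -> C 0 -> 0 < s -> s <= t -> dil C s v -> dil C t v.
Proof.
move=> cC C0 s0 st Cv; have t0 : 0 < t by lra.
move: st; rewrite le_eqVlt => /orP[/eqP <- //|st].
have ts0 : 0 < t - s by rewrite subr_gt0.
have := dil_add cC s0 ts0 Cv (dil0 (t - s) C0).
by rewrite addr0 [s + _]addrC subrK.
Qed.

Lemma dil_box C (d : R) s v : 0 < s ->
  (forall w : 'rV[R]_n, (forall i, `|w 0 i| <= d) -> C w) ->
  (forall i, `|v 0 i| <= s * d) -> dil C s v.
Proof.
move=> s0 H hv; apply: H => i; rewrite mxE normrM gtr0_norm ?invr_gt0 //.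
by rewrite ler_pdivrMl.
Qed.

End dilation.

Section packing.
Context {R : realType} {n : nat}.
Hypothesis n_gt0 : (0 < n)%N.
Variables (C : set 'rV[R]_n) (d gamma : R).
Hypotheses (cC : cvx C) (kC : compact C) (d0 : 0 < d).
Hypothesis boxC : forall w : 'rV[R]_n, (forall i, `|w 0 i| <= d) -> C w.
Hypotheses (g0 : 0 < gamma) (symC : symmetric_upto gamma C).

Let C0 : C 0.
Proof. by apply: boxC => i; rewrite mxE normr0 ltW. Qed.

Lemma compact_coord_bounded : exists2 M : R, 0 < M & forall v, C v -> forall i, `|v 0 i| <= M.
Proof.
have [M [_ hM]] := compact_bounded kC.
exists (Num.max M 0 + 1); first by rewrite ltr_wpDl // le_max lexx orbT.
move=> v Cv i; apply: le_trans (_ : `|v| <= _); last first.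
  by apply: (hM (Num.max M 0 + 1)) => //; rewrite ltr_pwDr // le_max lexx.
by rewrite [leRHS]/Num.Def.normr /= mx_normrE; apply/bigmax_geP; right => /=; exists (0, i).
Qed.

Lemma mem_cube_real (M : R) (N : nat) (u : 'rV[int]_n) : M < N.+1%:R ->
  (forall i, `|(u 0 i)%:~R : R| <= M) -> u \in cube n N.
Proof.
move=> MN hu; rewrite mem_cube; apply/forallP => i.
rewrite -ltnS -(ltr_nat R); apply: le_lt_trans MN.
by have := hu i; rewrite -intr_norm natr_absz.
Qed.

(** Finite, since a bounded set is covered by finitely many unit cells. Positive, since otherwise
    [grid_le_vol] would leave only d^n / 2 for the grid points of the box of radius d, while (2 k +
    1)^n points of mesh d / k already weigh more than d^n. *)
Lemma vol_finite_positive : exists2 V : R, 0 < V & vol C = V%:E.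
Proof.
have [M M0 hM] := compact_coord_bounded.
have fin : (vol C < +oo)%E.
  have := @vol_le_grid R n n_gt0 C 1 (cube n (Num.truncn (M + 1)).+1) ltr01.
  move=> H; apply: le_lt_trans (H _) (ltry _) => v Cv.
  have [u hu] := real_grid v ltr01; exists u => //.
  have MN : M + 1 < (Num.truncn (M + 1)).+2%:R.
    by apply: lt_trans (truncnS_gt _) _; rewrite ltr_nat.
  apply: (mem_cube_real MN) => i; have := hM v Cv i; have := hu i.
  by rewrite mul1r !ler_norml => /andP[? ?] /andP[? ?]; apply/andP; split; lra.
have pos : (0 < vol C)%E.
  rewrite ltNge; apply/negP => vC.
  have dn0 : 0 < d ^+ n / 2 by rewrite divr_gt0 // exprn_gt0.
  have [|e0 e00 H] := @grid_le_vol R n C (d ^+ n / 2) kC.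
    by apply: le_lt_trans vC _; rewrite lte_fin.
  pose k := (Num.truncn (d / e0)).+1.
  have k0 : 0 < k%:R :> R by rewrite ltr0n.
  have := H (d / k%:R) (cube n k) _ (cube_uniq _ _) _.
  rewrite divr_gt0 // ler_pdivrMr // mulrC -ler_pdivrMr // (ltW (truncnS_gt _)).
  move=> /(_ isT); rewrite size_cube natrX -exprMn => H'.
  suff : d ^+ n <= d ^+ n / 2 by lra.
  apply: le_trans (H' _) => [|u].
    apply: lerXn2r; rewrite ?nnegrE ?(ltW d0) // ?mulr_ge0 ?divr_ge0 ?ler0n ?(ltW d0) //.
    rewrite mulrCA ler_peMr ?(ltW d0) // ler_pdivlMr // mul1r ler_nat.
    by rewrite -addnS leq_addr.
  rewrite mem_cube => /forallP hu; apply: boxC => i; rewrite !mxE.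
  rewrite normrM gtr0_norm ?divr_gt0 // -mulrA ler_piMr ?(ltW d0) //.
  rewrite mulrC ler_pdivrMr // mul1r -intr_norm -natr_absz ler_nat; exact: hu.
exists (fine (vol C)); first by rewrite fine_gt0 ?pos.
by rewrite fineK // ge0_fin_numE // ltW.
Qed.

(* Move the separated points to the grid: their sums with the grid points of
   (tau / 4)K are distinct and lie in 2aC, so count grid points on both sides. *)
Lemma packing (a tau : R) (Z : seq 'rV[R]_n) : 0 < tau <= a -> uniq Z ->
  {in Z, forall z, dil C a z} ->
  {in Z &, forall z z', z != z' -> ~ (dil C tau (z - z') /\ dil C tau (z' - z))} ->
  (size Z)%:R <= 2 * (16 * a / (tau * gamma)) ^+ n.
Proof.
move=> /andP[t0 ta] uZ aZ sepZ; have a0 : 0 < a by lra.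
have l1 : tau / 16 + tau / 16 + (tau / 4 + tau / 4) <= tau by lra.
have l2 : a + tau / 16 + tau / 4 <= 2 * a by lra.

have [V V0 VE] := vol_finite_positive.
have [M M0 hM] := compact_coord_bounded.
(* Grid counts are bounded only by numbers above the volume; taking 2 V is the source of the leading
   factor 2. *)
have [|e0 e00 HC] := @grid_le_vol R n C (2 * V) kC; first by rewrite VE lte_fin; lra.
(* The first bound makes eta / (2 a) fine enough for [HC] after scaling 2 a C to C. The second keeps
   the rounding of a point to the grid inside (tau / 16) K. *)
pose eta := Num.min (2 * a * e0) (tau * d / 16).
have eta0 : 0 < eta by rewrite lt_min !mulr_gt0.
have eta1 : eta <= 2 * a * e0 by rewrite ge_min lexx.
have eta2 : eta <= tau * d / 16 by rewrite ge_min lexx orbT.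
have t16 : 0 < tau / 16 by rewrite divr_gt0.
have t4 : 0 < tau / 4 by rewrite divr_gt0.
pose K v := C v /\ C (- v).
have dK s v : dil K s v <-> dil C s v /\ dil C s (- v).
  by rewrite /dil /K /= scalerN.
have cK : cvx K.
  move=> u v t ht [u1 u2] [v1 v2]; split; first exact: cC.
  by rewrite opprD -!scalerN; exact: cC.
have K0 : K 0 by rewrite /K oppr0.
have boxK (w : 'rV[R]_n) : (forall i, `|w 0 i| <= d) -> K w.
  by move=> hw; split; apply: boxC => // i; rewrite mxE normrN.
have KN s v : dil K s v -> dil K s (- v).
  by rewrite !dK opprK => -[].
have KC s v : dil K s v -> dil C s v by rewrite dK => -[].
(* Dilation by tau / 8 takes mesh e1 to mesh eta. A cell of mesh e1 lies in K, so grid points of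
   cells meeting K lie in 2 K and are sent into (tau / 4) K. *)
pose e1 := 8 * eta / tau.
have e10 : 0 < e1 by rewrite divr_gt0 // mulr_gt0.
have e1d : e1 <= d / 2.
  by rewrite /e1 ler_pdivrMr //; lra.
pose G := [seq u <- cube n (Num.truncn ((M + e1) / e1)) |
            `[< dil K (tau / 4) (eta *: map_mx intr u) >]].
have uG : uniq G by rewrite filter_uniq // cube_uniq.
have volK : gamma ^+ n * V <= (size G)%:R * e1 ^+ n.
  rewrite -lee_fin EFinM -VE; apply: le_trans symC _.
  apply: (vol_le_grid n_gt0 e10) => v [Cv [w Cw wv]].
  have Kv : K v by split=> //; rewrite -wv opprK.
  have [u hu] := real_grid v e10; exists u => //.
  rewrite mem_filter; apply/andP; split.
    apply/asboolP.
    have -> : eta *: map_mx intr u = (tau / 8) *: v + (tau / 8) *: (- (v - e1 *: map_mx intr u)).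
      rewrite -scalerDr opprB addrCA subrr addr0 scalerA; congr (_ *: _).
      by rewrite /e1; field; lra.
    have -> : tau / 4 = tau / 8 * 1 + tau / 8 * 1 by field.
    have t8 : tau / 8 != 0 by lra.
    have t80 : 0 < tau / 8 * 1 by rewrite mulr1 divr_gt0.
    apply: dil_add => //; rewrite dilZ // dil1 //.
    apply: boxK => i; rewrite !mxE normrN; have /andP[? ?] := hu i.
    by rewrite ger0_norm //; lra.
  apply: (mem_cube_real (truncnS_gt _)) => i.
  rewrite ler_pdivlMr // -[X in _ * X]gtr0_norm // -normrM mulrC.
  have := hM v Cv i; have /andP[? ?] := hu i.
  by rewrite !ler_norml => /andP[? ?]; apply/andP; split; lra.
have [om hom] := choice (fun z : 'rV[R]_n => real_grid z eta0).
have omK (z : 'rV[R]_n) : dil K (tau / 16) (z - eta *: map_mx intr (om z)).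
  apply: (dil_box _ boxK); first lra.
  move=> i; rewrite !mxE; have /andP[? ?] := hom z i.
  by rewrite ger0_norm //; lra.
have GK u : u \in G -> dil K (tau / 4) (eta *: map_mx intr u).
  by rewrite mem_filter => /andP[/asboolP].
pose T := [seq om z + u | z <- Z, u <- G].
(* If two sums coincide for different p and p', then p - p' lies in (1/16 + 1/16 + 1/4 + 1/4) tau K,
   inside tau K, against the separation. *)
have uT : uniq T.
  apply: allpairs_uniq => // -[z u] [z' u'] /=.
  move=> /allpairsP[[p q] /= [zZ uGG [-> ->]]] /allpairsP[[p' q'] /= [zZ' uGG' [-> ->]]] E.
  have [zz'|zz'] := eqVneq p p'.
    by move: E; rewrite zz' => /addrI ->.
  case: (sepZ p p' zZ zZ' zz'); rewrite -[p' - p]opprB -dK.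
  have -> : p - p' = ((p - eta *: map_mx intr (om p)) + - (p' - eta *: map_mx intr (om p')))
      + (eta *: map_mx intr q' + - (eta *: map_mx intr q)).
    have E' : map_mx intr (om p) + map_mx intr q = map_mx intr (om p') + map_mx intr q' :> 'rV[R]_n.
      by rewrite -!raddfD /= E.
    apply/rowP => i; have /rowP/(_ i) := E'; rewrite !mxE => Ei.
    have : eta * (om p 0 i)%:~R + eta * (q 0 i)%:~R = eta * (om p' 0 i)%:~R + eta * (q' 0 i)%:~R.
      by rewrite -!mulrDr Ei.
    by lra.
  apply: (@dil_le _ _ _ ((tau / 16 + tau / 16) + (tau / 4 + tau / 4))) => //.
  - by rewrite !addr_gt0.
  - by do 2?[apply: dil_add; rewrite ?addr_gt0 //]; try apply: KN;
      try apply: omK; apply: GK.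
have TC u : u \in T -> C ((eta / (2 * a)) *: map_mx intr u).
  move=> /allpairsP[[z v] /= [zZ vG ->]].
  suff : dil C (2 * a) (eta *: map_mx intr (om z + v)).
    by rewrite /dil /= scalerA mulrC.
  have -> : eta *: map_mx intr (om z + v) =
     (z + - (z - eta *: map_mx intr (om z))) + eta *: map_mx intr v :> 'rV[R]_n.
    by rewrite map_mxD scalerDr opprB addrCA subrr addr0.
  apply: (@dil_le _ _ _ ((a + tau / 16) + tau / 4)) => //.
  - by rewrite !addr_gt0.
  apply: dil_add; rewrite ?addr_gt0 //; last by apply: KC; exact: GK.
  by apply: dil_add => //; [exact: aZ|apply: KC; apply: KN].
have := HC (eta / (2 * a)) T _ uT TC.
rewrite divr_gt0 ?mulr_gt0 //= ler_pdivrMr ?mulr_gt0 // [e0 * _]mulrC eta1 => /(_ isT).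
rewrite size_allpairs natrM => H.
set X := 16 * a / (tau * gamma).
have key : (size Z)%:R * (gamma ^+ n * V) * (eta / (2 * a)) ^+ n <= 2 * V * e1 ^+ n.
  have h1 : (size Z)%:R * (gamma ^+ n * V) <= (size Z)%:R * ((size G)%:R * e1 ^+ n).
    by rewrite ler_wpM2l.
  have h2 := ler_wpM2r (exprn_ge0 n (ltW (_ : 0 < eta / (2 * a)))) h1.
  apply: le_trans (h2 _) _; first by rewrite divr_gt0 // mulr_gt0.
  have h3 := ler_wpM2r (exprn_ge0 n (ltW e10)) H.
  by move: h3; congr (is_true (_ <= _)); ring.
have e1E : e1 = X * (gamma * (eta / (2 * a))).
  by rewrite /e1 /X; field; rewrite ?lt0r_neq0.
have D0 : 0 < V * (gamma ^+ n * (eta / (2 * a)) ^+ n).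
  by rewrite !mulr_gt0 // exprn_gt0 // divr_gt0 // mulr_gt0.
rewrite -(ler_pM2r D0); move: key; rewrite e1E !exprMn => key.
by move: key; congr (is_true (_ <= _)); ring.
Qed.

End packing.

(** * Coverings by lists *)

Section greedy_facts.
Context {V : zmodType}.
Variables (f : pred V) (nr : rel V).
Implicit Types (X Y D : seq V).

Lemma ins_ext D z : {subset D <= ins f nr D z}.
Proof.
by move=> q qD; rewrite /ins; case: ifP => //; rewrite mem_rcons inE qD orbT.
Qed.

Lemma comb1_ext Y D u : {subset D <= comb1 f nr Y D u}.
Proof.
rewrite /comb1; elim: Y D => [|v Y IH] D q qD //=.
by apply: IH; exact: ins_ext.
Qed.

Lemma comb_ind (P : seq V -> Prop) X Y : P [::] ->
  (forall D u v, P D -> u \in X -> v \in Y -> P (ins f nr D (u + v))) ->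
  P (comb f nr X Y).
Proof.
move=> P0 step; rewrite /comb.
have H1 D u : P D -> u \in X -> P (comb1 f nr Y D u).
  move=> PD uX; rewrite /comb1.
  have H Y' : {subset Y' <= Y} ->
      forall D', P D' -> P (foldl (fun D v => ins f nr D (u + v)) D' Y').
    elim: Y' => [|v Y' IH] sY D' PD' //=; apply: IH.
      by move=> w wY; apply: sY; rewrite inE wY orbT.
    by apply: step => //; apply: sY; rewrite inE eqxx.
  exact: H.
have H X' : {subset X' <= X} -> forall D, P D -> P (foldl (comb1 f nr Y) D X').
  elim: X' => [|u X' IH] sX D PD //=; apply: IH.
    by move=> w wX; apply: sX; rewrite inE wX orbT.
  by apply: H1 => //; apply: sX; rewrite inE eqxx.
exact: H.
Qed.

Lemma comb_sub X Y z : z \in comb f nr X Y ->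
  f z /\ exists u v, [/\ u \in X, v \in Y & z = u + v].
Proof.
apply: (comb_ind (P := fun D => z \in D -> f z /\ exists u v,
  [/\ u \in X, v \in Y & z = u + v])) => //= D u v IH uX vY.
rewrite /ins; case: ifP => [/andP[fz _]|_]; last exact: IH.
by rewrite mem_rcons inE => /predU1P[->|/IH //]; split => //; exists u, v.
Qed.

Hypothesis nr_refl : reflexive nr.

(** When u + v is considered, either a listed vector is already close to it or it is appended and is
    close to itself; later insertions remove nothing. *)
Lemma comb_cover X Y u v : u \in X -> v \in Y -> f (u + v) ->
  exists2 z, z \in comb f nr X Y & nr (u + v) z.
Proof.
move=> uX vY fz.
have cov D : exists2 z, z \in ins f nr D (u + v) & nr (u + v) z.
  rewrite /ins fz /=; have [/hasP[q qD hq]|_] := boolP (has _ D); first by exists q.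
  by exists (u + v); rewrite ?mem_rcons ?inE ?eqxx.
have cov1 D : exists2 z, z \in comb1 f nr Y D u & nr (u + v) z.
  rewrite /comb1; elim: Y vY D => // w Y' IH; rewrite inE => /predU1P[<- D|vY' D].
    by have [z zD hz] := cov D; exists z => //=; exact: (@comb1_ext Y' _ u _ zD).
  exact: IH.
rewrite /comb; elim: X uX [::] => // w X' IH; rewrite inE => /predU1P[<- D|uX' D] /=.
  have [z zD hz] := cov1 D; exists z => //.
  by elim: X' (comb1 f nr Y D u) zD {IH} => //= w' X'' IH D' zD'; apply: IH; apply: comb1_ext.
exact: IH.
Qed.

Hypothesis nr_sym : symmetric nr.

(** A candidate is compared only with older elements, so symmetry of [nr] is what gives separation
    in both orders, and reflexivity what excludes repetitions. *)
Lemma comb_sep X Y : uniq (comb f nr X Y) /\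
  {in comb f nr X Y &, forall z z', z != z' -> ~~ nr z z'}.
Proof.
apply: (comb_ind (P := fun D => uniq D /\ {in D &, forall z z', z != z' -> ~~ nr z z'})) => //.
move=> D u v [uD sD] _ _ /=; rewrite /ins; case: ifP => // /andP[_ /hasPn hz].
have zD : u + v \notin D by apply/negP => /hz; rewrite nr_refl.
rewrite rcons_uniq zD; split => // p q; rewrite !mem_rcons !inE.
move=> /predU1P[->|pD] /predU1P[->|qD]; rewrite ?eqxx // => pq.
- exact: hz.
- by rewrite nr_sym hz.
- exact: sD.
Qed.

End greedy_facts.

(** * The truncated symmetric bodies A_h in coefficient space *)

Section body.
Context {R : realType} {n : nat}.
Variables (C : set 'rV[R]_n) (B : 'M[R]_n).
Hypotheses (cC : cvx C) (kC : compact C).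

Definition body (h : R) : set 'rV[R]_n :=
  [set v : 'rV[R]_n | (forall i, `|v 0 i| <= h) /\ C (v *m B) /\ C (- (v *m B))].

Lemma body_cvx h : cvx (body h).
Proof.
move=> u v t ht [u0 [u1 u2]] [v0 [v1 v2]]; have /andP[t0 t1] := ht; split.
  move=> i; rewrite !mxE; apply: le_trans (ler_normD _ _) _.
  rewrite !normrM (ger0_norm t0) (@ger0_norm _ (1 - t)) ?subr_ge0 //.
  have -> : h = t * h + (1 - t) * h by ring.
  by rewrite lerD // ler_wpM2l // subr_ge0.
rewrite mulmxDl -!scalemxAl; split; first exact: cC.
by rewrite opprD -!scalerN; exact: cC.
Qed.

Lemma bodyN h (v : 'rV[R]_n) : body h v -> body h (- v).
Proof.
move=> [v0 [v1 v2]]; split; first by move=> i; rewrite mxE normrN.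
by rewrite mulNmx opprK.
Qed.

Lemma mulmxr_continuous (A : 'M[R]_n) : continuous (fun v : 'rV[R]_n => v *m A).
Proof.
move=> v; apply/cvgrPdist_le; first exact: nbhs_filter.
move=> e e0.
pose S := \sum_i \sum_j `|A i j| + 1.
have S0 : 0 < S by rewrite ltr_wpDl // sumr_ge0 // => i _; rewrite sumr_ge0.
have eS : 0 < e / S by rewrite divr_gt0.
have := nbhsx_ballx v _ eS; apply: filterS => w.
rewrite -ball_normE /= => vw; rewrite -mulmxBl.
rewrite [leLHS]/Num.Def.normr /= mx_normrE (bigmax_le _ (ltW e0)) //= => -[a j] _ /=.
rewrite mxE (ord1 a); apply: le_trans (ler_norm_sum _ _ _) _.
apply: le_trans (_ : \sum_i (e / S) * `|A i j| <= _).
  apply: ler_sum => i _; rewrite normrM ler_wpM2r //.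
  apply: le_trans (ltW vw); rewrite [leRHS]/Num.Def.normr /= mx_normrE.
  by apply/bigmax_geP; right => /=; exists (0, i).
rewrite -mulr_sumr mulrAC ler_pdivrMr // ler_wpM2l ?(ltW e0) //.
apply: le_trans (_ : \sum_i \sum_j `|A i j| <= _); last by rewrite lerDl.
by apply: ler_sum => i _; rewrite (bigD1 j) //= lerDl sumr_ge0.
Qed.

Lemma body_compact h : compact (body h).
Proof.
have -> : body h = [set v : 'rV[R]_n | forall i, `[- h, h]%classic (v ord0 i)] `&`
   (((fun v : 'rV[R]_n => v *m B) @^-1` C) `&`
    ((fun v : 'rV[R]_n => v *m - B) @^-1` C)).
  apply/seteqP; split=> v /=; rewrite mulmxN => -[v0 v1]; split => //.
    by move=> i; rewrite in_itv /= -ler_norml v0.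
  by move=> i; have := v0 i; rewrite in_itv /= -ler_norml.
have clC : closed C by apply: compact_closed kC; exact: norm_hausdorff.
apply: compact_closedI.
  by apply: (rV_compact (A := fun=> `[- h, h]%classic)) => i; exact: segment_compact.
by apply: closedI; apply: preimage_closed => // v _; exact: mulmxr_continuous.
Qed.

Lemma dil_body h t (v : 'rV[R]_n) : 0 < t -> dil (body h) t v <->
  (forall i, `|v 0 i| <= t * h) /\ (dil C t (v *m B) /\ dil C t (- (v *m B))).
Proof.
move=> t0; rewrite /dil /body /= -scalemxAl -scalerN.
split=> -[H1 H2]; split => // i; have := H1 i; rewrite mxE normrM.
  by rewrite gtr0_norm ?invr_gt0 // ler_pdivrMl.
by rewrite gtr0_norm ?invr_gt0 // ler_pdivrMl.
Qed.

Variables (oracle : 'rV[R]_n -> R) (mo : bool) (x : 'rV[R]_n).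
Hypothesis tstP : forall v, reflect (C v) (tst oracle mo v).

Lemma nearbP h t (z q : 'rV[R]_n) : 0 < t ->
  reflect (dil (body h) t (z - q)) (nearb oracle mo B h t z q).
Proof.
move=> t0; apply: (iffP and3P); rewrite dil_body // /amb subr0 invrN scaleNr -scalerN.
  by move=> [/forallP h1 /tstP h2 /tstP h3].
by move=> [h1 [/tstP h2 /tstP h3]]; split => //; apply/forallP.
Qed.

Lemma filcbP a (z : 'rV[R]_n) : reflect (dil C a (z *m B - x)) (filcb oracle mo B x a z).
Proof. by rewrite /filcb /amb subr0; exact: tstP. Qed.

End body.

Section coverings.
Context {R : realType} {n : nat}.
Hypothesis n_gt0 : (0 < n)%N.
Variables (C : set 'rV[R]_n) (B : 'M[R]_n).
Hypotheses (cC : cvx C) (kC : compact C).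
Variables (oracle : 'rV[R]_n -> R) (mo : bool) (x : 'rV[R]_n).
Hypothesis tstP : forall v, reflect (C v) (tst oracle mo v).
Variable (Q : nat).
Let g : R := 2 ^+ Q.
Hypothesis boxB : forall w : 'rV[R]_n, (forall i, `|w 0 i| <= 1 / g) -> C (w *m B).
Implicit Types (h rho : R) (D : seq 'rV[R]_n).

Local Notation body := (body C B).

Let g_gt0 : 0 < g. Proof. exact: exprn_gt0. Qed.

(** For h <= 1 / g this makes A_h the full cube of radius h, which is why lists can be written down
    directly at the initial scale. *)
Lemma box_body h (w : 'rV[R]_n) : (forall i, `|w 0 i| <= Num.min h (1 / g)) -> body h w.
Proof.
move=> hw; split; first by move=> i; have := hw i; rewrite le_min => /andP[].
have hg i : `|w 0 i| <= 1 / g by have := hw i; rewrite le_min => /andP[].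
by split; [|rewrite -mulNmx]; apply: boxB => // i; rewrite mxE normrN.
Qed.

Lemma body0 h : 0 <= h -> body h 0.
Proof.
move=> h0; apply: box_body => i.
by rewrite mxE normr0 le_min h0 divr_ge0 // ltW.
Qed.

Lemma nearb_refl h t : 0 <= h -> 0 < t -> reflexive (nearb oracle mo B h t).
Proof.
move=> h0 t0 z; apply/(nearbP B tstP h z z t0); rewrite subrr; apply: dil0.
exact: body0.
Qed.

Lemma dil_body_sub h t (z q : 'rV[R]_n) :
  dil (body h) t (z - q) -> dil (body h) t (q - z).
Proof. by rewrite -[q - z]opprB /dil /= scalerN; exact: bodyN. Qed.

Lemma nearb_sym h t : 0 < t -> symmetric (nearb oracle mo B h t).
Proof.
move=> t0 z q; apply/(nearbP B tstP h z q t0)/(nearbP B tstP h q z t0);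
  exact: dil_body_sub.
Qed.

Lemma body_symmetric h : symmetric_upto 1 (body h).
Proof.
rewrite /symmetric_upto expr1n mul1e; have -> // : body h `&` [set - c | c in body h] = body h.
apply/seteqP; split=> v; first by case.
by move=> hv; split => //; exists (- v); [exact: bodyN|rewrite opprK].
Qed.

(** Packing in the symmetric body A_h with a = 8 rho, tau = rho / 2 and gamma = 1 gives 2 * 256^n,
    whatever the sizes of X and Y. *)
Lemma size_lcomb h rho X Y : 0 < h -> 0 < rho ->
  (size (lcomb oracle mo B x h rho X Y) <= 512 ^ n)%N.
Proof.
move=> h0 rho0; have r2 : 0 < rho / 2 by rewrite divr_gt0.
have [uD sD] := comb_sep (filb oracle mo B x false (8 * rho) h)
  (nearb_refl (ltW h0) r2) (nearb_sym h r2) X Y.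
have d0 : 0 < Num.min h (1 / g) by rewrite lt_min h0 divr_gt0.
have r8 : 0 < rho / 2 <= 8 * rho by rewrite r2; lra.
have cA : cvx (body h) by exact: body_cvx.
have kA : compact (body h) by exact: body_compact.
have H := packing n_gt0 cA kA d0 (@box_body h) ltr01 (@body_symmetric h) r8 uD.
rewrite -(ler_nat R); apply: le_trans (H _ _) _.
- move=> z /comb_sub[/= ]; rewrite /filb => /(nearbP B tstP h z 0 _).
  by rewrite subr0 => + _; apply; rewrite mulr_gt0.
- move=> z z' zD z'D /(sD z z' zD z'D)/negP hz [hd _]; apply: hz.
  exact/(nearbP B tstP h z z' r2).
- have -> : 16 * (8 * rho) / (rho / 2 * 1) = 256 by field; rewrite lt0r_neq0.
  rewrite natrX; have -> : 512%:R = 2 * 256 :> R by rewrite -natrM.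
  rewrite exprMn; apply: ler_wpM2r; first exact: exprn_ge0 (ler0n _ _).
  by case: n n_gt0 => // k _; rewrite exprS ler_peMr // exprn_ege1 // ler1n.
Qed.

Definition intvec (z : 'rV[R]_n) : Prop := exists u : 'rV[int]_n, z = map_mx intr u.

Lemma intvecD z z' : intvec z -> intvec z' -> intvec (z + z').
Proof. by move=> [u ->] [u' ->]; exists (u + u'); rewrite map_mxD. Qed.

Lemma intvecB z z' : intvec z -> intvec z' -> intvec (z - z').
Proof. by move=> [u ->] [u' ->]; exists (u - u'); rewrite map_mxB. Qed.

(** The factor 4 is what the doubling of the scale requires: the coarse list of radius 2 rho leaves
    an error of 2 rho, and this has to be within reach of the fine list of radius rho / 2. *)
Definition covers h rho D : Prop :=
  (forall z, z \in D -> intvec z) /\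
  forall y, intvec y -> dil (body h) (4 * rho) y ->
    exists2 z, z \in D & dil (body h) rho (y - z).

Section grid.
Variables (h rho : R).
Hypotheses (h0 : 0 < h) (hg : h <= 1 / g) (rho0 : 0 < rho).
Let st := spacing h rho.
Hypothesis st_int : exists k : int, st = k%:~R.

Let rh0 : 0 < rho * h. Proof. exact: mulr_gt0. Qed.

Lemma spacing_gt0 : 0 < st.
Proof. by rewrite /st /spacing; case: ifP. Qed.

Lemma spacing_ge : rho * h <= st.
Proof. by rewrite /st /spacing; case: ifP => // /ltW. Qed.

Definition on_grid (z : 'rV[R]_n) : Prop :=
  exists u : 'rV[int]_n, z = st *: map_mx intr u.

Lemma multiples_on_grid t z : z \in @multiples R n st t -> on_grid z.
Proof.
move=> /mapP[k _ ->]; exists (\row_j ((k%:Z - 4) * (j == t :> nat)%:Z)).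
apply/rowP => j; rewrite !mxE intrM intrB -mulrA; congr (_ * (_ * _)).
Qed.

Lemma grid_list_on_grid t z : z \in grid_list oracle mo B x h rho t -> on_grid z.
Proof.
elim: t z => [|t IH] z /=.
  by rewrite inE => /eqP ->; exists 0; rewrite map_mx0 scaler0.
move=> /comb_sub[_ [u [v [/IH[u' ->] /multiples_on_grid[v' ->] ->]]]].
by exists (u' + v'); rewrite map_mxD scalerDr.
Qed.

(* Pruning never merges two grid points, since their spacing exceeds the
   pruning radius. *)
Lemma on_grid_sep z z' : on_grid z -> on_grid z' ->
  dil (body h) (rho / 2) (z - z') -> z = z'.
Proof.
move=> [u ->] [u' ->]; rewrite dil_body ?divr_gt0 // => -[hs _].
apply/rowP => i; have := hs i; rewrite !mxE -mulrBr -intrB normrM.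
rewrite (gtr0_norm spacing_gt0) -intr_norm => le1.
suff : `|u 0 i - u' 0 i| < 1 :> int.
  by rewrite -[ltRHS]add0r ltzD1 normr_le0 subr_eq0 => /eqP ->.
rewrite -(ltr_int R) -(ltr_pM2l spacing_gt0); apply: le_lt_trans le1 _.
rewrite mulr1 mulrAC; apply: lt_le_trans spacing_ge.
by rewrite ltr_pdivrMr // ltr_pMr // ltr1n.
Qed.

(** Induction on the coordinates: the vector without its last coordinate is listed by induction, the
    sum passes the filter because A_h is a cube, and the close element that [comb_cover] returns
    must be the vector itself by [on_grid_sep]. *)
Lemma grid_list_mem t (u : 'rV[int]_n) : (t <= n)%N ->
  (forall i, `|u 0 i| <= 4) ->
  (forall i, st * `|(u 0 i)%:~R| <= 8 * rho * h) ->
  (forall i : 'I_n, (t <= i)%N -> u 0 i = 0) ->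
  st *: map_mx intr u \in grid_list oracle mo B x h rho t.
Proof.
elim: t u => [|t IH] u tn u4 us u0 /=.
  rewrite inE; apply/eqP/rowP => i; rewrite !mxE u0 //= mulr0 //.
pose i0 := Ordinal tn.
pose u' := \row_i (if i == i0 then 0 else u 0 i).
have a4 : (absz (u 0 i0 + 4)%R)%:R - 4 = (u 0 i0)%:~R :> R.
  have := u4 i0; rewrite ler_norml => /andP[l1 l2].
  by rewrite natr_absz ger0_norm ?intrD ?addrK //; lia.
have uE : st *: map_mx intr u = st *: map_mx intr u' + (st * (u 0 i0)%:~R) *: evec t.
  apply/rowP => i; rewrite !mxE -val_eqE /=.
  by case: eqP => [ii|_]; rewrite ?mulr1 ?mulr0 ?addr0 // add0r; congr (_ * (u 0 _)%:~R); apply: val_inj.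
have mw : (st * (u 0 i0)%:~R) *: evec t \in @multiples R n st t.
  apply/mapP; exists (absz (u 0 i0 + 4)%R); last by rewrite a4.
  rewrite mem_iota /= add0n; have := u4 i0; rewrite ler_norml => /andP[l1 l2].
  by lia.
have mu' : st *: map_mx intr u' \in grid_list oracle mo B x h rho t.
  apply: IH; first exact: ltnW.
  - by move=> i; rewrite mxE; case: ifP; rewrite ?normr0.
  - move=> i; rewrite mxE; case: ifP => // _; rewrite normr0 mulr0.
    by rewrite -mulrA mulr_ge0 // ltW.
  - move=> i ti; rewrite mxE; case: eqP => // /eqP ii; apply: u0.
    by rewrite ltn_neqAle ti andbT eq_sym -val_eqE in ii *.
have r2 : 0 < rho / 2 by rewrite divr_gt0.
have r8 : 0 < 8 * rho by rewrite mulr_gt0.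
have [|z zD hz] := comb_cover (f := filb oracle mo B x false (8 * rho) h)
  (nearb_refl (ltW h0) r2) mu' mw.
  rewrite -uE /filb; apply/(nearbP B tstP h _ 0 r8); rewrite subr0.
  apply: (dil_box r8 (@box_body h)) => i.
  rewrite !mxE normrM (gtr0_norm spacing_gt0); apply: le_trans (us i) _.
  by rewrite (min_idPl hg).
suff -> : st *: map_mx intr u = z by [].
apply: on_grid_sep; first by exists u.
  exact: (grid_list_on_grid (t := t.+1)).
by apply/(nearbP B tstP h _ z r2); rewrite uE.
Qed.

(** Coordinates are rounded down to multiples of the spacing. For rho h < 1 the spacing is 1 and an
    integer vector is hit exactly; otherwise the remainders are below rho h, hence in rho A_h as A_h
    is a cube. *)
Lemma grid_covers : covers h rho (grid_list oracle mo B x h rho n).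
Proof.
split=> [z /grid_list_on_grid[u ->]|y [y' ->]].
  have [k ->] := st_int; exists (\row_i (k * u 0 i)).
  by apply/rowP => i; rewrite !mxE intrM.
have r4 : 0 < 4 * rho by rewrite mulr_gt0.
rewrite dil_body // => -[hy _].
have st0 := spacing_gt0; have rhs := spacing_ge.
have [u hu] := real_grid (map_mx intr y' : 'rV[R]_n) st0.
have hu1 i : rho * h < 1 -> y' 0 i = u 0 i.
  move=> lt1; have := hu i; rewrite /st /spacing lt1 mul1r mxE -intrB.
  by rewrite ler0z ltrz1; lia.
have u4 i : `|u 0 i| <= 4.
  have := hy i; have /andP[] := hu i; rewrite mxE ler_norml => h1 h2 /andP[h3 h4].
  rewrite ler_norml; apply/andP; split.
    rewrite lerNl -ltzD1 -(ltr_int R) -(ltr_pM2l st0) intrN mulrN.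
    by have -> : (4 + 1)%:~R = 5 :> R by []; lra.
  rewrite -(ler_int R) -(ler_pM2l st0); have -> : 4%:~R = 4 :> R by []; lra.
have us i : st * `|(u 0 i)%:~R| <= 8 * rho * h.
  have [lt1|ge1] := ltP (rho * h) 1.
    have st1 : st = 1 by rewrite /st /spacing lt1.
    have := hy i; rewrite mxE hu1 // st1 mul1r => hi; apply: le_trans hi _.
    by rewrite -!mulrA ler_wpM2r ?(ltW rh0) // ler_nat.
  have -> : st = rho * h by rewrite /st /spacing ltNge ge1.
  have : `|(u 0 i)%:~R| <= 4 :> R by rewrite -intr_norm (ler_int R _ 4).
  move=> /(ler_wpM2l (ltW rh0)); lra.
exists (st *: map_mx intr u).
  by apply: grid_list_mem => // i; rewrite leqNgt ltn_ord.
apply: (dil_box rho0 (@box_body h)) => i; rewrite (min_idPl hg) !mxE.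
have [lt1|ge1] := ltP (rho * h) 1.
  by rewrite hu1 // {1}/st /spacing lt1 mul1r subrr normr0 ltW.
have := hu i; rewrite mxE; have -> : st = rho * h by rewrite /st /spacing ltNge ge1.
by move=> /andP[? /ltW ?]; rewrite ger0_norm.
Qed.

End grid.

(** Doubling the cube alone enlarges A_h by at most 2; this is what links consecutive scales. *)
Lemma body_half h (v : 'rV[R]_n) : 0 <= h -> dil (body (2 * h)) 1 v -> dil (body h) 2 v.
Proof.
move=> h0; rewrite !dil_body // => -[v0 [v1 v2]]; split.
  by move=> i; have := v0 i; rewrite mul1r.
have Cz : C 0 by have := @boxB 0; rewrite mul0mx; apply => i; rewrite mxE normr0 divr_ge0 // ltW.
by split; apply: (dil_le cC Cz ltr01) => //; lra.
Qed.

Lemma body_sub h h' t (v : 'rV[R]_n) : 0 < t -> h <= h' -> dil (body h) t v -> dil (body h') t v.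
Proof.
move=> t0 hh; rewrite !dil_body // => -[v0 v1]; split => // i.
by apply: le_trans (v0 i) _; rewrite ler_wpM2l // ltW.
Qed.

Lemma lists_covers m k : covers (hscale g m) (lscale g m k) (lists oracle mo B x g m k).
Proof.
elim: m k => [|m IH] k /=.
  apply: grid_covers.
  - by rewrite /hscale divr_gt0.
  - by rewrite /hscale expr0.
  - by rewrite /lscale divr_gt0 // exprn_gt0.
  (* At scale 0 the product rho h equals 2^(k - 8 Q), an integer as soon as it is at least 1. *)
  - rewrite /spacing; case: ltP => [_|h1]; first by exists 1.
    exists (2 ^+ (k - 8 * Q)).
    have e8 : lscale g 0 k * hscale g 0 = 2 ^+ k / 2 ^+ (8 * Q).
      rewrite /lscale /hscale addn0 expr0 [(8 * Q)%N]mulnC exprM -/g.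
      by field; rewrite lt0r_neq0.
    have k8 : (8 * Q <= k)%N.
      move: h1; rewrite e8 ler_pdivlMr ?exprn_gt0 // mul1r.
      by rewrite ler_eXn2l // ltr1n.
    rewrite e8 -{1}(subnK k8) exprD mulfK ?expf_neq0 //.
    by rewrite rmorphXn.
have h0 : 0 < hscale g m by rewrite /hscale divr_gt0 // exprn_gt0.
have hS : hscale g m.+1 = 2 * hscale g m by rewrite /hscale exprS mulrA.
have r0 : 0 < lscale g m k by rewrite /lscale divr_gt0 // exprn_gt0.
have rS : lscale g m.+1 k = 2 * lscale g m k.
  by rewrite /lscale addnS exprS mulrA.
have r2 : lscale g m (k + 2) = 4 * lscale g m k.
  by rewrite /lscale -addnA [(2 + m)%N]addnC addnA addn2 !exprS !mulrA -natrM.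
have [i1 c1] := IH (k + 2)%N; have [i2 c2] := IH k.
move: hS rS r2 c1 c2 h0 r0; rewrite /lcomb.
move: (hscale g m) (hscale g m.+1) (lscale g m k) (lscale g m.+1 k) (lscale g m (k + 2)).
move=> h _ r _ _ -> -> -> c1 c2 h0 r0.
have r0' : 0 < 2 * r / 2 by rewrite mulrC mulKf.
have rE : 2 * r / 2 = r by rewrite mulrC mulKf.
have h20 : 0 <= 2 * h by rewrite mulr_ge0 // ltW.
have hh : h <= 2 * h by rewrite ler_peMl ?ler1n // ltW.
split=> [z /comb_sub[_ [u [v [/i1 iu /i2 iv ->]]]]|y iy hy].
  exact: intvecD.
(* In units of r, y lies in 8 A_2h and thus in 16 A_h, the reach of the list of radius 4; the
   remainder is in 4 A_h, the reach of the list of radius 1. The sum found lies in (8 + 1) A_2h,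
   inside the filter 16 A_2h, and pruning at 1 makes the total error 2. *)
have : dil (body h) (4 * (4 * r)) y.
  have p8 : 4 * (2 * r) != 0 by apply: lt0r_neq0; do 2?apply: mulr_gt0; rewrite ?ltr0n.
  have -> : 4 * (4 * r) = 4 * (2 * r) * 2 by ring.
  rewrite -[y](scalerKV p8) dilZ //; apply: body_half; first exact: ltW.
  by rewrite -(dilZ _ _ _ p8) mulr1 scalerKV.
move=> /(c1 y iy)[u uX hu].
have [v vY hv] := c2 (y - u) (intvecB iy (i1 u uX)) hu.
have hv' : dil (body (2 * h)) r (y - (u + v)).
  by rewrite opprD addrA; apply: body_sub hv.
have cB := body_cvx (B := B) cC (h := 2 * h).
have f8 : filb oracle mo B x false (8 * (2 * r)) (2 * h) (u + v).
  have p8 : 0 < 8 * (2 * r) by rewrite !mulr_gt0.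
  apply/(nearbP B tstP _ _ _ p8); rewrite subr0.
  apply: (@dil_le _ _ _ (4 * (2 * r) + r)) => //.
  - exact: body0.
  - by rewrite addr_gt0 // !mulr_gt0.
  - by lra.
  have -> : u + v = y + - (y - (u + v)) by rewrite opprB addrCA subrr addr0.
  apply: dil_add => //; first by rewrite !mulr_gt0.
  by rewrite /dil /= scalerN; apply: bodyN.
have [z zD hz] := comb_cover (nearb_refl h20 r0') uX vY f8.
exists z => //; have -> : y - z = (y - (u + v)) + (u + v - z) by rewrite addrA subrK.
have -> : 2 * r = r + r by ring.
apply: dil_add => //; rewrite -rE; exact/(nearbP B tstP _ _ _ r0').
Qed.

Lemma size_grid_list h rho t : 0 < h -> 0 < rho ->
  (size (grid_list oracle mo B x h rho t) <= 512 ^ n)%N.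
Proof.
by move=> h0 r0; case: t => [|t]; [rewrite expn_gt0|exact: size_lcomb].
Qed.

Lemma size_lists m k : (size (lists oracle mo B x g m k) <= 512 ^ n)%N.
Proof.
have h0 j : 0 < hscale g j by rewrite divr_gt0 // exprn_gt0.
have l0 j i : 0 < lscale g j i by rewrite divr_gt0 // exprn_gt0.
by case: m => [|m]; [exact: size_grid_list|exact: size_lcomb].
Qed.

End coverings.

(** * Refinement around the target *)

Section refinement.
Context {R : realType} {n : nat}.
Hypothesis n_gt0 : (0 < n)%N.
Variables (C : set 'rV[R]_n) (B : 'M[R]_n) (delta gamma : R).
Hypotheses (cC : cvx C) (kC : compact C) (delta0 : 0 < delta).
Hypothesis boxC : forall w : 'rV[R]_n, (forall i, `|w 0 i| <= delta) -> C w.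
Hypotheses (gamma0 : 0 < gamma <= 1) (symC : symmetric_upto gamma C).
Hypothesis B_unit : B \in unitmx.
Variables (oracle : 'rV[R]_n -> R) (mo : bool) (x : 'rV[R]_n).
Hypothesis tstP : forall v, reflect (C v) (tst oracle mo v).
Variables (Q : nat) (e : R).
Let g : R := 2 ^+ Q.
Hypothesis Q_ge3 : (3 <= Q)%N.
Hypothesis boxB : forall w : 'rV[R]_n, (forall i, `|w 0 i| <= 1 / g) -> C (w *m B).
Hypothesis coef_bound : forall v : 'rV[R]_n,
  C (v *m B) -> C (- (v *m B)) -> forall i, `|v 0 i| <= g.
Hypothesis oppC : forall v : 'rV[R]_n, C v -> dil C g (- v).
Hypotheses (x_in : dil C g x) (Nx_in : dil C g (- x)).
Hypotheses (e_le : 0 < e <= 1 / 8) (e_ge : 1 / e <= g).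

Local Notation body := (body C B).
Local Notation slist := (slist oracle mo B x g Q).
Local Notation kstop := (kstop g e Q).

Lemma guess_ge8 : 8 <= g.
Proof.
have -> : 8 = 2 ^+ 3 :> R by rewrite -natrX.
by rewrite /g ler_eXn2l // ltr1n.
Qed.

Let g0 : 0 < g. Proof. exact: exprn_gt0. Qed.
Let g3 : 0 < g ^+ 3. Proof. exact: exprn_gt0. Qed.
Let e0 : 0 < e. Proof. by case/andP: e_le. Qed.

Lemma C_zero : C 0.
Proof. by apply: boxC => i; rewrite mxE normr0 ltW. Qed.

Lemma hscale_last : hscale g (2 * Q) = g.
Proof. by rewrite /hscale mulnC exprM -/g expr2 mulfK // lt0r_neq0. Qed.

(** At scale g the bound on the coefficients follows from [coef_bound], so A_g is K without
    truncation. *)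
Lemma dil_body_g s (v : 'rV[R]_n) : 0 < s ->
  dil (body g) s v <-> dil C s (v *m B) /\ dil C s (- (v *m B)).
Proof.
move=> s0; rewrite dil_body //; split=> [[]//|H]; split => // i.
have := coef_bound (v := s^-1 *: v); rewrite -scalemxAl -scalerN.
move=> /(_ (proj1 H) (proj2 H) i); rewrite mxE normrM gtr0_norm ?invr_gt0 //.
by rewrite ler_pdivrMl.
Qed.

Lemma res_gt0 k : 0 < res g k.
Proof. by rewrite /res divr_gt0 // exprn_gt0. Qed.

Lemma res_halve k : res g k = 2 * res g k.+1.
Proof. by rewrite /res (exprS 2%:R); field; rewrite expf_neq0. Qed.

Lemma lscale_res k : (k < 8 * Q - 1)%N ->
  lscale g (2 * Q) (8 * Q - 2 - k) = res g k.+1 / 2.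
Proof.
move=> kQ; have [E1 E2] : (8 * Q - 2 - k + 2 * Q = Q * 10 - k.+2 /\ k.+2 <= Q * 10)%N.
  by move: Q_ge3 kQ; clear; lia.
rewrite /lscale /res E1.
have -> : 2 ^+ (Q * 10 - k.+2) = 2 ^+ (Q * 10) / 2 ^+ k.+2 :> R.
  by rewrite -[in RHS](subnK E2) exprD mulfK // expf_neq0.
rewrite exprM -/g !(exprS 2%:R); field.
by rewrite expf_neq0 // lt0r_neq0.
Qed.

Lemma slist_int d k z : z \in slist d k -> intvec z.
Proof.
elim: k z => [|k IH] z /=.
  by rewrite inE => /eqP ->; exists 0; rewrite map_mx0.
move=> /comb_sub[_ [u [v [/IH iu vY ->]]]]; apply: intvecD => //.
by have [+ _] := lists_covers n_gt0 cC x tstP boxB (2 * Q) (8 * Q - 2 - k); apply.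
Qed.

Lemma slist_near d k z : (0 < k)%N -> z \in slist d k ->
  dil C (d + res g k) (z *m B - x).
Proof.
by case: k => // k _ /comb_sub[/(filcbP B x tstP) ].
Qed.

(** At the start, yB = (yB - x) + x lies in (d + g) C and -yB in (d g + g) C, because negation costs
    a factor g; both are inside g^3 C as g >= 8. In a refinement the sum u + v differs from y by at
    most half the new accuracy, so it passes the filter (d + rho) C. *)
Lemma slist_cover d y k : 0 < d <= g -> intvec y -> dil C d (y *m B - x) ->
  (k <= 8 * Q - 1)%N ->
  exists2 z, z \in slist d k & dil (body g) (res g k) (y - z).
Proof.
move=> /andP[d0 dg] iy hy; elim: k => [_|k IH kQ].
  exists 0; first by rewrite inE.
  have g8 := guess_ge8; have gg : d * g + g <= g ^+ 3.
    have : d * g <= g * g by rewrite ler_pM2r.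
    have : 8 * g <= g * g by rewrite ler_pM2r.
    have : 8 * (g * g) <= g * (g * g) by rewrite ler_pM2r // mulr_gt0.
    by rewrite !exprS expr0 mulr1; lra.
  have dg0 : 0 < d * g by rewrite mulr_gt0.
  have d1 : d != 0 by rewrite lt0r_neq0.
  rewrite subr0 {1}/res expr0 divr1; apply/dil_body_g => //; split.
    apply: (dil_le cC C_zero _ gg); first by rewrite addr_gt0.
    rewrite -[y *m B](subrK x); apply: dil_add => //.
    by apply: (dil_le cC C_zero d0) => //; rewrite ler_peMr ?(ltW d0) //; lra.
  apply: (dil_le cC C_zero _ gg); first by rewrite addr_gt0.
  have -> : - (y *m B) = - (y *m B - x) + - x by rewrite -opprD subrK.
  apply: dil_add => //.
  rewrite -[- _](scalerKV d1) dilZ // scalerN; exact: oppC.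
have kQ' : (k < 8 * Q - 1)%N by [].
have [u uX hu] := IH (ltnW kQ').
have [iY cY] := lists_covers n_gt0 cC x tstP boxB (2 * Q) (8 * Q - 2 - k).
rewrite -/g hscale_last in iY cY.
have lE := lscale_res kQ'.
have r0 := res_gt0 k; have r1 := res_gt0 k.+1.
have r2 : 0 < res g k.+1 / 2 by rewrite divr_gt0.
have [v vY hv] : exists2 v, v \in lists oracle mo B x g (2 * Q) (8 * Q - 2 - k) &
    dil (body g) (res g k.+1 / 2) (y - u - v).
  rewrite -lE; apply: cY.
    by apply: intvecB => //; exact: slist_int uX.
  by rewrite lE; have -> : 4 * (res g k.+1 / 2) = res g k by rewrite (res_halve k); field.
have fz : filb oracle mo B x true (d + res g k.+1) (hscale g (2 * Q)) (u + v).
  apply/(filcbP B x tstP); apply: (@dil_le _ _ _ (d + res g k.+1 / 2)) => //.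
  - exact: C_zero.
  - by rewrite addr_gt0.
  - by rewrite lerD2l ler_piMr ?(ltW r1) //; lra.
  have -> : (u + v) *m B - x = (y *m B - x) + - ((y - u - v) *m B).
    by rewrite -addrA -opprD mulmxDl; rewrite !mulmxDl !mulNmx; apply/rowP => i; rewrite !mxE; ring.
  apply: dil_add => //; by have /(dil_body_g _ r2)[] := hv.
have h0 : 0 <= hscale g (2 * Q) by rewrite hscale_last ltW.
have [z zD hz] := comb_cover (nearb_refl tstP boxB h0 r2) uX vY fz.
exists z => //.
have -> : y - z = (y - u - v) + (u + v - z).
  by apply/rowP => i; rewrite !mxE; ring.
have -> : res g k.+1 = res g k.+1 / 2 + res g k.+1 / 2 by field.
apply: dil_add => //; first exact: body_cvx.
by move/(nearbP B tstP _ _ _ r2): hz; rewrite hscale_last.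
Qed.

(** Refinement goes on only while the previous accuracy exceeds e d, so d < 2 rho / e. With a = d +
    rho and tau = rho / 2 the packing ratio is 32 (d / rho + 1) / gamma, at most 96 / (e gamma);
    doubling the base absorbs the factor 2. *)
Lemma size_slist d k : 0 < d -> (forall j, (j < k)%N -> e * d < res g j) ->
  (size (slist d k))%:R <= (192 / (e * gamma)) ^+ n.
Proof.
move=> d0 hres; have /andP[ga0 ga1] := gamma0; have /andP[_ e8] := e_le.
have eg0 : 0 < e * gamma by rewrite mulr_gt0.
case: k hres => [|k] hres.
  rewrite /= exprn_ege1 // ler_pdivlMr // mul1r.
  have : e * gamma <= 1 * 1 by apply: ler_pM; rewrite ?(ltW e0) ?(ltW ga0) //; lra.
  by lra.
have h0 : 0 <= hscale g (2 * Q) by rewrite hscale_last ltW.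
set rho := res g k.+1; have rho0 : 0 < rho by exact: res_gt0.
have r2 : 0 < rho / 2 by rewrite divr_gt0.
have rd : e * d < 2 * rho by rewrite /rho -res_halve hres.
have [uD sD] := comb_sep (filb oracle mo B x true (d + rho) (hscale g (2 * Q)))
  (nearb_refl tstP boxB h0 r2) (nearb_sym B tstP (hscale g (2 * Q)) r2)
  (slist d k) (lists oracle mo B x g (2 * Q) (8 * Q - 2 - k)).
rewrite -/(scomb oracle mo B x g Q d rho _ _) in uD sD.
rewrite [slist d k.+1]/= -/rho; set D := scomb _ _ _ _ _ _ _ _ _ _ in uD sD *.
pose Z := [seq z *m B - x | z <- D].
have uZ : uniq Z.
  rewrite map_inj_uniq // => z z' /addIr /(congr1 (fun w => w *m invmx B)).
  by rewrite !mulmxK.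
have tau : 0 < rho / 2 <= d + rho by rewrite r2 /=; lra.
rewrite -(size_map (fun z => z *m B - x)) -/Z.
apply: le_trans (packing n_gt0 cC kC delta0 boxC ga0 symC tau uZ _ _) _.
- by move=> _ /mapP[z /comb_sub[/(filcbP B x tstP) hz _] ->].
- move=> _ _ /mapP[z zD ->] /mapP[z' zD' ->] neq.
  have zz : z != z' by apply: contra_neq neq => ->.
  have /negP hn := sD z z' zD zD' zz.
  have E (w w' : 'rV[R]_n) : w *m B - x - (w' *m B - x) = (w - w') *m B.
    by rewrite opprB addrA subrK mulmxBl.
  rewrite !E => -[h1 h2]; apply: hn; apply/(nearbP B tstP) => //.
  by rewrite hscale_last; apply/dil_body_g => //; split; rewrite // -mulNmx opprB.
- have q0 : 0 < 16 * (d + rho) / (rho / 2 * gamma).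
    by rewrite divr_gt0 // !mulr_gt0 // addr_gt0.
  have q1 : 16 * (d + rho) / (rho / 2 * gamma) <= 96 / (e * gamma).
    rewrite invfM [(e * gamma)^-1]invfM !mulrA ler_pM2r ?invr_gt0 //.
    rewrite ler_pdivrMr // mulrAC ler_pdivlMr //.
    have : rho * e <= rho * (1 / 8) by rewrite ler_pM2l.
    have : rho * e = e * rho by rewrite mulrC.
    by nra.
  have -> : 192 / (e * gamma) = 2 * (96 / (e * gamma)) by field; rewrite ?lt0r_neq0.
  rewrite [leRHS]exprMn ler_pM ?exprn_ge0 ?(ltW q0) //.
    by case: n n_gt0 => // k' _; rewrite exprS ler_peMr // exprn_ege1 // ler1n.
  by rewrite lerXn2r // nnegrE ltW // (lt_le_trans q0).
Qed.

Lemma kstopP d : 1 / g ^+ 3 <= d -> d <= g ->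
  [/\ (0 < kstop d)%N, (kstop d < 8 * Q)%N, res g (kstop d) <= e * d &
      forall j, (j < kstop d)%N -> e * d < res g j].
Proof.
move=> d1 dg; have g8 := guess_ge8; have /andP[_ e8] := e_le.
have d0 : 0 < d by apply: lt_le_trans d1; rewrite divr_gt0.
(* After 7 Q halvings of g^3 the accuracy is g^-4, while e >= 1 / g and d >= g^-3. *)
have ed : res g (7 * Q) <= e * d.
  rewrite /res mulnC exprM -/g.
  have -> : g ^+ 3 / g ^+ 7 = 1 / g * (1 / g ^+ 3) by field; rewrite lt0r_neq0.
  rewrite ler_pM ?divr_ge0 ?(ltW g0) ?(ltW g3) //.
  by rewrite ler_pdivrMr // mulrC -ler_pdivrMr.
have hs : has (fun k => res g k <= e * d) (iota 0 (8 * Q)).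
  by apply/hasP; exists (7 * Q)%N; rewrite // mem_iota; move: Q_ge3; clear; lia.
have kQ : (kstop d < 8 * Q)%N by rewrite -[X in (_ < X)%N](size_iota 0) -has_find.
have st : res g (kstop d) <= e * d.
  by have := nth_find 0%N hs; rewrite nth_iota // -[X in (_ < X)%N](size_iota 0) -has_find.
have before j : (j < kstop d)%N -> e * d < res g j.
  move=> jk; have := before_find 0%N jk; rewrite nth_iota ?add0n.
    by move/negbT; rewrite -ltNge.
  exact: ltn_trans kQ.
split => //; rewrite lt0n; apply/eqP => k0.
move: st; rewrite k0 /res expr0 divr1.
have : e * d <= 1 / 8 * g by apply: ler_pM; rewrite ?(ltW e0) ?(ltW d0).
have : 8 * g <= g * g by rewrite ler_pM2r.
have : 8 * (g * g) <= g * (g * g) by rewrite ler_pM2r // mulr_gt0.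
by rewrite !exprS expr0 mulr1; lra.
Qed.

Lemma dist_guess_bounds k : (k <= 4 * Q)%N -> 1 / g ^+ 3 <= dist_guess g k <= g.
Proof.
move=> kQ; rewrite /dist_guess ler_pM2r ?invr_gt0 //; apply/andP; split.
  by rewrite exprn_ege1 // ler1n.
rewrite ler_pdivrMr // -exprS /g -exprM ler_eXn2l ?ltr1n //; move: kQ; clear; lia.
Qed.

End refinement.

(** * Correctness *)

Section gauge.
Context {R : realType} {n : nat}.
Variables (C : set 'rV[R]_n) (delta : R).
Hypotheses (cC : cvx C) (kC : compact C) (delta0 : 0 < delta).
Hypothesis boxC : forall w : 'rV[R]_n, (forall i, `|w 0 i| <= delta) -> C w.
Implicit Types v : 'rV[R]_n.

Let S v := [set s : R | 0 <= s /\ [set s *: c | c in C] v].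

Let S_lb v : has_lbound (S v).
Proof. by exists 0 => s []. Qed.

Let dil_S s v : 0 < s -> dil C s v -> S v s.
Proof.
move=> s0 h; split; first exact: ltW.
by exists (s^-1 *: v) => //; rewrite scalerA divff ?scale1r // lt0r_neq0.
Qed.

Let S_n0 v : S v !=set0.
Proof.
pose M := \sum_i `|v 0 i| / delta + 1.
have M0 : 0 < M.
  by rewrite ltr_wpDl // sumr_ge0 // => i _; rewrite divr_ge0 // ltW.
exists M; apply: dil_S => //; apply: (dil_box M0 boxC) => i.
rewrite -ler_pdivrMr //.
apply: le_trans (_ : \sum_i `|v 0 i| / delta <= _); last by rewrite lerDl.
rewrite (bigD1 i) //= lerDl sumr_ge0 // => j _.
by rewrite divr_ge0 // ltW.
Qed.

Lemma gauge_ge0 v : 0 <= gauge C v.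
Proof. by apply: lb_le_inf; [exact: S_n0|move=> s []]. Qed.

Lemma gauge_le s v : 0 < s -> dil C s v -> gauge C v <= s.
Proof. by move=> s0 h; apply: (ge_inf (S_lb v)); exact: dil_S. Qed.

Let C0 : C 0.
Proof. by apply: boxC => i; rewrite mxE normr0 ltW. Qed.

Lemma gauge_lt s v : gauge C v < s -> dil C s v.
Proof.
move=> h; have [t [t0 [c Cc cv]] ts] := inf_lt (S_n0 v) h.
move: t0; rewrite le_eqVlt => /predU1P[t0|t0].
  by rewrite -cv -t0 scale0r; exact: dil0.
apply: (dil_le cC C0 t0 (ltW ts)).
by rewrite /dil /= -cv scalerA mulVf ?scale1r // lt0r_neq0.
Qed.

(** The infimum is attained because C is closed: the points (1 - eta) v / s lie in C and tend to v /
    s. *)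
Lemma dil_gauge s v : 0 < s -> gauge C v <= s -> dil C s v.
Proof.
move=> s0 h; have clC : closed C by apply: compact_closed kC; exact: norm_hausdorff.
apply: clC => U /nbhs_ballP[e /= e0 eU]; set p := s^-1 *: v in eU *.
have p0 : 0 < `|p| + 1 by rewrite ltr_wpDl.
pose eta := Num.min (1 / 2) (e / 2 / (`|p| + 1)).
have eta0 : 0 < eta by rewrite lt_min !divr_gt0.
have eta1 : eta <= 1 / 2 by rewrite ge_min lexx.
have eta2 : eta * (`|p| + 1) <= e / 2 by rewrite -ler_pdivlMr // ge_min lexx orbT.
exists ((1 - eta) *: p); split.
  have l1 : 0 < 1 - eta by lra.
  have -> : (1 - eta) *: p = (s / (1 - eta))^-1 *: v.
    by rewrite /p scalerA invf_div mulrC.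
  apply: gauge_lt; apply: le_lt_trans h _; rewrite ltr_pdivlMr // gtr_pMr //; lra.
apply: eU; rewrite -ball_normE /= scalerBl scale1r opprB addrCA subrr addr0.
rewrite normrZ gtr0_norm //; have : 0 <= eta by lra.
by move=> ?; rewrite mulrDr mulr1 in eta2; lra.
Qed.

Lemma gauge_dilP s v : 0 < s -> reflect (dil C s v) (gauge C v <= s).
Proof. by move=> s0; apply: (iffP idP); [exact: dil_gauge|exact: gauge_le]. Qed.

Lemma membership_tstP v : reflect (C v) (tst (membership_oracle C) true v).
Proof.
rewrite /tst /membership_oracle indicE; apply: (iffP idP); last by move=> /mem_set ->; rewrite ltxx.
by case: (boolP (v \in C)) => [/set_mem //|_]; rewrite ltr01.
Qed.

Lemma gauge_tstP v : reflect (C v) (tst (gauge_oracle C) false v).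
Proof. by rewrite /tst /gauge_oracle -leNgt -{1}(dil1 C); exact: gauge_dilP. Qed.

End gauge.

(** * Quality of the output *)

Section correctness.
Context {R : realType} {n : nat}.
Hypothesis n_gt0 : (0 < n)%N.
Variables (C : set 'rV[R]_n) (B : 'M[R]_n) (delta : R).
Hypotheses (cC : cvx C) (kC : compact C) (delta0 : 0 < delta).
Hypothesis boxC : forall w : 'rV[R]_n, (forall i, `|w 0 i| <= delta) -> C w.
Variables (oracle : 'rV[R]_n -> R) (mo : bool) (x : 'rV[R]_n).
Hypothesis tstP : forall v, reflect (C v) (tst oracle mo v).
Hypothesis oracle_gauge : ~~ mo -> oracle = gauge C.
Variables (Q : nat) (e : R).
Let g : R := 2 ^+ Q.
Hypothesis Q_ge3 : (3 <= Q)%N.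
Hypothesis boxB : forall w : 'rV[R]_n, (forall i, `|w 0 i| <= 1 / g) -> C (w *m B).
Hypothesis coef_bound : forall v : 'rV[R]_n,
  C (v *m B) -> C (- (v *m B)) -> forall i, `|v 0 i| <= g.
Hypothesis oppC : forall v : 'rV[R]_n, C v -> dil C g (- v).
Hypotheses (x_in : dil C g x) (Nx_in : dil C g (- x)).
Hypotheses (e_le : 0 < e <= 1 / 8) (e_ge : 1 / e <= g).

Local Notation slist := (slist oracle mo B x g Q).
Local Notation kstop := (kstop g e Q).
Local Notation result := (result oracle mo B x g e Q).
Local Notation value := (value oracle mo B x Q).
Local Notation cost z := (gauge C (z *m B - x)).

Let g0 : 0 < g. Proof. exact: exprn_gt0. Qed.
Let g3 : 0 < g ^+ 3. Proof. exact: exprn_gt0. Qed.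
Let e0 : 0 < e. Proof. by case/andP: e_le. Qed.
Let g8 : 8 <= g. Proof. exact: guess_ge8. Qed.

Lemma bisect_bounds k lo hi v : 0 <= lo -> lo < hi -> lo <= gauge C v <= hi ->
  gauge C v <= bisect oracle mo k lo hi v <= gauge C v + (hi - lo) / 2 ^+ k.
Proof.
elim: k lo hi => [|k IH] lo hi lo0 lh /andP[h1 h2] /=.
  by rewrite h2 expr0 divr1 /=; lra.
set mid := (lo + hi) / 2; have mid0 : 0 < mid by rewrite /mid; lra.
have lm : lo < mid by rewrite /mid; lra.
have mh : mid < hi by rewrite /mid; lra.
have p0 : 0 < 2 ^+ k :> R by rewrite exprn_gt0.
case: tstP => [/(gauge_le mid0) h|h].
  have -> : (hi - lo) / 2 ^+ k.+1 = (mid - lo) / 2 ^+ k.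
    by rewrite /mid exprS; field; rewrite lt0r_neq0.
  by apply: IH; rewrite // h1.
have -> : (hi - lo) / 2 ^+ k.+1 = (hi - mid) / 2 ^+ k.
  by rewrite /mid exprS; field; rewrite lt0r_neq0.
apply: IH => //; first exact: ltW.
rewrite h2 andbT leNgt; apply/negP => hm; apply: h.
exact: (gauge_lt cC delta0 boxC hm).
Qed.

Lemma value_bounds d z : 0 < d -> dil C (d + d) (z *m B - x) ->
  cost z <= value d z <= cost z + 2 * d / g.
Proof.
move=> d0 hz; rewrite /value /amb subr0; have d2 : 0 < d + d by rewrite addr_gt0.
case: ifPn => [_|/oracle_gauge ->].
  have := @bisect_bounds Q 0 (d + d) (z *m B - x) (lexx _) d2.
  rewrite (gauge_ge0 delta0 boxC) (gauge_le d2 hz) subr0 => /(_ isT).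
  by have -> : d + d = 2 * d by ring.
by rewrite lexx lerDl divr_ge0 ?mulr_ge0 ?(ltW d0) ?(ltW g0).
Qed.

Lemma better_fold d D bo : (forall z, z \in D -> intvec z /\ cost z <= value d z) ->
  intvec bo.2 /\ cost bo.2 <= bo.1 ->
  let bo' := foldl (better oracle mo B x Q d) bo D in
  [/\ intvec bo'.2 /\ cost bo'.2 <= bo'.1, bo'.1 <= bo.1 &
      forall z, z \in D -> bo'.1 <= value d z].
Proof.
elim: D bo => [|z D IH] bo hD hbo /=; first by split.
have [iz vz] := hD z (mem_head _ _).
have hD' z' : z' \in D -> intvec z' /\ cost z' <= value d z'.
  by move=> zD; apply: hD; rewrite inE zD orbT.
have hb : intvec (better oracle mo B x Q d bo z).2 /\
    cost (better oracle mo B x Q d bo z).2 <= (better oracle mo B x Q d bo z).1.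
  by rewrite /better; case: ifP.
have [h1 h2 h3] := IH _ hD' hb; split => //.
  apply: le_trans h2 _; rewrite /better; case: ifP => // /ltW //.
move=> z'; rewrite inE => /predU1P[->|/h3 //]; apply: le_trans h2 _.
by rewrite /better; case: ifPn => //; rewrite -leNgt.
Qed.

Lemma kstop_slist k z : (k <= 4 * Q)%N ->
  z \in slist (dist_guess g k) (kstop (dist_guess g k)) ->
  intvec z /\ cost z <= value (dist_guess g k) z <= cost z + 2 * dist_guess g k / g.
Proof.
move=> kQ; have /andP[d1 d2] := @dist_guess_bounds R Q k kQ.
have [k0 k1 k2 k3] := kstopP Q_ge3 e_le e_ge d1 d2.
set d := dist_guess g k in d1 d2 k0 k1 k2 k3 *.
have d0 : 0 < d by apply: lt_le_trans d1; rewrite divr_gt0.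
move=> zD; split; first exact: (slist_int n_gt0 cC tstP boxB zD).
have := slist_near tstP k0 zD => hz; apply: value_bounds => //.
apply: (dil_le cC _ _ _ hz); first exact: (C_zero delta0 boxC).
  by rewrite addr_gt0 // res_gt0.
rewrite lerD2l; apply: le_trans k2 _; rewrite ler_piMl ?(ltW d0) //.
by case/andP: e_le => _; lra.
Qed.

Lemma result_spec : [/\ intvec result.2, cost result.2 <= result.1, result.1 <= g &
  forall k z, (k <= 4 * Q)%N ->
    z \in slist (dist_guess g k) (kstop (dist_guess g k)) ->
    result.1 <= value (dist_guess g k) z].
Proof.
rewrite /result; have b0 : intvec (0 : 'rV[R]_n) /\ cost (0 : 'rV[R]_n) <= g.
  split; first by exists 0; rewrite map_mx0.
  by rewrite mul0mx sub0r; apply: gauge_le.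
suff h : forall m, (m <= 4 * Q + 1)%N ->
    let bo := foldl (round oracle mo B x g e Q) (g, 0) (iota 0 m) in
    [/\ intvec bo.2 /\ cost bo.2 <= bo.1, bo.1 <= g &
     forall k z, (k < m)%N -> z \in slist (dist_guess g k) (kstop (dist_guess g k)) ->
       bo.1 <= value (dist_guess g k) z].
  have [[h1 h2] h3 h4] := h (4 * Q + 1)%N (leqnn _).
  by split => // k z kQ; apply: h4; rewrite addn1 ltnS.
elim=> [|m IH] mQ; first by split.
have [h1 h2 h3] := IH (ltnW mQ).
rewrite -(addn1 m) iotaD foldl_cat /= add0n; set bo := foldl _ _ _ in h1 h2 h3 *.
have mQ' : (m <= 4 * Q)%N by rewrite -ltnS -[X in (_ < X)%N]addn1.
rewrite /round -/bo.
have [|h4 h5 h6] := @better_fold (dist_guess g m)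
   (slist (dist_guess g m) (kstop (dist_guess g m))) bo _ h1.
  by move=> z /(kstop_slist mQ')[iz /andP[]].
split => //; first exact: le_trans h5 h2.
move=> k z; rewrite addn1 ltnS leq_eqVlt => /predU1P[->|km] zD; first exact: h6.
exact: le_trans h5 (h3 k z km zD).
Qed.

(** The least guess above s. It is within a factor 2 of s unless it is the very first one, which
    happens for s too close to 0. *)
Lemma exists_guess s : s < g ->
  exists k, [/\ (k <= 4 * Q)%N, s <= dist_guess g k & k = 0%N \/ dist_guess g k <= 2 * s].
Proof.
move=> sg; have last : s <= dist_guess g (4 * Q).
  have -> : dist_guess g (4 * Q) = g; last exact: ltW.
  by rewrite /dist_guess mulnC exprM -/g exprS mulfK // lt0r_neq0.
have ex : exists k, (k <= 4 * Q)%N && (s <= dist_guess g k).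
  by exists (4 * Q)%N; rewrite leqnn.
case: (ex_minnP ex) => k /andP[kQ sk] kmin; exists k; split => //.
case: k kQ sk kmin => [|k] kQ sk kmin; [by left|right].
have : ~~ (s <= dist_guess g k).
  by apply/negP => h; have := kmin k; rewrite (ltnW kQ) h ltnn => /(_ isT).
by rewrite -ltNge /dist_guess (exprS 2%:R k) -mulrA => /ltW h; rewrite ler_pM2l.
Qed.

Lemma guess_close k y : (k <= 4 * Q)%N -> intvec y -> cost y <= dist_guess g k ->
  exists2 z, z \in slist (dist_guess g k) (kstop (dist_guess g k)) &
    dil (body C B g) (e * dist_guess g k) (y - z).
Proof.
move=> kQ iy; have /andP[d1 d2] := @dist_guess_bounds R Q k kQ.
have [k0 k1 k2 k3] := kstopP Q_ge3 e_le e_ge d1 d2.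
set d := dist_guess g k in d1 d2 k0 k1 k2 k3 * => cy.
have d0 : 0 < d by apply: lt_le_trans d1; rewrite divr_gt0.
have dd : 0 < d <= g by rewrite d0.
have hy := dil_gauge cC kC delta0 boxC d0 cy.
have kQ1 : (kstop d <= 8 * Q - 1)%N by move: (kstop d) k1 => j; move: Q_ge3; clear; lia.
have [z zD hz] := slist_cover n_gt0 cC delta0 boxC tstP Q_ge3 boxB coef_bound
   oppC x_in Nx_in dd iy hy kQ1.
exists z => //; have b0 : body C B g 0 by apply: (body0 boxB); exact: ltW.
have cA : cvx (body C B g) by exact: body_cvx.
have r0 := @res_gt0 R Q (kstop d); have := dil_le cA b0 r0 k2; exact.
Qed.

(* If y is closer than g^-3, the output is y itself: two lattice points that
   close to x have coefficients differing by less than one. *)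
Lemma result_approx y : mo -> intvec y -> cost result.2 <= (1 + 6 * e) * cost y.
Proof.
move=> _ iy; have [io c1 c2 c3] := result_spec; have g8' := g8; have e0' := e0.
have cy0 : 0 <= cost y by exact: (gauge_ge0 delta0 boxC).
have [gy|yg] := leP g (cost y).
  apply: le_trans c1 _; apply: le_trans c2 _; apply: le_trans gy _.
  by rewrite ler_peMl // lerDl mulr_ge0 // ltW.
have [k [kQ yk k2]] := exists_guess yg.
have /andP[d1 d2] := @dist_guess_bounds R Q k kQ.
set d := dist_guess g k in d1 d2 yk k2 *.
have d0 : 0 < d by apply: lt_le_trans d1; rewrite divr_gt0.
have ed0 : 0 < e * d by rewrite mulr_gt0.
have [z zD hz] := guess_close kQ iy yk; rewrite -/d in zD hz.
have [iz /andP[_ v2]] := kstop_slist kQ zD; rewrite -/d in v2.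
have vr := le_trans (c3 k z kQ zD) v2.
(* Q bisections of an interval of length 2 d leave the error 2 d / g, which 1 / e <= g turns into a
   multiple of e d. *)
have dg : 2 * d / g <= 2 * (e * d).
  rewrite ler_pdivrMr // -mulrA ler_pM2l // mulrAC ler_peMl ?(ltW d0) //.
  by rewrite mulrC -ler_pdivrMr.
have near s : 0 < s -> cost y <= s -> cost z <= s + e * d.
  move=> s0 ys; apply: gauge_le; first by rewrite addr_gt0.
  have -> : z *m B - x = (y *m B - x) + - ((y - z) *m B).
    by rewrite mulmxBl opprB [RHS]addrC addrA subrK.
  apply: dil_add => //; first exact: (dil_gauge cC kC delta0 boxC).
  by have /(dil_body_g coef_bound _ ed0)[] := hz.
have e8 : e <= 1 / 8 by case/andP: e_le.
(* For larger costs, the list contributes an error e d and the bisection 2 e d; with d at most twice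
   the cost of y this makes 6 e. *)
have [small|big] := ltP (cost y) (1 / g ^+ 3); last first.
  have y0 : 0 < cost y by apply: lt_le_trans big; rewrite divr_gt0.
  have dy : d <= 2 * cost y.
    by case: k2 => // k0; move: big; rewrite /d k0 /dist_guess expr0; lra.
  have := near _ y0 (lexx _); have : e * d <= e * (2 * cost y) by rewrite ler_pM2l.
  have -> : (1 + 6 * e) * cost y = cost y + 3 * (e * (2 * cost y)) by ring.
  lra.
have dE : d = 1 / g ^+ 3.
  case: k2 => [k0|dy]; first by rewrite /d k0 /dist_guess expr0.
  have [k0|k0] := posnP k; first by rewrite /d k0 /dist_guess expr0.
  have : 2 / g ^+ 3 <= d.
    by rewrite /d /dist_guess ler_pM2r ?invr_gt0 // -{1}[2]expr1 ler_eXn2l // ltr1n.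
  by move=> ?; lra.
clearbody d; suff -> : result.2 = y by rewrite ler_peMl // lerDl mulr_ge0 // ltW.
have cr : cost result.2 <= 2 * d.
  have := near d d0 yk; have : e * d <= 1 / 8 * d by rewrite ler_pM2r.
  lra.
have d20 : 0 < 2 * d by rewrite mulr_gt0.
have ry : dil C (2 * d) (result.2 *m B - x) by exact: (dil_gauge cC kC delta0 boxC).
have hy : dil C d (y *m B - x) by exact: (dil_gauge cC kC delta0 boxC).
have opp s v : 0 < s -> dil C s v -> dil C (s * g) (- v).
  move=> s0 hv; rewrite -[- v](scalerKV (lt0r_neq0 s0)) dilZ ?lt0r_neq0 // scalerN.
  exact: oppC.
have dg0 : 0 < d * g by rewrite mulr_gt0.
have d2g0 : 0 < 2 * d * g by rewrite mulr_gt0.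
(* The difference lies in 2 d C + d g C and its opposite in 2 d g C + d C; 3 d g covers both. Its
   coefficients are then at most 3 d g^2 = 3 / g < 1. *)
have t0 : 0 < 3 * d * g by rewrite !mulr_gt0.
have dleg : d <= d * g by rewrite ler_peMr ?(ltW d0) //; lra.
have C00 := C_zero delta0 boxC.
have h1 : dil C (3 * d * g) ((result.2 - y) *m B).
  have -> : (result.2 - y) *m B = (result.2 *m B - x) + - (y *m B - x).
    by rewrite mulmxBl opprB addrA subrK.
  apply: (@dil_le _ _ _ (2 * d + d * g)) => //; first by rewrite addr_gt0.
    by rewrite -!mulrA; lra.
  by apply: dil_add => //; exact: opp.
have h2 : dil C (3 * d * g) (- ((result.2 - y) *m B)).
  have -> : - ((result.2 - y) *m B) = - (result.2 *m B - x) + (y *m B - x).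
    by rewrite mulmxBl !opprB [RHS]addrC addrA subrK.
  apply: (@dil_le _ _ _ (2 * d * g + d)) => //; first by rewrite addr_gt0.
    by rewrite -!mulrA; lra.
  by apply: dil_add => //; exact: opp.
have : dil (body C B g) (3 * d * g) (result.2 - y).
  exact/(dil_body_g coef_bound _ t0).
rewrite dil_body // => -[hs _].
have [u uE] := intvecB io iy.
apply/eqP; rewrite -subr_eq0 uE; apply/eqP/rowP => i; have := hs i.
rewrite uE !mxE dE => le1.
have : `|u 0 i| < 1 :> int.
  rewrite -(ltr_int R) intr_norm; apply: le_lt_trans le1 _.
  have -> : 3 * (1 / g ^+ 3) * g * g = 3 / g by field; rewrite lt0r_neq0.
  by rewrite ltr_pdivrMr //; lra.
by rewrite -[ltRHS]add0r ltzD1 normr_le0 => /eqP ->.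
Qed.

(** If wB is in s C with s < g^-2, then -wB is in s g C, so w has coefficients at most s g^2 < 1
    and, being integral, vanishes. *)
Lemma lattice_sep w : intvec w -> w != 0 -> 1 / g ^+ 2 <= gauge C (w *m B).
Proof.
move=> [u ->] w0; rewrite leNgt; apply/negP => lt1; have g8' := g8.
have a0 : 0 <= gauge C (map_mx intr u *m B) by exact: (gauge_ge0 delta0 boxC).
set a := gauge C _ in lt1 a0.
pose s := (a + 1 / g ^+ 2) / 2; have as_ : a < s by rewrite /s; lra.
have s0 : 0 < s by lra.
have sg : s * g * g < 1.
  by rewrite -mulrA -expr2 -ltr_pdivlMr ?exprn_gt0 // /s; lra.
have hs := gauge_lt cC delta0 boxC as_.
have sg0 : 0 < s * g by rewrite mulr_gt0.
have hb : dil (body C B g) (s * g) (map_mx intr u).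
  apply/(dil_body_g coef_bound _ sg0); split.
    apply: (dil_le cC (C_zero delta0 boxC) s0 _ hs).
    by rewrite ler_peMr ?(ltW s0) //; lra.
  rewrite -[- _](scalerKV (lt0r_neq0 s0)) dilZ ?lt0r_neq0 // scalerN; exact: oppC.
move: hb; rewrite dil_body // => -[hu _]; move/eqP: w0; apply.
apply/rowP => i; have := hu i; rewrite !mxE => le1.
have : `|u 0 i| < 1 :> int.
  by rewrite -(ltr_int R) intr_norm; exact: le_lt_trans le1 sg.
by rewrite -[ltRHS]add0r ltzD1 normr_le0 => /eqP ->.
Qed.

(** Some listed z differs from y by at most e d. If d is at most 2 M, the hypothesis puts e d below
    [lam]; if d is the first guess g^-3, then e d < g^-2. So y = z, and its exact gauge has been
    compared. *)
Lemma result_exact y M lam : ~~ mo -> intvec y -> cost y <= M ->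
  e * (2 * M) < lam -> 1 / g ^+ 2 <= lam ->
  (forall w, intvec w -> w != 0 -> lam <= gauge C (w *m B)) ->
  result.1 <= cost y.
Proof.
move=> nmo iy yM eM glam sep; have [io c1 c2 c3] := result_spec.
have g8' := g8; have e0' := e0.
have [gy|yg] := leP g (cost y); first exact: le_trans gy.
have [k [kQ yk k2]] := exists_guess yg.
have /andP[d1 d2] := @dist_guess_bounds R Q k kQ.
set d := dist_guess g k in d1 d2 yk k2 *.
have d0 : 0 < d by apply: lt_le_trans d1; rewrite divr_gt0.
have ed0 : 0 < e * d by rewrite mulr_gt0.
have [z zD hz] := guess_close kQ iy yk; rewrite -/d in zD hz.
have [iz _] := kstop_slist kQ zD.
have edl : e * d < lam.
  case: k2 => [k0|dy].
    apply: lt_le_trans glam; rewrite /d k0 /dist_guess expr0.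
    have -> : e * (1 / g ^+ 3) = e / g * (1 / g ^+ 2) by field; rewrite lt0r_neq0.
    rewrite gtr_pMl ?divr_gt0 ?exprn_gt0 // ltr_pdivrMr // mul1r.
    by case/andP: e_le => _; lra.
  by apply: le_lt_trans eM; rewrite ler_pM2l //; lra.
have yz : y = z.
  apply/eqP; rewrite -subr_eq0; apply/negPn/negP => /(sep _ (intvecB iy iz)).
  rewrite leNgt => /negP; apply; apply: le_lt_trans edl.
  by apply: gauge_le => //; have /(dil_body_g coef_bound _ ed0)[] := hz.
have := c3 k z kQ zD.
by rewrite /value (negbTE nmo) (oracle_gauge nmo) /amb subr0 yz.
Qed.

End correctness.

(** * Input size and running time *)

Section parameters.
Context {R : realType}.

Lemma sum_lift m (F : 'I_m.+1 -> R) j : (forall i, 0 <= F i) ->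
  \sum_l F (lift j l) <= \sum_l F l.
Proof. by move=> F0; rewrite [leRHS](bigD1_ord j) //= lerDr. Qed.

(** A weaker substitute for Hadamard's inequality, free of roots: Laplace expansion along the first
    row. *)
Lemma det_le_row_sums m (A : 'M[R]_m) : `|\det A| <= \prod_i \sum_j `|A i j|.
Proof.
elim: m A => [|m IH] A.
  by rewrite det_mx00 normr1 big_ord0.
rewrite (expand_det_row A ord0) [leRHS](bigD1_ord ord0) //= mulr_suml.
apply: le_trans (ler_norm_sum _ _ _) _; apply: ler_sum => j _.
rewrite normrM ler_wpM2l // /cofactor normrM normrX normrN1 expr1n mul1r.
apply: le_trans (IH _) _; apply: ler_prod => i _; rewrite sumr_ge0 //=.
under eq_bigr do rewrite !mxE.
exact: (@sum_lift _ (fun l => `|A (lift ord0 i) l|)).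
Qed.

Lemma cofactor_le m (A : 'M[R]_m.+1) i j :
  `|cofactor A i j| <= \prod_(k < m) \sum_l `|A (lift i k) l|.
Proof.
rewrite /cofactor normrM normrX normrN1 expr1n mul1r.
apply: le_trans (det_le_row_sums _) _; apply: ler_prod => k _; rewrite sumr_ge0 //=.
under eq_bigr do rewrite !mxE.
exact: (@sum_lift _ (fun l => `|A (lift i k) l|)).
Qed.

(** This entry is a cofactor with row i deleted, so the factor of row i is missing in the
    product. *)
Lemma adj_le m (A : 'M[R]_m) (b : 'I_m -> R) i j :
  (forall k, \sum_l `|A k l| <= b k) -> `|(\adj A) j i| <= \prod_(k | k != i) b k.
Proof.
move=> hb; rewrite mxE; case: m A b i j hb => [|m] A b i j hb; first by case: i.
rewrite big_mkcond (bigD1_ord i) //= eqxx mul1r.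
apply: le_trans (cofactor_le _ _ _) _; apply: ler_prod => k _.
by rewrite sumr_ge0 //= eq_sym neq_lift hb.
Qed.

Lemma sum_le_prod (I : finType) (f : I -> R) : (forall i, 0 <= f i) ->
  \sum_i f i <= \prod_i (1 + f i).
Proof.
move=> f0; suff h : 1 + \sum_i f i <= \prod_i (1 + f i).
  by apply: le_trans h; rewrite lerDr.
suff [h _] : 1 + \sum_i f i <= \prod_i (1 + f i) /\ 0 <= \sum_i f i by [].
apply: (big_ind2 (fun s p => 1 + s <= p /\ 0 <= s)).
- by rewrite addr0.
- move=> s p t q [h1 h2] [h3 h4]; split; last by rewrite addr_ge0.
  apply: le_trans (_ : (1 + s) * (1 + t) <= _).
    by rewrite mulrDl mul1r mulrDr mulr1; have := mulr_ge0 h2 h4; lra.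
  by rewrite ler_pM ?addr_ge0.
- by move=> i _.
Qed.

Lemma sumsq_le (I : finType) (f : I -> R) (s : R) :
  \sum_i `|f i| <= s -> \sum_i f i ^+ 2 <= s ^+ 2.
Proof.
move=> h; have n0 : 0 <= \sum_i `|f i| by rewrite sumr_ge0.
apply: le_trans (_ : (\sum_i `|f i|) ^+ 2 <= _); last by rewrite lerXn2r ?nnegrE ?(le_trans n0).
rewrite expr2 mulr_suml; apply: ler_sum => i _.
apply: le_trans (ler_norm _) _; rewrite normrX expr2 ler_wpM2l //.
by rewrite (bigD1 i) //= lerDl sumr_ge0.
Qed.

Context {n : nat}.
Hypothesis n_gt0 : (0 < n)%N.
Variables (C : set 'rV[R]_n) (B : 'M[R]_n) (x : 'rV[R]_n).
Variables (r Rad par : R) (mo : bool) (Q : nat).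
Hypotheses (cen : centered r Rad C) (B_unit : B \in unitmx).
Hypothesis e_gt0 : 0 < precision mo par.
Let g : R := 2 ^+ Q.
Hypothesis bound : size_bound mo B x r Rad par <= g.

Let P := rows_prod B.
Let X := \sum_j x 0 j * x 0 j.
Let a i := rdot B i i + n%:R.

Let r0 : 0 < r. Proof. by case: cen. Qed.
Let g0 : 0 < g. Proof. exact: exprn_gt0. Qed.
Let X0 : 0 <= X. Proof. by apply: sumr_ge0 => i _; exact: sqr_ge0. Qed.

Let rdot0 i : 0 <= rdot B i i.
Proof. by apply: sumr_ge0 => j _; exact: sqr_ge0. Qed.

Let a0 i : 0 <= a i. Proof. by rewrite addr_ge0. Qed.

Let P_ge : \prod_i (1 + a i) <= P.
Proof.
apply: ler_prod => i _; rewrite addr_ge0 ?a0 //= /a.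
by have := rdot0 i; have : 0 <= n%:R :> R by []; lra.
Qed.

Let P0 : 0 <= P.
Proof. by apply: le_trans P_ge; apply: prodr_ge0 => i _; rewrite addr_ge0. Qed.

(** From |b| <= b^2 + 1, so that the computable squared norm replaces the sum of absolute values. *)
Let row_sum_le i : \sum_j `|B i j| <= a i.
Proof.
rewrite /a /rdot; apply: le_trans (_ : \sum_j (B i j * B i j + 1) <= _).
  apply: ler_sum => j _; rewrite -expr2 -real_normK ?num_real //.
  by have := sqr_ge0 (`|B i j| - 1); rewrite sqrrB1; have := normr_ge0 (B i j); lra.
by rewrite big_split /= sumr_const card_ord.
Qed.

Let bounds : [/\ `|Rad| * P * (1 / (\det B) ^+ 2 + 1) <= g, P <= g * r, `|Rad| <= g * r,
  X + 1 <= g * r & 1 / precision mo par <= g /\ 8 <= g].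
Proof.
move: bound; rewrite /size_bound -/P -/X.
set A1 := `|Rad| * P * _; set A2 := _ / r; set A3 := 1 / _ => h.
have A10 : 0 <= A1.
  by rewrite /A1 mulr_ge0 ?mulr_ge0 // addr_ge0 // divr_ge0 // sqr_ge0.
have R0 : 0 <= `|Rad| by [].
have A20 : 0 <= A2 by rewrite divr_ge0 ?(ltW r0) // !addr_ge0.
have A30 : 0 <= A3 by rewrite divr_ge0 // ltW.
have h2 : P + `|Rad| + 1 + X <= g * r by rewrite -ler_pdivrMr // -/A2; lra.
have p0 := P0; have x0 := X0.
by split; [lra|lra|lra|lra|split; lra].
Qed.

Lemma ball_sub (v : 'rV[R]_n) : \sum_j v 0 j ^+ 2 <= r ^+ 2 -> C v.
Proof. by case: cen => _ h _; exact: h. Qed.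

Lemma exponent_ge3 : (3 <= Q)%N.
Proof.
have [_ _ _ _ [_ g8]] := bounds.
have : (2 ^+ 3 : R) <= 2 ^+ Q by apply: le_trans g8; rewrite -natrX.
by rewrite ler_eXn2l // ltr1n.
Qed.

Lemma precision_ge : 1 / precision mo par <= g.
Proof. by have [_ _ _ _ []] := bounds. Qed.

Lemma center_box (w : 'rV[R]_n) : (forall i, `|w 0 i| <= r / n%:R) -> C w.
Proof.
move=> hw; apply: ball_sub; apply: sumsq_le.
apply: le_trans (_ : \sum_(i < n) r / n%:R <= _); first exact: ler_sum.
by rewrite sumr_const card_ord -[leLHS]mulr_natr divfK // pnatr_eq0 -lt0n.
Qed.

Lemma box_image (w : 'rV[R]_n) : (forall i, `|w 0 i| <= 1 / g) -> C (w *m B).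
Proof.
move=> hw; apply: ball_sub; apply: sumsq_le.
apply: le_trans (_ : \sum_j \sum_i (1 / g) * `|B i j| <= _).
  apply: ler_sum => j _; rewrite mxE; apply: le_trans (ler_norm_sum _ _ _) _.
  by apply: ler_sum => i _; rewrite normrM ler_wpM2r.
rewrite exchange_big /=; under eq_bigr do rewrite -mulr_sumr.
rewrite -mulr_sumr mul1r ler_pdivrMl //; have [_ Pg _ _ _] := bounds.
apply: le_trans Pg; apply: le_trans P_ge; apply: le_trans (sum_le_prod a0).
by apply: ler_sum => i _; exact: row_sum_le.
Qed.

Let C_coord v : C v -> forall j, `|v 0 j| <= `|Rad|.
Proof.
case: cen => _ _ h /h hv j.
have : v 0 j ^+ 2 <= Rad ^+ 2.
  by apply: le_trans hv; rewrite (bigD1 j) //= lerDl sumr_ge0 // => i _; exact: sqr_ge0.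
by rewrite -[v 0 j ^+ 2]real_normK ?num_real // -[Rad ^+ 2]real_normK ?num_real //
  ler_pXn2r ?nnegrE.
Qed.

(** Cramer's rule: v is (vB) times the adjugate divided by det B, and the entries of vB are at most
    |Rad|. *)
Lemma coef_image (v : 'rV[R]_n) :
  C (v *m B) -> C (- (v *m B)) -> forall i, `|v 0 i| <= g.
Proof.
move=> Cv _ i; have [h1 _ _ _ _] := bounds; apply: le_trans h1.
have d0 : 0 < `|\det B| by rewrite normr_gt0 -unitfE.
have vE : v = ((v *m B) *m \adj B) *m ((\det B)^-1)%:M.
  rewrite -[v *m B *m _]mulmxA mul_mx_adj -mulmxA -scalar_mxM divff ?mulmx1 //.
  by rewrite -normr_gt0.
have cof j : `|(\adj B) j i| <= \prod_(k | k != i) a k by exact: adj_le.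
have -> : `|v 0 i| = `|((v *m B) *m \adj B) 0 i| / `|\det B|.
  by rewrite {1}vE mul_mx_scalar mxE normrM normfV mulrC.
have sumle : `|((v *m B) *m \adj B) 0 i| <= `|Rad| * P.
  rewrite mxE; apply: le_trans (ler_norm_sum _ _ _) _.
  apply: le_trans (_ : \sum_(j < n) `|Rad| * \prod_(k | k != i) a k <= _).
    by apply: ler_sum => j _; rewrite normrM ler_pM // C_coord.
  rewrite sumr_const card_ord -[leLHS]mulr_natr -mulrA ler_wpM2l //.
  apply: le_trans P_ge; rewrite [leRHS](bigD1 i) //= [leLHS]mulrC.
  apply: ler_pM; rewrite ?ler0n ?prodr_ge0 //.
    by rewrite /a addrA lerDr addr_ge0.
  by apply: ler_prod => k _; rewrite a0 lerDr ler01.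
apply: le_trans (_ : `|Rad| * P / `|\det B| <= _); first by rewrite ler_pM2r ?invr_gt0.
(* It remains to bound 1 / |det B| by 1 / det B^2 + 1, which needs a case distinction at |det B| = 1
   but no root. *)
rewrite ler_wpM2l ?mulr_ge0 // -[(\det B) ^+ 2]real_normK ?num_real // mul1r.
set d := `|\det B| in d0 *.
have [d1|d1] := leP 1 d.
  by apply: le_trans (_ : 1 <= _); rewrite ?invf_le1 // lerDr invr_ge0 exprn_ge0 // ltW.
apply: le_trans (_ : (d ^+ 2)^-1 <= _); last by rewrite lerDl.
by rewrite lef_pV2 ?posrE ?exprn_gt0 // expr2 ler_piMl // ltW.
Qed.

Lemma opp_dil (v : 'rV[R]_n) : C v -> dil C g (- v).
Proof.
case: cen => _ _ h /h hv; apply: ball_sub.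
under eq_bigr do rewrite mxE exprMn mxE sqrrN.
rewrite -mulr_sumr exprVn ler_pdivrMl ?exprn_gt0 // -exprMn.
apply: le_trans hv _; have [_ _ Rg _ _] := bounds.
rewrite -[Rad ^+ 2]real_normK ?num_real //.
by rewrite lerXn2r // nnegrE mulr_ge0 // ltW.
Qed.

(** The squared norm X is at most (X + 1)^2, which again avoids a square root of X. *)
Let x_ball : \sum_j x 0 j ^+ 2 <= (g * r) ^+ 2.
Proof.
have [_ _ _ h _] := bounds; rewrite (eq_bigr (fun j => x 0 j * x 0 j)) //.
have gr : 0 <= g * r by rewrite mulr_ge0 // ltW.
have x0 := X0; rewrite -/X; apply: le_trans (_ : (X + 1) ^+ 2 <= _).
  by rewrite expr2; have := mulr_ge0 x0 x0; lra.
by rewrite lerXn2r // nnegrE addr_ge0.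
Qed.

Lemma target_dil : dil C g x /\ dil C g (- x).
Proof.
have h := x_ball; split; apply: ball_sub.
  under eq_bigr do rewrite mxE exprMn.
  by rewrite -mulr_sumr exprVn ler_pdivrMl ?exprn_gt0 // -exprMn.
under eq_bigr do rewrite mxE exprMn mxE sqrrN.
by rewrite -mulr_sumr exprVn ler_pdivrMl ?exprn_gt0 // -exprMn.
Qed.

End parameters.

(** * Bound on the exponent and the final constant *)

Section complexity.
Context {R : realType}.

Lemma expR_logmag (a : R) : `|a| <= expR (logmag a).
Proof.
have [->|a0] := eqVneq a 0; first by rewrite normr0 expR_ge0.
by rewrite -[leLHS]lnK ?posrE ?normr_gt0 // ler_expR ler_norm.
Qed.

Lemma expR_logmagV (a : R) : a != 0 -> `|a|^-1 <= expR (logmag a).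
Proof.
move=> a0; rewrite -[X in X^-1]lnK ?posrE ?normr_gt0 // -expRN ler_expR.
by apply: le_trans (ler_norm _) _; rewrite normrN.
Qed.

(** The square root of Euler's number is at most 2, because exp(-1/2) >= 1 - 1/2. *)
Lemma expR_le_pow2 (y : R) N : y <= N%:R -> expR (y / 2) <= 2 ^+ N.
Proof.
move=> yN; apply: le_trans (_ : expR (N%:R * (1 / 2)) <= _).
  by rewrite ler_expR mulrA mulr1 ler_pM2r // invr_gt0.
rewrite expRM_natl lerXn2r ?nnegrE ?expR_ge0 //.
have := expR_ge1Dx (- (1 / 2) : R); rewrite expRN => h.
have h0 : 0 < expR (1 / 2 : R) by exact: expR_gt0.
by rewrite -[leLHS]invrK invf_ple ?posrE ?invr_gt0 //; lra.
Qed.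

Section size.
Context {n : nat}.
Hypothesis n_gt0 : (0 < n)%N.
Variables (B : 'M[R]_n) (x : 'rV[R]_n) (r Rad gamma par : R) (mo : bool).
Let s := input_size r Rad gamma par B x.

Lemma input_size_ge : [/\ n%:R <= s, 1 <= s,
  [/\ logmag r <= s, logmag Rad <= s, logmag par <= s & logmag (\det B) <= s],
  (forall i j, logmag (B i j) <= s) & forall j, logmag (x 0 j) <= s].
Proof.
have l0 (a : R) : 0 <= logmag a by exact: normr_ge0.
have sB0 : 0 <= \sum_i \sum_j logmag (B i j).
  by apply: sumr_ge0 => i _; apply: sumr_ge0.
have sx0 : 0 <= \sum_j logmag (x 0 j) by exact: sumr_ge0.
have n1 : 1 <= n%:R :> R by rewrite ler1n.
have lr := l0 r; have lR := l0 Rad; have lg := l0 gamma; have lp := l0 par.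
have ld := l0 (\det B); rewrite /s /input_size.
have hB i j : logmag (B i j) <= \sum_i \sum_j logmag (B i j).
  rewrite [leRHS](bigD1 i) //= [in leRHS](bigD1 j) //= -addrA lerDl.
  by rewrite addr_ge0 // sumr_ge0 // => k _; exact: sumr_ge0.
have hx j : logmag (x 0 j) <= \sum_j logmag (x 0 j).
  by rewrite [leRHS](bigD1 j) //= lerDl sumr_ge0.
split.
- lra.
- lra.
- split; lra.
- move=> i j; have := hB i j; lra.
- move=> j; have := hx j; lra.
Qed.

Hypotheses (r0 : 0 < r) (B_unit : B \in unitmx).
Hypothesis precision_small : 1 / precision mo par <= 16 * expR (logmag par).

(** Every input number is at most F = exp(s), a row contributes at most F^6, and as n <= s the n
    rows together at most E^6 with E = exp(s^2). All summands then add up to at most 30 E^9, and 30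
    <= E^5. The exponent of g is therefore quadratic in the input size. *)
Lemma size_bound_le : size_bound mo B x r Rad par <= expR (14 * s ^+ 2).
Proof.
have [ns s1 [lr lR lp ld] lB lx] := input_size_ge.
have ex2 : 2 <= expR 1 :> R by have := expR_ge1Dx (1 : R); lra.
pose F := expR s; have F2 : 2 <= F by apply: le_trans ex2 _; rewrite ler_expR.
have F0 : 0 <= F by lra.
have F1 : 1 <= F by lra.
have nF : n%:R <= F by apply: le_trans ns _; have := expR_ge1Dx s; rewrite -/F; lra.
have toF a : logmag a <= s -> `|a| <= F.
  by move=> h; apply: le_trans (expR_logmag a) _; rewrite ler_expR.
have sqF a : logmag a <= s -> a * a <= F ^+ 2.
  move=> /toF h; rewrite -expr2 -real_normK ?num_real //.
  by rewrite lerXn2r ?nnegrE.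
have sumF (f : 'I_n -> R) : (forall j, logmag (f j) <= s) -> \sum_j f j * f j <= F ^+ 3.
  move=> h; apply: le_trans (_ : \sum_(j < n) F ^+ 2 <= _).
    by apply: ler_sum => j _; exact: sqF.
  by rewrite sumr_const card_ord -[leLHS]mulr_natl [leRHS]exprS ler_wpM2r // exprn_ge0.
have F_pow i j : (i <= j)%N -> F ^+ i <= F ^+ j by move=> ij; rewrite ler_weXn2l.
have F13 := F_pow 1%N 3 isT; have F03 := F_pow 0%N 3 isT; rewrite expr1 expr0 in F13 F03.
have F3_8 : 8 <= F ^+ 3.
  have -> : 8 = 2 ^+ 3 :> R by rewrite -natrX.
  by rewrite lerXn2r ?nnegrE.
pose E := expR (s ^+ 2); have ss : s <= s ^+ 2 by rewrite expr2 ler_peMl //; lra.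
have FE : F <= E by rewrite ler_expR.
have E2 : 2 <= E by lra.
have E0 : 0 <= E by lra.
have PE : rows_prod B <= E ^+ 6.
  apply: le_trans (_ : \prod_(i < n) F ^+ 6 <= _).
    apply: ler_prod => i _; have := sumF (fun j => B i j) (lB i).
    rewrite -/(rdot B i i) => h; apply/andP; split.
      rewrite mulr_ge0 // !addr_ge0 // sumr_ge0 // => j _; exact: sqr_ge0.
    rewrite (exprD F 3 3); have : 8 * F ^+ 3 <= F ^+ 3 * F ^+ 3.
      by rewrite ler_wpM2r // exprn_ge0.
    lra.
  rewrite prodr_const card_ord -exprM -!expRM_natl ler_expR natrM -mulrA.
  rewrite ler_wpM2l // expr2 ler_wpM2r //; lra.
have P0 : 0 <= rows_prod B.
  apply: prodr_ge0 => i _; rewrite mulr_ge0 // !addr_ge0 // sumr_ge0 // => j _.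
  exact: sqr_ge0.
have E_pow i j : (i <= j)%N -> E ^+ i <= E ^+ j by move=> ij; rewrite ler_weXn2l //; lra.
have d0 : \det B != 0 by rewrite -unitfE.
have dE : 1 / (\det B) ^+ 2 <= E ^+ 2.
  rewrite -[(\det B) ^+ 2]real_normK ?num_real // div1r -exprVn lerXn2r ?nnegrE ?invr_ge0 //.
  apply: le_trans (expR_logmagV d0) _; rewrite ler_expR; exact: le_trans ld ss.
have rE : r^-1 <= E.
  have := expR_logmagV (lt0r_neq0 r0); rewrite (gtr0_norm r0) => h; apply: le_trans h _.
  by rewrite ler_expR (le_trans lr).
have RE : `|Rad| <= E by apply: le_trans (toF _ lR) FE.
have xE : \sum_j x 0 j * x 0 j <= E ^+ 3.
  by apply: le_trans (sumF _ lx) _; rewrite lerXn2r ?nnegrE.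
have pE : 1 / precision mo par <= 16 * E.
  apply: le_trans precision_small _; rewrite ler_pM2l // ler_expR.
  exact: le_trans lp ss.
have t1 : `|Rad| * rows_prod B * (1 / (\det B) ^+ 2 + 1) <= 2 * E ^+ 9.
  apply: le_trans (_ : E * E ^+ 6 * (2 * E ^+ 2) <= _).
    apply: ler_pM; rewrite ?mulr_ge0 ?addr_ge0 ?divr_ge0 ?sqr_ge0 ?ler_pM //.
    have := E_pow 0%N 2 isT; rewrite expr0; lra.
  by have -> : E * E ^+ 6 * (2 * E ^+ 2) = 2 * E ^+ 9 by ring.
have t2 : (rows_prod B + `|Rad| + 1 + \sum_j x 0 j * x 0 j) / r <= 4 * E ^+ 9.
  have x0 : 0 <= \sum_j x 0 j * x 0 j by apply: sumr_ge0 => j _; exact: sqr_ge0.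
  apply: le_trans (_ : (4 * E ^+ 6) * E <= _).
    apply: ler_pM; rewrite ?invr_ge0 ?(ltW r0) ?addr_ge0 //.
    have := E_pow 0%N 6 isT; have := E_pow 1%N 6 isT; have := E_pow 3 6 isT.
    rewrite expr0 expr1; lra.
  by rewrite -mulrA ler_pM2l // -exprSr E_pow.
have E19 := E_pow 1%N 9 isT; have E09 := E_pow 0%N 9 isT; rewrite expr1 expr0 in E19 E09.
have E5 : 30 <= E ^+ 5.
  apply: le_trans (_ : 2 ^+ 5 <= _); last by rewrite lerXn2r ?nnegrE.
  by rewrite -natrX ler_nat.
have -> : expR (14 * s ^+ 2) = E ^+ 5 * E ^+ 9 by rewrite expRM_natl -exprD.
have : 30 * E ^+ 9 <= E ^+ 5 * E ^+ 9 by rewrite ler_wpM2r // exprn_ge0.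
by rewrite /size_bound; lra.
Qed.

Lemma exponent_le : exists2 N, size_bound mo B x r Rad par <= 2 ^+ N &
  (0 < N)%N /\ N%:R <= 29 * s ^+ 2.
Proof.
have [_ s1 _ _ _] := input_size_ge.
have s2 : 1 <= s ^+ 2 by rewrite exprn_ege1.
exists (Num.truncn (28 * s ^+ 2)).+1.
  apply: le_trans size_bound_le _.
  have -> : 14 * s ^+ 2 = 28 * s ^+ 2 / 2 by field.
  by apply: expR_le_pow2; exact/ltW/truncnS_gt.
split => //; rewrite -natr1.
have : (Num.truncn (28 * s ^+ 2))%:R <= 28 * s ^+ 2 by rewrite truncn_le; lra.
lra.
Qed.

End size.

(** The seventh power consists of N^2, of order s^4, and n^3. The exponential parts 512^(3 n) and
    MS^2 go into the base, as does the constant factor A, since A >= 1 and n >= 1 give A <= A^n. *)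
Lemma runtime_constant (K : R) : 0 <= K -> exists c : nat,
  forall (n N MS : nat) (s W : R), (0 < n)%N -> (0 < N)%N -> (0 < MS)%N ->
    n%:R <= s -> N%:R <= 29 * s ^+ 2 -> 1 <= W -> (MS%:R) ^+ 2 <= (K * W) ^+ n ->
    (@tMAIN n N (512 ^ n) MS + 4 * n + 70)%:R <= s ^+ 7 * (c%:R * W) ^+ n.
Proof.
move=> K0.
(* The large numerals are hidden behind variables, so that they are not computed with. *)
have [f [Ef f0]] : exists f : R, 512 = f /\ 0 <= f by exists 512; rewrite ler0n.
have [b [Eb b1]] : exists b : R, 29 = b /\ 1 <= b by exists 29; rewrite ler1n.
have [a [Ea a1]] : exists a : R, 200 * 1000 = a /\ 1 <= a.
  by exists (200 * 1000); rewrite -natrM ler1n.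
pose A := a * b ^+ 2; pose c0 := f ^+ 3 * K.
exists (Num.bound (A * (c0 + 1))) => n N MS s W n0 N0 M0 ns Ns W1 hM.
have b2 : 1 <= b ^+ 2 by exact: exprn_ege1.
have A1 : 1 <= A by rewrite /A -[1]mulr1 ler_pM.
have p512 : 0 <= f ^+ 3 by exact: exprn_ge0.
have c00 : 0 <= c0 by exact: mulr_ge0.
have s1 : 1 <= s by apply: le_trans ns; rewrite ler1n.
have s0 : 0 <= s by lra.
have W0 : 0 <= W by lra.
have A0 : 0 <= A by lra.
have b0 : 0 <= b by lra.
have a0 : 0 <= a by lra.
set c := Num.bound _; have hc : A * (c0 + 1) <= c%:R.
  by apply/ltW/archi_boundP; rewrite mulr_ge0 ?addr_ge0.
clearbody c; rewrite Eb in Ns.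
have L0 : (0 < 512 ^ n)%N by rewrite expn_gt0.
have h1 := tMAIN_le n0 N0 L0 M0; set L := (512 ^ n)%N in L0 h1 *.
have h2 : (@tMAIN n N L MS + 4 * n + 70 <=
   200 * 1000 * (N * N * (n * n * n) * (L * L * L * (MS * MS))))%N.
  have : (n <= N * N * (n * n * n) * (L * L * L * (MS * MS)))%N.
    apply: leq_trans (leq_pmulr _ _); last by rewrite !muln_gt0 L0 M0.
    apply: leq_trans (leq_pmull _ _); last by rewrite muln_gt0 N0.
    by rewrite -mulnA leq_pmulr // muln_gt0 n0.
  move: (N * N * _ * _)%N h1 n0 => Z; clear; lia.
apply: le_trans (_ : (200 * 1000 * (N * N * (n * n * n) * (L * L * L * (MS * MS))))%N%:R <= _).
  by rewrite ler_nat.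
have n00 : 0 <= n%:R :> R by [].
have N00 : 0 <= N%:R :> R by [].
have hL : L%:R = f ^+ n by rewrite /L natrX Ef.
rewrite !natrM hL.
have -> : 200%:R * 1000%:R * (N%:R * N%:R * (n%:R * n%:R * n%:R) *
    (f ^+ n * f ^+ n * f ^+ n * (MS%:R * MS%:R))) =
    a * (N%:R ^+ 2 * n%:R ^+ 3) * ((f ^+ 3) ^+ n * MS%:R ^+ 2) :> R.
  by rewrite Ea -exprM mulnC exprM; ring.
have q1 : (f ^+ 3) ^+ n * MS%:R ^+ 2 <= (c0 * W) ^+ n.
  have -> : c0 * W = f ^+ 3 * (K * W) by rewrite /c0 mulrA.
  by rewrite [leRHS]exprMn; apply: ler_wpM2l hM; exact: exprn_ge0.
have q2 : N%:R ^+ 2 * n%:R ^+ 3 <= b ^+ 2 * s ^+ 7.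
  have -> : b ^+ 2 * s ^+ 7 = (b * s ^+ 2) ^+ 2 * s ^+ 3 by ring.
  have bs : 0 <= b * s ^+ 2 by rewrite mulr_ge0 // exprn_ge0.
  by apply: ler_pM; rewrite ?exprn_ge0 // lerXn2r ?nnegrE.
have cW : 0 <= c0 * W by exact: mulr_ge0.
apply: le_trans (_ : a * (b ^+ 2 * s ^+ 7) * (c0 * W) ^+ n <= _).
  apply: ler_pM => //.
  - by apply: mulr_ge0 => //; apply: mulr_ge0; exact: exprn_ge0.
  - by apply: mulr_ge0; exact: exprn_ge0.
  - exact: ler_wpM2l.
have -> : a * (b ^+ 2 * s ^+ 7) * (c0 * W) ^+ n = s ^+ 7 * (A * (c0 * W) ^+ n).
  by rewrite /A; ring.
apply: ler_wpM2l; first exact: exprn_ge0.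
apply: le_trans (_ : (A * (c0 * W)) ^+ n <= _).
  rewrite [leRHS]exprMn; apply: ler_wpM2r; first exact: exprn_ge0.
  by rewrite -[leLHS]expr1 ler_weXn2l.
have cc : A * (c0 * W) <= c%:R * W.
  rewrite mulrA; apply: ler_wpM2r => //; apply: le_trans hc.
  by apply: ler_wpM2l => //; rewrite lerDl.
by rewrite lerXn2r ?nnegrE // mulr_ge0.
Qed.

End complexity.

Lemma wf_MAIN mo : wf (MAIN mo).
Proof. by case: mo; vm_compute. Qed.

(** * Assembly for both oracles *)

Section solver.
Context {R : realType} {n : nat}.
Hypothesis n_gt0 : (0 < n)%N.
Variables (C : set 'rV[R]_n) (B : 'M[R]_n) (x : 'rV[R]_n) (r Rad gamma par : R).
Variables (oracle : 'rV[R]_n -> R) (mo : bool).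
Hypotheses (bodyC : convex_body C) (cen : centered r Rad C).
Hypotheses (gamma01 : 0 < gamma <= 1) (symC : symmetric_upto gamma C).
Hypothesis B_unit : B \in unitmx.
Hypothesis tstP : forall v, reflect (C v) (tst oracle mo v).
Hypothesis oracle_gauge : ~~ mo -> oracle = gauge C.
Let e := precision mo par.
Hypotheses (e_le : 0 < e <= 1 / 8) (e_ge : 1 / e <= 16 * expR (logmag par)).

Let cC : cvx C. Proof. by apply: convex_set_cvx; case: bodyC. Qed.
Let kC : compact C. Proof. by case: bodyC. Qed.
Let e0 : 0 < e. Proof. by case/andP: e_le. Qed.
Let r0 : 0 < r. Proof. by case: cen. Qed.
Let delta0 : 0 < r / n%:R. Proof. by rewrite divr_gt0 // ltr0n. Qed.
Let boxC := center_box n_gt0 cen.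

Lemma result_good Q (lam : R) : size_bound mo B x r Rad par <= 2 ^+ Q ->
  let bo := result oracle mo B x (2 ^+ Q) e Q in
  let cost z := gauge C (z *m B - x) in
  [/\ intvec bo.2, cost bo.2 <= bo.1,
      mo -> forall y, intvec y -> cost bo.2 <= (1 + 6 * e) * cost y,
      forall w, intvec w -> w != 0 -> 1 / (2 ^+ Q) ^+ 2 <= gauge C (w *m B) &
      ~~ mo -> 1 / (2 ^+ Q) ^+ 2 <= lam ->
        (forall w, intvec w -> w != 0 -> lam <= gauge C (w *m B)) ->
        forall y M, intvec y -> cost y <= M -> e * (2 * M) < lam -> bo.1 <= cost y].
Proof.
move=> bound bo cost.
have Q3 := exponent_ge3 cen e0 bound.
have bB := box_image cen e0 bound.
have cB := coef_image cen B_unit e0 bound.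
have oC := opp_dil cen e0 bound.
have [xC NxC] := target_dil cen e0 bound.
have eg := precision_ge cen e0 bound.
have [io c1 _ _] := result_spec n_gt0 cC delta0 boxC tstP oracle_gauge Q3 bB NxC e_le eg.
split => //.
- move=> hmo y iy.
  exact: (result_approx n_gt0 cC kC delta0 boxC tstP oracle_gauge Q3 bB cB oC
    xC NxC e_le eg).
- by move=> w iw w0; apply: (lattice_sep cC delta0 boxC Q3 cB oC).
- move=> nmo gl sep y M iy yM eM.
  exact: (result_exact n_gt0 cC kC delta0 boxC tstP oracle_gauge Q3 bB cB oC
    xC NxC e_le eg nmo iy yM eM gl sep).
Qed.

(** The time is quadratic in the size of the search lists, hence the condition on the square of 192
    / (e gamma); [W] is the base promised in the statement and [K] a numerical constant. *)
Lemma solver_computes (K W : R) (c : nat) (good : set 'rV[R]_n) :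
  (forall (n N MS : nat) (s W : R), (0 < n)%N -> (0 < N)%N -> (0 < MS)%N ->
    n%:R <= s -> N%:R <= 29 * s ^+ 2 -> 1 <= W -> (MS%:R) ^+ 2 <= (K * W) ^+ n ->
    (@tMAIN n N (512 ^ n) MS + 4 * n + 70)%:R <= s ^+ 7 * (c%:R * W) ^+ n) ->
  1 <= W -> (192 / (e * gamma)) ^+ 2 <= K * W ->
  (forall Q, size_bound mo B x r Rad par <= 2 ^+ Q ->
     good ((result oracle mo B x (2 ^+ Q) e Q).2 *m B)) ->
  computes_within (assemble (MAIN mo)) oracle (cvp_input r Rad gamma par B x)
    (input_size r Rad gamma par B x ^+ 7 * (c%:R * W) ^+ n) (1 - 2 ^- n) good.
Proof.
move=> hc W1 hK hgood.
have [ns s1 _ _ _] := input_size_ge n_gt0 B x r Rad gamma par.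
have [N lN [N0 Ns]] := exponent_le n_gt0 x Rad gamma r0 B_unit e_ge.
have /andP[ga0 ga1] := gamma01; have /andP[_ e8] := e_le.
have eg0 : 0 < e * gamma by rewrite mulr_gt0.
pose Y := (192 / (e * gamma)) ^+ n.
have Y1 : 1 <= Y.
  rewrite exprn_ege1 // ler_pdivlMr // mul1r.
  have : e * gamma <= 1 * 1 by apply: ler_pM; rewrite ?(ltW e0) ?(ltW ga0) //; lra.
  lra.
have Y0 : 0 <= Y by lra.
pose MS := Num.truncn Y.
have M0 : (0 < MS)%N by rewrite truncn_gt0.
have MY : MS%:R ^+ 2 <= (K * W) ^+ n.
  apply: le_trans (_ : Y ^+ 2 <= _).
    by rewrite lerXn2r ?nnegrE // truncn_le.
  rewrite /Y -exprM mulnC exprM lerXn2r ?nnegrE ?sqr_ge0 //.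
  exact: le_trans (sqr_ge0 _) hK.
apply: (computes_of_ev (tm := @tMAIN n N (512 ^ n) MS)) => //.
- exact: wf_MAIN.
- apply: (MAIN_spec n_gt0 B_unit lN) => Q QN bound g e'.
  have Q3 := exponent_ge3 cen e0 bound.
  have bB := box_image cen e0 bound.
  have cB := coef_image cen B_unit e0 bound.
  have eg := precision_ge cen e0 bound.
  have g0 : 0 < g by exact: exprn_gt0.
  split.
  - exact: ltn_trans Q3.
  - move=> k t _ _; apply: (size_grid_list n_gt0 cC kC x tstP bB).
      by rewrite /hscale divr_gt0.
    by rewrite /lscale divr_gt0 // exprn_gt0.
  - by move=> m k _; apply: (size_lists n_gt0 cC kC x tstP bB).
  - move=> k kQ; have /andP[d1 d2] := @dist_guess_bounds R Q k kQ.
    have [_ k1 _ k3] := kstopP Q3 e_le eg d1 d2; split => // j jk.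
    rewrite /MS truncn_ge_nat //.
    apply: (size_slist n_gt0 cC kC delta0 boxC gamma01 symC B_unit x tstP bB cB e_le).
      by apply: lt_le_trans d1; rewrite divr_gt0 // exprn_gt0.
    by move=> i ij; apply: k3; exact: leq_trans ij jk.
  - exact: hgood.
- exact: hc.
Qed.

End solver.

Lemma lattice_intvec (R : realType) n (B : 'M[R]_n) z : lattice B z <->
  exists2 u, intvec u & z = u *m B.
Proof.
by split=> [[c ->]|[_ [c ->] ->]]; [exists (map_mx intr c) => //|]; exists c.
Qed.

Theorem theorem7 (R : realType) :
  (exists (P : program) (c k : nat),
     forall (n : nat) (r Rad gamma : R) (C : set 'rV[R]_n)
            (B : 'M[R]_n) (x : 'rV[R]_n) (eps : R),
     (0 < n)%N ->
     convex_body C -> centered r Rad C ->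
     0 < gamma <= 1 -> symmetric_upto gamma C ->
     B \in unitmx ->
     0 < eps < 1 / 3 ->
     computes_within P (membership_oracle C) (cvp_input r Rad gamma eps B x)
       (input_size r Rad gamma eps B x ^+ k
          * (c%:R * (1 / (gamma ^+ 4 * eps ^+ 2))) ^+ n)
       (1 - 2 ^- n)
       [set y | lattice B y /\
                gauge C (y - x) <= (1 + eps) * lattice_dist C (lattice B) x])
  /\
  (exists (P : program) (c k : nat),
     forall (n : nat) (r Rad gamma : R) (C : set 'rV[R]_n)
            (B : 'M[R]_n) (x : 'rV[R]_n) (t : R),
     (0 < n)%N ->
     convex_body C -> centered r Rad C ->
     0 < gamma <= 1 -> symmetric_upto gamma C ->
     B \in unitmx ->
     2 <= t ->
     lattice_dist C (lattice B) x <= t * lambda1 C (lattice B) ->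
     computes_within P (gauge_oracle C) (cvp_input r Rad gamma t B x)
       (input_size r Rad gamma t B x ^+ k
          * (c%:R * (t ^+ 2 / gamma ^+ 4)) ^+ n)
       (1 - 2 ^- n)
       [set y | lattice B y /\
                gauge C (y - x) = lattice_dist C (lattice B) x]).

Proof.
split.
  have [c hc] := @runtime_constant R ((192 * 8) ^+ 2) (sqr_ge0 _).
  exists (assemble (MAIN true)), c, 7%N => n r Rad gamma C B x eps.
  move=> n0 bodyC cen gamma01 symC B_unit /andP[eps0 eps1].
  have cC : cvx C by apply: convex_set_cvx; case: bodyC.
  have kC : compact C by case: bodyC.
  have e_le : 0 < precision true eps <= 1 / 8 by rewrite /precision; apply/andP; split; lra.
  have e_ge : 1 / precision true eps <= 16 * expR (logmag eps).
    have := expR_logmagV (lt0r_neq0 eps0); rewrite gtr0_norm // => h.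
    have -> : 1 / precision true eps = 8 * eps^-1 by rewrite /precision; field; rewrite lt0r_neq0.
    have := expR_ge0 (logmag eps); lra.
  have tstP := membership_tstP C.
  have /andP[ga0 ga1] := gamma01.
  have ge0 : 0 < gamma ^+ 4 * eps ^+ 2 by rewrite mulr_gt0 ?exprn_gt0.
  have orc : ~~ true -> membership_oracle C = gauge C by [].
  apply: (solver_computes n0 bodyC cen gamma01 symC B_unit tstP e_le e_ge hc).
  - rewrite ler_pdivlMr // mul1r -[leRHS]mulr1 ler_pM ?exprn_ge0 ?exprn_ile1 //; lra.
  (* The lists give gamma^-2, which is at most the stated gamma^-4 because gamma <= 1. *)
  - have -> : (192 / (precision true eps * gamma)) ^+ 2 = (192 * 8) ^+ 2 * ((gamma ^+ 2 * eps ^+ 2)^-1).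
      by rewrite /precision; field; rewrite ?lt0r_neq0.
    rewrite div1r ler_wpM2l ?sqr_ge0 // lef_pV2 ?posrE ?mulr_gt0 ?exprn_gt0 //.
    by rewrite ler_wpM2r ?sqr_ge0 // ler_wiXn2l // ltW.
  - move=> Q bound.
    have [io _ appr _ _] := result_good n0 bodyC cen B_unit tstP orc e_le 0 bound.
    split; first by apply/lattice_intvec; eexists; [exact: io|].
    have eps1' : 0 < 1 + eps by lra.
    rewrite -ler_pdivrMl //; apply: lb_le_inf.
      by exists (gauge C (0 - x)), 0 => //; exists 0; rewrite map_mx0 mul0mx.
    move=> _ [z /lattice_intvec[y iy ->] <-]; rewrite ler_pdivrMl //.
    apply: le_trans (appr isT y iy) _; apply: ler_wpM2r.
      have d0 : 0 < r / n%:R by case: cen => r0 _ _; rewrite divr_gt0 // ltr0n.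
      exact: (gauge_ge0 d0 (center_box n0 cen)).
    (* The error 6 e is 6 eps / 8, below eps. *)
    by rewrite /precision; lra.
have [c hc] := @runtime_constant R ((192 * 16) ^+ 2) (sqr_ge0 _).
exists (assemble (MAIN false)), c, 7%N => n r Rad gamma C B x t.
move=> n0 bodyC cen gamma01 symC B_unit t2 dist_le.
have cC : cvx C by apply: convex_set_cvx; case: bodyC.
have kC : compact C by case: bodyC.
have d0 : 0 < r / n%:R by case: cen => r0 _ _; rewrite divr_gt0 // ltr0n.
have bC := center_box n0 cen.
have t0 : 0 < t by lra.
have e_le : 0 < precision false t <= 1 / 8.
  rewrite /precision divr_gt0 ?mulr_gt0 //= ler_pdivrMr ?mulr_gt0 //; lra.
have e_ge : 1 / precision false t <= 16 * expR (logmag t).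
  have := expR_logmag t; rewrite gtr0_norm // => h.
  have -> : 1 / precision false t = 16 * t by rewrite /precision; field; rewrite lt0r_neq0.
  lra.
have tstP := gauge_tstP cC kC d0 bC.
have /andP[ga0 ga1] := gamma01.
have orc : ~~ false -> gauge_oracle C = gauge C by [].
apply: (solver_computes n0 bodyC cen gamma01 symC B_unit tstP e_le e_ge hc).
- rewrite ler_pdivlMr ?exprn_gt0 // mul1r; apply: le_trans (_ : 1 <= _).
    by rewrite exprn_ile1 // ltW.
  by rewrite exprn_ege1 //; lra.
- have -> : (192 / (precision false t * gamma)) ^+ 2 = (192 * 16) ^+ 2 * (t ^+ 2 * (gamma ^+ 2)^-1).
    by rewrite /precision; field; rewrite ?lt0r_neq0.
  rewrite ler_wpM2l ?sqr_ge0 // ler_wpM2l ?sqr_ge0 // lef_pV2 ?posrE ?exprn_gt0 //.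
  by rewrite ler_wiXn2l // ltW.
- move=> Q bound; set lam := lambda1 C (lattice B).
  have [io c1 _ sep exact_] := result_good n0 bodyC cen B_unit tstP orc e_le lam bound.
  set out := (_.2) in io c1 *; set cost := fun z => gauge C (z *m B - x) in c1 exact_.
  have lam_ge : 1 / (2 ^+ Q) ^+ 2 <= lam.
    apply: lb_le_inf.
      (* The infimum of an empty set is 0 by convention, so a nonzero lattice vector has to be
         exhibited before [lambda1] can be bounded from below. *)
      pose u : 'rV[int]_n := delta_mx 0 (Ordinal n0).
      exists (gauge C (map_mx intr u *m B)), (map_mx intr u *m B) => //; split.
        by exists u.
      move=> /= /(congr1 (fun w => w *m invmx B)); rewrite mulmxK // mul0mx.
      by move=> /rowP/(_ (Ordinal n0)); rewrite !mxE !eqxx => /eqP; rewrite oner_eq0.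
    move=> _ [z [/lattice_intvec[w iw ->] w0] <-]; apply: sep => //.
    by apply/eqP => w00; apply: w0; rewrite /= w00 mul0mx.
  have lam0 : 0 < lam by apply: lt_le_trans lam_ge; rewrite divr_gt0 ?exprn_gt0.
  have lam_le w : intvec w -> w != 0 -> lam <= gauge C (w *m B).
    move=> iw w0; apply: ge_inf.
      by exists 0 => _ [z _ <-]; exact: (gauge_ge0 d0 bC).
    exists (w *m B) => //; split; first by apply/lattice_intvec; exists w.
    move=> /= /(congr1 (fun v => v *m invmx B)); rewrite mulmxK // mul0mx => w00.
    by rewrite w00 eqxx in w0.
  have dist_le_cost y : intvec y -> lattice_dist C (lattice B) x <= cost y.
    move=> iy; apply: ge_inf; first by exists 0 => _ [z _ <-]; exact: (gauge_ge0 d0 bC).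
    by exists (y *m B) => //; apply/lattice_intvec; exists y.
  (* Twice the allowed distance: some lattice vector then has cost strictly below M although the
     infimum is not yet known to be attained. Vectors of larger cost are compared with that one. *)
  pose M := t * lam * 2.
  have tl0 : 0 < t * lam by rewrite mulr_gt0.
  (* With e = 1 / (16 t) the resolution 2 e M equals lam / 4, too fine to separate two lattice
     vectors. *)
  have eM : precision false t * (2 * M) < lam.
    have -> : precision false t * (2 * M) = lam / 4.
      by rewrite /precision /M; field; rewrite lt0r_neq0.
    by lra.
  have out_le y : intvec y -> cost out <= cost y.
    move=> iy; apply: le_trans c1 _.
    have [yM|My] := leP (cost y) M; first exact: (exact_ isT lam_ge lam_le y M).
    have dM : lattice_dist C (lattice B) x < M by apply: le_lt_trans dist_le _; rewrite /M -/lam; lra.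
    have [_ [z /lattice_intvec[y' iy' ->] <-] lt_M] : exists2 v,
        [set gauge C (z - x) | z in lattice B] v & v < M.
      apply: inf_lt dM.
      by exists (gauge C (0 - x)), 0 => //; exists 0; rewrite map_mx0 mul0mx.
    apply: le_trans (ltW My); apply: le_trans (ltW lt_M).
    exact: (exact_ isT lam_ge lam_le y' M iy' (ltW lt_M) eM).
  split; first by apply/lattice_intvec; exists out.
  apply/eqP; rewrite eq_le dist_le_cost // andbT; apply: lb_le_inf.
    by exists (gauge C (0 - x)), 0 => //; exists 0; rewrite map_mx0 mul0mx.
  by move=> _ [z /lattice_intvec[y iy ->] <-]; exact: out_le.
Qed.
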